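(* There exist universal constants $c,\kappa>0$ with the following property. Let $1\le \ell\le n$ be integers and let $K\subset\mathbb{R}^n$ be a convex body. Let $X$ be a random vector distributed uniformly in $K$, and suppose that $X$ has zero mean and identity covariance matrix. Assume that $\ell\le c\,n^{\kappa}$. Then there exists a subset $\mathcal{E}\subseteq G_{n,\ell}$ with $\sigma_{n,\ell}(\mathcal{E})\ge 1-\exp(-c\sqrt{n})$ such that for every $E\in\mathcal{E}$, $$\sup_{A\subseteq E}\left|\mathrm{Prob}\{\mathrm{Proj}_E(X)\in A\}-\frac{1}{(2\pi)^{\ell/2}}\int_A \exp\left(-\frac{|x|^2}{2}\right)dx\right|\le \frac{1}{n^{\kappa}},$$ where the supremum runs over all measurable sets $A\subseteq E$ and $dx$ is Lebesgue measure on $E$.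
   Context: A convex body in $\mathbb{R}^n$ is a compact convex set with nonempty interior. $G_{n,\ell}$ denotes the Grassmannian of $\ell$-dimensional linear subspaces of $\mathbb{R}^n$ and $\sigma_{n,\ell}$ its unique rotation-invariant probability measure. $|\cdot|$ is the Euclidean norm and $\mathrm{Proj}_E$ is the orthogonal projection onto the subspace $E$. *)

(* Defs.v *)
From HB Require Import structures.
From mathcomp Require Import all_boot all_order all_algebra.
From mathcomp Require Import all_classical all_reals all_analysis.
Set Implicit Arguments. Unset Strict Implicit. Unset Printing Implicit Defensive.
Import Order.TTheory GRing.Theory Num.Theory.
Import numFieldNormedType.Exports.
Local Open Scope classical_set_scope.
Local Open Scope ring_scope.

Section Defs.
Variable R : realType.

(* Points of R^k are row vectors 'rV[R]_k; the measurable structure used is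
   the product (= Borel) sigma-algebra on k.-tuple R, transported by rv_of. *)
Definition rv_of (k : nat) (t : k.-tuple R) : 'rV[R]_k := \row_i tnth t i.

Definition rv_measurable (k : nat) (B : set 'rV[R]_k) : Prop :=
  @measurable _ (k.-tuple R) (@rv_of k @^-1` B).

(* Iterated Lebesgue integral over R^k (= Lebesgue integral on R^k for
   nonnegative measurable / integrable integrands, by Fubini-Tonelli). *)
Fixpoint iint (k : nat) : (k.-tuple R -> \bar R) -> \bar R :=
  match k return (k.-tuple R -> \bar R) -> \bar R with
  | 0 => fun f => f [tuple]
  | k'.+1 => fun f =>
      (\int[@lebesgue_measure R]_x iint (fun t => f [tuple of x :: t]))%E
  end.

Definition integral_on (k : nat) (S : set 'rV[R]_k) (f : 'rV[R]_k -> R) : \bar R :=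
  iint (fun t : k.-tuple R => ((\1_S (rv_of t)) * f (rv_of t))%:E).

Definition lvol (k : nat) (S : set 'rV[R]_k) : \bar R := integral_on S (fun _ => 1).

Definition sqnorm (k : nat) (v : 'rV[R]_k) : R := \sum_i v 0 i ^+ 2.

Definition gauss_measure (k : nat) (B : set 'rV[R]_k) : R :=
  ((2 * pi) `^ (k%:R / 2))^-1 * fine (integral_on B (fun x => expR (- (sqnorm x / 2)))).

Definition convex_body (n : nat) (K : set 'rV[R]_n) : Prop :=
  [/\ compact K,
      (forall x y (t : R), K x -> K y -> 0 <= t <= 1 -> K (t *: x + (1 - t) *: y))
    & (K° !=set0)].

Definition isotropic_position (n : nat) (K : set 'rV[R]_n) : Prop :=
  (forall i : 'I_n, integral_on K (fun x => x 0 i) = 0%E) /\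
  (forall i j : 'I_n, integral_on K (fun x => x 0 i * x 0 j) =
                      (if i == j then lvol K else 0%E)).

Definition unif_prob (n : nat) (K S : set 'rV[R]_n) : R :=
  fine (lvol (K `&` S)) / fine (lvol K).

(* The Grassmannian G_{n,l} is represented by orthogonal projection matrices
   of rank l; matrices are encoded as n.-tuple (n.-tuple R) for measurability. *)
Definition mx_of (n : nat) (t : n.-tuple (n.-tuple R)) : 'M[R]_n :=
  \matrix_(i, j) tnth (tnth t i) j.

Definition tuple_of_mx (n : nat) (M : 'M[R]_n) : n.-tuple (n.-tuple R) :=
  [tuple [tuple M i j | j < n] | i < n].

Definition is_orth_proj (n l : nat) (P : 'M[R]_n) : Prop :=
  [/\ P^T = P, P *m P = P & \rank P = l].

Definition grass_set (n l : nat) : set (n.-tuple (n.-tuple R)) :=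
  [set t | is_orth_proj l (mx_of t)].

Definition orthogonal_mx (n : nat) (O : 'M[R]_n) : Prop := O *m O^T = 1%:M.

Definition grass_invariant (n l : nat)
    (mu : probability (n.-tuple (n.-tuple R)) R) : Prop :=
  (forall A, measurable A -> A `&` @grass_set n l = set0 -> mu A = 0%E) /\
  (forall (O : 'M[R]_n) A, orthogonal_mx O -> measurable A ->
     mu ((fun t => tuple_of_mx (O *m mx_of t *m O^T)) @^-1` A) = mu A).

(* U is an orthonormal frame (rows) of the subspace E = range of P;
   y |-> y *m U is a linear isometry R^l -> E, x |-> x *m U^T gives the
   coordinates of Proj_E x. *)
Definition frame (n l : nat) (U : 'M[R]_(l, n)) (P : 'M[R]_n) : Prop :=
  U *m U^T = 1%:M /\ U^T *m U = P.

End Defs.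

(* Main.v *)
(* The idea is to smooth, average over Gaussian matrices, and desmooth. Let X be uniform in K, Z a standard Gaussian
   vector and G an l x n matrix with independent N(0, 1/n) entries. By Prekopa's theorem the density of
   G X + sqrt v Z is log-concave. Its mean over G is a mixture of centred Gaussians of variance v + |X|^2 / n, and its
   second moment is close to the square of the mean, because two independent copies of X are nearly orthogonal (the
   one-dimensional marginals of X have exponential tails). Hence for some G the mixture is almost midpoint log-concave
   in the radial direction; this is impossible unless |X|^2 / n is concentrated near 1, and therefore the mixture is
   itself nearly a standard Gaussian density and G X + sqrt v Z is close to Gaussian in total variation on average.
   The overlap with the Gaussian density is a Lipschitz function of G, so Maurey's property (tau) gives exponential
   concentration. Gram-Schmidt carries the law of G to an invariant law on the Grassmannian, which is unique. Finally
   a log-concave density with nearly full overlap with a Gaussian changes little under small translations, so that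
   the noise sqrt v Z can be removed. *)
Require Import Defs.
From HB Require Import structures.
From mathcomp Require Import all_boot all_order all_algebra.
From mathcomp Require Import all_classical all_reals all_analysis.
From mathcomp Require Import measurable_realfun.
From mathcomp Require Import ring lra.
Set Implicit Arguments. Unset Strict Implicit. Unset Printing Implicit Defensive.
Import Order.TTheory GRing.Theory Num.Theory.
Import numFieldNormedType.Exports.
Local Open Scope classical_set_scope.
Local Open Scope ring_scope.

(* The cost of [lra] is dominated by the parsing of the hypotheses, so they are cleared first; the trivial ones
   are there because [lra] fails when the context is shorter than the list of section variables. *)
Ltac goal_lra := clear; do 50 pose proof tt; intros; lra.

(** The obstacle is that |X|^2 / n near 1 is what makes marginals Gaussian, and nothing is known
    about it in advance. It is extracted from an auxiliary marginal whose dimension y^32 is far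
    larger than l, y being the integer part of n^(1/300): in high dimension the radial profile of a
    Gaussian is so peaked that a spread of variances becomes visible. There the noise can have
    variance 1; only afterwards is it reduced to y^-8, in dimension l <= y. Gaussian matrices are
    used because their rows are independent: the moments of the smoothed density are explicit
    products of Gaussian densities in one and two variables, and concentration tensorises. The noise
    dominates the covariance of the images of two copies of X, bounds the density, and makes the
    overlap Lipschitz. Pairs of copies far from orthogonal are excluded only up to probability exp(-
    y^40), which has to be negligible against the squared mean density, about exp(- 2 y^39) at the
    largest radii used; this governs the order of the exponents. *)

Ltac mR_ext := fail.

(** Measurability by recursion on the syntax of the function; [mR_ext] is redefined whenever new
    functions acquire a measurability lemma, and goals that no rule matches are left open. *)
Ltac mR := cbv beta; lazymatch goal with
| |- measurable_fun _ (fun x => EFin (@?f x)) => apply/measurable_EFinP; mR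
| |- measurable_fun _ (EFin \o _) => apply/measurable_EFinP; mR
| |- measurable_fun _ (fun x => x) => exact: measurable_id
| |- measurable_fun _ (fun x => GRing.add (@?f x) (@?g x)) => apply: measurable_funD; mR
| |- measurable_fun _ (fun x => GRing.opp (@?f x)) => apply: measurable_funN; mR
| |- measurable_fun _ (fun x => GRing.mul (@?f x) (@?g x)) => apply: measurable_funM; mR
| |- measurable_fun _ (fun x => GRing.exp (@?f x) (@?g x)) => apply: measurable_funX; mR
| |- measurable_fun _ (fun x => expR (@?g x)) => apply: (measurableT_comp (@measurable_expR _)); mR
| |- measurable_fun _ (fun x => tnth (@?g x) ?i) => apply: (measurableT_comp (measurable_tnth i)); mR
| |- measurable_fun _ (fun x => fst (@?g x)) => apply: (measurableT_comp measurable_fst); mR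
| |- measurable_fun _ (fun x => snd (@?g x)) => apply: (measurableT_comp measurable_snd); mR
| |- measurable_fun _ (fun x => pair (@?f x) (@?g x)) => apply: measurable_fun_pair; mR
| |- measurable_fun _ (fun x => bigop.body _ (@?s x) (@?g x)) => first [apply: measurable_sum => ?; mR | apply: measurable_prod => ? ?; mR]
| |- measurable_fun _ ?h =>
   first [ exact: measurable_cst | eassumption | exact: measurable_fst | exact: measurable_snd | exact: measurable_tnth
   | mR_ext | lazymatch h with (fun x => ?f (@?g x)) =>
     match goal with H : measurable_fun _ f |- _ => apply: (measurableT_comp H); mR end end | idtac ]
end.

(** * Lebesgue measure on the line and product measures on tuples *)

Section Leb.
Context (R : realType).
(** Lebesgue measure on the measurable structure of [R] that [k.-tuple R] uses, whereas
    [lebesgue_measure] is attached to [measurableTypeR R]. The integrals are compared by a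
    pushforward along the identity in [ge0_integral_leb]. *)
Definition leb : set R -> \bar R := @lebesgue_measure R.

Let leb0 : leb set0 = 0%E.
Proof. exact: (@measure0 _ _ _ (@lebesgue_measure R)). Qed.
Let leb_ge0 A : (0 <= leb A)%E.
Proof. exact: (@measure_ge0 _ _ _ (@lebesgue_measure R)). Qed.
Let leb_sigma_additive : semi_sigma_additive leb.
Proof. exact: (@measure_semi_sigma_additive _ _ _ (@lebesgue_measure R)). Qed.
HB.instance Definition _ := isMeasure.Build _ _ _ leb leb0 leb_ge0 leb_sigma_additive.
Let leb_sf : sigma_finite setT leb.
Proof. exact: (@sigma_finiteT _ _ _ (@lebesgue_measure R)). Qed.
HB.instance Definition _ := Measure_isSigmaFinite.Build _ _ _ leb leb_sf.

Lemma ge0_integral_leb (f : R -> \bar R) : measurable_fun setT f -> (forall x, 0 <= f x)%E ->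
  (\int[@lebesgue_measure R]_x f x = \int[leb]_x f x)%E.
Proof.
move=> mf f0.
have mid : @measurable_fun _ _ (measurableTypeR R) R setT id by move=> _ Y mY; rewrite setTI.
have := @ge0_integral_pushforward _ _ (measurableTypeR R) R R id mid (@lebesgue_measure R) setT f measurableT mf (fun x _ => f0 x).
rewrite preimage_setT => <-.
apply: eq_measure_integral => A mA _ //.
Qed.

End Leb.

Lemma integral_prob_cst d (T : measurableType d) (R : realType) (mu : {measure set T -> \bar R}) (r : \bar R) :
  mu setT = 1%E -> (\int[mu]_x r = r)%E.
Proof. by move=> h; rewrite (integral_cst mu measurableT r) h mule1. Qed.

Section IntegralT.
Context d (T : measurableType d) (R : realType) (mu : {measure set T -> \bar R}).
Local Open Scope ereal_scope.

Lemma ge0_ZlT (k : R) (f : T -> \bar R) : (0 <= k)%R -> measurable_fun setT f -> (forall x, 0 <= f x) ->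
  \int[mu]_x (k%:E * f x) = k%:E * \int[mu]_x f x.
Proof. by move=> k0 mf f0; rewrite ge0_integralZl // lee_fin. Qed.

Lemma ge0_ZrT (k : R) (f : T -> \bar R) : (0 <= k)%R -> measurable_fun setT f -> (forall x, 0 <= f x) ->
  \int[mu]_x (f x * k%:E) = \int[mu]_x f x * k%:E.
Proof. by move=> k0 mf f0; rewrite ge0_integralZr // lee_fin. Qed.

Lemma ge0_DT (f g : T -> \bar R) : measurable_fun setT f -> measurable_fun setT g ->
  (forall x, 0 <= f x) -> (forall x, 0 <= g x) ->
  \int[mu]_x (f x + g x) = \int[mu]_x f x + \int[mu]_x g x.
Proof. by move=> mf mg f0 g0; rewrite ge0_integralD. Qed.

Lemma ge0_leT (f g : T -> \bar R) : measurable_fun setT f -> measurable_fun setT g ->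
  (forall x, 0 <= f x) -> (forall x, f x <= g x) -> \int[mu]_x f x <= \int[mu]_x g x.
Proof. by move=> mf mg f0 fg; apply: ge0_le_integral => // x _; apply: le_trans (fg x). Qed.

End IntegralT.

Lemma emeasurable_prod d (T : measurableType d) (R : realType) (I : Type) (s : seq I) (P : pred I)
    (h : I -> T -> \bar R) :
  (forall i, P i -> measurable_fun setT (h i)) ->
  measurable_fun setT (fun x => \prod_(i <- s | P i) h i x)%E.
Proof.
move=> mh; elim: s => [|a s IH].
  by rewrite (_ : (fun _ => _) = cst 1%E) //; apply/funext => x; rewrite big_nil.
case Pa : (P a); last by rewrite (_ : (fun _ => _) = (fun x => \prod_(i <- s | P i) h i x)%E) //;
  apply/funext => x; rewrite big_cons Pa.
rewrite (_ : (fun _ => _) = (h a \* (fun x => \prod_(i <- s | P i) h i x))%E).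
  by apply: emeasurable_funM => //; exact: mh.
by apply/funext => x; rewrite big_cons Pa.
Qed.

Section Power.
Context d (T : measurableType d) (R : realType).

Definition consm n (z : T * n.-tuple T) : n.+1.-tuple T := [tuple of z.1 :: z.2].

Lemma measurable_consm n : measurable_fun setT (@consm n).
Proof. by apply: measurable_cons => //; exact: measurable_fst || exact: measurable_snd. Qed.

Variable m : {sigma_finite_measure set T -> \bar R}.

Section step.
Variables (n : nat) (mn : {sigma_finite_measure set (n.-tuple T) -> \bar R}).
Definition pwS : set (n.+1.-tuple T) -> \bar R := pushforward (m \x mn)%E (@consm n).
Let pwS0 : pwS set0 = 0%E.
Proof. by rewrite /pwS /pushforward preimage_set0 measure0. Qed.
Let mpwS : {measure set (n.+1.-tuple T) -> \bar R} :=
  measure_function_pushforward__canonical__measure_function_Measure (m \x mn)%E (@measurable_consm n).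
Let pwS_ge0 A : (0 <= pwS A)%E.
Proof. exact: (@measure_ge0 _ _ _ mpwS). Qed.
Let pwS_sa : semi_sigma_additive pwS.
Proof. exact: (@measure_semi_sigma_additive _ _ _ mpwS). Qed.
HB.instance Definition _ := isMeasure.Build _ _ _ pwS pwS0 pwS_ge0 pwS_sa.

Lemma pwS_sf : sigma_finite setT pwS.
Proof.
have /sigma_finiteP[F [FT ndF Foo]] := sigma_finiteT m.
have /sigma_finiteP[G [GT ndG Goo]] := sigma_finiteT mn.
exists (fun k => [set t : n.+1.-tuple T | F k (thead t) /\ G k [tuple of behead t]]).
  apply/seteqP; split => // t _.
  have : (\bigcup_k F k) (thead t) by rewrite -FT.
  have : (\bigcup_k G k) [tuple of behead t] by rewrite -GT.
  move=> [j _ Gj] [k _ Fk]; exists (maxn j k) => //; split.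
    by move: Fk; exact/subsetPset/ndF/leq_maxr.
  by move: Gj; exact/subsetPset/ndG/leq_maxl.
move=> k; have [mF Fk] := Foo k; have [mG Gk] := Goo k; split.
  apply: (@measurableI _ _ ((fun t => thead t) @^-1` F k) ((fun t : n.+1.-tuple T => [tuple of behead t]) @^-1` G k)).
    by rewrite -[X in measurable X]setTI; exact: (measurable_tnth ord0).
  by rewrite -[X in measurable X]setTI; exact: measurable_behead.
rewrite /pwS /pushforward.
rewrite (_ : _ @^-1` _ = F k `*` G k); last first.
  apply/seteqP; split => -[x t] /=; rewrite /consm /= theadE => -[Fx Gt].
    by split => //; rewrite (_ : t = [tuple of behead [tuple of x :: t]]) //; exact/val_inj.
  by split => //; rewrite (_ : [tuple of _] = (t : n.-tuple T)) //; exact/val_inj.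
by rewrite product_measure1E // lte_mul_pinfty // ge0_fin_numE.
Qed.
HB.instance Definition _ := Measure_isSigmaFinite.Build _ _ _ pwS pwS_sf.
End step.

(** The n-fold product of [m], as an image of the binary product under [cons]. Each stage returns a
    sigma-finite measure, since this is what the next product and Tonelli's theorem require. *)
Fixpoint pw_rec n : {sigma_finite_measure set (n.-tuple T) -> \bar R} :=
  if n is n'.+1 return {sigma_finite_measure set (n.-tuple T) -> \bar R}
  then pwS (pw_rec n') else (\d_ ([tuple] : 0.-tuple T)).

End Power.

HB.lock Definition pw d (T : measurableType d) (R : realType) (m : {sigma_finite_measure set T -> \bar R}) (n : nat) :
  {sigma_finite_measure set (n.-tuple T) -> \bar R} := pw_rec m n.

Section PowerTheory.
Context d (T : measurableType d) (R : realType).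
Variable m : {sigma_finite_measure set T -> \bar R}.
Local Notation pw := (pw m).

Lemma ge0_integral_pwS n (f : n.+1.-tuple T -> \bar R) : measurable_fun setT f ->
  (forall t, 0 <= f t)%E ->
  (\int[pw n.+1]_t f t = \int[m]_x \int[pw n]_t f [tuple of x :: t])%E.
Proof.
move=> mf f0; rewrite unlock /=.
rewrite (@ge0_integral_pushforward _ _ _ _ R _ (@measurable_consm _ T n) (m \x pw_rec m n)%E setT f measurableT mf) //.
rewrite preimage_setT fubini_tonelli1 //; last by move=> z; exact: f0.
by apply: measurableT_comp => //; exact: measurable_consm.
Qed.

Lemma integral_pw0 (f : 0.-tuple T -> \bar R) : (\int[pw 0]_t f t = f [tuple])%E.
Proof.
rewrite unlock /= integral_dirac //=.
  by rewrite diracT mul1e.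
move=> _ Y mY; rewrite setTI.
have [h|h] := pselect (Y (f [tuple])).
  rewrite (_ : _ @^-1` _ = setT) //; apply/seteqP; split => // t _ /=.
  by rewrite (tuple0 t).
rewrite (_ : _ @^-1` _ = set0) //; apply/seteqP; split => // t /=.
by rewrite (tuple0 t).
Qed.

Lemma measurable_cons_r n (x : T) : measurable_fun setT (fun t : n.-tuple T => [tuple of x :: t]).
Proof. by apply: measurable_cons. Qed.

Lemma measurable_integral_cons n (f : n.+1.-tuple T -> \bar R) : measurable_fun setT f ->
  (forall t, 0 <= f t)%E -> measurable_fun setT (fun x => \int[pw n]_t f [tuple of x :: t])%E.
Proof.
move=> mf f0.
apply: (@measurable_fun_fubini_tonelli_F _ _ _ _ _ (pw n) (fun z => f (consm z))) => //.
by apply: measurableT_comp => //; exact: measurable_consm.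
Qed.

Lemma pw_setT n : m setT = 1%E -> pw n setT = 1%E.
Proof.
move=> m1; elim: n => [|n IH]; first by rewrite unlock /= diracT.
rewrite -[LHS]mul1e -(integral_cst (pw n.+1) measurableT 1%E) ge0_integral_pwS //.
under eq_integral do rewrite integral_prob_cst //.
by rewrite integral_prob_cst.
Qed.

Local Open Scope ereal_scope.
Lemma ge0_pw_prod n (F : 'I_n -> T -> \bar R) : (forall i, measurable_fun setT (F i)) ->
  (forall i x, 0 <= F i x) ->
  \int[pw n]_t \prod_(i < n) F i (tnth t i) = \prod_(i < n) \int[m]_x F i x.
Proof.
elim: n F => [|n IH] F mF F0; first by rewrite integral_pw0 !big_ord0.
have mprod k (G : 'I_k -> T -> \bar R) : (forall i, measurable_fun setT (G i)) ->
    measurable_fun setT (fun t : k.-tuple T => \prod_(i < k) G i (tnth t i)).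
  move=> mG; apply: emeasurable_prod => i _.
  by apply: (measurableT_comp (mG i)); exact: measurable_tnth.
rewrite ge0_integral_pwS //; last 2 first.
- exact: mprod.
- by move=> t; apply: prode_ge0.
rewrite big_ord_recl.
rewrite -ge0_integralZr //; last by apply: prode_ge0 => i _; apply: integral_ge0.
apply: eq_integral => x _; rewrite -(IH (fun i => F (lift ord0 i))) // -ge0_integralZl //.
- apply: eq_integral => t _; rewrite big_ord_recl tnth0; congr (_ * _)%E.
  by apply: eq_bigr => i _; rewrite tnthS.
- by apply: (mprod _ (fun i => F (lift ord0 i))).
- by move=> t _; apply: prode_ge0.
Qed.

Lemma ge0_pw_coord n (i : 'I_n) (f : T -> \bar R) : m setT = 1 -> measurable_fun setT f ->
  (forall x, 0 <= f x) -> \int[pw n]_t f (tnth t i) = \int[m]_x f x.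
Proof.
move=> m1 mf f0.
have := @ge0_pw_prod n (fun j x => if j == i then f x else 1).
rewrite (bigD1 i) //= eqxx big1 ?mule1; last first.
  by move=> j /negbTE ->; rewrite integral_prob_cst.
move=> <-; last 2 first.
- by move=> j; case: (j == i) => //; exact: measurable_cst.
- by move=> j x; case: (j == i) => //; exact: lee01.
apply: eq_integral => t _; rewrite (bigD1 i) //= eqxx big1 ?mule1 //.
by move=> j /negbTE ->.
Qed.

End PowerTheory.

Section Iint.
Context (R : realType).
Notation lebn := (pw (@leb R)).

Lemma iintE n (f : n.-tuple R -> \bar R) : measurable_fun setT f -> (forall t, 0 <= f t)%E ->
  iint f = (\int[lebn n]_t f t)%E.
Proof.
elim: n f => [|n IH] f mf f0; first by rewrite integral_pw0.
rewrite ge0_integral_pwS //= -ge0_integral_leb //; last 2 first.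
- exact: measurable_integral_cons.
- by move=> x; apply: integral_ge0.
apply: eq_integral => x _; rewrite IH //.
by apply: measurableT_comp => //; exact: measurable_cons_r.
Qed.
End Iint.

(** * Measures with a density; Gaussian measure on the line *)

Section Density.
Context d (T : measurableType d) (R : realType).
Local Open Scope ereal_scope.
Import HBNNSimple.

(** For nonnegative simple functions this is linearity; monotone convergence on both sides gives the
    general case. *)
Lemma ge0_integral_density (mu nu : {measure set T -> \bar R}) (p : T -> R) (f : T -> \bar R) :
  measurable_fun setT p -> (forall x, (0 <= p x)%R) ->
  (forall A, measurable A -> nu A = \int[mu]_(x in A) (p x)%:E) ->
  measurable_fun setT f -> (forall x, 0 <= f x) ->
  \int[nu]_x f x = \int[mu]_x (f x * (p x)%:E).
Proof.
move=> mp p0 nuE mf f0.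
have mpE : measurable_fun setT (EFin \o p) by exact/measurable_EFinP.
have pE0 x : 0 <= (p x)%:E by rewrite lee_fin.
pose f_ := nnsfun_approx measurableT mf.
have sf (h : {nnsfun T >-> R}) : \int[nu]_x (h x)%:E = \int[mu]_x ((h x)%:E * (p x)%:E).
  rewrite integralT_nnsfun sintegralE.
  transitivity (\sum_(k \in range h) \int[mu]_x (k%:E * ((EFin \o p) \_ (h @^-1` [set k])) x)).
    apply: eq_fsbigr => k /[!inE] -[y _ <-].
    rewrite ge0_integralZl //.
    - by rewrite nuE // [in LHS]integral_mkcond.
    - by apply/(measurable_restrictT _ _).1 => //; exact: measurable_funTS.
    - by move=> x _; rewrite patchE; case: ifP => // _; exact: pE0.
    - by rewrite lee_fin.
  rewrite -ge0_integral_fsum //.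
  - apply: eq_integral => x _; rewrite fimfunE -fsumEFin //.
    rewrite ge0_mule_fsuml; last by move=> k; rewrite nnfun_muleindic_ge0.
    apply: eq_fsbigr => k _; rewrite EFinM -muleA; congr (_ * _).
    by rewrite patchE indicE; case: ifPn => h1; rewrite ?mul1e ?mul0e.
  - move=> k; apply: measurable_funeM.
    by apply/(measurable_restrictT _ _).1 => //; exact: measurable_funTS.
  - move=> k x _; have [[y _ <-]|kn] := pselect (range h k).
      by rewrite mule_ge0 ?lee_fin // patchE; case: ifP => // _; exact: pE0.
    rewrite patchE; case: ifPn; last by rewrite mule0.
    by rewrite inE /= => hx; exfalso; apply: kn; exists x.
transitivity (limn (fun n => \int[nu]_x (f_ n x)%:E)).
  rewrite -monotone_convergence //.
  - by apply: eq_integral => x _; apply/esym/cvg_lim => //; apply: cvg_nnsfun_approx.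
  - by move=> n; exact/measurable_EFinP/measurable_funP.
  - by move=> n y _; rewrite lee_fin.
  - by move=> y _ m n mn; rewrite lee_fin; exact/lefP/nd_nnsfun_approx.
transitivity (limn (fun n => \int[mu]_x ((f_ n x)%:E * (p x)%:E))).
  by congr (limn _); apply/funext => n; exact: sf.
rewrite -monotone_convergence //.
- apply: eq_integral => x _; apply/cvg_lim => //.
  by apply: cvgeMr => //; apply: cvg_nnsfun_approx.
- by move=> n; apply: emeasurable_funM => //; exact/measurable_EFinP/measurable_funP.
- by move=> n y _; rewrite mule_ge0 ?lee_fin.
- by move=> y _ m n mn; rewrite lee_wpmul2r // lee_fin; exact/lefP/nd_nnsfun_approx.
Qed.

End Density.

(** Density of N(0, w). The parameter is the variance, so that parameters add under convolution;
    [normal_pdf] takes the standard deviation. *)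
HB.lock Definition gpdf (R : realType) (w x : R) : R :=
  (Num.sqrt (2 * pi * w))^-1 * expR (- (x ^+ 2 / (2 * w))).

Section Gauss.
Context (R : realType).
Implicit Types (w x : R).
Local Notation leb := (@leb R).

Lemma gpdf_normal w : 0 < w -> gpdf w = normal_pdf 0 (Num.sqrt w).
Proof.
move=> w0; have sw : Num.sqrt w != 0 by rewrite gt_eqF // sqrtr_gt0.
apply/funext => x; rewrite normal_pdfE // unlock /normal_peak /normal_fun sqr_sqrtr ?ltW // subr0.
congr (_^-1 * expR _); first by congr Num.sqrt; rewrite -mulr_natr; ring.
by rewrite mulNr -[w *+ 2]mulr_natl.
Qed.

Definition gau w : set R -> \bar R := normal_prob 0 (Num.sqrt w).
Let gau0 w : gau w set0 = 0%E.
Proof. exact: (@measure0 _ _ _ (normal_prob 0 (Num.sqrt w))). Qed.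
Let gau_ge0 w A : (0 <= gau w A)%E.
Proof. exact: (@measure_ge0 _ _ _ (normal_prob 0 (Num.sqrt w))). Qed.
Let gau_sigma_additive w : semi_sigma_additive (gau w).
Proof. exact: (@measure_semi_sigma_additive _ _ _ (normal_prob 0 (Num.sqrt w))). Qed.
HB.instance Definition _ w := isMeasure.Build _ _ _ (gau w) (gau0 w) (gau_ge0 w) (@gau_sigma_additive w).
Let gauT w : gau w setT = 1%E.
Proof. exact: (@probability_setT _ _ _ (normal_prob 0 (Num.sqrt w))). Qed.
HB.instance Definition _ w := Measure_isProbability.Build _ _ _ (gau w) (gauT w).
Definition gau_setT := gauT.

Lemma gpdf_ge0 w x : 0 <= gpdf w x.
Proof. by rewrite unlock mulr_ge0 ?expR_ge0 // invr_ge0 sqrtr_ge0. Qed.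

Lemma gpdf_gt0 w x : 0 < w -> 0 < gpdf w x.
Proof. by move=> w0; rewrite unlock mulr_gt0 ?expR_gt0 // invr_gt0 sqrtr_gt0 !mulr_gt0 // pi_gt0. Qed.

Lemma measurable_gpdf w : measurable_fun setT (gpdf w).
Proof.
rewrite (_ : gpdf w = fun x => (Num.sqrt (2 * pi * w))^-1 * expR (- (x ^+ 2 / (2 * w)))); last first.
  by apply/funext => x; rewrite unlock.
apply: measurable_funM => //; apply: measurableT_comp => //; apply: measurable_funN.
by apply: measurable_funM => //; exact: measurable_funX.
Qed.

Lemma integral_gpdf w : 0 < w -> (\int[leb]_x (gpdf w x)%:E = 1)%E.
Proof.
move=> w0; rewrite -ge0_integral_leb //; last 2 first.
- by apply/measurable_EFinP; exact: measurable_gpdf.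
- by move=> x; rewrite lee_fin gpdf_ge0.
by rewrite gpdf_normal // integral_normal_pdf.
Qed.

Lemma ge0_integral_gau w (f : R -> \bar R) : 0 < w -> measurable_fun setT f -> (forall x, 0 <= f x)%E ->
  (\int[gau w]_x f x = \int[leb]_x (f x * (gpdf w x)%:E))%E.
Proof.
move=> w0 mf f0; apply: ge0_integral_density => //.
- exact: measurable_gpdf.
- by move=> x; exact: gpdf_ge0.
move=> A mA; change (normal_prob 0 (Num.sqrt w) A = \int[leb]_(x in A) (gpdf w x)%:E)%E.
rewrite /normal_prob -gpdf_normal //.
rewrite integral_mkcond ge0_integral_leb //; last 2 first.
- apply/(measurable_restrictT _ _).1 => //; apply: measurable_funTS; apply/measurable_EFinP; exact: measurable_gpdf.
- by move=> x; apply: erestrict_ge0 => z _; rewrite lee_fin gpdf_ge0.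
by rewrite [RHS]integral_mkcond.
Qed.

Lemma leb_subst_fun (F : R -> R) (c : R) (f : R -> \bar R) : 0 < c -> measurable_fun setT F ->
  (forall A, measurable A -> leb (F @^-1` A) = (c%:E * leb A)%E) ->
  measurable_fun setT f -> (forall x, 0 <= f x)%E ->
  (\int[leb]_x f (F x) = c%:E * \int[leb]_x f x)%E.
Proof.
move=> c0 mF FE mf f0.
have := ge0_integral_pushforward mF leb measurableT mf (fun x _ => f0 x).
rewrite preimage_setT => <-.
rewrite (eq_measure_integral (mscale (NngNum (ltW c0)) leb)) => [|A mA _]; last exact: FE.
by rewrite ge0_integral_mscale.
Qed.

Lemma leb_ocitv (a b : R) : leb `]a, b] = (if a < b then (b - a)%:E else 0%:E).
Proof. by rewrite /leb lebesgue_measure_itv /= lte_fin; case: ifP. Qed.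

(** The set function sending A to [a] times the measure of its preimage gives every half-open
    interval its length, so it is Lebesgue measure by uniqueness. *)
Lemma leb_affine (a b : R) : 0 < a -> forall A, measurable A ->
  leb ((fun x => a * x + b) @^-1` A) = (a^-1%:E * leb A)%E.
Proof.
move=> a0.
have mF : measurable_fun setT (fun x : R => a * x + b).
  by apply: measurable_funD => //; exact: measurable_funM.
have ai : 0 < a by [].
have mF' : @measurable_fun _ _ (measurableTypeR R) (measurableTypeR R) setT (fun x : R => a * x + b) := mF.
pose m1 : {measure set (measurableTypeR R) -> \bar R} := mscale (NngNum (ltW a0))
  (measure_function_pushforward__canonical__measure_function_Measure (@lebesgue_measure R) mF').
have E A : measurable A -> @lebesgue_measure R A = m1 A.
  apply: lebesgue_measure_unique => _ [[c e] _ <-] /=.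
  change (leb `]c, e] = a%:E * leb ((fun x : R => a * x + b)%R @^-1` `]c, e]))%E.
  rewrite (_ : _ @^-1` _ = `](c - b) / a, (e - b) / a]%classic); last first.
    apply/seteqP; split => x /=; rewrite !in_itv /= ltr_pdivrMr // ler_pdivlMr // ltrBlDr lerBrDr (mulrC x).
    by [].
    by [].
  rewrite !leb_ocitv ltr_pM2r ?invr_gt0 // ltrD2r; case: ifP => _; last by rewrite mule0.
  by rewrite -EFinM; congr EFin; field; rewrite gt_eqF.
move=> A mA; have -> : leb A = (a%:E * leb ((fun x : R => a * x + b)%R @^-1` A))%E := E A mA.
rewrite muleA -EFinM mulVf ?mul1e // gt_eqF //.
Qed.

Lemma ge0_integral_affine (a b : R) (f : R -> \bar R) : 0 < a ->
  measurable_fun setT f -> (forall x, 0 <= f x)%E ->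
  (\int[leb]_x f (a * x + b)%R = a^-1%:E * \int[leb]_x f x)%E.
Proof.
move=> a0 mf f0; apply: leb_subst_fun => //; first by rewrite invr_gt0.
- by apply: measurable_funD => //; exact: measurable_funM.
- exact: leb_affine.
Qed.

Lemma ge0_integral_shift (b : R) (f : R -> \bar R) :
  measurable_fun setT f -> (forall x, 0 <= f x)%E ->
  (\int[leb]_x f (x + b)%R = \int[leb]_x f x)%E.
Proof.
move=> mf f0; have := ge0_integral_affine b (@ltr01 R) mf f0.
by rewrite invr1 mul1e => <-; apply: eq_integral => x _; rewrite mul1r.
Qed.

(* completing the square *)
Lemma integral_expR_quad (A B C : R) : 0 < A ->
  (\int[leb]_g (expR (- ((A * g ^+ 2 - 2 * B * g + C) / 2)))%:E =
   (Num.sqrt (2 * pi / A) * expR (- ((C - B ^+ 2 / A) / 2)))%:E)%E.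
Proof.
move=> A0; have Ai : 0 < A^-1 by rewrite invr_gt0.
have An0 : A != 0 by rewrite gt_eqF.
have sn0 : Num.sqrt (2 * pi / A) != 0 by rewrite gt_eqF // sqrtr_gt0 !mulr_gt0 // pi_gt0.
rewrite -[RHS]mule1 -(integral_gpdf Ai).
have mg : measurable_fun setT (fun x => (gpdf A^-1 x)%:E) by apply/measurable_EFinP; exact: measurable_gpdf.
have g0 x : (0 <= (gpdf A^-1 x)%:E)%E by rewrite lee_fin gpdf_ge0.
rewrite -(ge0_integral_shift (- (B / A)) mg g0) -ge0_integralZl //; last first.
- by apply/measurable_EFinP; apply: (measurableT_comp (measurable_gpdf _)); exact: measurable_funD.
apply: eq_integral => g _; rewrite -EFinM unlock; congr EFin.
rewrite mulrACA divff // mul1r -expRD; congr expR.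
by field.
Qed.

End Gauss.

(** * The Prekopa-Leindler inequality and Prekopa's theorem *)

Section PrekopaLine.
Context (R : realType).
Local Notation leb := (@leb R).

Lemma measurable_is_interval (W : set R) : is_interval W -> measurable W.
Proof. by move=> iW; exact: is_interval_measurable. Qed.

Lemma leb_itvcc (a b : R) : a <= b -> leb `[a, b] = (b - a)%:E.
Proof.
move=> ab; rewrite /leb lebesgue_measure_itv /= lte_fin; case: ltgtP ab => // -> _.
by rewrite subrr.
Qed.

Lemma leb_itvoo (a b : R) : a <= b -> leb `]a, b[ = (b - a)%:E.
Proof.
move=> ab; rewrite /leb lebesgue_measure_itv /= lte_fin; case: ltgtP ab => // -> _.
by rewrite subrr.
Qed.

Lemma leb_ge_length (W : set R) (a b : R) : is_interval W -> W a -> W b -> ((b - a)%:E <= leb W)%E.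
Proof.
move=> iW Wa Wb; have [ab|ba] := leP a b; last first.
  by apply: le_trans (measure_ge0 _ _); rewrite lee_fin subr_le0 ltW.
rewrite -leb_itvcc //; apply: le_measure; rewrite ?inE //.
  exact: measurable_is_interval.
by move=> z /=; rewrite in_itv /=; exact: iW.
Qed.

(** Because [W] is an interval, its measure is at least the distance between any two of its points,
    so t (u2 - u1) + (1 - t) (v2 - v1) <= leb W for all points of U and V; suprema and infima then
    give the claim with the lengths of the convex hulls. The interval hypothesis, which superlevel
    sets of log-concave functions satisfy, takes the place of an approximation by compact sets. *)
Lemma brunn_minkowski_line (t : R) (U V W : set R) : 0 < t < 1 -> is_interval W ->
  measurable U -> measurable V -> U !=set0 -> V !=set0 ->
  (forall x y, U x -> V y -> W (t * x + (1 - t) * y)) ->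
  (t%:E * leb U + (1 - t)%:E * leb V <= leb W)%E.
Proof.
move=> /andP[t0 t1] iW mU mV [u0 Uu0] [v0 Vv0] UVW.
have t1' : 0 < 1 - t by rewrite subr_gt0.
have [->|Woo] := eqVneq (leb W) +oo%E; first by rewrite leey.
have Wfin : (leb W \is a fin_num)%E by rewrite ge0_fin_numE ?ltey // measure_ge0.
set w := fine (leb W); have wE : leb W = w%:E by rewrite fineK.
have H u1 u2 v1 v2 : U u1 -> U u2 -> V v1 -> V v2 -> t * (u2 - u1) + (1 - t) * (v2 - v1) <= w.
  move=> Uu1 Uu2 Vv1 Vv2; rewrite -lee_fin -wE.
  apply: le_trans (leb_ge_length iW (UVW _ _ Uu1 Vv1) (UVW _ _ Uu2 Vv2)).
  by rewrite lee_fin; lra.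
have w0 : 0 <= w by have := H _ _ _ _ Uu0 Uu0 Vv0 Vv0; lra.
(* A finite [leb W] bounds U and V, so that their suprema and infima exist. *)
have hu u : U u -> t * `|u - u0| <= w.
  move=> Uu; have := H _ _ _ _ Uu Uu0 Vv0 Vv0; have := H _ _ _ _ Uu0 Uu Vv0 Vv0.
  by have [h|h] := lerP 0 (u - u0); rewrite ?(ger0_norm h) ?(ltr0_norm h); lra.
have hv v : V v -> (1 - t) * `|v - v0| <= w.
  move=> Vv; have := H _ _ _ _ Uu0 Uu0 Vv Vv0; have := H _ _ _ _ Uu0 Uu0 Vv0 Vv.
  by have [h|h] := lerP 0 (v - v0); rewrite ?(ger0_norm h) ?(ltr0_norm h); lra.
have bd (s : R) (X : set R) x0 : 0 < s -> (forall x, X x -> s * `|x - x0| <= w) ->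
    (forall x, X x -> x0 - w / s <= x <= x0 + w / s).
  move=> s0 hx x /hx; rewrite mulrC -ler_pdivlMr // ler_norml => /andP[]; lra.
have bU := bd t U u0 t0 hu; have bV := bd _ V v0 t1' hv.
have sU : has_sup U by split; [exists u0|exists (u0 + w / t) => x /bU /andP[]].
have iU : has_inf U by split; [exists u0|exists (u0 - w / t) => x /bU /andP[]].
have sV : has_sup V by split; [exists v0|exists (v0 + w / (1 - t)) => x /bV /andP[]].
have iV : has_inf V by split; [exists v0|exists (v0 - w / (1 - t)) => x /bV /andP[]].
have lebX (X : set R) : measurable X -> has_sup X -> has_inf X -> (leb X <= (sup X - inf X)%:E)%E.
  move=> mX sX iX.
  have le : inf X <= sup X by case: (sX) => -[x Xx] _; apply: (le_trans (ge_inf iX.2 Xx)); apply: sup_ubound => //; exact: sX.2.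
  rewrite -leb_itvcc //; apply: le_measure; rewrite ?inE // => x Xx /=.
  by rewrite in_itv /= ge_inf ?sup_ubound //; [exact: sX.2 | exact: iX.2].
have K : t * (sup U - inf U) + (1 - t) * (sup V - inf V) <= w.
  rewrite leNgt; apply/negP => h.
  set e := (t * (sup U - inf U) + (1 - t) * (sup V - inf V) - w) / 4.
  have e0 : 0 < e by rewrite divr_gt0 // subr_gt0.
  have [u2 Uu2 hu2] := sup_adherent e0 sU; have [u1 Uu1 hu1] := inf_adherent e0 iU.
  have [v2 Vv2 hv2] := sup_adherent e0 sV; have [v1 Vv1 hv1] := inf_adherent e0 iV.
  have := H _ _ _ _ Uu1 Uu2 Vv1 Vv2.
  have a1 : t * (sup U - inf U - 2 * e) <= t * (u2 - u1) by rewrite ler_pM2l //; lra.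
  have a2 : (1 - t) * (sup V - inf V - 2 * e) <= (1 - t) * (v2 - v1) by rewrite ler_pM2l //; move: hv1 hv2; goal_lra.
  have : w = t * (sup U - inf U) + (1 - t) * (sup V - inf V) - 4 * e by rewrite /e; field.
  by move: a2 a1 h; goal_lra.
apply: (@le_trans _ _ (t%:E * (sup U - inf U)%:E + (1 - t)%:E * (sup V - inf V)%:E)%E).
  by apply: leeD; (apply: lee_wpmul2l; [by rewrite lee_fin ltW | exact: lebX]).
by rewrite wE -!EFinM -EFinD lee_fin.
Qed.

Let lvl (M : R) (f : R -> \bar R) (s : R) := leb [set x | (M * s)%:E < f x]%E.

Lemma measurable_superlevel (M : R) (f : R -> \bar R) : measurable_fun setT f ->
  measurable [set z : R * R | (M * z.1)%:E < f z.2]%E.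
Proof.
move=> mf; rewrite -[X in measurable X]setTI; apply: measurable_lte => //; first by mR.
by apply: (measurableT_comp mf).
Qed.

Lemma measurable_lvl (M : R) (f : R -> \bar R) : measurable_fun setT f -> measurable_fun setT (lvl M f).
Proof.
move=> mf; have := measurable_fun_xsection leb (measurable_superlevel M mf).
rewrite (_ : _ \o _ = lvl M f) //; apply/funext => s /=; rewrite /lvl; congr (leb _).
by apply/seteqP; split => x; rewrite /xsection /= inE.
Qed.

(** Levels are normalised to s in ]0, 1[ so that functions truncated at different heights can be
    compared level by level. *)
Lemma layer_cake (M : R) (f : R -> \bar R) : 0 < M -> measurable_fun setT f -> (forall x, 0 <= f x)%E ->
  (\int[leb]_x mine (f x) M%:E = M%:E * (\int[leb]_(s in `]0%R, 1%R[) lvl M f s))%E.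
Proof.
move=> M0 mf f0.
pose B := [set z : R * R | (M * z.1)%:E < f z.2]%E `&` [set z | z.1 \in `]0, 1[].
have mB : measurable B.
  apply: measurableI; first exact: measurable_superlevel.
  rewrite (_ : [set _ | _] = fst @^-1` `]0, 1[%classic) //.
  by rewrite -[X in measurable X]setTI; apply: measurable_fst.
have mB1 : measurable_fun setT (fun z => (\1_B z : R)%:E) by apply/measurable_EFinP; exact: measurable_indic.
have E1 : (\int[leb]_(s in `]0%R, 1%R[) lvl M f s = \int[leb]_s \int[leb]_x (\1_B (s, x) : R)%:E)%E.
  rewrite integral_mkcond; apply: eq_integral => s _; rewrite patchE.
  have -> : (fun x => (\1_B (s, x) : R)%:E) = (fun x => (\1_(xsection B s) x)%:E) :> (R -> \bar R).
    by apply/funext => x; rewrite !indicE /xsection mem_setE; congr ((_ : bool)%:R%:E); apply/idP/idP; rewrite inE.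
  rewrite integral_indic ?setIT //; last exact: measurable_xsection.
  case: ifPn => sI.
    rewrite /lvl; congr (leb _); apply/seteqP; split => x; rewrite /xsection /B /= inE /=.
      by move=> h; split => //; move: sI; rewrite inE.
    by case.
  rewrite (_ : xsection B s = set0) ?measure0 //; apply/seteqP; split => x //; rewrite /xsection /B /= inE /= => -[_ h].
  by move: sI; rewrite notin_setE /=.
rewrite E1 (fubini_tonelli (fun z : R * R => (\1_B z : R)%:E)) //=.
rewrite -ge0_integralZl //; last 3 first.
- by apply: (measurable_fun_fubini_tonelli_G (m1 := leb) (fun z : R * R => (\1_B z : R)%:E)) => // z; rewrite lee_fin.
- by move=> x _; apply: integral_ge0 => s _; rewrite lee_fin.
- by rewrite lee_fin ltW.
apply: eq_integral => x _.
have -> : (fun s => (\1_B (s, x) : R)%:E) = (fun s => (\1_(ysection B x) s)%:E) :> (R -> \bar R).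
  by apply/funext => s; rewrite !indicE /ysection mem_setE; congr ((_ : bool)%:R%:E); apply/idP/idP; rewrite inE.
rewrite integral_indic ?setIT //; last exact: measurable_ysection.
have [Mf|fM] := leP M%:E (f x).
  rewrite (_ : ysection B x = `]0, 1[%classic); last first.
    apply/seteqP; split => s; rewrite /ysection /B /= inE /=; first by case.
    move=> h; split => //; apply: lt_le_trans Mf; rewrite lte_fin -[ltRHS]mulr1 ltr_pM2l //.
    by move: h; rewrite in_itv /= => /andP[].
  have -> : (leb : {measure set R -> \bar R}) `]0, 1[%classic = 1%E by rewrite -[LHS]/(leb `]0, 1[%classic) leb_itvoo // subr0.
  by rewrite mule1.
have fr : f x \is a fin_num by rewrite ge0_fin_numE // (lt_trans fM) // ltry.
rewrite -(fineK fr) in fM *; have r0 : 0 <= fine (f x) by rewrite fine_ge0.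
set r := fine (f x) in fM r0 *; rewrite lte_fin in fM.
rewrite (_ : ysection B x = `]0, r / M[%classic); last first.
  apply/seteqP; split => s; rewrite /ysection /B /= inE /= !in_itv /= -(fineK fr) lte_fin ltr_pdivlMr // (mulrC s).
    by move=> [-> /andP[->]].
  move=> /andP[s0 sr]; split => //; rewrite s0 /= -(ltr_pM2l M0) mulr1.
  exact: lt_trans sr fM.
rewrite -[X in (_ * X)%E]/(leb `]0, (r / M)[%classic) leb_itvoo; last by rewrite divr_ge0 // ltW.
by rewrite subr0 -EFinM mulrCA divff ?gt_eqF // mulr1 /r fineK.
Qed.

Lemma expR_convex (t a b : R) : 0 < t < 1 -> expR (t * a + (1 - t) * b) <= t * expR a + (1 - t) * expR b.
Proof.
move=> /andP[t0 t1]; set c := t * a + (1 - t) * b.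
have H x : expR c * (1 + (x - c)) <= expR x.
  by rewrite (_ : expR x = expR c * expR (x - c)) ?ler_pM2l ?expR_gt0 ?expR_ge1Dx // -expRD addrC subrK.
have Ha : t * (expR c * (1 + (a - c))) <= t * expR a by rewrite ler_pM2l.
have Hb : (1 - t) * (expR c * (1 + (b - c))) <= (1 - t) * expR b by rewrite ler_pM2l ?subr_gt0.
apply: le_trans (lerD Ha Hb); rewrite le_eqVlt; apply/orP; left; apply/eqP; rewrite /c; ring.
Qed.

(** At level s, the superlevel sets of u at e^m1 s and of v at e^m2 s combine into that of w at e^(t
    m1 + (1 - t) m2) s. [brunn_minkowski_line] asks for both to be nonempty, which is why each
    function is cut at a height all of whose lower levels are attained. The sum of measures becomes
    a product by convexity of the exponential. *)
Lemma prekopa_leindler_levels (t m1 m2 A B : R) (u v w : R -> \bar R) : 0 < t < 1 ->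
  measurable_fun setT u -> measurable_fun setT v -> measurable_fun setT w ->
  (forall x, 0 <= u x)%E -> (forall x, 0 <= v x)%E -> (forall x, 0 <= w x)%E ->
  (forall r, is_interval [set x | r%:E < w x]%E) ->
  (forall x y a b : R, (expR a)%:E <= u x -> (expR b)%:E <= v y ->
     (expR (t * a + (1 - t) * b))%:E <= w (t * x + (1 - t) * y)%R)%E ->
  (forall s : R, (0 < s < 1)%R -> exists x, (expR m1 * s)%:E < u x)%E ->
  (forall s : R, (0 < s < 1)%R -> exists x, (expR m2 * s)%:E < v x)%E ->
  ((expR A)%:E <= \int[leb]_x mine (u x) (expR m1)%:E)%E ->
  ((expR B)%:E <= \int[leb]_x mine (v x) (expR m2)%:E)%E ->
  ((expR (t * A + (1 - t) * B))%:E <= \int[leb]_x w x)%E.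
Proof.
move=> t01 mu mv mw u0 v0 w0 iw uvw nu nv Au Bv.
have [t0 t1] := andP t01; have t1' : 0 < 1 - t by rewrite subr_gt0.
pose M := expR (t * m1 + (1 - t) * m2).
apply: (@le_trans _ _ (\int[leb]_x mine (w x) M%:E)%E); last first.
  apply: ge0_le_integral => //.
  - by move=> x _; rewrite le_min w0 lee_fin expR_ge0.
  - exact: measurable_mine.
  - by move=> x _; rewrite ge_min lexx.
rewrite (layer_cake (expR_gt0 m1) mu u0) in Au; rewrite (layer_cake (expR_gt0 m2) mv v0) in Bv; rewrite (layer_cake (expR_gt0 _) mw w0).
have mI (f : R -> \bar R) k : measurable_fun setT f -> measurable_fun (`]0%R, 1%R[%classic : set R) (lvl k f).
  by move=> mf; apply: measurable_funTS; exact: measurable_lvl.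
have I0 (f : R -> \bar R) k : (0 <= \int[leb]_(s in `]0%R, 1%R[) lvl k f s)%E by apply: integral_ge0 => s _; exact: measure_ge0.
set U := (\int[leb]_(s in _) _)%E in Au; set V := (\int[leb]_(s in _) _)%E in Bv; set W := (\int[leb]_(s in _) _)%E.
have UVW : (t%:E * U + (1 - t)%:E * V <= W)%E.
  have Zl (c k : R) (f : R -> \bar R) : 0 < c -> measurable_fun setT f ->
      (c%:E * (\int[leb]_(s in `]0%R, 1%R[) lvl k f s) = \int[leb]_(s in `]0%R, 1%R[) (c%:E * lvl k f s))%E.
    move=> c0 mf; rewrite ge0_integralZl //; first [exact: mI | by move=> *; exact: measure_ge0 | by rewrite lee_fin ltW].
  rewrite /U /V !Zl //.
  rewrite -ge0_integralD //; last 4 first.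
  - by move=> s _; apply: mule_ge0; [rewrite lee_fin ltW|exact: measure_ge0].
  - by apply: measurable_funeM; exact: mI.
  - by move=> s _; apply: mule_ge0; [rewrite lee_fin ltW|exact: measure_ge0].
  - by apply: measurable_funeM; exact: mI.
  apply: ge0_le_integral => //.
  - by move=> s _; apply: adde_ge0; (apply: mule_ge0; [by rewrite lee_fin ltW|exact: measure_ge0]).
  - by apply: emeasurable_funD; apply: measurable_funeM; exact: mI.
  - exact: mI.
  move=> s /=; rewrite in_itv /= => s01; have [s0 s1] := andP s01.
  have msup (f : R -> \bar R) k : measurable_fun setT f -> measurable [set x | (k * s)%:E < f x]%E.
    by move=> mf; rewrite -[X in measurable X]setTI; exact: emeasurable_fun_o_infty.
  apply: (brunn_minkowski_line t01 (iw _)) => //; [exact: msup|exact: msup|exact: nu|exact: nv|].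
  move=> x y /= hx hy.
  have up (z : \bar R) k : ((expR k * s)%:E < z)%E -> exists2 a, k + ln s < a & ((expR a)%:E <= z)%E.
    move=> h; have ks : 0 < expR k * s by rewrite mulr_gt0 // expR_gt0.
    have kE : expR k * s = expR (k + ln s) by rewrite expRD lnK.
    case: z h => [r| |] //; last by exists (k + ln s + 1); [rewrite ltrDl|rewrite leey].
    rewrite lte_fin => h; exists (ln r); last by rewrite lnK // posrE (lt_trans ks).
    by rewrite -ltr_expR -kE lnK // posrE (lt_trans ks).
  have [a ha ua] := up _ _ hx; have [b hb vb] := up _ _ hy.
  apply: lt_le_trans (uvw _ _ _ _ ua vb); rewrite lte_fin /M.
  have -> : expR (t * m1 + (1 - t) * m2) * s = expR (t * m1 + (1 - t) * m2 + ln s) by rewrite [RHS]expRD lnK // posrE.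
  rewrite ltr_expR.
  have h1 : t * (m1 + ln s) < t * a by rewrite ltr_pM2l.
  have h2 : (1 - t) * (m2 + ln s) < (1 - t) * b by rewrite ltr_pM2l.
  by move: h1 h2; goal_lra.
have red (k a : R) (Z : \bar R) : ((expR a)%:E <= (expR k)%:E * Z)%E -> ((expR (a - k))%:E <= Z)%E.
  by move=> h; rewrite -(@lee_pmul2l _ (expR k)%:E) ?lte_fin ?expR_gt0 // -EFinM -expRD addrC subrK.
apply: (@le_trans _ _ (M%:E * (t%:E * U + (1 - t)%:E * V))%E); last by rewrite lee_wpmul2l // lee_fin expR_ge0.
apply: (@le_trans _ _ (M%:E * (t%:E * (expR (A - m1))%:E + (1 - t)%:E * (expR (B - m2))%:E))%E); last first.
  rewrite lee_wpmul2l ?lee_fin ?expR_ge0 // leeD //; (apply: lee_wpmul2l; [by rewrite lee_fin ltW|exact: red]).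
rewrite -(EFinM t) -(EFinM (1 - t)) -(EFinD (t * _)) -(EFinM M) lee_fin.
apply: le_trans (_ : M * expR (t * (A - m1) + (1 - t) * (B - m2)) <= _); last by rewrite ler_pM2l ?expR_gt0 //; exact: expR_convex.
by rewrite -expRD ler_expR; lra.
Qed.

(** If u is bounded, its supremum is such a height and nothing is lost; otherwise every height is
    admissible, and a large one costs little by monotone convergence. This is the reason for the
    loss from A to A'. *)
Lemma truncation_level (A A' : R) (u : R -> \bar R) : measurable_fun setT u -> (forall x, 0 <= u x)%E ->
  ((expR A)%:E <= \int[leb]_x u x)%E -> A' < A ->
  exists2 m : R, (forall s : R, (0 < s < 1)%R -> exists x, (expR m * s)%:E < u x)%E &
    ((expR A')%:E <= \int[leb]_x mine (u x) (expR m)%:E)%E.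
Proof.
move=> mu u0 Au AA'.
have [uoo|ufin] := eqVneq (ereal_sup (range u)) +oo%E.
  have [k hk] : exists k : nat, ((expR A')%:E <= \int[leb]_x mine (u x) (expR k%:R)%:E)%E.
    apply: contrapT => /forallNP nk.
    have : (\int[leb]_x u x <= (expR A')%:E)%E.
      have -> : (\int[leb]_x u x = \int[leb]_x limn (fun k : nat => mine (u x) (expR k%:R)%:E))%E.
        apply: eq_integral => x _; apply/esym/cvg_lim => //.
        case E : (u x) => [r| |]; last by have := u0 x; rewrite E.
          apply: cvg_near_cst; near=> k; rewrite min_l // lee_fin.
          apply: le_trans (_ : k%:R <= _); last by apply: le_trans (expR_ge1Dx _); rewrite lerDr.
          by near: k; exact: nbhs_infty_ger.
        rewrite (_ : (fun _ => _) = (fun k : nat => (expR k%:R)%:E)); last by apply/funext => k; rewrite min_r // leey.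
        apply/cvgeryP; apply/cvgryPge => a; near=> k.
        apply: le_trans (_ : k%:R <= _); last by apply: le_trans (expR_ge1Dx _); rewrite lerDr.
        by near: k; exact: nbhs_infty_ger.
      rewrite monotone_convergence //; last 3 first.
      - by move=> n; exact: measurable_mine.
      - by move=> n x _; rewrite le_min u0 lee_fin expR_ge0.
      - move=> x _ a b ab; rewrite le_min ge_min lexx /= ge_min; apply/orP; right.
        by rewrite lee_fin ler_expR ler_nat.
      apply: lime_le; last by apply: nearW => k; apply: ltW; rewrite ltNge; apply/negP/nk.
      apply: ereal_nondecreasing_is_cvgn => a b ab; apply: ge0_le_integral => //.
      - by move=> x _; rewrite le_min u0 lee_fin expR_ge0.
      - exact: measurable_mine.
      - exact: measurable_mine.
      - move=> x _; rewrite le_min ge_min lexx /= ge_min; apply/orP; right.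
        by rewrite lee_fin ler_expR ler_nat.
    by apply/negP; rewrite -ltNge; apply: lt_le_trans Au; rewrite lte_fin ltr_expR.
  exists k%:R => // s /andP[s0 s1].
  have : ((expR k%:R * s)%:E < ereal_sup (range u))%E by rewrite uoo ltry.
  by move=> /ereal_sup_gt[_ [x _ <-] hx]; exists x.
have ule x : (u x <= ereal_sup (range u))%E by apply: ereal_sup_ubound; exists x.
case E : (ereal_sup (range u)) => [r| |] //; last 2 first.
- by rewrite E in ufin.
- by have := ule 0; rewrite E leNgt (lt_le_trans _ (u0 0)).
have r0 : 0 < r.
  rewrite ltNge; apply/negP => r0; move: Au; rewrite integral0_eq; first by rewrite leNgt lte_fin expR_gt0.
  by move=> x _; apply/eqP; rewrite eq_le u0 andbT (le_trans (ule x)) // E lee_fin.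
exists (ln r) => [s /andP[s0 s1]|]; rewrite ?lnK ?posrE //.
  have : ((r * s)%:E < ereal_sup (range u))%E by rewrite E lte_fin -[ltRHS]mulr1 ltr_pM2l.
  by move=> /ereal_sup_gt[_ [x _ <-] hx]; exists x.
apply: le_trans (_ : _ <= \int[leb]_x u x)%E _; first by apply: le_trans Au; rewrite lee_fin ler_expR ltW.
suff -> : (\int[leb]_x mine (u x) r%:E = \int[leb]_x u x)%E by [].
by apply: eq_integral => x _; rewrite min_l // -E.
Unshelve. all: end_near. Qed.

Lemma le_expR_approx (z : \bar R) (c : R) : (forall e : R, (0 < e)%R -> (expR (c - e))%:E <= z)%E -> ((expR c)%:E <= z)%E.
Proof.
case: z => [r| |] h; [|by rewrite leey|by have := h 1 ltr01].
have r0 : 0 < r by have := h 1 ltr01; rewrite lee_fin; apply: lt_le_trans; exact: expR_gt0.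
rewrite lee_fin -(lnK r0) ler_expR; apply/ler_addgt0Pr => e e0.
by rewrite -lerBlDr -ler_expR (lnK r0) -lee_fin; exact: h.
Qed.

Lemma prekopa_leindler_line (t A B : R) (u v w : R -> \bar R) : 0 < t < 1 ->
  measurable_fun setT u -> measurable_fun setT v -> measurable_fun setT w ->
  (forall x, 0 <= u x)%E -> (forall x, 0 <= v x)%E -> (forall x, 0 <= w x)%E ->
  (forall r, is_interval [set x | r%:E < w x]%E) ->
  (forall x y a b : R, (expR a)%:E <= u x -> (expR b)%:E <= v y ->
     (expR (t * a + (1 - t) * b))%:E <= w (t * x + (1 - t) * y)%R)%E ->
  ((expR A)%:E <= \int[leb]_x u x)%E -> ((expR B)%:E <= \int[leb]_x v x)%E ->
  ((expR (t * A + (1 - t) * B))%:E <= \int[leb]_x w x)%E.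
Proof.
move=> t01 mu mv mw u0 v0 w0 iw uvw Au Bv; apply: le_expR_approx => e e0.
have Ae : A - e < A by rewrite ltrBlDr ltrDl.
have Be : B - e < B by rewrite ltrBlDr ltrDl.
have [m1 n1 h1] := truncation_level mu u0 Au Ae; have [m2 n2 h2] := truncation_level mv v0 Bv Be.
have := prekopa_leindler_levels t01 mu mv mw u0 v0 w0 iw uvw n1 n2 h1 h2.
by rewrite (_ : t * (A - e) + _ = t * A + (1 - t) * B - e) //; ring.
Qed.

End PrekopaLine.

Section LogConcave.
Context (R : realType).
Local Notation leb := (@leb R).
Local Notation lebn := (pw leb).

(** The inequality F(t x + (1 - t) y) >= F(x)^t F(y)^(1 - t), tested on real exponentials below the
    two values: zero values impose nothing, infinite values are allowed, and no power of an extended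
    real occurs. *)
Definition log_concave (V : lmodType R) (F : V -> \bar R) :=
  forall (x y : V) (t a b : R), 0 < t < 1 -> ((expR a)%:E <= F x)%E -> ((expR b)%:E <= F y)%E ->
  ((expR (t * a + (1 - t) * b))%:E <= F (t *: x + (1 - t) *: y)%R)%E.

Definition tmix n (t : R) (x y : n.-tuple R) : n.-tuple R :=
  [tuple t * tnth x i + (1 - t) * tnth y i | i < n].

Definition log_concave2 (V : lmodType R) n (F : V -> n.-tuple R -> \bar R) :=
  forall (x y : V) (p q : n.-tuple R) (t a b : R), 0 < t < 1 ->
  ((expR a)%:E <= F x p)%E -> ((expR b)%:E <= F y q)%E ->
  ((expR (t * a + (1 - t) * b))%:E <= F (t *: x + (1 - t) *: y)%R (tmix t p q))%E.

Lemma tmix_cons n (t x y : R) (p q : n.-tuple R) :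
  tmix t [tuple of x :: p] [tuple of y :: q] = [tuple of (t * x + (1 - t) * y) :: tmix t p q].
Proof.
apply: eq_from_tnth => i; rewrite tnth_mktuple.
by have [j ->|->] := unliftP ord0 i; rewrite ?tnth0 // !tnthS tnth_mktuple.
Qed.

Lemma log_concave_superlevel (V : lmodType R) (F : V -> \bar R) (r : R) (x y : V) (t : R) :
  log_concave F -> (forall x, 0 <= F x)%E -> 0 < t < 1 -> (r%:E < F x)%E -> (r%:E < F y)%E ->
  (r%:E < F (t *: x + (1 - t) *: y)%R)%E.
Proof.
move=> lF F0 t01 hx hy; have [t0 t1] := andP t01.
have [r0|r0] := ltP r 0; first by apply: lt_le_trans (F0 _); rewrite lte_fin.
have up (z : \bar R) : (r%:E < z)%E -> exists2 a : R, r < expR a & ((expR a)%:E <= z)%E.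
  case: z => [s| |] //; last by move=> _; exists (r + 1); [apply: lt_le_trans (expR_ge1Dx _); lra|rewrite leey].
  rewrite lte_fin => rs; have s0 : s \is Num.pos by rewrite posrE (le_lt_trans r0).
  by exists (ln s); rewrite lnK.
have [a ra ax] := up _ hx; have [b rb bx] := up _ hy.
apply: lt_le_trans (lF x y t a b t01 ax bx); rewrite lte_fin.
have [ab|ba] := leP a b.
  apply: lt_le_trans ra _; rewrite ler_expR.
  have : (1 - t) * a <= (1 - t) * b by rewrite ler_pM2l ?subr_gt0.
  lra.
apply: lt_trans rb _; rewrite ltr_expR.
have : t * b < t * a by rewrite ltr_pM2l.
lra.
Qed.

Lemma log_concave_is_interval (F : R -> \bar R) (r : R) :
  log_concave (F : R^o -> \bar R) -> (forall x, 0 <= F x)%E -> is_interval [set x | r%:E < F x]%E.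
Proof.
move=> lF F0 x y /= hx hy z /andP[xz zy].
have [->//|xz'] := eqVneq z x; have [->//|zy'] := eqVneq z y.
have xz1 : x < z by rewrite lt_neqAle eq_sym xz'.
have zy1 : z < y by rewrite lt_neqAle zy'.
have yx : 0 < y - x by rewrite subr_gt0 (lt_trans xz1).
have -> : z = (y - z) / (y - x) *: (x : R^o) + (1 - (y - z) / (y - x)) *: (y : R^o).
  by rewrite /GRing.scale /=; field; rewrite gt_eqF.
apply: log_concave_superlevel => //; apply/andP; split; first by rewrite divr_gt0 // subr_gt0.
by rewrite ltr_pdivrMr // mul1r ltrD2l ltrN2.
Qed.

(** The parameter space [V] is quantified inside the induction so that it can grow: the first
    coordinate joins the parameters, the induction hypothesis integrates the others, and the
    one-dimensional inequality integrates the first. *)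
Theorem prekopa n (V : lmodType R) (F : V -> n.-tuple R -> \bar R) :
  (forall v p, 0 <= F v p)%E -> (forall v, measurable_fun setT (F v)) ->
  log_concave2 F -> log_concave (fun v => \int[lebn n]_p F v p)%E.
Proof.
elim: n V F => [|n IH] V F F0 mF lF.
  move=> x y t a b t01; rewrite !integral_pw0 => hx hy.
  have := lF x y [tuple] [tuple] t a b t01 hx hy.
  by rewrite (_ : tmix _ _ _ = [tuple]) //; apply: eq_from_tnth => -[].
pose G (z : V * R^o) := (\int[lebn n]_p F z.1 [tuple of z.2 :: p])%E.
have G0 z : (0 <= G z)%E by apply: integral_ge0.
have lG : log_concave G.
  apply: (IH (V * R^o)%type (fun z p => F z.1 [tuple of z.2 :: p])) => //.
    by move=> z; apply: (measurableT_comp (mF _)); exact: measurable_cons_r.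
  by move=> x y p q t a b t01 hx hy /=; rewrite -tmix_cons; exact: lF.
have mG v : measurable_fun setT (fun x : R => G (v, x)).
  exact: (@measurable_integral_cons _ _ _ _ _ (F v)).
move=> x y t a b t01; rewrite (ge0_integral_pwS leb (mF x) (F0 x)) (ge0_integral_pwS leb (mF y) (F0 y)) (ge0_integral_pwS leb (mF _) (F0 _)) => hx hy.
have iw r : is_interval [set s : R | r%:E < G ((t *: x + (1 - t) *: y)%R, s)]%E.
  apply: log_concave_is_interval => // u w s a' b' s01 hu hw.
  have := lG _ _ _ _ _ s01 hu hw; congr (_ <= G (_, _))%E => /=.
  by rewrite -scalerDl addrC subrK scale1r.
apply: (prekopa_leindler_line t01 (mG x) (mG y) (mG _) _ _ _ iw _ hx hy) => //.
by move=> u w a' b' hu hw; have := lG _ _ _ _ _ t01 hu hw.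
Qed.

End LogConcave.

(** * Gaussian densities in one, two and several variables *)

HB.lock Definition qpdf (R : realType) (s t r x y : R) : R := (2 * pi * Num.sqrt (s * t - r ^+ 2))^-1 *
  expR (- ((t * x ^+ 2 - 2 * r * x * y + s * y ^+ 2) / (2 * (s * t - r ^+ 2)))).

HB.lock Definition dot (R : realType) n (x y : n.-tuple R) : R := \sum_(i < n) tnth x i * tnth y i.

HB.lock Definition gpdfn (R : realType) n (w : R) (x : n.-tuple R) : R := \prod_(i < n) gpdf w (tnth x i).

Definition tadd (R : realType) n (x y : n.-tuple R) : n.-tuple R := [tuple tnth x i + tnth y i | i < n].
Definition tscale (R : realType) n (c : R) (x : n.-tuple R) : n.-tuple R := [tuple c * tnth x i | i < n].

Section MeasurableGaussian.
Context d (T : measurableType d) (R : realType).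

Lemma measurable_dotf n (f g : T -> n.-tuple R) : measurable_fun setT f -> measurable_fun setT g ->
  measurable_fun setT (fun x => dot (f x) (g x)).
Proof.
move=> mf mg; rewrite (_ : (fun _ => _) = fun x => \sum_(i < n) tnth (f x) i * tnth (g x) i).
  by mR.
by apply/funext => x; rewrite unlock.
Qed.

Lemma measurable_gpdff w (f : T -> R) : measurable_fun setT f -> measurable_fun setT (fun x => gpdf w (f x)).
Proof. by move=> mf; exact: (measurableT_comp (measurable_gpdf w)). Qed.

Lemma measurable_gpdfnf n w (f : T -> n.-tuple R) : measurable_fun setT f ->
  measurable_fun setT (fun x => gpdfn w (f x)).
Proof.
move=> mf; rewrite (_ : (fun _ => _) = fun x => \prod_(i < n) gpdf w (tnth (f x) i)).
  have mg := measurable_gpdf w; by mR.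
by apply/funext => x; rewrite unlock.
Qed.

Lemma measurable_qpdff (s t r : R) (f g : T -> R) : measurable_fun setT f -> measurable_fun setT g ->
  measurable_fun setT (fun x => qpdf s t r (f x) (g x)).
Proof.
move=> mf mg; rewrite (_ : (fun _ => _) = fun z => (2 * pi * Num.sqrt (s * t - r ^+ 2))^-1 *
  expR (- ((t * f z ^+ 2 - 2 * r * f z * g z + s * g z ^+ 2) / (2 * (s * t - r ^+ 2))))).
  by mR.
by apply/funext => x; rewrite unlock.
Qed.

Lemma measurable_tuple_of n (f : 'I_n -> T -> R) : (forall i, measurable_fun setT (f i)) ->
  measurable_fun setT (fun x => [tuple f i x | i < n]).
Proof.
move=> mf; apply/measurable_fun_tnthP => i.
by rewrite (_ : _ \o _ = f i) //; apply/funext => x /=; rewrite tnth_mktuple.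
Qed.

Lemma measurable_tadd n (f g : T -> n.-tuple R) : measurable_fun setT f -> measurable_fun setT g ->
  measurable_fun setT (fun x => tadd (f x) (g x)).
Proof. by move=> mf mg; apply: measurable_tuple_of => i; mR. Qed.

Lemma measurable_tscale n c (f : T -> n.-tuple R) : measurable_fun setT f ->
  measurable_fun setT (fun x => tscale c (f x)).
Proof. by move=> mf; apply: measurable_tuple_of => i; mR. Qed.

End MeasurableGaussian.

Ltac mR_ext ::= lazymatch goal with
| |- measurable_fun _ (fun x => dot (@?f x) (@?g x)) => apply: measurable_dotf; mR
| |- measurable_fun _ (fun x => gpdf _ (@?f x)) => apply: measurable_gpdff; mR
| |- measurable_fun _ (fun x => gpdfn _ (@?f x)) => apply: measurable_gpdfnf; mR
| |- measurable_fun _ (fun x => qpdf _ _ _ (@?f x) (@?g x)) => apply: measurable_qpdff; mR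
| |- measurable_fun _ (fun x => tadd (@?f x) (@?g x)) => apply: measurable_tadd; mR
| |- measurable_fun _ (fun x => tscale _ (@?f x)) => apply: measurable_tscale; mR
end.

Section GaussianFormulas.
Context (R : realType).
Local Notation leb := (@leb R).
Local Notation lebn := (pw leb).
Local Notation gau := (@gau R).

Lemma qpdf_ge0 (s t r x y : R) : 0 <= qpdf s t r x y.
Proof. by rewrite unlock mulr_ge0 ?expR_ge0 // invr_ge0 !mulr_ge0 ?sqrtr_ge0 // pi_ge0. Qed.

Lemma sqrtVM (a b : R) : 0 <= a -> (Num.sqrt a)^-1 * (Num.sqrt b)^-1 = (Num.sqrt (a * b))^-1.
Proof. by move=> a0; rewrite sqrtrM // invfM. Qed.

Lemma qpdf_indep (s t x y : R) : 0 < s -> 0 < t -> qpdf s t 0 x y = gpdf s x * gpdf t y.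
Proof.
move=> s0 t0; rewrite qpdf.unlock !gpdf.unlock mulrACA -expRD expr0n /= subr0; congr (_ * expR _); last by field; rewrite !gt_eqF.
rewrite sqrtVM ?mulr_ge0 ?pi_ge0 ?ltW //; congr (_^-1).
rewrite (_ : 2 * pi * s * (2 * pi * t) = (2 * pi) ^+ 2 * (s * t)); last by ring.
rewrite [RHS]sqrtrM ?sqr_ge0 //; congr (_ * _).
by rewrite sqrtr_sqr ger0_norm // mulr_ge0 ?pi_ge0.
Qed.

Lemma quad_form_ge0 (s t r a b : R) : 0 < t -> 0 < s * t - r ^+ 2 -> 0 <= t * a ^+ 2 - 2 * r * a * b + s * b ^+ 2.
Proof.
move=> t0 D0; rewrite -(pmulr_rge0 _ t0).
have -> : t * (t * a ^+ 2 - 2 * r * a * b + s * b ^+ 2) = (t * a - r * b) ^+ 2 + (s * t - r ^+ 2) * b ^+ 2 by ring.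
by rewrite addr_ge0 ?sqr_ge0 // mulr_ge0 ?sqr_ge0 ?ltW.
Qed.

(** [qpdf s t r] is the centred Gaussian density on the plane with covariance ((s, r), (r, t)).
    Convolution with the law of g (a, b), for g of variance w, adds the rank-one matrix w (a, b)^T
    (a, b). In the proof A is the coefficient of g^2 and the new determinant is D w A. *)
Lemma integral_gau_qpdf (w s t r a b x y : R) : 0 < w -> 0 < t -> 0 < s * t - r ^+ 2 ->
  (\int[gau w]_g (qpdf s t r (x - a * g) (y - b * g))%:E =
   (qpdf (s + w * a ^+ 2) (t + w * b ^+ 2) (r + w * a * b) x y)%:E)%E.
Proof.
move=> w0 t0 D0; rewrite ge0_integral_gau //; last 2 first.
- by mR.
- by move=> g; rewrite lee_fin qpdf_ge0.
set D := s * t - r ^+ 2 in D0 *.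
pose Q := t * a ^+ 2 - 2 * r * a * b + s * b ^+ 2.
have Q0 : 0 <= Q by exact: quad_form_ge0.
pose A := Q / D + w^-1; pose B := (t * x * a - r * (x * b + y * a) + s * y * b) / D.
pose C := (t * x ^+ 2 - 2 * r * x * y + s * y ^+ 2) / D.
have A0 : 0 < A by rewrite ltr_wpDl ?invr_gt0 // divr_ge0 // ltW.
have Dn : D != 0 by rewrite gt_eqF.
have wn : w != 0 by rewrite gt_eqF.
pose k := (2 * pi * Num.sqrt D)^-1 * (Num.sqrt (2 * pi * w))^-1.
have k0 : 0 <= k by rewrite mulr_ge0 // invr_ge0 ?mulr_ge0 ?sqrtr_ge0 // pi_ge0.
transitivity (\int[leb]_g (k%:E * (expR (- ((A * g ^+ 2 - 2 * B * g + C) / 2)))%:E))%E.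
  apply: eq_integral => g _; rewrite -!EFinM; congr EFin.
  rewrite qpdf.unlock gpdf.unlock -/D mulrACA -expRD; congr (_ * expR _).
  by rewrite /A /B /C /Q; field; rewrite Dn wn.
rewrite ge0_integralZl //; last by mR.
rewrite integral_expR_quad // -EFinM; congr EFin.
have D'E : (s + w * a ^+ 2) * (t + w * b ^+ 2) - (r + w * a * b) ^+ 2 = D * w * A.
  by rewrite /A /Q /D; field; rewrite -/D Dn wn.
have An : A != 0 by rewrite gt_eqF.
rewrite qpdf.unlock D'E [LHS]mulrA; congr (_ * expR _); last first.
  have QE : Q / D = A - w^-1 by rewrite /A addrK.
  have Q'E : Q = D * A - D / w by rewrite -[LHS](divfK Dn) QE; field; rewrite wn.
  have AE : A = (w * Q + D) / (D * w) by rewrite /A; field; rewrite wn Dn.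
  have wQ : w * Q + D != 0 by rewrite gt_eqF // ltr_wpDl // mulr_ge0 // ltW.
  rewrite AE /B /C /Q /D; rewrite /Q /D in wQ; field; rewrite -/D Dn wn /=.
  by rewrite -/D in wQ; move: wQ; rewrite /D; congr (_ != 0); ring.
have pi0 : 0 < 2 * pi :> R by rewrite mulr_gt0 // pi_gt0.
have S (x' : R) : 0 < x' -> Num.sqrt x' != 0 by move=> ?; rewrite gt_eqF // sqrtr_gt0.
have pin : pi != 0 :> R by rewrite gt_eqF // pi_gt0.
rewrite /k !sqrtrM ?mulr_ge0 ?pi_ge0 ?ltW ?invr_ge0 // sqrtrV ?ltW //.
have e2 : Num.sqrt 2 * Num.sqrt 2 = 2 :> R by rewrite -expr2 sqr_sqrtr.
have ep : Num.sqrt pi * Num.sqrt pi = pi :> R by rewrite -expr2 sqr_sqrtr // pi_ge0.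
have h2 := S 2 (ltr0Sn _ 1); have hp := S pi (pi_gt0 R); have hD := S D D0; have hw := S w w0; have hA := S A A0.
clear e2 ep k k0 pi0; move: h2 hp hD hw hA pin; generalize (@pi R) => P.
move: (Num.sqrt 2) (Num.sqrt P) (Num.sqrt D) (Num.sqrt w) (Num.sqrt A) => z2 zp zD zw zA h2 hp hD hw hA pin.
by field; rewrite pin h2 hp hD hw hA.
Qed.

Lemma integral_gau_gpdf (w v a x : R) : 0 < w -> 0 < v ->
  (\int[gau w]_g (gpdf v (x - a * g))%:E = (gpdf (v + w * a ^+ 2) x)%:E)%E.
Proof.
move=> w0 v0; have mg := measurable_gpdf v.
rewrite ge0_integral_gau //; last 2 first.
- by mR.
- by move=> g; rewrite lee_fin gpdf_ge0.
have vn : v != 0 by rewrite gt_eqF.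
have wn : w != 0 by rewrite gt_eqF.
have v'0 : 0 < v + w * a ^+ 2 by rewrite ltr_wpDr // mulr_ge0 ?sqr_ge0 // ltW.
have v'n : v + w * a ^+ 2 != 0 by rewrite gt_eqF.
pose A := (v + w * a ^+ 2) / (v * w); pose B := x * a / v; pose C := x ^+ 2 / v.
have A0 : 0 < A by rewrite divr_gt0 // mulr_gt0.
pose k := (Num.sqrt (2 * pi * v))^-1 * (Num.sqrt (2 * pi * w))^-1.
have k0 : (0 <= k%:E)%E by rewrite lee_fin mulr_ge0 // invr_ge0 sqrtr_ge0.
transitivity (\int[leb]_g (k%:E * (expR (- ((A * g ^+ 2 - 2 * B * g + C) / 2)))%:E))%E.
  apply: eq_integral => g _; rewrite -!EFinM; congr EFin.
  rewrite !unlock mulrACA -expRD; congr (_ * expR _).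
  by rewrite /A /B /C; field; rewrite vn wn.
rewrite ge0_integralZl //; last by mR.
rewrite integral_expR_quad // -EFinM; congr EFin; rewrite unlock [LHS]mulrA; congr (_ * expR _); last first.
  by rewrite /A /B /C; field; rewrite vn wn v'n.
have pi0 : 0 < 2 * pi :> R by rewrite mulr_gt0 // pi_gt0.
have pin : pi != 0 :> R by rewrite gt_eqF // pi_gt0.
rewrite /k sqrtVM ?mulr_ge0 ?pi_ge0 ?ltW //.
have -> : 2 * pi * v * (2 * pi * w) = (2 * pi / A) * (2 * pi * (v + w * a ^+ 2)).
  by rewrite /A; field; rewrite vn wn v'n.
have qA : 0 < 2 * pi / A by rewrite divr_gt0.
by rewrite sqrtrM ?ltW // invfM mulrAC mulVf ?mul1r // gt_eqF // sqrtr_gt0.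
Qed.

Definition nsq n (x : n.-tuple R) : R := dot x x.

Lemma dot_cons n (a b : R) (x y : n.-tuple R) : dot [tuple of a :: x] [tuple of b :: y] = a * b + dot x y.
Proof. by rewrite dot.unlock big_ord_recl !tnth0; congr (_ + _); apply: eq_bigr => i _; rewrite !tnthS. Qed.

Lemma nsq_ge0 n (x : n.-tuple R) : 0 <= nsq x.
Proof. by rewrite /nsq unlock; apply: sumr_ge0 => i _; rewrite -expr2 sqr_ge0. Qed.

Lemma dot_sqr_le n (x y : n.-tuple R) : dot x y ^+ 2 <= nsq x * nsq y.
Proof.
have H (s : R) : 0 <= nsq x * s ^+ 2 + 2 * dot x y * s + nsq y.
  have -> : nsq x * s ^+ 2 + 2 * dot x y * s + nsq y = \sum_(i < n) (tnth x i * s + tnth y i) ^+ 2.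
    rewrite /nsq dot.unlock mulr_suml !mulr_sumr mulr_suml -!big_split /=.
    by apply: eq_bigr => i _; ring.
  by apply: sumr_ge0 => i _; exact: sqr_ge0.
have [x0|x0] := eqVneq (nsq x) 0.
  have H1 s : 0 <= 2 * dot x y * s + nsq y by have := H s; rewrite x0 mul0r add0r.
  have [->|d0] := eqVneq (dot x y) 0; first by rewrite expr0n /= x0 mul0r.
  have := H1 (- (nsq y + 1) / (2 * dot x y)); rewrite mulrC divfK ?mulf_neq0 //; lra.
have xp : 0 < nsq x by rewrite lt_neqAle eq_sym x0 nsq_ge0.
have := H (- dot x y / nsq x); rewrite -(pmulr_rge0 _ xp).
suff -> : nsq x * (nsq x * (- dot x y / nsq x) ^+ 2 + 2 * dot x y * (- dot x y / nsq x) + nsq y) =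
  nsq x * nsq y - dot x y ^+ 2 by rewrite subr_ge0.
by field.
Qed.

Lemma tuple_cons_ind n (P : n.+1.-tuple R -> Prop) : (forall (a : R) (x : n.-tuple R), P [tuple of a :: x]) -> forall x, P x.
Proof. by move=> H x; rewrite (tuple_eta x); exact: H. Qed.

(** The determinant is the initial one plus w times a sum of values of a positive quadratic form
    plus w^2 times a Gram determinant. This keeps the covariance nondegenerate along the induction
    of [integral_gaun_qpdf]. *)
Lemma det_cov_gt0 n (w s t r : R) (X Y : n.-tuple R) : 0 < w -> 0 < t -> 0 < s * t - r ^+ 2 ->
  0 < (s + w * nsq X) * (t + w * nsq Y) - (r + w * dot X Y) ^+ 2.
Proof.
move=> w0 t0 D0.
have Q0 : 0 <= t * nsq X - 2 * r * dot X Y + s * nsq Y.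
  rewrite /nsq dot.unlock !mulr_sumr -sumrB -big_split /=; apply: sumr_ge0 => i _.
  have -> : t * (tnth X i * tnth X i) - 2 * r * (tnth X i * tnth Y i) + s * (tnth Y i * tnth Y i) =
    t * tnth X i ^+ 2 - 2 * r * tnth X i * tnth Y i + s * tnth Y i ^+ 2 by ring.
  exact: quad_form_ge0.
have -> : (s + w * nsq X) * (t + w * nsq Y) - (r + w * dot X Y) ^+ 2 = (s * t - r ^+ 2) +
  (w * (t * nsq X - 2 * r * dot X Y + s * nsq Y) + w ^+ 2 * (nsq X * nsq Y - dot X Y ^+ 2)) by ring.
rewrite ltr_wpDr // addr_ge0 // mulr_ge0 ?sqr_ge0 ?(ltW w0) // subr_ge0; exact: dot_sqr_le.
Qed.

Lemma integral_gaun_qpdf n (w s t r : R) (X Y : n.-tuple R) (x y : R) : 0 < w -> 0 < t -> 0 < s * t - r ^+ 2 ->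
  (\int[pw (gau w) n]_g (qpdf s t r (x - dot g X) (y - dot g Y))%:E =
   (qpdf (s + w * nsq X) (t + w * nsq Y) (r + w * dot X Y) x y)%:E)%E.
Proof.
move=> w0; elim: n X Y s t r x y => [|n IH] X Y s t r x y t0 D0.
  by rewrite integral_pw0 /nsq dot.unlock !big_ord0 !mulr0 !subr0 !addr0.
elim/tuple_cons_ind : X => a X; elim/tuple_cons_ind : Y => b Y.
rewrite ge0_integral_pwS //; last 2 first.
- by mR.
- by move=> g; rewrite lee_fin qpdf_ge0.
have D'0 : 0 < (s + w * nsq X) * (t + w * nsq Y) - (r + w * dot X Y) ^+ 2.
  exact: det_cov_gt0.
transitivity (\int[gau w]_g (qpdf (s + w * nsq X) (t + w * nsq Y) (r + w * dot X Y) (x - a * g) (y - b * g))%:E)%E.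
  apply: eq_integral => g _.
  rewrite -(IH X Y s t r _ _ t0 D0); apply: eq_integral => h _; rewrite !dot_cons.
  by congr (qpdf _ _ _ _ _)%:E; rewrite opprD addrA (mulrC g).
rewrite integral_gau_qpdf //; last by rewrite ltr_wpDr // mulr_ge0 ?nsq_ge0 // ltW.
by congr (qpdf _ _ _ _ _)%:E; rewrite /nsq !dot_cons; ring.
Qed.

Lemma integral_gaun_gpdf n (w v : R) (X : n.-tuple R) (x : R) : 0 < w -> 0 < v ->
  (\int[pw (gau w) n]_g (gpdf v (x - dot g X))%:E = (gpdf (v + w * nsq X) x)%:E)%E.
Proof.
move=> w0; elim: n X v x => [|n IH] X v x v0.
  by rewrite integral_pw0 /nsq dot.unlock !big_ord0 !mulr0 !subr0 !addr0.
elim/tuple_cons_ind : X => a X; have mg := measurable_gpdf v.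
rewrite ge0_integral_pwS //; last 2 first.
- by mR.
- by move=> g; rewrite lee_fin gpdf_ge0.
transitivity (\int[gau w]_g (gpdf (v + w * nsq X) (x - a * g))%:E)%E.
  apply: eq_integral => g _.
  rewrite -(IH X v _ v0); apply: eq_integral => h _; rewrite dot_cons.
  by congr (gpdf _ _)%:E; rewrite opprD addrA (mulrC g).
rewrite integral_gau_gpdf //; last by rewrite ltr_wpDr // mulr_ge0 ?nsq_ge0 // ltW.
by congr (gpdf _ _)%:E; rewrite /nsq !dot_cons; ring.
Qed.

Lemma gpdfn_ge0 n w (x : n.-tuple R) : 0 <= gpdfn w x.
Proof. by rewrite unlock; apply: prodr_ge0 => i _; exact: gpdf_ge0. Qed.

Lemma measurable_gpdfn n w : measurable_fun setT (@gpdfn R n w).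
Proof.
have mg := measurable_gpdf w.
rewrite (_ : @gpdfn R n w = (fun x => \prod_(i < n) gpdf w (tnth x i))); last by apply/funext => x; rewrite unlock.
by mR. Qed.

Lemma gpdfn_cons n w a (x : n.-tuple R) : gpdfn w [tuple of a :: x] = gpdf w a * gpdfn w x.
Proof. by rewrite gpdfn.unlock big_ord_recl tnth0; congr (_ * _); apply: eq_bigr => i _; rewrite tnthS. Qed.

Lemma tadd_cons n (a b : R) (x y : n.-tuple R) :
  tadd [tuple of a :: x] [tuple of b :: y] = [tuple of (a + b) :: tadd x y].
Proof.
apply: eq_from_tnth => i; rewrite tnth_mktuple.
by have [j ->|->] := unliftP ord0 i; rewrite ?tnth0 // !tnthS tnth_mktuple.
Qed.

Lemma tscale_cons n (a b : R) (x : n.-tuple R) :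
  tscale a [tuple of b :: x] = [tuple of (a * b) :: tscale a x].
Proof.
apply: eq_from_tnth => i; rewrite tnth_mktuple.
by have [j ->|->] := unliftP ord0 i; rewrite ?tnth0 // !tnthS tnth_mktuple.
Qed.

Lemma integral_lebn_affine n (c : R) (b : n.-tuple R) (f : n.-tuple R -> \bar R) : 0 < c ->
  measurable_fun setT f -> (forall x, 0 <= f x)%E ->
  (\int[lebn n]_x f (tadd (tscale c x) b) = (c ^- n)%:E * \int[lebn n]_x f x)%E.
Proof.
move=> c0; elim: n b f => [|n IH] b f mf f0.
  rewrite !integral_pw0 expr0 invr1 mul1e; congr f; apply: eq_from_tnth => -[] //.
elim/tuple_cons_ind : b => b0 b.
have mid m : measurable_fun setT (fun x : m.-tuple R => x) by exact: measurable_id.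
have mcb := measurable_cons_r (T := R).
rewrite ge0_integral_pwS //; last first.
  by apply: (measurableT_comp mf); apply: measurable_tadd => //; exact: measurable_tscale.
rewrite ge0_integral_pwS //.
transitivity (\int[leb]_x ((c ^- n)%:E * \int[lebn n]_t f [tuple of (c * x + b0)%R :: t]))%E.
  apply: eq_integral => x _; rewrite -(IH b (fun t => f [tuple of (c * x + b0)%R :: t])) //; last first.
    by apply: (measurableT_comp mf); exact: mcb.
  by apply: eq_integral => t _; rewrite tscale_cons tadd_cons.
have mG := measurable_integral_cons leb mf f0.
have G0 x : (0 <= \int[lebn n]_t f [tuple of x :: t])%E by apply: integral_ge0.
have cn0 m : (0 <= (c ^- m)%:E)%E by rewrite lee_fin invr_ge0 exprn_ge0 // ltW.
pose G x := (\int[lebn n]_t f [tuple of x :: t])%E.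
transitivity ((c ^- n)%:E * \int[leb]_x G (c * x + b0)%R)%E.
  apply: ge0_ZlT.
  - by rewrite invr_ge0 exprn_ge0 // ltW.
  - by apply: (measurableT_comp mG); mR.
  - by move=> x; exact: G0.
transitivity ((c ^- n)%:E * (c^-1%:E * \int[leb]_x G x))%E.
  by congr (_ * _)%E; exact: (ge0_integral_affine b0 c0 mG G0).
by rewrite muleA -EFinM exprS invfM mulrC.
Qed.

Lemma smoothing n (v : R) (y : n.-tuple R) (f : n.-tuple R -> \bar R) : 0 < v ->
  measurable_fun setT f -> (forall x, 0 <= f x)%E ->
  (\int[pw (gau v) n]_z f (tadd y z) = \int[lebn n]_x (f x * (gpdfn v (tadd x (tscale (-1) y)))%:E))%E.
Proof.
move=> v0; elim: n y f => [|n IH] y f mf f0.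
  by rewrite !integral_pw0 gpdfn.unlock big_ord0 mule1; congr f; apply: eq_from_tnth => -[].
elim/tuple_cons_ind : y => b y.
have mid m : measurable_fun setT (fun x : m.-tuple R => x) by exact: measurable_id.
have mcb := measurable_cons_r (T := R).
have mp m : measurable_fun setT (fun x : m.-tuple R => (gpdfn v x)%:E) by apply/measurable_EFinP; exact: measurable_gpdfn.
have p0 m (x : m.-tuple R) : (0 <= (gpdfn v x)%:E)%E by rewrite lee_fin gpdfn_ge0.
have msh m (u : m.-tuple R) : measurable_fun setT (fun x => tadd x (tscale (-1) u)).
  by apply: measurable_tadd => //; exact: measurable_cst.
rewrite ge0_integral_pwS //; last first.
  by apply: (measurableT_comp mf); apply: measurable_tadd => //; exact: measurable_cst.
rewrite ge0_integral_pwS //; last 2 first.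
- apply: emeasurable_funM => //; apply: (measurableT_comp (mp _)); exact: msh.
- by move=> x; exact: mule_ge0.
pose G x := (\int[lebn n]_t (f [tuple of x :: t] * (gpdfn v (tadd t (tscale (-1) y)))%:E))%E.
have mG : measurable_fun setT G.
  have := @measurable_fun_fubini_tonelli_F _ _ _ _ _ (lebn n) (fun z : R * n.-tuple R => f (consm z) * (gpdfn v (tadd z.2 (tscale (-1) y)))%:E)%E.
  apply=> [|z]; last exact: mule_ge0.
  apply: emeasurable_funM; first by apply: (measurableT_comp mf); exact: measurable_consm.
  by apply: (measurableT_comp (mp _)); apply: measurable_tadd; [exact: measurable_snd|exact: measurable_cst].
have G0 x : (0 <= G x)%E by apply: integral_ge0 => t _; exact: mule_ge0.
transitivity (\int[gau v]_x G (x + b)%R)%E.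
  apply: eq_integral => x _; rewrite /G -(IH y (fun t => f [tuple of (x + b)%R :: t])) //; last by apply: (measurableT_comp mf); exact: mcb.
  by apply: eq_integral => t _; rewrite tadd_cons addrC.
rewrite ge0_integral_gau //; last by apply: (measurableT_comp mG); exact: measurable_funD.
have mg : measurable_fun setT (fun x => (gpdf v x)%:E) by apply/measurable_EFinP; exact: measurable_gpdf.
have := @ge0_integral_shift R b (fun x => G x * (gpdf v (x - b))%:E)%E.
under eq_integral do rewrite addrK.
move=> ->; last 2 first.
- by apply: emeasurable_funM => //; apply: (measurableT_comp mg); exact: measurable_funD.
- by move=> x; rewrite mule_ge0 // lee_fin gpdf_ge0.
apply: eq_integral => x _; rewrite /G -ge0_integralZr //; last 3 first.
- apply: emeasurable_funM; first by apply: (measurableT_comp mf); exact: mcb.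
  by apply: (measurableT_comp (mp _)); exact: msh.
- by move=> t _; exact: mule_ge0.
- by rewrite lee_fin gpdf_ge0.
apply: eq_integral => t _; rewrite tscale_cons tadd_cons mulN1r gpdfn_cons -muleA; congr (_ * _)%E.
by rewrite -EFinM mulrC.
Qed.

Lemma integral_gau_expR_sqr (w c : R) : 0 < w -> 2 * c * w < 1 ->
  (\int[gau w]_g (expR (c * g ^+ 2))%:E = ((Num.sqrt (1 - 2 * c * w))^-1)%:E)%E.
Proof.
move=> w0 cw; rewrite ge0_integral_gau //; last by mR.
have A0 : 0 < w^-1 - 2 * c by rewrite subr_gt0 -(ltr_pM2r w0) mulVf ?gt_eqF.
have k0 : (0 <= ((Num.sqrt (2 * pi * w))^-1)%:E)%E by rewrite lee_fin invr_ge0 sqrtr_ge0.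
transitivity (\int[leb]_g (((Num.sqrt (2 * pi * w))^-1)%:E * (expR (- (((w^-1 - 2 * c) * g ^+ 2 - 2 * 0 * g + 0) / 2)))%:E))%E.
  apply: eq_integral => g _; rewrite -!EFinM; congr EFin; rewrite gpdf.unlock mulrCA -expRD; congr (_ * expR _).
  by field; rewrite gt_eqF.
rewrite ge0_integralZl //; last by mR.
rewrite integral_expR_quad // -EFinM expr0n /= mul0r subr0 mul0r oppr0 expR0 mulr1; congr EFin.
have wn : w != 0 by rewrite gt_eqF.
have -> : 2 * pi / (w^-1 - 2 * c) = (2 * pi * w) * (1 - 2 * c * w)^-1 :> R.
  by field; rewrite wn /= subr_eq0 gt_eqF //= andbT; rewrite gt_eqF // -subr_gt0 in A0 *; rewrite subr_gt0 // .
have p0 : 0 < 2 * pi * w by rewrite !mulr_gt0 // pi_gt0.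
rewrite [X in _ * X = _]sqrtrM ?(ltW p0) // mulrA mulVf ?mul1r ?gt_eqF ?sqrtr_gt0 // sqrtrV // subr_ge0 ltW //.
Qed.

End GaussianFormulas.

Lemma le_mul_measure d (T : measurableType d) (R : realType) (m : {measure set T -> \bar R}) (A : set T)
    (c : R) (f : T -> \bar R) : measurable A -> 0 <= c -> measurable_fun setT f -> (forall x, 0 <= f x)%E ->
  (forall x, A x -> c%:E <= f x)%E -> (c%:E * m A <= \int[m]_x f x)%E.
Proof.
move=> mA c0 mf f0 cf; have m1A : measurable_fun setT (fun x => (\1_A x : R)%:E).
  by apply/measurable_EFinP; exact: measurable_indic.
have i0 x : (0 <= (\1_A x : R)%:E)%E by rewrite lee_fin.
have -> : m A = (\int[m]_x (\1_A x : R)%:E)%E by rewrite integral_indic // setIT.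
rewrite -(ge0_ZlT m c0 m1A i0); apply: ge0_leT => //.
- exact: measurable_funeM.
- by move=> x; apply: mule_ge0.
- move=> x; rewrite indicE; have [xA|xA] := pselect (A x); first by rewrite mem_set // mule1; exact: cf.
  by rewrite memNset // mule0.
Qed.

(** * Property (tau) for Gaussian measures and the concentration it yields *)

Section PropertyTau.
Context (R : realType).
Local Notation leb := (@leb R).
Local Notation gau := (@gau R).

(* Maurey's property (tau) for the cost c. *)
Definition prop_tau d (T : measurableType d) (m : {measure set T -> \bar R}) (c : T -> T -> R) :=
  forall u v : T -> \bar R, measurable_fun setT u -> measurable_fun setT v ->
  (forall x, 0 <= u x)%E -> (forall x, 0 <= v x)%E ->
  (forall x y, u x * v y <= (expR (c x y))%:E)%E -> (\int[m]_x u x * \int[m]_x v x <= 1)%E.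

Lemma mule_le1_expR (x y : \bar R) : (0 <= x)%E -> (0 <= y)%E ->
  (forall a b : R, ((expR a)%:E <= x)%E -> ((expR b)%:E <= y)%E -> a + b <= 0) -> (x * y <= 1)%E.
Proof.
move=> x0 y0 H.
have up (z : \bar R) (r : R) : (r%:E < z)%E -> 0 < r -> exists2 a, r <= expR a & ((expR a)%:E <= z)%E.
  by move=> rz r0; exists (ln r); rewrite lnK // ltW.
have half (z : \bar R) : (0 < z)%E -> exists a, ((expR a)%:E <= z)%E.
  case: z => [r| |] //; first by rewrite lte_fin => r0; exists (ln r); rewrite lnK.
  by move=> _; exists 0; rewrite leey.
have [->|xn] := eqVneq x 0%E; first by rewrite mul0e lee01.
have [->|yn] := eqVneq y 0%E; first by rewrite mule0 lee01.
have xp : (0 < x)%E by rewrite lt_neqAle eq_sym xn.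
have yp : (0 < y)%E by rewrite lt_neqAle eq_sym yn.
have [a ax] := half _ xp; have [b bx] := half _ yp.
case: x x0 xn xp H a ax => [x| |] // x0 xn xp H a ax.
- case: y y0 yn yp H b bx => [y| |] // y0 yn yp H b bx.
  + rewrite !lte_fin in xp yp; have := H (ln x) (ln y); rewrite !lnK // => /(_ (lexx _) (lexx _)) h.
    by rewrite -EFinM lee_fin -(lnK xp) -(lnK yp) -expRD -expR0 ler_expR.
  + by have := H a (1 - a) ax (leey _); rewrite addrC subrK ler10.
- by have := H (1 - b) b (leey _) bx; rewrite subrK ler10.
Qed.

(** Prekopa-Leindler at t = 1/2 for u gamma, v gamma and gamma, with gamma the density: the cost is
    exactly the defect in gamma(x) gamma(y) exp((x - y)^2 / (4 w)) = gamma((x + y) / 2)^2. *)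
Lemma prop_tau_gau (w : R) : 0 < w -> prop_tau (gau w) (fun x y => (x - y) ^+ 2 / (4 * w)).
Proof.
move=> w0 u v mu mv u0 v0 uv.
rewrite !ge0_integral_gau //.
have mg : measurable_fun setT (fun x => (gpdf w x)%:E) by apply/measurable_EFinP; exact: measurable_gpdf.
have g0 x : (0 <= (gpdf w x)%:E)%E by rewrite lee_fin gpdf_ge0.
have mug : measurable_fun setT (fun x => u x * (gpdf w x)%:E)%E by exact: emeasurable_funM.
have mvg : measurable_fun setT (fun x => v x * (gpdf w x)%:E)%E by exact: emeasurable_funM.
have ug0 x : (0 <= u x * (gpdf w x)%:E)%E by exact: mule_ge0.
have vg0 x : (0 <= v x * (gpdf w x)%:E)%E by exact: mule_ge0.
apply: mule_le1_expR => [||A B hA hB]; [by apply: integral_ge0|by apply: integral_ge0|].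
have h12 : 0 < (2^-1 : R) < 1 by rewrite invr_gt0 ltr0n invf_lt1 ?ltr1n ?ltr0n.
have := @prekopa_leindler_line R 2^-1 A B _ _ (fun x => (gpdf w x)%:E) h12 mug mvg mg ug0 vg0 g0.
rewrite integral_gpdf // => /(_ _ _ hA hB) h.
suff : ((expR (2^-1 * A + (1 - 2^-1) * B))%:E <= 1)%E by rewrite lee_fin -[X in _ <= X]expR0 ler_expR; lra.
apply: h => [r x y /= hx hy z /andP[xz zy]|x y a b hx hy].
  rewrite lte_fin in hx; rewrite lte_fin in hy; rewrite lte_fin.
  have [rle|rgt] := leP r 0; first by apply: le_lt_trans rle (gpdf_gt0 _ w0).
  have mono (p q : R) : p ^+ 2 <= q ^+ 2 -> gpdf w q <= gpdf w p.
    move=> pq; rewrite gpdf.unlock ler_wpM2l ?invr_ge0 ?sqrtr_ge0 // ler_expR lerN2 ler_pM2r //.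
    by rewrite invr_gt0 mulr_gt0.
  have [z0|z0] := leP 0 z.
    apply: lt_le_trans hy (mono _ _ _); rewrite lerXn2r ?nnegrE //; exact: le_trans zy.
  apply: lt_le_trans hx (mono _ _ _); rewrite -(sqrrN z) -(sqrrN x) lerXn2r ?nnegrE ?oppr_ge0 ?(ltW z0) ?lerN2 //.
  exact: le_trans (ltW z0).
have uvfin : ((expR (a + b))%:E <= (expR ((x - y) ^+ 2 / (4 * w)))%:E * (gpdf w x * gpdf w y)%:E)%E.
  apply: (@le_trans _ _ ((u x * (gpdf w x)%:E) * (v y * (gpdf w y)%:E))%E).
    rewrite expRD EFinM; apply: lee_pmul => //; by rewrite lee_fin expR_ge0.
  by rewrite muleACA -EFinM; apply: lee_wpmul2r; [rewrite lee_fin mulr_ge0 ?gpdf_ge0|exact: uv].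
have gE : gpdf w x * gpdf w y * expR ((x - y) ^+ 2 / (4 * w)) = gpdf w (2^-1 * x + (1 - 2^-1) * y) ^+ 2.
  rewrite !gpdf.unlock; cbv beta; set c := (Num.sqrt _)^-1; rewrite exprMn -expRM_natl.
  rewrite (mulrACA c) -expr2 -mulrA -!expRD; congr (_ * expR _).
  by field; rewrite gt_eqF.
rewrite -EFinM lee_fin mulrC gE in uvfin; rewrite lee_fin.
have -> : 2^-1 * a + (1 - 2^-1) * b = (a + b) / 2 by field.
rewrite -(@ler_pXn2r _ 2) ?nnegrE ?expR_ge0 ?gpdf_ge0 // -expRM_natl.
by rewrite (_ : 2%:R * ((a + b) / 2) = a + b) // mulrC divfK.
Qed.

(** The first coordinates x, y are frozen; the induction hypothesis for u(x, .) and exp(- c x y)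
    v(y, .) shows that the partial integrals satisfy the cost inequality in x and y, to which [Hm]
    applies. *)
Lemma prop_tau_pw d (T : measurableType d) (m : {sigma_finite_measure set T -> \bar R}) (c : T -> T -> R) n :
  prop_tau m c -> prop_tau (pw m n) (fun x y => \sum_(i < n) c (tnth x i) (tnth y i)).
Proof.
move=> Hm; elim: n => [|n IH] u v mu mv u0 v0 uv.
  by rewrite !integral_pw0; apply: le_trans (uv _ _) _; rewrite big_ord0 expR0.
rewrite !ge0_integral_pwS //.
have mU := measurable_integral_cons m mu u0; have mV := measurable_integral_cons m mv v0.
apply: Hm => //; [by move=> x; apply: integral_ge0|by move=> x; apply: integral_ge0|move=> x y].
have mux : measurable_fun setT (fun t : n.-tuple T => u [tuple of x :: t]).
  by apply: (measurableT_comp mu); exact: measurable_cons_r.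
have mvy : measurable_fun setT (fun t : n.-tuple T => v [tuple of y :: t]).
  by apply: (measurableT_comp mv); exact: measurable_cons_r.
have := IH (fun t => u [tuple of x :: t]) (fun t => (expR (- c x y))%:E * v [tuple of y :: t])%E mux.
have e0 : 0 <= expR (- c x y) by exact: expR_ge0.
rewrite (ge0_ZlT (pw m n) e0 mvy) => [H|t]; last exact: v0.
have {}H : (\int[pw m n]_t u [tuple of x :: t] * ((expR (- c x y))%:E * \int[pw m n]_t v [tuple of y :: t]) <= 1)%E.
  apply: H => //.
  - exact: measurable_funeM.
  - by move=> t; apply: mule_ge0.
  move=> t t'; rewrite muleCA.
  apply: (@le_trans _ _ ((expR (- c x y))%:E * (expR (c x y + \sum_(i < n) c (tnth t i) (tnth t' i)))%:E)%E).
    apply: lee_wpmul2l; first by rewrite lee_fin.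
    apply: le_trans (uv _ _) _; rewrite big_ord_recl !tnth0 lee_fin ler_expR lerD2l.
    by under eq_bigr do rewrite !tnthS.
  by rewrite -EFinM -expRD addKr.
have -> : (expR (c x y))%:E = ((expR (c x y))%:E * 1)%E by rewrite mule1.
have := @lee_wpmul2l _ _ (expR_ge0 (c x y) : (0 <= (expR (c x y))%:E)%E) _ _ H.
by rewrite muleCA [X in (_ * X)%E]muleA -EFinM -expRD subrr expR0 mul1e.
Qed.

(** The last hypothesis is the Lipschitz bound F y - F x <= sqrt (D x y / v), with the square root
    linearised by a free parameter t. Property (tau) is applied to exp(- la F) and exp(la F - la^2 w
    / v); the integral of exp(la F) is bounded from below by Jensen's inequality, that of exp(- la
    F) by Markov's. *)
Lemma prop_tau_concentration d (T : measurableType d) (m : {measure set T -> \bar R}) (D : T -> T -> R)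
    (F : T -> R) (v w e s : R) : 0 < v -> 0 < w -> 0 < s -> m setT = 1%E ->
  prop_tau m (fun x y => D x y / (4 * w)) -> measurable_fun setT F -> (forall x, 0 <= F x) ->
  (\int[m]_x (F x)%:E = e%:E)%E ->
  (forall x y t, 0 < t -> F y <= F x + t * D x y / (8 * v) + 2 / t) ->
  (m [set x | F x <= e - s]%R <= (expR (- (s ^+ 2 * v / (4 * w))))%:E)%E.
Proof.
move=> v0 w0 s0 m1 Hm mF F0 EF HF.
(* The minimiser of la^2 w / v - la s, with minimum - s^2 v / (4 w). *)
pose la := s * v / (2 * w).
have la0 : 0 < la by rewrite divr_gt0 ?mulr_gt0.
have la1 := ltW la0.
have e0 : 0 <= e by rewrite -lee_fin -EF; apply: integral_ge0 => x _; rewrite lee_fin.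
have HFl x y : la * (F y - F x) <= D x y / (4 * w) + la ^+ 2 * w / v.
  have t0 : 0 < 2 * v / (la * w) by rewrite divr_gt0 // mulr_gt0.
  have := HF x y _ t0; rewrite -addrA -lerBlDl -(ler_pM2l la0); move/le_trans; apply.
  rewrite le_eqVlt; apply/orP; left; apply/eqP; field; rewrite !gt_eqF //.
have mexp : measurable_fun setT (fun x => (expR (la * F x))%:E) by mR.
have mexpN : measurable_fun setT (fun x => (expR (- la * F x))%:E) by mR.
pose k := expR (- (la ^+ 2 * w / v)).
have k0 : 0 <= k by exact: expR_ge0.
have := Hm (fun x => (expR (- la * F x))%:E) (fun x => k%:E * (expR (la * F x))%:E)%E mexpN.
rewrite ge0_ZlT // => H.
have {}H : (\int[m]_x (expR (- la * F x))%:E * (k%:E * \int[m]_x (expR (la * F x))%:E) <= 1)%E.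
  apply: H.
  - exact: measurable_funeM.
  - by move=> x; rewrite lee_fin expR_ge0.
  - by move=> x; rewrite mule_ge0 // lee_fin ?expR_ge0.
  - move=> x y; rewrite -!EFinM lee_fin /k -!expRD ler_expR.
    by have := HFl x y; lra.
(* Jensen's inequality, from the tangent line of the exponential at [la * e]. *)
have J : ((expR (la * e))%:E <= \int[m]_x (expR (la * F x))%:E)%E.
  have h : ((expR (la * e) + expR (la * e) * la * e)%:E <=
      \int[m]_x (expR (la * F x))%:E + (expR (la * e) * la * e)%:E)%E.
    have c0 : 0 <= expR (la * e) * la * e by rewrite mulr_ge0 // mulr_ge0 ?expR_ge0.
    have c1 : 0 <= expR (la * e) * la by rewrite mulr_ge0 ?expR_ge0.
    have mF1 : measurable_fun setT (fun x => (F x)%:E) by mR.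
    have -> : (expR (la * e) + expR (la * e) * la * e)%:E =
       (\int[m]_x ((expR (la * e))%:E + (expR (la * e) * la)%:E * (F x)%:E))%E.
      rewrite ge0_DT.
      - by rewrite integral_prob_cst // ge0_ZlT // EF -EFinM.
      - exact: measurable_cst.
      - exact: measurable_funeM.
      - by move=> x; rewrite lee_fin expR_ge0.
      - by move=> x; rewrite -EFinM lee_fin mulr_ge0.
    rewrite -[X in (_ <= _ + X)%E](integral_prob_cst _ m1) -ge0_DT.
    - apply: ge0_leT.
      + by apply: emeasurable_funD; [exact: measurable_cst|exact: measurable_funeM].
      + by apply: emeasurable_funD; [|exact: measurable_cst].
      + by move=> x; rewrite -EFinM lee_fin addr_ge0 ?expR_ge0 // mulr_ge0.
      + move=> x; rewrite -EFinM -!EFinD lee_fin -lerBlDr.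
        rewrite (_ : _ - _ = expR (la * e) * (1 + (la * F x - la * e))); last by ring.
        apply: (@le_trans _ _ (expR (la * e) * expR (la * F x - la * e))).
          by rewrite ler_pM2l ?expR_gt0 // expR_ge1Dx.
        by rewrite -expRD addrC subrK.
    - exact: mexp.
    - exact: measurable_cst.
    - by move=> x; rewrite lee_fin expR_ge0.
    - by move=> x; rewrite lee_fin.
  by move: h; rewrite EFinD leeD2rE.
have mA : measurable [set x | F x <= e - s].
  rewrite -[X in measurable X]setTI; have := mF measurableT _ (measurable_itv `]-oo, (e - s)%R]).
  by congr measurable; apply/seteqP; split => x /=; rewrite in_itv.
have M : ((expR (- la * (e - s)))%:E * m [set x | F x <= e - s]%R <= \int[m]_x (expR (- la * F x))%:E)%E.
  apply: le_mul_measure => // x /= Fx.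
  by rewrite lee_fin ler_expR !mulNr lerN2 ler_pM2l.
set p := m _ in M *.
have p0 : (0 <= p)%E by exact: measure_ge0.
have HH : ((expR (- la * (e - s)))%:E * p * (k%:E * (expR (la * e))%:E) <= 1)%E.
  apply: le_trans H; apply: lee_pmul => //.
  - by apply: mule_ge0 => //; rewrite lee_fin expR_ge0.
  - by rewrite mule_ge0 // lee_fin ?expR_ge0.
  - by apply: lee_wpmul2l; rewrite ?lee_fin.
have E1 : ((expR (- la * (e - s)))%:E * p * (k%:E * (expR (la * e))%:E) = (expR (s ^+ 2 * v / (4 * w)))%:E * p)%E.
  rewrite muleAC -!EFinM /k -!expRD; congr ((expR _)%:E * _)%E.
  by rewrite /la; field; rewrite !gt_eqF.
rewrite E1 in HH.
have := @lee_wpmul2l _ _ (expR_ge0 (- (s ^+ 2 * v / (4 * w))) : (0 <= (expR (- (s ^+ 2 * v / (4 * w))))%:E)%E) _ _ HH.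
by rewrite muleA -EFinM -expRD addNr expR0 mul1e mule1.
Qed.

End PropertyTau.

(** * Tonelli's theorem in two variables and further measurable functions *)

Section Swap.
Context d1 d2 (T1 : measurableType d1) (T2 : measurableType d2) (R : realType).
Variables (m1 : {sigma_finite_measure set T1 -> \bar R}) (m2 : {sigma_finite_measure set T2 -> \bar R}).
Variable f : T1 -> T2 -> \bar R.
Hypothesis mf : measurable_fun setT (fun z : T1 * T2 => f z.1 z.2).
Hypothesis f0 : forall x y, (0 <= f x y)%E.

Lemma ge0_swap : (\int[m1]_x \int[m2]_y f x y = \int[m2]_y \int[m1]_x f x y)%E.
Proof. exact: (@fubini_tonelli _ _ _ _ _ m1 m2 (fun z => f z.1 z.2) mf (fun z => f0 z.1 z.2)). Qed.

Lemma measurable_int2 : measurable_fun setT (fun x => \int[m2]_y f x y)%E.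
Proof. exact: (@measurable_fun_fubini_tonelli_F _ _ _ _ _ m2 (fun z => f z.1 z.2) mf (fun z => f0 z.1 z.2)). Qed.

Lemma measurable_sec x : measurable_fun setT (f x).
Proof. by apply: (measurableT_comp mf (g := fun y => (x, y))); apply: measurable_fun_pair. Qed.
End Swap.

Definition tsub (R : realType) n (x y : n.-tuple R) : n.-tuple R := tadd x (tscale (-1) y).

HB.lock Definition app (R : realType) l n (G : l.-tuple (n.-tuple R)) (X : n.-tuple R) : l.-tuple R :=
  [tuple dot (tnth G i) X | i < l].

Section MeasurableApp.
Context d (T : measurableType d) (R : realType).

Lemma measurable_appf l n (f : T -> l.-tuple (n.-tuple R)) (g : T -> n.-tuple R) :
  measurable_fun setT f -> measurable_fun setT g -> measurable_fun setT (fun x => app (f x) (g x)).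
Proof.
move=> mf mg; rewrite (_ : (fun _ => _) = fun x => [tuple dot (tnth (f x) i) (g x) | i < l]); last first.
  by apply/funext => x; rewrite app.unlock.
by apply: measurable_tuple_of => i; mR.
Qed.

Lemma measurable_tsubf n (f g : T -> n.-tuple R) : measurable_fun setT f -> measurable_fun setT g ->
  measurable_fun setT (fun x => tsub (f x) (g x)).
Proof. by move=> mf mg; rewrite /tsub; mR. Qed.

Lemma measurable_nsqf n (f : T -> n.-tuple R) : measurable_fun setT f ->
  measurable_fun setT (fun x => nsq (f x)).
Proof. by move=> mf; rewrite /nsq; mR. Qed.

Lemma measurable_invf (f : T -> R) : measurable_fun setT f -> (forall x, 0 <= f x) ->
  measurable_fun setT (fun x => (f x)^-1).
Proof.
move=> mf f0; rewrite (_ : (fun _ => _) = (fun x => f x `^ (-1))); last first.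
  by apply/funext => x; rewrite powR_inv1.
exact: (measurableT_comp (@measurable_powR _ _) mf).
Qed.

Lemma measurable_sqrtf (f : T -> R) : measurable_fun setT f -> (forall x, 0 <= f x) ->
  measurable_fun setT (fun x => Num.sqrt (f x)).
Proof.
move=> mf f0; rewrite (_ : (fun _ => _) = (fun x => f x `^ (2^-1))); last first.
  by apply/funext => x; rewrite powR12_sqrt.
exact: (measurableT_comp (@measurable_powR _ _) mf).
Qed.

Lemma measurable_gpdfn_var l (f : T -> R) (g : T -> l.-tuple R) : measurable_fun setT f -> measurable_fun setT g ->
  (forall x, 0 <= f x) -> measurable_fun setT (fun x => gpdfn (f x) (g x)).
Proof.
move=> mf mg f0; rewrite (_ : (fun _ => _) = fun X => \prod_(i < l) ((Num.sqrt (2 * pi * f X))^-1 *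
     expR (- (tnth (g X) i ^+ 2 / (2 * f X))))); last first.
  by apply/funext => X; rewrite gpdfn.unlock; apply: eq_bigr => i _; rewrite gpdf.unlock.
apply: measurable_prod => i _; apply: measurable_funM.
  apply: measurable_invf => [|x]; last exact: sqrtr_ge0.
  by apply: measurable_sqrtf => [|x]; [mR|rewrite mulr_ge0 // mulr_ge0 // pi_ge0].
apply: measurableT_comp => //; apply: measurable_funN; apply: measurable_funM; first by mR.
by apply: measurable_invf => [|x]; [mR|rewrite mulr_ge0].
Qed.

End MeasurableApp.

Ltac mR_ext ::= lazymatch goal with
| |- measurable_fun _ (fun x => dot (@?f x) (@?g x)) => apply: measurable_dotf; mR
| |- measurable_fun _ (fun x => nsq (@?f x)) => apply: measurable_nsqf; mR
| |- measurable_fun _ (fun x => gpdf _ (@?f x)) => apply: measurable_gpdff; mR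
| |- measurable_fun _ (fun x => gpdfn _ (@?f x)) => apply: measurable_gpdfnf; mR
| |- measurable_fun _ (fun x => qpdf _ _ _ (@?f x) (@?g x)) => apply: measurable_qpdff; mR
| |- measurable_fun _ (fun x => tadd (@?f x) (@?g x)) => apply: measurable_tadd; mR
| |- measurable_fun _ (fun x => tsub (@?f x) (@?g x)) => apply: measurable_tsubf; mR
| |- measurable_fun _ (fun x => tscale _ (@?f x)) => apply: measurable_tscale; mR
| |- measurable_fun _ (fun x => app (@?f x) (@?g x)) => apply: measurable_appf; mR
| |- measurable_fun _ (app ?G) => apply: (measurable_appf (f := fun=> G) (g := fun x => x)); mR
| |- measurable_fun _ (dot ?G) => apply: (measurable_dotf (f := fun=> G) (g := fun x => x)); mR
| |- measurable_fun _ (@nsq _ _) => apply: (measurable_nsqf (f := fun x => x)); mR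
| |- measurable_fun _ (gpdf ?w) => exact: measurable_gpdf
| |- measurable_fun _ (gpdfn ?w) => exact: measurable_gpdfn
| |- measurable_fun _ (tsub ?G) => apply: (measurable_tsubf (f := fun=> G) (g := fun x => x)); mR
| |- measurable_fun _ (tadd ?G) => apply: (measurable_tadd (f := fun=> G) (g := fun x => x)); mR
| |- measurable_fun _ (tscale ?c) => apply: (measurable_tscale c (f := fun x => x)); mR
end.

Lemma le_of_sqr (R : realType) (a b : R) : 0 <= b -> a ^+ 2 <= b ^+ 2 -> a <= b.
Proof.
move=> b0 ab; rewrite leNgt; apply/negP => ba; move: ab; rewrite leNgt => /negP; apply.
by rewrite ltr_pXn2r ?nnegrE // (le_trans b0) // ltW.
Qed.

Lemma lee_addr_fin (R : realType) (x : \bar R) (a b : R) : (x + a%:E <= b%:E -> x <= (b - a)%:E)%E.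
Proof. by case: x => [r h||_] //; [rewrite lee_fin lerBrDr; exact: h|rewrite leNye]. Qed.

(** * Total variation distance between translated Gaussians *)

Section GaussianTV.
Context (R : realType).
Local Notation leb := (@leb R).
Local Notation lebn := (pw leb).
Local Notation gau := (@gau R).

Lemma tnth_tsub n (x y : n.-tuple R) i : tnth (tsub x y) i = tnth x i - tnth y i.
Proof. by rewrite !tnth_mktuple mulN1r. Qed.

Lemma tnth_app l n (G : l.-tuple (n.-tuple R)) X i : tnth (app G X) i = dot (tnth G i) X.
Proof. by rewrite app.unlock tnth_mktuple. Qed.

Lemma nsqE n (x : n.-tuple R) : nsq x = \sum_(i < n) tnth x i ^+ 2.
Proof. by rewrite /nsq dot.unlock; apply: eq_bigr => i _; rewrite expr2. Qed.

Lemma gpdf_le0 (v x : R) : 0 < v -> gpdf v x <= gpdf v 0.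
Proof.
move=> v0; rewrite gpdf.unlock ler_wpM2l ?invr_ge0 ?sqrtr_ge0 // ler_expR lerN2 expr0n /= mul0r.
by rewrite divr_ge0 ?sqr_ge0 // mulr_ge0 // ltW.
Qed.

Lemma gpdfn_le n (v : R) (x : n.-tuple R) : 0 < v -> gpdfn v x <= gpdf v 0 ^+ n.
Proof.
move=> v0; rewrite gpdfn.unlock -[X in _ ^+ X]card_ord -prodr_const.
by apply: ler_prod => i _; rewrite gpdf_ge0 gpdf_le0.
Qed.

Lemma gpdfn_gt0 n (v : R) (x : n.-tuple R) : 0 < v -> 0 < gpdfn v x.
Proof. by move=> v0; rewrite gpdfn.unlock; apply: prodr_gt0 => i _; exact: gpdf_gt0. Qed.

Lemma gpdfnE n (v : R) (x : n.-tuple R) : 0 < v -> gpdfn v x = gpdf v 0 ^+ n * expR (- (nsq x / (2 * v))).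
Proof.
move=> v0; rewrite gpdfn.unlock -[X in _ ^+ X]card_ord -prodr_const nsqE mulr_suml -sumrN expR_sum -big_split /=.
by apply: eq_bigr => i _; rewrite gpdf.unlock expr0n /= mul0r oppr0 expR0 mulr1.
Qed.

Lemma integral_gpdfn n (v : R) (c : n.-tuple R) : 0 < v -> (\int[lebn n]_x (gpdfn v (tsub x c))%:E = 1)%E.
Proof.
move=> v0; have := @smoothing R n v c (cst 1%E) v0 (measurable_cst _) (fun=> lee01).
rewrite integral_prob_cst; last by apply: pw_setT; exact: gau_setT.
by move=> ->; apply: eq_integral => x _; rewrite mul1e.
Qed.

(** The geometric mean of two translated densities is the density centred at the midpoint times
    exp(- |a - b|^2 / (8 v)), their Hellinger affinity; the exponents agree by the parallelogram
    identity. *)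
Lemma gpdfn_mid n (v : R) (x a b : n.-tuple R) : 0 < v -> let c := tscale 2^-1 (tadd a b) in
  (gpdfn v (tsub x c) * expR (- (nsq (tsub a b) / (8 * v)))) ^+ 2 = gpdfn v (tsub x a) * gpdfn v (tsub x b).
Proof.
move=> v0 c; rewrite !gpdfnE // exprMn exprMn -!expRM_natl mulrACA -expRD -!expr2 -mulrA -expRD; congr (_ * expR _).
rewrite -!mulrDr -!opprD -!mulrDl !nsqE.
have -> : 8 * v = (2 * v) * 4 by ring.
have vn : v != 0 by rewrite gt_eqF.
transitivity (- (2 * (\sum_(i < n) tnth (tsub x c) i ^+ 2 + 4^-1 * \sum_(i < n) tnth (tsub a b) i ^+ 2) / (2 * v))).
  by field.
congr (- (_ / _)).
rewrite mulr_sumr -!big_split /= mulr_sumr; apply: eq_bigr => i _.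
by rewrite !tnth_tsub /c !tnth_mktuple; field.
Qed.

(** The arithmetic-geometric inequality with weight t for |p - q| = |sqrt p - sqrt q| (sqrt p + sqrt
    q), where [s] is sqrt (p q). The terms are placed so that both sides are sums of nonnegative
    functions and can be integrated. *)
Lemma abs_sub_le_sqrt (p q s t : R) : 0 < t -> 0 <= p -> 0 <= q -> 0 <= s -> s ^+ 2 = p * q ->
  `|p - q| + t * s <= (t / 2 + (2 * t)^-1) * (p + q) + s / t.
Proof.
move=> t0 p0 q0 s0 sE.
have h0 : 0 <= p + q - 2 * s.
  have : (2 * s) ^+ 2 <= (p + q) ^+ 2 by rewrite exprMn sE -subr_ge0 (_ : _ - _ = (p - q) ^+ 2) ?sqr_ge0 //; ring.
  by move/(le_of_sqr (addr_ge0 p0 q0)); rewrite subr_ge0.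
have h1 : 0 <= p + q + 2 * s by rewrite !addr_ge0 ?mulr_ge0.
have H : (2 * `|p - q|) ^+ 2 <= (t * (p + q - 2 * s) + (p + q + 2 * s) / t) ^+ 2.
  have -> : (2 * `|p - q|) ^+ 2 = 4 * ((p + q - 2 * s) * (p + q + 2 * s)).
    rewrite exprMn real_normK ?num_real // (_ : (p - q) ^+ 2 = (p + q) ^+ 2 - 4 * (p * q)); last by ring.
    by rewrite -sE; ring.
  rewrite -subr_ge0 (_ : _ - _ = (t * (p + q - 2 * s) - (p + q + 2 * s) / t) ^+ 2) ?sqr_ge0 //.
  by field; rewrite gt_eqF.
rewrite ler_pXn2r ?nnegrE ?addr_ge0 ?divr_ge0 ?mulr_ge0 ?(ltW t0) // in H.
rewrite -(ler_pM2l (ltr0Sn R 1)) mulrDr; apply: le_trans (lerD H (lexx _)) _.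
by rewrite le_eqVlt; apply/orP; left; apply/eqP; field; rewrite gt_eqF.
Qed.

(** Integrates [abs_sub_le_sqrt], with s equal to [be] times the midpoint density, so that only the
    affinity enters. The best t would give |a - b| / sqrt v; a free t keeps the bound linear in |a -
    b|^2, hence ready for averaging. *)
Lemma gpdfn_TV n (v : R) (a b : n.-tuple R) (t : R) : 0 < v -> 0 < t ->
  (\int[lebn n]_x `|gpdfn v (tsub x a) - gpdfn v (tsub x b)|%:E <= (t * nsq (tsub a b) / (8 * v) + 2 / t)%:E)%E.
Proof.
move=> v0 t0; pose c := tscale 2^-1 (tadd a b); pose be := expR (- (nsq (tsub a b) / (8 * v))).
have be0 : 0 <= be by exact: expR_ge0.
have t1 := ltW t0.
have mid : measurable_fun setT (fun x : n.-tuple R => x) by exact: measurable_id.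
have m1 e : measurable_fun setT (fun x : n.-tuple R => (gpdfn v (tsub x e))%:E) by mR.
have mI : measurable_fun setT (fun x : n.-tuple R => (`|gpdfn v (tsub x a) - gpdfn v (tsub x b)|)%:E).
  by apply/measurable_EFinP; apply: measurableT_comp => //; mR.
have g0 e x : (0 <= (gpdfn v (tsub x e : n.-tuple R))%:E)%E by rewrite lee_fin gpdfn_ge0.
have G1 e := @integral_gpdfn n v e v0.
pose k := t / 2 + (2 * t)^-1.
have k0 : 0 <= k by rewrite addr_ge0 ?divr_ge0 ?invr_ge0 ?mulr_ge0.
have bt0 : 0 <= be / t by rewrite divr_ge0.
have tb0 : 0 <= t * be by rewrite mulr_ge0.
have H : (\int[lebn n]_x `|gpdfn v (tsub x a) - gpdfn v (tsub x b)|%:E + (t * be)%:E <=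
    (k + k + be / t)%:E)%E.
  have -> : (k + k + be / t)%:E = (\int[lebn n]_x (k%:E * (gpdfn v (tsub x a))%:E + k%:E * (gpdfn v (tsub x b))%:E
      + (be / t)%:E * (gpdfn v (tsub x c))%:E))%E.
    rewrite ge0_DT.
    - rewrite ge0_DT.
      + by rewrite !ge0_ZlT // !G1 !mule1.
      + exact: measurable_funeM.
      + exact: measurable_funeM.
      + by move=> x; apply: mule_ge0.
      + by move=> x; apply: mule_ge0.
    - by apply: emeasurable_funD; exact: measurable_funeM.
    - exact: measurable_funeM.
    - by move=> x; apply: adde_ge0; apply: mule_ge0.
    - by move=> x; apply: mule_ge0.
  have -> : (t * be)%:E = (\int[lebn n]_x ((t * be)%:E * (gpdfn v (tsub x c))%:E))%E.
    by rewrite ge0_ZlT // G1 mule1.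
  rewrite -ge0_DT //.
  - apply: ge0_leT => //.
    + by apply: emeasurable_funD => //; exact: measurable_funeM.
    + by repeat apply: emeasurable_funD => //; exact: measurable_funeM.
    + by move=> x; apply: adde_ge0; [rewrite lee_fin|exact: mule_ge0].
    + move=> x; rewrite -!EFinM -!EFinD lee_fin.
      have := @abs_sub_le_sqrt (gpdfn v (tsub x a)) (gpdfn v (tsub x b)) (gpdfn v (tsub x c) * be) t t0.
      rewrite !gpdfn_ge0 mulr_ge0 ?gpdfn_ge0 // gpdfn_mid // => /(_ isT isT isT erefl).
      move=> h; apply: le_trans (le_trans h _); rewrite le_eqVlt; apply/orP; left; apply/eqP; first by ring.
      by rewrite /k; ring.
  - exact: measurable_funeM.
  - by move=> x; exact: mule_ge0.
have beh : 1 - nsq (tsub a b) / (8 * v) <= be by apply: expR_ge1Dx.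
have be1 : be <= 1.
  by rewrite -[X in _ <= X]expR0 ler_expR oppr_le0 divr_ge0 ?nsq_ge0 // mulr_ge0 // ltW.
move/lee_addr_fin: H; move/le_trans; apply; rewrite lee_fin.
have -> : t * nsq (tsub a b) / (8 * v) + 2 / t = t * (nsq (tsub a b) / (8 * v)) + 2 / t by rewrite mulrA.
have hb1 : be / t <= 1 / t by rewrite ler_pM2r ?invr_gt0.
have hb2 : t * (1 - nsq (tsub a b) / (8 * v)) <= t * be by rewrite ler_pM2l.
have -> : k + k = t + 1 / t by rewrite /k; field; rewrite gt_eqF.
have -> : 2 / t = 1 / t + 1 / t by rewrite -mulrDl.
lra.
Qed.

End GaussianTV.

(* Density at x of G X + sqrt v Z, for X of law mu and Z a standard Gaussian vector. *)
HB.lock Definition sm (R : realType) l n (mu : probability (n.-tuple R) R) (v : R)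
    (G : l.-tuple (n.-tuple R)) (x : l.-tuple R) : R :=
  fine (\int[mu]_X (gpdfn v (tsub x (app G X)))%:E)%E.

(* Expectation of [sm mu v G x] when the entries of G are independent of law N(0, w). *)
HB.lock Definition mix (R : realType) l n (mu : probability (n.-tuple R) R) (v w : R) (x : l.-tuple R) : R :=
  fine (\int[mu]_X (gpdfn (v + w * nsq X) x)%:E)%E.

(** * First and second moments of the smoothed density over Gaussian matrices *)

Section Smoothed.
Context (R : realType) (l n : nat) (mu : probability (n.-tuple R) R).
Implicit Types (v w : R) (G : l.-tuple (n.-tuple R)) (x y : l.-tuple R) (X Y : n.-tuple R).
Local Notation leb := (@leb R).
Local Notation lebn := (pw leb).
Local Notation gau := (@gau R).
Local Notation GG w := (pw (pw (gau w) n) l).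

Lemma prob_fin (f : n.-tuple R -> R) (C : R) : measurable_fun setT f -> (forall X, 0 <= f X <= C) ->
  ((fine (\int[mu]_X (f X)%:E))%:E = \int[mu]_X (f X)%:E)%E /\ 0 <= fine (\int[mu]_X (f X)%:E)%E <= C.
Proof.
move=> mf fC.
have f0 X : (0 <= (f X)%:E)%E by rewrite lee_fin; case/andP: (fC X).
have mfE : measurable_fun setT (fun X => (f X)%:E) by apply/measurable_EFinP.
have I0 : (0 <= \int[mu]_X (f X)%:E)%E by exact: integral_ge0.
have IC : (\int[mu]_X (f X)%:E <= C%:E)%E.
  rewrite -(integral_prob_cst C%:E (probability_setT mu)); apply: ge0_leT => //.
  by move=> X; rewrite lee_fin; case/andP: (fC X).
have E : ((fine (\int[mu]_X (f X)%:E))%:E = \int[mu]_X (f X)%:E)%E.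
  by rewrite fineK // ge0_fin_numE // (le_lt_trans IC) // ltry.
by split => //; rewrite -!lee_fin E I0 IC.
Qed.

Lemma smP v G x : 0 < v -> ((sm mu v G x)%:E = \int[mu]_X (gpdfn v (tsub x (app G X)))%:E)%E /\
  0 <= sm mu v G x <= gpdf v 0 ^+ l.
Proof.
move=> v0; rewrite sm.unlock; apply: prob_fin.
  by mR.
by move=> X; rewrite gpdfn_ge0 gpdfn_le.
Qed.

Lemma smE v G x : 0 < v -> ((sm mu v G x)%:E = \int[mu]_X (gpdfn v (tsub x (app G X)))%:E)%E.
Proof. by move=> v0; case: (smP G x v0). Qed.

Lemma sm_ge0 v G x : 0 < v -> 0 <= sm mu v G x.
Proof. by move=> v0; case: (smP G x v0) => _ /andP[]. Qed.

Lemma sm_le v G x : 0 < v -> sm mu v G x <= gpdf v 0 ^+ l.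
Proof. by move=> v0; case: (smP G x v0) => _ /andP[]. Qed.

Lemma gpdf0_antitone (s t : R) : 0 < s -> s <= t -> gpdf t 0 <= gpdf s 0.
Proof.
move=> s0 st; have t0 : 0 < t by apply: lt_le_trans st.
rewrite !gpdf.unlock !expr0n /= !mul0r !oppr0 expR0 !mulr1 lef_pV2 ?posrE ?sqrtr_gt0 ?mulr_gt0 ?pi_gt0 //.
by rewrite ler_wsqrtr // ler_pM2l // mulr_gt0 // pi_gt0.
Qed.

Lemma mixP v w x : 0 < v -> 0 < w -> ((mix mu v w x)%:E = \int[mu]_X (gpdfn (v + w * nsq X) x)%:E)%E /\
  0 <= mix mu v w x <= gpdf v 0 ^+ l.
Proof.
move=> v0 w0; rewrite mix.unlock.
have vX X : v <= v + w * nsq X by rewrite lerDl mulr_ge0 ?nsq_ge0 // ltW.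
have vX0 X : 0 < v + w * nsq X by apply: lt_le_trans (vX X).
apply: prob_fin.
  by apply: measurable_gpdfn_var; [mR|mR|move=> X; exact: ltW].
move=> X; rewrite gpdfn_ge0 /=; apply: le_trans (gpdfn_le _ (vX0 X)) _.
by rewrite lerXn2r ?nnegrE ?gpdf_ge0 // gpdf0_antitone.
Qed.

Lemma mixE v w x : 0 < v -> 0 < w -> ((mix mu v w x)%:E = \int[mu]_X (gpdfn (v + w * nsq X) x)%:E)%E.
Proof. by move=> v0 w0; case: (mixP x v0 w0). Qed.

Lemma mix_ge0 v w x : 0 < v -> 0 < w -> 0 <= mix mu v w x.
Proof. by move=> v0 w0; case: (mixP x v0 w0) => _ /andP[]. Qed.

Lemma measurable_sm v : 0 < v -> measurable_fun setT (fun z : l.-tuple (n.-tuple R) * l.-tuple R => sm mu v z.1 z.2).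
Proof.
move=> v0; apply/measurable_EFinP.
rewrite (_ : _ \o _ = fun z => \int[mu]_X (gpdfn v (tsub z.2 (app z.1 X)))%:E)%E; last first.
  by apply/funext => z /=; rewrite smE.
apply: measurable_int2.
  by mR.
by move=> z X; rewrite lee_fin gpdfn_ge0.
Qed.

Lemma gpdfn_prodE v x X G : (gpdfn v (tsub x (app G X)))%:E = (\prod_(i < l) (gpdf v (tnth x i - dot (tnth G i) X))%:E)%E.
Proof. by rewrite gpdfn.unlock prodEFin; congr EFin; apply: eq_bigr => i _; rewrite tnth_tsub tnth_app. Qed.

Lemma gau_matT w : GG w setT = 1%E.
Proof. by apply: pw_setT; apply: pw_setT; exact: gau_setT. Qed.

(** For a fixed X the coordinates of G X are independent of law N(0, w |X|^2), and the smoothing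
    adds v to each variance. *)
Lemma expectation_sm v w x : 0 < v -> 0 < w -> (\int[GG w]_G (sm mu v G x)%:E = (mix mu v w x)%:E)%E.
Proof.
move=> v0 w0; rewrite mixE //.
transitivity (\int[GG w]_G \int[mu]_X (gpdfn v (tsub x (app G X)))%:E)%E.
  by apply: eq_integral => G _; rewrite smE.
rewrite ge0_swap; last 2 first.
- by mR.
- by move=> G X; rewrite lee_fin gpdfn_ge0.
apply: eq_integral => X _.
under eq_integral do rewrite gpdfn_prodE.
rewrite (ge0_pw_prod (pw (gau w) n) (F := fun i g => (gpdf v (tnth x i - dot g X))%:E)); last 2 first.
- by move=> i; mR.
- by move=> i g; rewrite lee_fin gpdf_ge0.
rewrite gpdfn.unlock -prodEFin; apply: eq_bigr => i _.
exact: integral_gaun_gpdf.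
Qed.

(** The square is a double integral over independent copies X and Y. The rows of G are independent,
    and the inner products of one row with X and with Y form a Gaussian pair whose covariance is w
    times the Gram matrix of X, Y; hence one planar density per coordinate, taken on the
    diagonal. *)
Lemma expectation_sm2 v w x : 0 < v -> 0 < w -> (\int[GG w]_G ((sm mu v G x)%:E * (sm mu v G x)%:E) =
  \int[mu]_X \int[mu]_Y \prod_(i < l) (qpdf (v + w * nsq X) (v + w * nsq Y) (w * dot X Y) (tnth x i) (tnth x i))%:E)%E.
Proof.
move=> v0 w0.
have mg : measurable_fun setT (fun z : l.-tuple (n.-tuple R) * n.-tuple R => (gpdfn v (tsub x (app z.1 z.2)))%:E) by mR.
have g0 G X : (0 <= (gpdfn v (tsub x (app G X)))%:E)%E by rewrite lee_fin gpdfn_ge0.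
transitivity (\int[GG w]_G \int[mu]_X \int[mu]_Y ((gpdfn v (tsub x (app G X)))%:E * (gpdfn v (tsub x (app G Y)))%:E))%E.
  apply: eq_integral => G _; rewrite [X in (_ * X)%E]smE // -ge0_ZlT ?sm_ge0 //; last first.
    exact: (measurable_sec (f := fun G X => (gpdfn v (tsub x (app G X)))%:E) mg).
  rewrite (_ : (fun X => _) = fun Y => ((gpdfn v (tsub x (app G Y)))%:E * (sm mu v G x)%:E)%E); last first.
    by apply/funext => Y; rewrite muleC.
  apply: eq_integral => X _; rewrite smE // -ge0_ZlT ?gpdfn_ge0 //.
  exact: (measurable_sec (f := fun G X => (gpdfn v (tsub x (app G X)))%:E) mg).
rewrite (@ge0_swap _ _ _ _ _ (GG w) mu (fun G X => \int[mu]_Y ((gpdfn v (tsub x (app G X)))%:E * (gpdfn v (tsub x (app G Y)))%:E))%E); last 2 first.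
- apply: (@measurable_int2 _ _ _ _ _ mu (fun z Y => ((gpdfn v (tsub x (app z.1 z.2)))%:E * (gpdfn v (tsub x (app z.1 Y)))%:E)%E)).
    by apply: emeasurable_funM; mR.
  by move=> z Y; exact: mule_ge0.
- by move=> G X; apply: integral_ge0 => Y _; exact: mule_ge0.
apply: eq_integral => X _.
rewrite (@ge0_swap _ _ _ _ _ (GG w) mu (fun G Y => ((gpdfn v (tsub x (app G X)))%:E * (gpdfn v (tsub x (app G Y)))%:E)%E)); last 2 first.
- by apply: emeasurable_funM; mR.
- by move=> G Y; exact: mule_ge0.
apply: eq_integral => Y _.
transitivity (\int[GG w]_G \prod_(i < l) (qpdf v v 0 (tnth x i - dot (tnth G i) X) (tnth x i - dot (tnth G i) Y))%:E)%E.
  apply: eq_integral => G _; rewrite !gpdfn_prodE -big_split /=; apply: eq_bigr => i _.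
  by rewrite qpdf_indep // EFinM.
rewrite (ge0_pw_prod (pw (gau w) n) (F := fun i g => (qpdf v v 0 (tnth x i - dot g X) (tnth x i - dot g Y))%:E)); last 2 first.
- by move=> i; mR.
- by move=> i g; rewrite lee_fin qpdf_ge0.
apply: eq_bigr => i _; rewrite integral_gaun_qpdf // ?add0r //.
by rewrite expr0n /= subr0 mulr_gt0.
Qed.

Lemma integral_sm v G : 0 < v -> (\int[lebn l]_x (sm mu v G x)%:E = 1)%E.
Proof.
move=> v0; transitivity (\int[lebn l]_x \int[mu]_X (gpdfn v (tsub x (app G X)))%:E)%E.
  by apply: eq_integral => x _; rewrite smE.
rewrite ge0_swap; last 2 first.
- by mR.
- by move=> x X; rewrite lee_fin gpdfn_ge0.
under eq_integral do rewrite integral_gpdfn //.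
by apply: integral_prob_cst; exact: probability_setT.
Qed.

End Smoothed.

Lemma lee_subr_fin (R : realType) (x : \bar R) (a b : R) : (a%:E <= x + b%:E -> (a - b)%:E <= x)%E.
Proof. by case: x => [r h|_|]; [rewrite lee_fin lerBlDr; exact: h|rewrite leey|]. Qed.

Section RealBounds.
Context (R : realType).
Implicit Types (v s t r rho x y : R).

(** A small covariance r costs two factors against the product density: exp(rho^2 / v^2) from the
    determinant and exp(2 rho x^2 / v^2) from the quadratic form. The bound on rho keeps the
    determinant above v^2 / 2. *)
Lemma qpdf_le_ratio v s t r rho x : 0 < v -> v <= s -> v <= t -> `|r| <= rho -> rho ^+ 2 <= v ^+ 2 / 2 ->
  qpdf s t r x x <= gpdf s x * gpdf t x * expR (rho ^+ 2 / v ^+ 2 + 2 * rho * x ^+ 2 / v ^+ 2).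
Proof.
move=> v0 vs vt rr rv.
have s0 : 0 < s by apply: lt_le_trans vs.
have t0 : 0 < t by apply: lt_le_trans vt.
have rho0 : 0 <= rho by apply: le_trans rr.
have v2 : 0 < v ^+ 2 by rewrite exprn_gt0.
have r2 : r ^+ 2 <= rho ^+ 2 by rewrite -[X in X <= _]real_normK ?num_real // lerXn2r ?nnegrE.
have st : v ^+ 2 <= s * t by rewrite expr2 ler_pM // ltW.
set D := s * t - r ^+ 2.
have Dv : v ^+ 2 / 2 <= D by rewrite /D; lra.
have D0 : 0 < D by apply: lt_le_trans Dv; rewrite divr_gt0.
have pi20 : 0 < 2 * pi :> R by rewrite mulr_gt0 // pi_gt0.
have st0 : 0 < s * t by rewrite mulr_gt0.
have H1 : (2 * pi * Num.sqrt D)^-1 <= (2 * pi * Num.sqrt (s * t))^-1 * expR (rho ^+ 2 / v ^+ 2).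
  set P := 2 * pi in pi20 *; rewrite (invfM P (Num.sqrt D)) (invfM P) -mulrA ler_pM2l ?invr_gt0 //.
  rewrite -[X in X <= _]mul1r ler_pdivrMr ?sqrtr_gt0 // -mulrA ler_pdivlMl ?sqrtr_gt0 // mulr1.
  apply: le_of_sqr; first by rewrite mulr_ge0 ?expR_ge0 ?sqrtr_ge0.
  rewrite exprMn !sqr_sqrtr ?(ltW st0) ?(ltW D0) // -expRM_natl.
  apply: (@le_trans _ _ ((1 + 2%:R * (rho ^+ 2 / v ^+ 2)) * D)); last first.
    by rewrite ler_pM2r // expR_ge1Dx.
  have -> : (1 + 2%:R * (rho ^+ 2 / v ^+ 2)) * D = D + rho ^+ 2 * (D / (v ^+ 2 / 2)).
    by field; rewrite gt_eqF.
  have : rho ^+ 2 <= rho ^+ 2 * (D / (v ^+ 2 / 2)).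
    by rewrite ler_peMr ?sqr_ge0 // ler_pdivlMr ?divr_gt0 // mul1r.
  by rewrite /D; lra.
have H2 : - ((t * x ^+ 2 - 2 * r * x * x + s * x ^+ 2) / (2 * D)) <=
    - (x ^+ 2 / (2 * s)) + - (x ^+ 2 / (2 * t)) + 2 * rho * x ^+ 2 / v ^+ 2.
  have h : 2 * r * (s * t) - (s + t) * r ^+ 2 <= 4 * rho / v ^+ 2 * (s * t * D).
    have h1 : 2 * r * (s * t) <= 2 * rho * (s * t).
      by rewrite ler_pM2r // ler_pM2l // (le_trans _ rr) // ler_norm.
    have h2 : 0 <= (s + t) * r ^+ 2 by rewrite mulr_ge0 ?sqr_ge0 // addr_ge0 // ltW.
    have h3 : 2 * rho * (s * t) <= 4 * rho / v ^+ 2 * (s * t * D).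
      have -> : 4 * rho / v ^+ 2 * (s * t * D) = 2 * rho * (s * t) * (D / (v ^+ 2 / 2)) by field; rewrite gt_eqF.
      have h4 : 0 <= 2 * rho * (s * t) by rewrite mulr_ge0 ?(ltW st0) // mulr_ge0.
      by rewrite ler_peMr // ler_pdivlMr ?divr_gt0 // mul1r.
    lra.
  rewrite -subr_ge0.
  have -> : - (x ^+ 2 / (2 * s)) + - (x ^+ 2 / (2 * t)) + 2 * rho * x ^+ 2 / v ^+ 2 -
     - ((t * x ^+ 2 - 2 * r * x * x + s * x ^+ 2) / (2 * D)) =
     x ^+ 2 / (2 * (s * t * D)) * (4 * rho / v ^+ 2 * (s * t * D) - (2 * r * (s * t) - (s + t) * r ^+ 2)).
    by rewrite /D; field; rewrite -/D !gt_eqF.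
  by rewrite mulr_ge0 ?subr_ge0 // divr_ge0 ?sqr_ge0 // mulr_ge0 // ltW // mulr_gt0.
rewrite qpdf.unlock -/D !gpdf.unlock mulrACA sqrtVM; last by rewrite mulr_ge0 // ltW.
have -> : Num.sqrt (2 * pi * s * (2 * pi * t)) = 2 * pi * Num.sqrt (s * t).
  rewrite (_ : 2 * pi * s * (2 * pi * t) = (2 * pi) ^+ 2 * (s * t)); last by ring.
  by rewrite sqrtrM ?sqr_ge0 // sqrtr_sqr ger0_norm // ltW.
apply: (@le_trans _ _ ((2 * pi * Num.sqrt (s * t))^-1 * expR (rho ^+ 2 / v ^+ 2) *
  expR (- (x ^+ 2 / (2 * s)) + - (x ^+ 2 / (2 * t)) + 2 * rho * x ^+ 2 / v ^+ 2))).
  apply: ler_pM => //; rewrite ?expR_ge0 ?ler_expR //.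
  by rewrite invr_ge0 mulr_ge0 ?sqrtr_ge0 // ltW.
by rewrite le_eqVlt; apply/orP; left; apply/eqP; rewrite !expRD; ring.
Qed.

Lemma gpdf0_sqr v : 0 < v -> gpdf v 0 ^+ 2 = (2 * pi * v)^-1.
Proof.
move=> v0; rewrite gpdf.unlock expr0n /= mul0r oppr0 expR0 mulr1 exprVn sqr_sqrtr //.
by rewrite mulr_ge0 ?ltW // mulr_gt0 // pi_gt0.
Qed.

Lemma qpdf_le_max v s t r x y : 0 < v -> 0 < t -> v ^+ 2 <= s * t - r ^+ 2 -> qpdf s t r x y <= gpdf v 0 ^+ 2.
Proof.
move=> v0 t0 D0; rewrite gpdf0_sqr // qpdf.unlock -[X in _ <= X]mulr1.
have Dp : 0 < s * t - r ^+ 2 by apply: lt_le_trans D0; rewrite exprn_gt0.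
have pi20 : 0 < 2 * pi :> R by rewrite mulr_gt0 // pi_gt0.
apply: ler_pM; rewrite ?expR_ge0 //.
- by rewrite invr_ge0 mulr_ge0 ?sqrtr_ge0 // ltW.
- set P := 2 * pi in pi20 *; rewrite lef_pV2 ?posrE ?(mulr_gt0 pi20) ?sqrtr_gt0 // ler_pM2l //.
  by apply: le_of_sqr; rewrite ?sqrtr_ge0 // sqr_sqrtr // ltW.
- by rewrite -[X in _ <= X]expR0 ler_expR oppr_le0 divr_ge0 // ?quad_form_ge0 // mulr_ge0 // ltW.
Qed.

(** This is (1 - u)_+ <= t / 2 + (1 - u)^2 / (2 t), rearranged without subtraction so that it can be
    integrated in the extended reals. *)
Lemma le_min_sqr (u t : R) : 0 <= u -> 0 < t -> 1 + u / t <= Num.min 1 u + t / 2 + (1 + u ^+ 2) / (2 * t).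
Proof.
move=> u0 t0; have tn : t != 0 by rewrite gt_eqF.
rewrite -subr_ge0; have [u1|u1] := leP 1 u.
  have -> : 1 + t / 2 + (1 + u ^+ 2) / (2 * t) - (1 + u / t) = t / 2 + (1 - u) ^+ 2 / (2 * t) by field.
  by rewrite addr_ge0 ?divr_ge0 ?sqr_ge0 ?mulr_ge0 // ltW.
have -> : u + t / 2 + (1 + u ^+ 2) / (2 * t) - (1 + u / t) = (t - (1 - u)) ^+ 2 / (2 * t) by field.
by rewrite divr_ge0 ?sqr_ge0 ?mulr_ge0 // ltW.
Qed.

End RealBounds.

(** * Second moment method and midpoint log-concavity of the mixture *)

Section SecondMoment.
Context d (T : measurableType d) (R : realType) (m : {measure set T -> \bar R}).

(** For u = f / a the hypotheses give E (1 - u)^2 <= eta, so [le_min_sqr] gives E (1 - u)_+ <= t / 2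
    + eta / (2 t). The level b enters through min(b, f) >= min(b, a) min(1, u). *)
Lemma integral_min_ge (f : T -> R) (a b eta t : R) : m setT = 1%E -> measurable_fun setT f -> (forall x, 0 <= f x) ->
  0 < a -> 0 <= b -> 0 < t -> (\int[m]_x (f x)%:E = a%:E)%E ->
  (\int[m]_x ((f x)%:E * (f x)%:E) <= ((1 + eta) * a ^+ 2)%:E)%E ->
  ((Num.min b a * (1 - (t / 2 + eta / (2 * t))))%:E <= \int[m]_x (Num.min b (f x))%:E)%E.
Proof.
move=> m1 mf f0 a0 b0 t0 Ef Ef2.
have mfE : measurable_fun setT (fun x => (f x)%:E) by apply/measurable_EFinP.
have ff0 x : (0 <= (f x)%:E * (f x)%:E)%E by rewrite mule_ge0 ?lee_fin.
have mff : measurable_fun setT (fun x => (f x)%:E * (f x)%:E)%E by exact: emeasurable_funM.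
have mmin (c : R) : measurable_fun setT (fun x => (Num.min c (f x))%:E).
  by apply/measurable_EFinP; apply: measurable_minr.
have an : a != 0 by rewrite gt_eqF.
have min0 c x : 0 <= c -> 0 <= Num.min c (f x) by move=> c0; rewrite le_min c0 f0.
have mab0 : 0 <= Num.min b a by rewrite le_min b0 ltW.
have tn : t != 0 by rewrite gt_eqF.
have H : ((1 - (t / 2 + eta / (2 * t)))%:E <= a^-1%:E * \int[m]_x (Num.min a (f x))%:E)%E.
  have ai : 0 <= a^-1 by rewrite invr_ge0 ltW.
  have ti : 0 <= (2 * t * a ^+ 2)^-1 by rewrite invr_ge0 !mulr_ge0 ?sqr_ge0 // ltW.
  have ta : 0 <= (t * a)^-1 by rewrite invr_ge0 mulr_ge0 // ltW.
  have c0 : 0 <= t / 2 + (2 * t)^-1 by rewrite addr_ge0 // ?divr_ge0 ?invr_ge0 ?mulr_ge0 // ltW.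
  have K : ((1 + t^-1)%:E <= a^-1%:E * \int[m]_x (Num.min a (f x))%:E + (t / 2 + (2 * t)^-1 + (1 + eta) / (2 * t))%:E)%E.
    have -> : ((1 + t^-1)%:E = \int[m]_x (1%:E + (t * a)^-1%:E * (f x)%:E))%E.
      rewrite ge0_DT //; last 2 first.
      - exact: measurable_funeM.
      - by move=> x; rewrite -EFinM lee_fin mulr_ge0.
      rewrite ge0_ZlT // integral_prob_cst // Ef -EFinM -EFinD; congr EFin.
      by field; rewrite an tn.
    apply: (@le_trans _ _ (\int[m]_x (a^-1%:E * (Num.min a (f x))%:E + ((t / 2 + (2 * t)^-1)%:E + (2 * t * a ^+ 2)^-1%:E * ((f x)%:E * (f x)%:E))))%E).
      apply: ge0_leT.
      - by apply: emeasurable_funD; [exact: measurable_cst|exact: measurable_funeM].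
      - apply: emeasurable_funD; first exact: measurable_funeM.
        by apply: emeasurable_funD; [exact: measurable_cst|exact: measurable_funeM].
      - by move=> x; rewrite -EFinM -EFinD lee_fin addr_ge0 // mulr_ge0.
      - move=> x; rewrite -!EFinM -!EFinD lee_fin.
        have := @le_min_sqr R (a^-1 * f x) t (mulr_ge0 ai (f0 x)) t0.
        have -> : a^-1 * Num.min a (f x) = Num.min 1 (a^-1 * f x) by rewrite minr_pMr // mulVf.
        move=> h; apply: le_trans (le_trans h _);
          rewrite le_eqVlt; apply/orP; left; apply/eqP; field; rewrite ?an ?tn //.
    rewrite ge0_DT; last 4 first.
    - exact: measurable_funeM.
    - by apply: emeasurable_funD; [exact: measurable_cst|exact: measurable_funeM].
    - by move=> x; rewrite -EFinM lee_fin mulr_ge0 // min0 // ltW.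
    - by move=> x; apply: adde_ge0; [by rewrite lee_fin|apply: mule_ge0; [by rewrite lee_fin|exact: ff0]].
    rewrite ge0_ZlT //; last by move=> x; rewrite lee_fin min0 // ltW.
    apply: leeD2l; rewrite ge0_DT; last 4 first.
    - exact: measurable_cst.
    - exact: measurable_funeM.
    - by move=> x; rewrite lee_fin.
    - by move=> x; apply: mule_ge0; [rewrite lee_fin|exact: ff0].
    rewrite integral_prob_cst // ge0_ZlT // (EFinD _ ((1 + eta) / (2 * t))); apply: leeD2l.
    apply: (@le_trans _ _ ((2 * t * a ^+ 2)^-1%:E * ((1 + eta) * a ^+ 2)%:E)%E).
      by apply: lee_wpmul2l; rewrite ?lee_fin.
    by rewrite -EFinM lee_fin le_eqVlt; apply/orP; left; apply/eqP; field; rewrite an tn.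
  move/lee_subr_fin: K; apply: le_trans.
  by rewrite lee_fin le_eqVlt; apply/orP; left; apply/eqP; field; rewrite tn.
have := lee_wpmul2l (_ : (0 <= (Num.min b a)%:E)%E) H; rewrite lee_fin -EFinM => /(_ mab0) /le_trans; apply.
rewrite muleA -EFinM -ge0_ZlT //; last 2 first.
- by rewrite mulr_ge0 // invr_ge0 ltW.
- by move=> x; rewrite lee_fin min0 // ltW.
apply: ge0_leT => //.
- exact: measurable_funeM.
- by move=> x; rewrite -EFinM lee_fin !mulr_ge0 ?invr_ge0 ?min0 // ltW.
- move=> x; rewrite -EFinM lee_fin -mulrA minr_pMr ?invr_ge0 ?(ltW a0) // mulVf //.
  rewrite le_min; apply/andP; split.
    apply: (@le_trans _ _ (Num.min b a)); last by rewrite ge_min lexx.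
    by rewrite ler_piMr // ge_min lexx.
  rewrite -[X in _ <= X](mulVKf an); apply: ler_pM => //.
  - by rewrite le_min ler01 mulr_ge0 // invr_ge0 ltW.
  - by rewrite ge_min lexx orbT.
  - by rewrite ge_min lexx orbT.
Qed.

End SecondMoment.

Section SmoothedMoments.
Context (R : realType) (l n : nat) (mu : probability (n.-tuple R) R).
Implicit Types (v w rho : R) (G : l.-tuple (n.-tuple R)) (x y : l.-tuple R) (X Y : n.-tuple R).
Local Notation leb := (@leb R).
Local Notation lebn := (pw leb).
Local Notation gau := (@gau R).
Local Notation GG w := (pw (pw (gau w) n) l).

Definition bad_pair w rho : set (n.-tuple R * n.-tuple R) := [set z | rho < `|w * dot z.1 z.2|].

Lemma measurable_bad_pair w rho : measurable (bad_pair w rho).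
Proof.
have mf : measurable_fun setT (fun z : n.-tuple R * n.-tuple R => `|w * dot z.1 z.2|).
  by apply: measurableT_comp => //; mR.
have := mf measurableT _ (measurable_itv `]rho, +oo[); rewrite setTI.
by congr measurable; apply/seteqP; split => z /=; rewrite /bad_pair /= in_itv /= andbT.
Qed.

Lemma prod_qpdf_le v w rho x X Y : 0 < v -> 0 < w -> 0 <= rho -> rho ^+ 2 <= v ^+ 2 / 2 ->
  \prod_(i < l) qpdf (v + w * nsq X) (v + w * nsq Y) (w * dot X Y) (tnth x i) (tnth x i) <=
  expR (l%:R * (rho ^+ 2 / v ^+ 2) + 2 * rho * nsq x / v ^+ 2) * (gpdfn (v + w * nsq X) x * gpdfn (v + w * nsq Y) x) +
  gpdf v 0 ^+ (2 * l) * \1_(bad_pair w rho) (X, Y).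
Proof.
move=> v0 w0 rho0 rv.
have vX (Z : n.-tuple R) : v <= v + w * nsq Z by rewrite lerDl mulr_ge0 ?nsq_ge0 // ltW.
have vX0 (Z : n.-tuple R) : 0 < v + w * nsq Z by apply: lt_le_trans (vX Z).
rewrite indicE; have [bad|good] := pselect (bad_pair w rho (X, Y)).
  rewrite mem_set // mulr1; apply: ler_wpDl.
    by rewrite mulr_ge0 ?expR_ge0 // mulr_ge0 ?gpdfn_ge0.
  rewrite exprM -[X in _ ^+ X]card_ord -prodr_const.
  apply: ler_prod => i _; rewrite qpdf_ge0 /=; apply: qpdf_le_max => //.
  have -> : (v + w * nsq X) * (v + w * nsq Y) - (w * dot X Y) ^+ 2 =
    v ^+ 2 + (v * w * (nsq X + nsq Y) + w ^+ 2 * (nsq X * nsq Y - dot X Y ^+ 2)) by ring.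
  have w1 := ltW w0; have v1 := ltW v0.
  rewrite lerDl; apply: addr_ge0.
    by apply: mulr_ge0; [exact: mulr_ge0|apply: addr_ge0; exact: nsq_ge0].
  by apply: mulr_ge0; [exact: sqr_ge0|rewrite subr_ge0 dot_sqr_le].
rewrite memNset // mulr0 addr0.
have -> : l%:R * (rho ^+ 2 / v ^+ 2) + 2 * rho * nsq x / v ^+ 2 =
    \sum_(i < l) (rho ^+ 2 / v ^+ 2 + 2 * rho * tnth x i ^+ 2 / v ^+ 2).
  rewrite big_split /= sumr_const card_ord mulr_natl; congr (_ + _).
  by rewrite nsqE -mulr_suml -mulr_sumr.
rewrite expR_sum !gpdfn.unlock -!big_split /=; apply: ler_prod => i _; rewrite qpdf_ge0 /=.
rewrite [X in _ <= X]mulrC; apply: qpdf_le_ratio => //.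
by rewrite leNgt; apply/negP.
Qed.

(** Up to the factor C the first term is the square of the mean, so the relative variance is small
    as soon as C is near 1 and the contribution of the bad pairs is negligible against [mix ^+ 2]. A
    pair is bad when its inner product is too large for [qpdf_le_ratio]. *)
Lemma expectation_sm2_le v w rho x (p0 : R) : 0 < v -> 0 < w -> 0 <= rho -> rho ^+ 2 <= v ^+ 2 / 2 ->
  (\int[mu]_X \int[mu]_Y (\1_(bad_pair w rho) (X, Y) : R)%:E <= p0%:E)%E ->
  (\int[GG w]_G ((sm mu v G x)%:E * (sm mu v G x)%:E) <=
   (expR (l%:R * (rho ^+ 2 / v ^+ 2) + 2 * rho * nsq x / v ^+ 2) * mix mu v w x ^+ 2 + gpdf v 0 ^+ (2 * l) * p0)%:E)%E.
Proof.
move=> v0 w0 rho0 rv Hp; rewrite expectation_sm2 //.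
set C := expR _; set M := gpdf v 0 ^+ _.
have C0 : 0 <= C by exact: expR_ge0.
have M0 : 0 <= M by rewrite exprn_ge0 // gpdf_ge0.
have v1 := ltW v0; have w1 := ltW w0.
pose g X : R := gpdfn (v + w * nsq X) x.
have g0 X : (0 <= (g X)%:E)%E by rewrite lee_fin gpdfn_ge0.
have mg : measurable_fun setT (fun X => (g X)%:E).
  apply/measurable_EFinP; apply: measurable_gpdfn_var; [by mR|by mR|move=> X].
  by rewrite addr_ge0 // mulr_ge0 // nsq_ge0.
have mB : measurable_fun setT (fun z => (\1_(bad_pair w rho) (z.1, z.2) : R)%:E).
  apply/measurable_EFinP; rewrite (_ : (fun _ => _) = \1_(bad_pair w rho)); first by apply: measurable_indic; exact: measurable_bad_pair.
  by apply/funext => -[].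
have B0 X Y : (0 <= (\1_(bad_pair w rho) (X, Y) : R)%:E)%E by rewrite lee_fin.
have mBs X := measurable_sec (f := fun X Y => (\1_(bad_pair w rho) (X, Y) : R)%:E) mB X.
have miB := measurable_int2 mu mB B0.
have miB0 X : (0 <= \int[mu]_Y (\1_(bad_pair w rho) (X, Y) : R)%:E)%E by apply: integral_ge0.
have mixE' : (\int[mu]_X (g X)%:E = (mix mu v w x)%:E)%E by rewrite mixE.
have mx0 := mix_ge0 mu x v0 w0.
pose H X Y := (C%:E * ((g X)%:E * (g Y)%:E) + M%:E * (\1_(bad_pair w rho) (X, Y) : R)%:E)%E.
apply: (@le_trans _ _ (\int[mu]_X \int[mu]_Y H X Y)%E).
  have mprod : measurable_fun setT (fun z : n.-tuple R * n.-tuple R =>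
     \prod_(i < l) (qpdf (v + w * nsq z.1) (v + w * nsq z.2) (w * dot z.1 z.2) (tnth x i) (tnth x i))%:E)%E.
    apply: emeasurable_prod => i _; apply/measurable_EFinP.
    rewrite (_ : (fun _ => _) = fun z : n.-tuple R * n.-tuple R =>
      let D := (v + w * nsq z.1) * (v + w * nsq z.2) - (w * dot z.1 z.2) ^+ 2 in
      (2 * pi * Num.sqrt D)^-1 * expR (- (((v + w * nsq z.2) * tnth x i ^+ 2 - 2 * (w * dot z.1 z.2) * tnth x i * tnth x i +
        (v + w * nsq z.1) * tnth x i ^+ 2) / (2 * D)))); last by apply/funext => z; rewrite qpdf.unlock.
    have D0 (z : n.-tuple R * n.-tuple R) : 0 <= (v + w * nsq z.1) * (v + w * nsq z.2) - (w * dot z.1 z.2) ^+ 2.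
      rewrite (_ : _ - _ = v ^+ 2 + (v * w * (nsq z.1 + nsq z.2) + w ^+ 2 * (nsq z.1 * nsq z.2 - dot z.1 z.2 ^+ 2))); last by ring.
      apply: addr_ge0; first exact: sqr_ge0.
      apply: addr_ge0.
        by apply: mulr_ge0; [exact: mulr_ge0|apply: addr_ge0; exact: nsq_ge0].
      by apply: mulr_ge0; [exact: sqr_ge0|rewrite subr_ge0 dot_sqr_le].
    have mD : measurable_fun setT (fun z : n.-tuple R * n.-tuple R => (v + w * nsq z.1) * (v + w * nsq z.2) - (w * dot z.1 z.2) ^+ 2) by mR.
    cbv zeta; apply: measurable_funM.
      apply: measurable_invf => [|z]; last by rewrite mulr_ge0 ?sqrtr_ge0 // mulr_ge0 // pi_ge0.
      by apply: measurable_funM; [mR|exact: measurable_sqrtf].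
    apply: measurableT_comp => //; apply: measurable_funN; apply: measurable_funM; first by mR.
    by apply: measurable_invf => [|z]; [apply: measurable_funM => //; mR|rewrite mulr_ge0].
  have prod0 X Y : (0 <= \prod_(i < l) (qpdf (v + w * nsq X) (v + w * nsq Y) (w * dot X Y) (tnth x i) (tnth x i))%:E)%E.
    by apply: prode_ge0 => i _; rewrite lee_fin qpdf_ge0.
  have mH : measurable_fun setT (fun z : n.-tuple R * n.-tuple R => H z.1 z.2).
    apply: emeasurable_funD; last exact: measurable_funeM.
    apply: measurable_funeM; apply: emeasurable_funM; apply: (measurableT_comp mg).
      exact: measurable_fst.
    exact: measurable_snd.
  have H0 X Y : (0 <= H X Y)%E by rewrite /H; apply: adde_ge0; apply: mule_ge0 => //; exact: mule_ge0.
  apply: ge0_leT.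
  - exact: measurable_int2.
  - exact: measurable_int2.
  - by move=> X; apply: integral_ge0.
  move=> X; apply: ge0_leT => //.
  - exact: (measurable_sec (f := fun X Y => \prod_(i < l) (qpdf (v + w * nsq X) (v + w * nsq Y)
      (w * dot X Y) (tnth x i) (tnth x i))%:E)%E mprod).
  - exact: (measurable_sec (f := H) mH).
  by move=> Y; rewrite prodEFin /H -!EFinM -EFinD lee_fin; exact: prod_qpdf_le.
have E X : (\int[mu]_Y H X Y = (C * mix mu v w x)%:E * (g X)%:E + M%:E * \int[mu]_Y (\1_(bad_pair w rho) (X, Y) : R)%:E)%E.
  rewrite ge0_DT.
  - congr (_ + _)%E; last by rewrite ge0_ZlT.
    rewrite ge0_ZlT //; last 2 first.
    + exact: measurable_funeM.
    + by move=> Y; exact: mule_ge0.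
    by rewrite ge0_ZlT ?gpdfn_ge0 // mixE' -!EFinM; congr EFin; ring.
  - by apply: measurable_funeM; exact: measurable_funeM.
  - exact: measurable_funeM.
  - by move=> Y; apply: mule_ge0 => //; exact: mule_ge0.
  - by move=> Y; apply: mule_ge0; rewrite ?lee_fin.
under eq_integral do rewrite E.
have Cm0 : 0 <= C * mix mu v w x by exact: mulr_ge0.
rewrite ge0_DT.
- rewrite ge0_ZlT // ge0_ZlT // mixE' EFinD; apply: leeD.
    by rewrite -EFinM lee_fin expr2 mulrA.
  by rewrite EFinM; apply: lee_wpmul2l; rewrite ?lee_fin.
- exact: measurable_funeM.
- exact: measurable_funeM.
- by move=> X; apply: mule_ge0; rewrite ?lee_fin // gpdfn_ge0.
- by move=> X; apply: mule_ge0; rewrite ?lee_fin.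
Qed.

(* Prekopa's theorem for the measure mu, restricted to lines. *)
Definition log_concave_marginals := forall F : R -> n.-tuple R -> \bar R,
  (forall s p, 0 <= F s p)%E -> (forall s, measurable_fun setT (F s)) ->
  log_concave2 (F : R^o -> _) -> log_concave ((fun s => \int[mu]_X F s X)%E : R^o -> _).

Lemma app_tmix t G X Y : app G (tmix t X Y) = tmix t (app G X) (app G Y).
Proof.
apply: eq_from_tnth => i; rewrite tnth_app !tnth_mktuple !tnth_app dot.unlock !mulr_sumr -big_split /=.
by apply: eq_bigr => j _; rewrite tnth_mktuple; ring.
Qed.

Lemma nsq_tmix k t (a b : k.-tuple R) : 0 <= t <= 1 -> nsq (tmix t a b) <= t * nsq a + (1 - t) * nsq b.
Proof.
move=> /andP[t0 t1]; rewrite !nsqE !mulr_sumr -big_split /=; apply: ler_sum => i _.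
rewrite tnth_mktuple -subr_ge0.
have -> : t * tnth a i ^+ 2 + (1 - t) * tnth b i ^+ 2 - (t * tnth a i + (1 - t) * tnth b i) ^+ 2 =
  t * (1 - t) * (tnth a i - tnth b i) ^+ 2 by ring.
by rewrite mulr_ge0 ?sqr_ge0 // mulr_ge0 // subr_ge0.
Qed.

Lemma gpdfn_log_concave v (k : nat) (p q : k.-tuple R) t a b : 0 < v -> 0 < t < 1 ->
  expR a <= gpdfn v p -> expR b <= gpdfn v q -> expR (t * a + (1 - t) * b) <= gpdfn v (tmix t p q).
Proof.
move=> v0 t01; have [t0 t1] := andP t01; rewrite !gpdfnE //.
have g0 : 0 < gpdf v 0 ^+ k by rewrite exprn_gt0 // gpdf_gt0.
rewrite -(lnK g0) -!expRD !ler_expR; set c := ln _ => ha hb.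
have := @nsq_tmix k t p q _; rewrite (ltW t0) (ltW t1) => /(_ isT) h.
have h2 : nsq (tmix t p q) / (2 * v) <= (t * nsq p + (1 - t) * nsq q) / (2 * v).
  by rewrite ler_pM2r // invr_gt0 mulr_gt0.
have h3 : t * a <= t * (c - nsq p / (2 * v)) by rewrite ler_pM2l.
have h4 : (1 - t) * b <= (1 - t) * (c - nsq q / (2 * v)) by rewrite ler_pM2l // subr_gt0.
have h5 : (t * nsq p + (1 - t) * nsq q) / (2 * v) = t * (nsq p / (2 * v)) + (1 - t) * (nsq q / (2 * v)).
  by rewrite mulrDl !mulrA.
rewrite h5 in h2; lra.
Qed.

Lemma sm_log_concave v G x y t a b : log_concave_marginals -> 0 < v -> 0 < t < 1 ->
  expR a <= sm mu v G x -> expR b <= sm mu v G y -> expR (t * a + (1 - t) * b) <= sm mu v G (tmix t x y).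
Proof.
move=> Hlc v0 t01; rewrite -!lee_fin !smE // => hx hy.
(* The segment from y to x is parametrised by one real s, as [log_concave_marginals] asks; the
   endpoints are s = 1 and s = 0. *)
pose F (s : R) X := (gpdfn v (tsub (tmix s x y) (app G X)))%:E.
have E1 : tmix 1 x y = x by apply: eq_from_tnth => i; rewrite tnth_mktuple; ring.
have E0 : tmix 0 x y = y by apply: eq_from_tnth => i; rewrite tnth_mktuple; ring.
have := Hlc F _ _ _ 1 0 t a b t01; rewrite /F E1 E0 => H.
have -> : tmix t x y = tmix (t *: (1 : R^o) + (1 - t) *: 0)%R x y.
  by rewrite scaler0 addr0 /GRing.scale /= mulr1.
apply: H => // [s p|s|s1 s2 p q t' a' b' t'01].
- by rewrite lee_fin gpdfn_ge0.
- by mR.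
rewrite !lee_fin => h1 h2.
have := gpdfn_log_concave v0 t'01 h1 h2; congr (_ <= gpdfn v _).
apply: eq_from_tnth => i; rewrite app_tmix tnth_mktuple !tnth_tsub !tnth_mktuple /GRing.scale /=; ring.
Qed.

(** No single matrix is selected; the inequality is averaged over G. With p and q the ratios of [sm]
    to [mix] at x and y, cut at 1, one has p + q <= 1 + p q, and p q is at most sm(z) / S by
    log-concavity for each G. The second moments make the means of p and q close to 1. *)
Lemma mix_mid v w x y t eta : log_concave_marginals -> 0 < v -> 0 < w -> 0 < t ->
  0 < mix mu v w x -> 0 < mix mu v w y ->
  (\int[GG w]_G ((sm mu v G x)%:E * (sm mu v G x)%:E) <= ((1 + eta) * mix mu v w x ^+ 2)%:E)%E ->
  (\int[GG w]_G ((sm mu v G y)%:E * (sm mu v G y)%:E) <= ((1 + eta) * mix mu v w y ^+ 2)%:E)%E ->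
  Num.sqrt (mix mu v w x * mix mu v w y) * (1 - 2 * (t / 2 + eta / (2 * t))) <= mix mu v w (tmix 2^-1 x y).
Proof.
move=> Hlc v0 w0 t0 mx my hx hy; set z := tmix _ x y; set S := Num.sqrt _; set ep := t / 2 + _.
have S0 : 0 < S by rewrite sqrtr_gt0 mulr_gt0.
have mz0 := mix_ge0 mu z v0 w0.
have mS u : measurable_fun setT (fun G => sm mu v G u).
  by apply: (measurableT_comp (measurable_sm mu v0) (g := fun G => (G, u))); apply: measurable_fun_pair.
have smn0 u G : 0 <= sm mu v G u by exact: sm_ge0.
have GT := gau_matT l n w.
have Hx : forall u, 0 < mix mu v w u -> (\int[GG w]_G ((sm mu v G u)%:E * (sm mu v G u)%:E) <= ((1 + eta) * mix mu v w u ^+ 2)%:E)%E ->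
   ((1 - ep)%:E <= \int[GG w]_G (Num.min 1 ((mix mu v w u)^-1 * sm mu v G u))%:E)%E.
  move=> u mu0 hu; have mun : mix mu v w u != 0 by rewrite gt_eqF.
  have := integral_min_ge GT (mS u) (smn0 u) mu0 (ltW mu0) t0 (expectation_sm mu u v0 w0) hu.
  rewrite minxx => h; have mi : 0 <= (mix mu v w u)^-1 by rewrite invr_ge0 ltW.
  have := lee_wpmul2l (_ : (0 <= ((mix mu v w u)^-1)%:E)%E) h; rewrite lee_fin => /(_ mi).
  rewrite -EFinM mulrA mulVf // mul1r => /le_trans; apply.
  have mm : measurable_fun setT (fun G => (Num.min (mix mu v w u) (sm mu v G u))%:E).
    by apply/measurable_EFinP; apply: measurable_minr.
  rewrite -ge0_ZlT //; last by move=> G; rewrite lee_fin le_min smn0 ltW.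
  rewrite le_eqVlt; apply/orP; left; apply/eqP; apply: eq_integral => G _.
  by rewrite -EFinM minr_pMr // mulVf.
have mmin u : measurable_fun setT (fun G => (Num.min 1 ((mix mu v w u)^-1 * sm mu v G u))%:E).
  by apply/measurable_EFinP; apply: measurable_minr => //; apply: measurable_funM.
have min0 u G : 0 < mix mu v w u -> (0 <= (Num.min 1 ((mix mu v w u)^-1 * sm mu v G u))%:E)%E.
  by move=> h; rewrite lee_fin le_min ler01 mulr_ge0 // invr_ge0 ltW.
have msz : measurable_fun setT (fun G => (sm mu v G z)%:E) by apply/measurable_EFinP.
have Si : 0 <= S^-1 by rewrite invr_ge0 ltW.
have K : ((1 - ep)%:E + (1 - ep)%:E <= 1%:E + S^-1%:E * (mix mu v w z)%:E)%E.
  apply: (le_trans (leeD (Hx x mx hx) (Hx y my hy))).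
  rewrite -ge0_DT //; last 2 first.
  - by move=> G; exact: min0.
  - by move=> G; exact: min0.
  rewrite -(expectation_sm mu z v0 w0) -ge0_ZlT //; last by move=> G; rewrite lee_fin.
  rewrite -[X in (_ <= X + _)%E](integral_prob_cst 1%:E GT) -ge0_DT //; last 2 first.
  - exact: measurable_funeM.
  - by move=> G; rewrite -EFinM lee_fin mulr_ge0.
  apply: ge0_leT.
  - exact: emeasurable_funD.
  - by apply: emeasurable_funD; [exact: measurable_cst|exact: measurable_funeM].
  - by move=> G; apply: adde_ge0; exact: min0.
  move=> G; rewrite -EFinM -!EFinD lee_fin.
  have le1 u : Num.min 1 ((mix mu v w u)^-1 * sm mu v G u) <= 1 by rewrite ge_min lexx.
  have k0 : 0 <= S^-1 * sm mu v G z by rewrite mulr_ge0.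
  have [sx0|sx0] := leP (sm mu v G x) 0.
    have -> : sm mu v G x = 0 by apply/eqP; rewrite eq_le sx0 smn0.
    by rewrite mulr0 (min_idPr ler01) add0r ler_wpDr.
  have [sy0|sy0] := leP (sm mu v G y) 0.
    have -> : sm mu v G y = 0 by apply/eqP; rewrite eq_le sy0 smn0.
    by rewrite mulr0 (min_idPr ler01) addr0 ler_wpDr.
  set p := Num.min 1 _; set q := Num.min 1 _.
  have p0 : 0 <= p by rewrite le_min ler01 mulr_ge0 // invr_ge0 ltW.
  have q0 : 0 <= q by rewrite le_min ler01 mulr_ge0 // invr_ge0 ltW.
  have p1 : p <= 1 by exact: le1.
  have q1 : q <= 1 by exact: le1.
  suff : p * q <= S^-1 * sm mu v G z.
    move=> h; have : 0 <= (1 - p) * (1 - q) by rewrite mulr_ge0 ?subr_ge0.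
    by nra.
  have h12 : 0 < (2^-1 : R) < 1 by rewrite invr_gt0 ltr0n invf_lt1 ?ltr1n ?ltr0n.
  have := @sm_log_concave v G x y 2^-1 (ln (sm mu v G x)) (ln (sm mu v G y)) Hlc v0 h12.
  rewrite !lnK // => /(_ (lexx _) (lexx _)) hz.
  have hz2 : sm mu v G x * sm mu v G y <= sm mu v G z ^+ 2.
    apply: (@le_trans _ _ (expR (2^-1 * ln (sm mu v G x) + (1 - 2^-1) * ln (sm mu v G y)) ^+ 2)); last first.
      by rewrite lerXn2r ?nnegrE ?expR_ge0 ?smn0.
    rewrite -expRM_natl (_ : 2%:R * _ = ln (sm mu v G x) + ln (sm mu v G y)); last by field.
    by rewrite expRD !lnK.
  apply: le_of_sqr => //.
  rewrite exprMn [X in _ <= X]exprMn exprVn sqr_sqrtr; last by rewrite mulr_ge0 // ltW.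
  apply: (@le_trans _ _ ((mix mu v w x * mix mu v w y)^-1 * (sm mu v G x * sm mu v G y))); last first.
    by rewrite ler_wpM2l // invr_ge0 mulr_ge0 // ltW.
  rewrite invfM [X in _ <= X]mulrACA; apply: ler_pM; rewrite ?sqr_ge0 //.
    apply: (@le_trans _ _ p); first by rewrite expr2 ler_piMr.
    by rewrite ge_min lexx orbT.
  apply: (@le_trans _ _ q); first by rewrite expr2 ler_piMr.
  by rewrite ge_min lexx orbT.
rewrite -EFinM -!EFinD lee_fin in K.
rewrite -(ler_pM2l (_ : 0 < S^-1)) ?invr_gt0 // mulrA mulVf ?gt_eqF // mul1r; move: K; goal_lra.
Qed.

End SmoothedMoments.

(* One minus the total variation distance between the standard Gaussian and the smoothed marginal. *)
HB.lock Definition ovl (R : realType) l n (mu : probability (n.-tuple R) R) (v : R)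
    (G : l.-tuple (n.-tuple R)) : R :=
  fine (\int[pw (@leb R) l]_x (Num.min (gpdfn 1 x) (sm mu v G x))%:E)%E.

Lemma lee_addr_addr (R : realType) (x y : \bar R) (a b : R) : (x + a%:E <= y + b%:E -> x <= y + (b - a)%:E)%E.
Proof.
by case: x => [x||]; case: y => [y||] // h; rewrite ?leNye ?leey // -EFinD lee_fin addrA lerBrDr; exact: h.
Qed.

(** * Overlap of the smoothed density with the Gaussian density *)

Section GaussianBasics.
Context (R : realType).
Local Notation leb := (@leb R).
Local Notation lebn := (pw leb).
Local Notation gau := (@gau R).

Lemma tsub0 n (x : n.-tuple R) : tsub x [tuple 0 | i < n] = x.
Proof. by apply: eq_from_tnth => i; rewrite tnth_tsub tnth_mktuple subr0. Qed.

Lemma ge0_integral_gaun n (v : R) (f : n.-tuple R -> \bar R) : 0 < v ->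
  measurable_fun setT f -> (forall x, 0 <= f x)%E ->
  (\int[pw (gau v) n]_z f z = \int[lebn n]_x (f x * (gpdfn v x)%:E))%E.
Proof.
move=> v0 mf f0; have := smoothing [tuple 0 | i < n] v0 mf f0.
rewrite (_ : (fun z => f (tadd _ z)) = f); last first.
  apply/funext => z; congr f; apply: eq_from_tnth => i; by rewrite !tnth_mktuple add0r.
by move=> ->; apply: eq_integral => x _; rewrite -/(tsub _ _) tsub0.
Qed.

(** The second moment is v; the constant 6 comes from x^2 <= 4 v exp(x^2 / (4 v)) and sqrt 2 <= 3 /
    2, the exponential moment being explicit. *)
Lemma gau_sqr_le (v : R) : 0 < v -> (\int[gau v]_x (x ^+ 2)%:E <= (6 * v)%:E)%E.
Proof.
move=> v0; have h4 : 0 <= 4 * v :> R by rewrite mulr_ge0 // ltW.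
have mx : measurable_fun setT (fun x : R => (expR ((4 * v)^-1 * x ^+ 2))%:E) by mR.
apply: (@le_trans _ _ (\int[gau v]_x ((4 * v)%:E * (expR ((4 * v)^-1 * x ^+ 2))%:E))%E).
  apply: ge0_leT.
  - by mR.
  - exact: measurable_funeM.
  - by move=> x; rewrite lee_fin sqr_ge0.
  move=> x; rewrite -EFinM lee_fin -ler_pdivrMl ?mulr_gt0 //.
  by have := expR_ge1Dx ((4 * v)^-1 * x ^+ 2); lra.
have e : 2 * (4 * v)^-1 * v = 2^-1 :> R by field; rewrite gt_eqF.
rewrite ge0_ZlT // integral_gau_expR_sqr // ?e; last by lra.
rewrite -EFinM lee_fin.
have -> : 1 - 2^-1 = (2^-1 : R) by field.
rewrite sqrtrV // invrK.
have h : Num.sqrt 2 <= 3 / 2 :> R.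
  by apply: le_of_sqr; rewrite ?sqr_sqrtr //; lra.
have -> : 6 * v = 4 * v * (3 / 2) by field.
by rewrite ler_wpM2l.
Qed.

Lemma gaun_nsq_le n (v : R) : 0 < v -> (\int[pw (gau v) n]_x (nsq x)%:E <= (6 * v * n%:R)%:E)%E.
Proof.
move=> v0; have -> : (\int[pw (gau v) n]_x (nsq x)%:E = \sum_(i < n) \int[pw (gau v) n]_x (tnth x i ^+ 2)%:E)%E.
  transitivity (\int[pw (gau v) n]_x \sum_(i < n) (tnth x i ^+ 2)%:E)%E.
    by apply: eq_integral => x _; rewrite nsqE sumEFin.
  rewrite ge0_integral_sum //.
  - by move=> i; mR.
  - by move=> i x _; rewrite lee_fin sqr_ge0.
apply: (@le_trans _ _ (\sum_(i < n) (6 * v)%:E)%E).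
  apply: lee_sum => i _; rewrite (@ge0_pw_coord _ _ _ (gau v) n i (fun x : R => (x ^+ 2)%:E)) ?gau_sqr_le //.
  - exact: gau_setT.
  - by mR.
  - by move=> x; rewrite lee_fin sqr_ge0.
by rewrite sumEFin sumr_const card_ord mulr_natr.
Qed.

Lemma measurable_nsq_le n (r : R) : measurable [set x : n.-tuple R | nsq x <= r].
Proof.
have mf : measurable_fun setT (fun x : n.-tuple R => nsq x) by mR.
have := mf measurableT _ (measurable_itv `]-oo, r]); rewrite setTI.
by congr measurable; apply/seteqP; split => z /=; rewrite in_itv.
Qed.

Lemma measurable_nsq_gt n (r : R) : measurable [set x : n.-tuple R | r < nsq x].
Proof.
have mf : measurable_fun setT (fun x : n.-tuple R => nsq x) by mR.
have := mf measurableT _ (measurable_itv `]r, +oo[); rewrite setTI.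
by congr measurable; apply/seteqP; split => z /=; rewrite in_itv /= andbT.
Qed.

Lemma gaun_ball_ge n (r : R) : 0 < r ->
  ((1 - 6 * n%:R / r)%:E <= \int[lebn n]_x ((\1_[set x : n.-tuple R | nsq x <= r] x : R)%:E * (gpdfn 1 x)%:E))%E.
Proof.
move=> r0; have mA := @measurable_nsq_le n r; have mB := @measurable_nsq_gt n r.
have m1 (A : set (n.-tuple R)) : measurable A -> measurable_fun setT (fun x => (\1_A x : R)%:E).
  by move=> mA'; apply/measurable_EFinP; exact: measurable_indic.
rewrite -ge0_integral_gaun //; last exact: m1.
pose A : set (n.-tuple R) := [set x | nsq x <= r]; pose B : set (n.-tuple R) := [set x | r < nsq x].
have GT : pw (gau 1) n setT = 1%E by apply: pw_setT; exact: gau_setT.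
have H : (r%:E * pw (gau 1) n B <= (6 * n%:R)%:E)%E.
  have := @gaun_nsq_le n 1 ltr01; rewrite mulr1; apply: le_trans; apply: le_mul_measure => //.
  - exact: ltW.
  - by mR.
  - by move=> x; rewrite lee_fin nsq_ge0.
  - by move=> x /= ?; rewrite lee_fin ltW.
have E1 : (\int[pw (gau 1) n]_x (\1_A x : R)%:E + pw (gau 1) n B = 1)%E.
  have -> : pw (gau 1) n B = (\int[pw (gau 1) n]_x (\1_B x : R)%:E)%E.
    by rewrite integral_indic // setIT.
  rewrite -ge0_DT //.
  - rewrite -[RHS](integral_prob_cst 1%E GT); apply: eq_integral => x _; rewrite -EFinD; congr EFin.
    rewrite !indicE; have [h|h] := leP (nsq x) r.
      by rewrite mem_set // memNset /= ?addr0 // => h'; move: (lt_le_trans h' h); rewrite ltxx.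
    by rewrite memNset ?mem_set ?add0r //= => h'; move: (lt_le_trans h h'); rewrite ltxx.
  - by apply/measurable_EFinP; exact: measurable_indic.
  - by apply/measurable_EFinP; exact: measurable_indic.
rewrite -/A.
apply: lee_subr_fin; rewrite -E1; apply: leeD2l.
have := lee_wpmul2l (_ : (0 <= (r^-1)%:E)%E) H; rewrite lee_fin invr_ge0 (ltW r0) => /(_ isT).
by rewrite muleA -EFinM mulVf ?gt_eqF // mul1e -EFinM mulrC.
Qed.

Lemma gpdf_ratio (s tau x : R) : tau <= 1 / 2 -> `|s - 1| <= tau ->
  gpdf 1 x * expR (- (tau / 2 + tau * x ^+ 2)) <= gpdf s x.
Proof.
move=> tau1 hs; have tau0 : 0 <= tau by apply: le_trans hs.
have /andP[s1 s2] : 1 - tau <= s <= 1 + tau by rewrite ler_distl in hs.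
have s0 : 0 < s by lra.
have pi20 : 0 < 2 * pi :> R by rewrite mulr_gt0 // pi_gt0.
have pi2s0 : 0 < 2 * pi * s by exact: mulr_gt0.
rewrite !gpdf.unlock mulr1 opprD expRD mulrACA; apply: ler_pM.
- by rewrite mulr_ge0 ?expR_ge0 // invr_ge0 sqrtr_ge0.
- by rewrite mulr_ge0 ?expR_ge0.
- rewrite [Num.sqrt (2 * pi * s)]sqrtrM ?(ltW pi20) // invfM ler_pM2l ?invr_gt0 ?sqrtr_gt0 //.
  rewrite expRN lef_pV2 ?posrE ?sqrtr_gt0 ?expR_gt0 //.
  apply: le_of_sqr; rewrite ?expR_ge0 // sqr_sqrtr ?(ltW s0) // -expRM_natl.
  rewrite (_ : 2%:R * (tau / 2) = tau); last by field.
  by apply: (le_trans s2); exact: expR_ge1Dx.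
- rewrite -expRD ler_expR mulr1 -opprD lerN2.
  have : (2 * s)^-1 <= 2^-1 + tau.
    rewrite -(ler_pM2l (_ : 0 < 2 * s)) ?mulr_gt0 // divff ?gt_eqF ?mulr_gt0 //.
    nra.
  move=> h; have := @ler_wpM2l _ _ (sqr_ge0 x) _ _ h; lra.
Qed.

Lemma gpdfn_ratio n (s tau : R) (x : n.-tuple R) : tau <= 1 / 2 -> `|s - 1| <= tau ->
  gpdfn 1 x * expR (- (n%:R * (tau / 2) + tau * nsq x)) <= gpdfn s x.
Proof.
move=> tau1 hs.
have -> : n%:R * (tau / 2) + tau * nsq x = \sum_(i < n) (tau / 2 + tau * tnth x i ^+ 2).
  by rewrite big_split /= sumr_const card_ord mulr_natl nsqE mulr_sumr.
rewrite -sumrN expR_sum !gpdfn.unlock -big_split /=.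
apply: ler_prod => i _; rewrite gpdf_ratio // andbT.
by rewrite mulr_ge0 ?expR_ge0 ?gpdf_ge0.
Qed.

End GaussianBasics.

Section Overlap.
Context (R : realType) (l n : nat) (mu : probability (n.-tuple R) R).
Implicit Types (v w : R) (G : l.-tuple (n.-tuple R)) (x y : l.-tuple R) (X Y : n.-tuple R).
Local Notation leb := (@leb R).
Local Notation lebn := (pw leb).
Local Notation gau := (@gau R).
Local Notation GG w := (pw (pw (gau w) n) l).

Lemma measurable_min_sm v : 0 < v ->
  measurable_fun setT (fun z : l.-tuple (n.-tuple R) * l.-tuple R => (Num.min (gpdfn 1 z.2) (sm mu v z.1 z.2))%:E).
Proof.
move=> v0; apply/measurable_EFinP; apply: measurable_minr; first by mR.
exact: measurable_sm.
Qed.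

Lemma min_sm_ge0 v G x : 0 < v -> (0 <= (Num.min (gpdfn 1 x) (sm mu v G x))%:E)%E.
Proof. by move=> v0; rewrite lee_fin le_min gpdfn_ge0 sm_ge0. Qed.

Lemma ovlP v G : 0 < v -> ((ovl mu v G)%:E = \int[lebn l]_x (Num.min (gpdfn 1 x) (sm mu v G x))%:E)%E /\
  0 <= ovl mu v G <= 1.
Proof.
move=> v0; rewrite ovl.unlock; set I := (\int[_]_x _)%E.
have mm := measurable_sec (f := fun G x => (Num.min (gpdfn 1 x) (sm mu v G x))%:E) (measurable_min_sm v0) G.
have I0 : (0 <= I)%E by apply: integral_ge0 => x _; exact: min_sm_ge0.
have I1 : (I <= 1)%E.
  rewrite -(integral_gpdfn [tuple 0 | i < l] (@ltr01 R)); apply: ge0_leT => //.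
  - by mR.
  - by move=> x; exact: min_sm_ge0.
  - by move=> x; rewrite tsub0 lee_fin ge_min lexx.
have E : ((fine I)%:E = I)%E by rewrite fineK // ge0_fin_numE // (le_lt_trans I1) // ltry.
by split => //; rewrite -!lee_fin E I0 I1.
Qed.

Lemma ovlE v G : 0 < v -> ((ovl mu v G)%:E = \int[lebn l]_x (Num.min (gpdfn 1 x) (sm mu v G x))%:E)%E.
Proof. by move=> v0; case: (ovlP G v0). Qed.

Lemma ovl_ge0 v G : 0 < v -> 0 <= ovl mu v G.
Proof. by move=> v0; case: (ovlP G v0) => _ /andP[]. Qed.

Lemma measurable_ovl v : 0 < v -> measurable_fun setT (fun G => ovl mu v G).
Proof.
move=> v0; apply/measurable_EFinP.
rewrite (_ : _ \o _ = fun G => \int[lebn l]_x (Num.min (gpdfn 1 x) (sm mu v G x))%:E)%E; last first.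
  by apply/funext => z /=; rewrite ovlE.
apply: measurable_int2; first exact: measurable_min_sm.
by move=> G x; exact: min_sm_ge0.
Qed.

(** The squared Hilbert-Schmidt distance. *)
Definition gdist G G' : R := \sum_(i < l) nsq (tsub (tnth G i) (tnth G' i)).

Definition sub_isotropic := forall a : n.-tuple R, (\int[mu]_X (dot a X ^+ 2)%:E <= (nsq a)%:E)%E.

Lemma dot_tsub (a b X : n.-tuple R) : dot (tsub a b) X = dot a X - dot b X.
Proof. by rewrite dot.unlock -sumrB; apply: eq_bigr => i _; rewrite tnth_tsub mulrBl. Qed.

(** The change of [sm] is at most the mean over X of the total variation between the kernels centred
    at G X and G' X; sub-isotropy turns the mean of |(G' - G) X|^2 into the Hilbert-Schmidt norm. *)
Lemma ovl_lipschitz v G G' (t : R) : sub_isotropic -> 0 < v -> 0 < t ->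
  ovl mu v G' <= ovl mu v G + t * gdist G' G / (8 * v) + 2 / t.
Proof.
move=> Hiso v0 t0.
pose d (x : l.-tuple R) X : R := `|gpdfn v (tsub x (app G' X)) - gpdfn v (tsub x (app G X))|.
have md : measurable_fun setT (fun z : l.-tuple R * n.-tuple R => (d z.1 z.2)%:E).
  by apply/measurable_EFinP; apply: measurableT_comp => //; mR.
have d0 x X : (0 <= (d x X)%:E)%E by rewrite lee_fin /d.
pose W x := (\int[mu]_X (d x X)%:E)%E.
have mW : measurable_fun setT W by apply: measurable_int2.
have W0 x : (0 <= W x)%E by apply: integral_ge0.
have hW x : ((sm mu v G' x)%:E <= (sm mu v G x)%:E + W x)%E.
  have mg H : measurable_fun setT (fun X => (gpdfn v (tsub x (app H X)))%:E) by mR.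
  have g0 H X : (0 <= (gpdfn v (tsub x (app H X)))%:E)%E by rewrite lee_fin gpdfn_ge0.
  rewrite !smE // -ge0_DT //; last exact: (measurable_sec (f := fun x X => (d x X)%:E) md).
  apply: ge0_leT => //.
  - by apply: emeasurable_funD => //; exact: (measurable_sec (f := fun x X => (d x X)%:E) md).
  - move=> X; rewrite -EFinD lee_fin -lerBlDl; exact: ler_norm.
have hmin x : ((Num.min (gpdfn 1 x) (sm mu v G' x))%:E <= (Num.min (gpdfn 1 x) (sm mu v G x))%:E + W x)%E.
  move: (hW x) (W0 x); case: (W x) => [r h r0|_ _|_]; [|by rewrite addey // leey|by []].
  rewrite -!EFinD !lee_fin in h r0 *; rewrite -lerBlDr le_min !lerBlDr.
  apply/andP; split; first by apply: le_trans (_ : gpdfn 1 x <= _); rewrite ?ge_min ?lexx // lerDl.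
  by apply: le_trans h; rewrite ge_min lexx orbT.
have mm H := measurable_sec (f := fun G x => (Num.min (gpdfn 1 x) (sm mu v G x))%:E) (measurable_min_sm v0) H.
have IW : (\int[lebn l]_x W x <= (t * gdist G' G / (8 * v) + 2 / t)%:E)%E.
  rewrite ge0_swap //.
  have c1 : 0 <= t / (8 * v) by rewrite divr_ge0 // ?mulr_ge0 // ltW.
  have c2 : 0 <= 2 / t by rewrite divr_ge0 // ltW.
  pose q X := nsq (tsub (app G' X) (app G X)).
  have mq : measurable_fun setT (fun X => (q X)%:E) by rewrite /q; mR.
  have q0 X : (0 <= (q X)%:E)%E by rewrite lee_fin nsq_ge0.
  apply: (@le_trans _ _ (\int[mu]_X ((t / (8 * v))%:E * (q X)%:E + (2 / t)%:E))%E).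
    apply: ge0_leT.
    - by apply: measurable_int2; [apply: (measurableT_comp md (g := fun z => (z.2, z.1))); mR|move=> x y; exact: d0].
    - by apply: emeasurable_funD; [exact: measurable_funeM|exact: measurable_cst].
    - by move=> X; apply: integral_ge0.
    - move=> X; rewrite -EFinM -EFinD; have := gpdfn_TV (app G' X) (app G X) v0 t0.
      by rewrite /q mulrAC.
  rewrite ge0_DT; last 4 first.
  - exact: measurable_funeM.
  - exact: measurable_cst.
  - by move=> X; exact: mule_ge0.
  - by move=> X; rewrite lee_fin.
  rewrite ge0_ZlT // integral_prob_cst; last exact: probability_setT.
  rewrite (mulrAC t) EFinD; apply: leeD2r; rewrite (EFinM (t / (8 * v))); apply: lee_wpmul2l; first by rewrite lee_fin.
  apply: (@le_trans _ _ (\int[mu]_X \sum_(i < l) (dot (tsub (tnth G' i) (tnth G i)) X ^+ 2)%:E)%E).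
    rewrite le_eqVlt; apply/orP; left; apply/eqP; apply: eq_integral => X _; rewrite /q nsqE sumEFin; congr EFin.
    by apply: eq_bigr => i _; rewrite tnth_tsub !tnth_app dot_tsub.
  rewrite ge0_integral_sum //; last 2 first.
  - by move=> i; mR.
  - by move=> i X _; rewrite lee_fin sqr_ge0.
  by rewrite /gdist -sumEFin; apply: lee_sum => i _; exact: Hiso.
rewrite -lee_fin -addrA EFinD !ovlE //; apply: le_trans (leeD2l _ IW).
rewrite -ge0_DT //; last by move=> x; exact: min_sm_ge0.
apply: ge0_leT => //; last by move=> x; exact: min_sm_ge0.
exact: emeasurable_funD.
Qed.

(** Pointwise, 1_B p + min(p, q) <= 1_B q + p for nonnegative p and q; integrate, with p of mass
    one. *)
Lemma ovl_TV v G (B : set (l.-tuple R)) : 0 < v -> measurable B ->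
  (\int[lebn l]_x ((\1_B x : R)%:E * (gpdfn 1 x)%:E) <= \int[lebn l]_x ((\1_B x : R)%:E * (sm mu v G x)%:E) + (1 - ovl mu v G)%:E)%E /\
  (\int[lebn l]_x ((\1_B x : R)%:E * (sm mu v G x)%:E) <= \int[lebn l]_x ((\1_B x : R)%:E * (gpdfn 1 x)%:E) + (1 - ovl mu v G)%:E)%E.
Proof.
move=> v0 mB.
have m1 : measurable_fun setT (fun x => (\1_B x : R)%:E) by apply/measurable_EFinP; exact: measurable_indic.
have mg : measurable_fun setT (fun x : l.-tuple R => (gpdfn 1 x)%:E) by mR.
have ms : measurable_fun setT (fun x => (sm mu v G x)%:E).
  by apply/measurable_EFinP; apply: (measurableT_comp (measurable_sm mu v0) (g := fun x => (G, x))); apply: measurable_fun_pair.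
have mm := measurable_sec (f := fun G x => (Num.min (gpdfn 1 x) (sm mu v G x))%:E) (measurable_min_sm v0) G.
have g0 x : (0 <= (gpdfn 1 x : R)%:E)%E by rewrite lee_fin gpdfn_ge0.
have s0 x : (0 <= (sm mu v G x)%:E)%E by rewrite lee_fin sm_ge0.
have i0 x : (0 <= (\1_B x : R)%:E)%E by rewrite lee_fin.
have gI : (\int[lebn l]_x (gpdfn 1 x)%:E = 1)%E.
  rewrite -[RHS](integral_gpdfn [tuple 0 | i < l] (@ltr01 R)).
  by apply: eq_integral => x _; rewrite tsub0.
have aux (p q : l.-tuple R -> R) : measurable_fun setT (fun x => (p x)%:E) -> measurable_fun setT (fun x => (q x)%:E) ->
   (forall x, 0 <= (p x)%:E)%E -> (forall x, 0 <= (q x)%:E)%E ->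
   (forall x, Num.min (gpdfn 1 x) (sm mu v G x) <= Num.min (p x) (q x)) ->
   (\int[lebn l]_x (p x)%:E = 1 ->
   \int[lebn l]_x ((\1_B x : R)%:E * (p x)%:E) <= \int[lebn l]_x ((\1_B x : R)%:E * (q x)%:E) + (1 - ovl mu v G)%:E)%E.
  move=> mp mq p0 q0 hmin Ip.
  have mip : measurable_fun setT (fun x => (\1_B x : R)%:E * (p x)%:E)%E by exact: emeasurable_funM.
  have miq : measurable_fun setT (fun x => (\1_B x : R)%:E * (q x)%:E)%E by exact: emeasurable_funM.
  have ip0 x : (0 <= (\1_B x : R)%:E * (p x)%:E)%E by exact: mule_ge0.
  have iq0 x : (0 <= (\1_B x : R)%:E * (q x)%:E)%E by exact: mule_ge0.
  have K : (\int[lebn l]_x ((\1_B x : R)%:E * (p x)%:E) + (ovl mu v G)%:E <= \int[lebn l]_x ((\1_B x : R)%:E * (q x)%:E) + 1%:E)%E.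
    rewrite ovlE // -Ip -!ge0_DT //; last by move=> x; exact: min_sm_ge0.
    apply: ge0_leT.
    - exact: emeasurable_funD.
    - exact: emeasurable_funD.
    - by move=> x; apply: adde_ge0 => //; exact: min_sm_ge0.
    move=> x; rewrite -!EFinM -!EFinD lee_fin.
    have /andP[h1 h2] : (Num.min (gpdfn 1 x) (sm mu v G x) <= p x) && (Num.min (gpdfn 1 x) (sm mu v G x) <= q x).
      by rewrite -le_min.
    rewrite indicE; case: (x \in B); rewrite ?mul1r ?mul0r ?add0r //.
    by rewrite addrC lerD2r.
  exact: lee_addr_addr K.
split; apply: aux => //.
  by move=> x; rewrite minC.
exact: integral_sm.
Qed.

Lemma mix_ge v w (tau r p : R) x : 0 < v -> 0 < w -> tau <= 1 / 2 -> nsq x <= r -> 0 <= p ->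
  (p%:E <= mu [set X | `|v + w * nsq X - 1| <= tau]%R)%E -> 0 <= tau ->
  p * expR (- (l%:R * (tau / 2) + tau * r)) * gpdfn 1 x <= mix mu v w x.
Proof.
move=> v0 w0 tau1 xr p0 hp tau0.
rewrite -mulrA; set c := expR _ * gpdfn 1 x.
have c0 : 0 <= c by rewrite mulr_ge0 ?expR_ge0 ?gpdfn_ge0.
have mf : measurable_fun setT (fun X => `|v + w * nsq X - 1|).
  by apply: measurableT_comp => //; mR.
have mA : measurable [set X : n.-tuple R | `|v + w * nsq X - 1| <= tau].
  have := mf measurableT _ (measurable_itv `]-oo, tau]); rewrite setTI.
  by congr measurable; apply/seteqP; split => z /=; rewrite in_itv.
rewrite -lee_fin mixE //; apply: (@le_trans _ _ (c%:E * mu [set X | `|v + w * nsq X - 1| <= tau]%R)%E).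
  by rewrite mulrC EFinM; apply: lee_wpmul2l; rewrite ?lee_fin.
apply: le_mul_measure => //.
- apply/measurable_EFinP; apply: measurable_gpdfn_var; [by mR|by mR|move=> X].
  by apply: addr_ge0; [exact: ltW|apply: mulr_ge0; [exact: ltW|exact: nsq_ge0]].
- by move=> X; rewrite lee_fin gpdfn_ge0.
move=> X /= hX; rewrite lee_fin; apply: le_trans (gpdfn_ratio x tau1 hX).
rewrite /c mulrC ler_wpM2l ?gpdfn_ge0 // ler_expR lerN2 lerD2l ler_wpM2l //.
Qed.

(** Both densities have mass one, so a lower bound for their minimum suffices, and for this a lower
    bound for [mix]. It comes from the X whose variance is within tau of 1, on the ball nsq x <= r
    that carries most of the Gaussian mass. *)
Lemma expectation_ovl_ge v w (tau r p t eta : R) : 0 < v -> 0 < w -> 0 <= tau <= 1 / 2 -> 0 < r -> 0 < p <= 1 -> 0 < t ->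
  t / 2 + eta / (2 * t) <= 1 ->
  (p%:E <= mu [set X | `|v + w * nsq X - 1| <= tau]%R)%E ->
  (forall x, nsq x <= r -> (\int[GG w]_G ((sm mu v G x)%:E * (sm mu v G x)%:E) <= ((1 + eta) * mix mu v w x ^+ 2)%:E)%E) ->
  ((p * expR (- (l%:R * (tau / 2) + tau * r)) * (1 - (t / 2 + eta / (2 * t))) * (1 - 6 * l%:R / r))%:E <=
   \int[GG w]_G (ovl mu v G)%:E)%E.
Proof.
move=> v0 w0 /andP[tau0 tau1] r0 /andP[p0 p1] t0 ep1 hp H2; set ep := t / 2 + _; set th := expR _.
have p0' := ltW p0.
have ep0 : 0 <= 1 - ep by rewrite subr_ge0.
have th0 : 0 < th by exact: expR_gt0.
have th1 : th <= 1.
  rewrite -[X in _ <= X]expR0 ler_expR oppr_le0 addr_ge0 //; first by rewrite mulr_ge0 // divr_ge0.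
  by rewrite mulr_ge0 // ltW.
have -> : (\int[GG w]_G (ovl mu v G)%:E = \int[lebn l]_x \int[GG w]_G (Num.min (gpdfn 1 x) (sm mu v G x))%:E)%E.
  transitivity (\int[GG w]_G \int[lebn l]_x (Num.min (gpdfn 1 x) (sm mu v G x))%:E)%E.
    by apply: eq_integral => G _; rewrite ovlE.
  apply: ge0_swap; first exact: measurable_min_sm.
  by move=> G x; exact: min_sm_ge0.
have c0 : 0 <= p * th * (1 - ep) by rewrite mulr_ge0 // mulr_ge0 // ltW.
rewrite EFinM; apply: le_trans (lee_wpmul2l _ (gaun_ball_ge l r0)) _; first by rewrite lee_fin.
have mA := @measurable_nsq_le R l r.
have mi : measurable_fun setT (fun x => (\1_[set x : l.-tuple R | nsq x <= r] x : R)%:E * (gpdfn 1 x)%:E)%E.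
  by apply: emeasurable_funM; [apply/measurable_EFinP; exact: measurable_indic|mR].
have i0 x : (0 <= (\1_[set x : l.-tuple R | nsq x <= r] x : R)%:E * (gpdfn 1 x)%:E)%E.
  by apply: mule_ge0; rewrite lee_fin ?gpdfn_ge0.
rewrite -ge0_ZlT //; apply: ge0_leT.
- exact: measurable_funeM.
- apply: measurable_int2; last by move=> G x; exact: min_sm_ge0.
  by apply: (measurableT_comp (measurable_min_sm v0) (g := fun z => (z.2, z.1))); mR.
- by move=> x; apply: mule_ge0.
move=> x; rewrite indicE; have [hx|hx] := pselect (nsq x <= r); last first.
  by rewrite memNset //= mul0e mule0; apply: integral_ge0 => G _; exact: min_sm_ge0.
rewrite mem_set // mul1e.
have hm := mix_ge v0 w0 tau1 hx p0' hp tau0; rewrite -/th in hm.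
have g0 := gpdfn_gt0 x (@ltr01 R).
have m0 : 0 < mix mu v w x by apply: lt_le_trans hm; rewrite mulr_gt0 // mulr_gt0.
have mS : measurable_fun setT (fun G => sm mu v G x).
  by apply: (measurableT_comp (measurable_sm mu v0) (g := fun G => (G, x))); apply: measurable_fun_pair.
have := integral_min_ge (gau_matT l n w) mS (fun G => sm_ge0 mu G x v0) m0 (ltW g0) t0 (expectation_sm mu x v0 w0) (H2 x hx).
apply: le_trans; rewrite -EFinM lee_fin -/ep mulrAC; apply: ler_wpM2r => //.
rewrite le_min hm andbT ler_piMl ?(ltW g0) //.
by rewrite mulr_ile1 // ltW.
Qed.

End Overlap.

(** * Tails and moments of linear functionals of X; near orthogonality of independent copies *)

Section Tails.
Context (R : realType) (n : nat) (mu : probability (n.-tuple R) R).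
Implicit Types (X Y a : n.-tuple R).
Hypothesis Hlc : log_concave_marginals mu.
Hypothesis Hiso : sub_isotropic mu.

Let mu_prob : mu setT = 1%E. Proof. exact: probability_setT. Qed.

Lemma measurable_ge_fun (f : n.-tuple R -> R) (c : R) : measurable_fun setT f -> measurable [set X : n.-tuple R | c <= f X].
Proof.
move=> mf; have := mf measurableT _ (measurable_itv `[c, +oo[); rewrite setTI.
by congr measurable; apply/seteqP; split => z /=; rewrite in_itv /= andbT.
Qed.

Lemma measure_indicE (A : set (n.-tuple R)) : measurable A -> (mu A = \int[mu]_X (\1_A X : R)%:E)%E.
Proof. by move=> mA; rewrite integral_indic // setIT. Qed.

Lemma dot_scaleN a X : dot (tscale (-1) a) X = - dot a X.
Proof. by rewrite dot.unlock -sumrN; apply: eq_bigr => i _; rewrite tnth_mktuple mulN1r mulNr. Qed.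

Lemma nsq_scaleN a : nsq (tscale (-1) a) = nsq a.
Proof. by rewrite !nsqE; apply: eq_bigr => i _; rewrite tnth_mktuple mulN1r sqrrN. Qed.

Lemma dot_tmix t a X Y : dot a (tmix t X Y) = t * dot a X + (1 - t) * dot a Y.
Proof.
by rewrite dot.unlock !mulr_sumr -big_split; apply: eq_bigr => i _ /=; rewrite tnth_mktuple; ring.
Qed.

Lemma chebyshev_tail a (A : R) : 0 < A -> nsq a <= A ^+ 2 -> (mu [set X | 2 * A <= dot a X]%R <= (4^-1)%:E)%E.
Proof.
move=> A0 hA.
have m1 : measurable_fun setT (fun X => dot a X) by mR.
have A2 : 0 <= (2 * A) ^+ 2 by exact: sqr_ge0.
have h : (((2 * A) ^+ 2)%:E * mu [set X | 2 * A <= dot a X]%R <= (A ^+ 2)%:E)%E.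
  apply: (@le_trans _ _ (\int[mu]_X (dot a X ^+ 2)%:E)%E).
    apply: le_mul_measure => //.
    - exact: measurable_ge_fun.
    - by mR.
    - by move=> X; rewrite lee_fin sqr_ge0.
    - move=> X /= hX; rewrite lee_fin lerXn2r ?nnegrE // ?mulr_ge0 ?(ltW A0) //.
      by apply: le_trans hX; rewrite mulr_ge0 // ltW.
  by apply: le_trans (Hiso a) _; rewrite lee_fin.
have c0 : 0 <= ((2 * A) ^+ 2)^-1 by rewrite invr_ge0.
have := lee_wpmul2l (_ : (0 <= (((2 * A) ^+ 2)^-1)%:E)%E) h; rewrite lee_fin => /(_ c0).
rewrite muleA -!EFinM mulVf ?mul1e; last by rewrite gt_eqF // exprn_gt0 // mulr_gt0.
by rewrite (_ : ((2 * A) ^+ 2)^-1 * A ^+ 2 = 4^-1) //; field; rewrite gt_eqF.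
Qed.

(* The tail function t |-> mu {t A <= dot a X} is log-concave, at least 3/4 at -2 and at most 1/4 at 2,
   hence it decays geometrically. *)
Lemma one_sided_tail a (A T : R) : 0 < A -> nsq a <= A ^+ 2 -> 2 < T ->
  (mu [set X | T * A <= dot a X]%R <= (expR (- ((T + 2) / 8)))%:E)%E.
Proof.
move=> A0 hA T2.
have m1 (b : n.-tuple R) : measurable_fun setT (fun X => dot b X) by mR.
pose S (s : R) : set (n.-tuple R) := [set X | s * A <= dot a X].
have mS s : measurable (S s) by exact: measurable_ge_fun.
have S2 : (mu (S 2%R) <= (4^-1)%:E)%E by exact: chebyshev_tail.
have SN2 : ((3 / 4)%:E <= mu (S (-2)%R))%E.
  have hN := chebyshev_tail A0 (_ : nsq (tscale (-1) a) <= A ^+ 2).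
  rewrite nsq_scaleN in hN; have {}hN := hN hA.
  have mN : measurable [set X | 2 * A <= dot (tscale (-1) a) X] by exact: measurable_ge_fun.
  have : (1 <= mu (S (-2)%R) + mu [set X | 2 * A <= dot (tscale (-1) a) X]%R)%E.
    rewrite -mu_prob; apply: (@le_trans _ _ (mu (S (-2)%R `|` [set X | 2 * A <= dot (tscale (-1) a) X]%R))%E).
      apply: le_measure; rewrite ?inE //; first exact: measurableU.
      move=> X _; rewrite /S /= dot_scaleN; have [h|h] := leP (- 2 * A) (dot a X); [by left|right].
      by rewrite lerNr -mulNr ltW.
    exact: measureU2.
  move=> h; have : (1%:E <= mu (S (-2)%R) + (4^-1)%:E)%E by apply: (le_trans h); apply: leeD2l.
  by move/lee_subr_fin; apply: le_trans; rewrite lee_fin; lra.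
rewrite leNgt; apply/negP => hT.
pose F (s : R) X := (\1_(S s) X : R)%:E.
have lF : log_concave2 (F : R^o -> _).
  move=> s1 s2 p q t b c /andP[t0 t1]; rewrite /F !lee_fin !indicE.
  have [h1|h1] := pselect (S s1 p); last by rewrite (memNset h1) leNgt expR_gt0.
  have [h2|h2] := pselect (S s2 q); last by rewrite (memNset h2) => _; rewrite leNgt expR_gt0.
  rewrite (mem_set h1) (mem_set h2) mem_set; last first.
    rewrite /S /= dot_tmix /GRing.scale /= mulrDl -!mulrA; apply: lerD; rewrite ler_pM2l // subr_gt0 //.
  rewrite -[X in _ <= X -> _]expR0 ler_expR => b0; rewrite -[X in _ <= X -> _]expR0 ler_expR => c0.
  rewrite -[X in _ <= X]expR0 ler_expR.
  have : t * b <= 0 by rewrite pmulr_rle0.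
  have : (1 - t) * c <= 0 by rewrite pmulr_rle0 // subr_gt0.
  lra.
(* The weight for which th T - 2 (1 - th) = 2. A mass above exp(- (T + 2) / 8) at T would give at
   least 3/4 exp(- 1/2), which exceeds 1/4, at 2. *)
pose th := 4 / (T + 2).
have T20 : 0 < T + 2 by lra.
have th01 : 0 < th < 1 by rewrite /th divr_gt0 //= ltr_pdivrMr //; lra.
have mF s : measurable_fun setT (F s) by apply/measurable_EFinP; exact: measurable_indic.
have F0 s p : (0 <= F s p)%E by rewrite lee_fin.
have q0 : 0 < 3 / 4 :> R by lra.
have := @Hlc F F0 mF lF T (-2) th (- ((T + 2) / 8)) (ln (3 / 4)) th01.
rewrite /F -!measure_indicE // => /(_ (ltW hT)).
rewrite lnK // => /(_ SN2).
have -> : th *: (T : R^o) + (1 - th) *: (-2 : R^o) = 2.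
  by rewrite /GRing.scale /= /th; field; rewrite gt_eqF.
move=> /le_trans /(_ S2); rewrite lee_fin.
have -> : th * - ((T + 2) / 8) = - 2^-1 by rewrite /th; field; rewrite gt_eqF.
rewrite expRD leNgt => /negP; apply.
have h1 : 2^-1 <= expR (- 2^-1) :> R by apply: le_trans (expR_ge1Dx _); lra.
have h2 : 3 / 4 <= expR ((1 - th) * ln (3 / 4)) :> R.
  rewrite -[X in X <= _](lnK q0) ler_expR mulrBl mul1r lerDl oppr_ge0 mulr_ge0_le0 //.
    by case/andP: th01 => /ltW.
  by rewrite ln_le0 //; lra.
apply: (@lt_le_trans _ _ (2^-1 * (3 / 4))); first by lra.
by apply: ler_pM => //; rewrite ?invr_ge0 // divr_ge0.
Qed.

Lemma two_sided_tail a (A T : R) : 0 < A -> nsq a <= A ^+ 2 ->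
  (mu [set X | T * A <= `|dot a X|]%R <= (3 * expR (- (T / 8)))%:E)%E.
Proof.
move=> A0 hA.
have mabs : measurable_fun setT (fun X => `|dot a X|) by apply: measurableT_comp => //; mR.
have m1 (b : n.-tuple R) : measurable_fun setT (fun X => dot b X) by mR.
have [T2|T2] := leP T 2.
  apply: (@le_trans _ _ 1%E).
    by rewrite -mu_prob; apply: le_measure; rewrite ?inE //; exact: measurable_ge_fun.
  rewrite lee_fin; have : 3 / 4 <= expR (- (T / 8)) by apply: le_trans (expR_ge1Dx _); lra.
  lra.
have hN : nsq (tscale (-1) a) <= A ^+ 2 by rewrite nsq_scaleN.
have h1 := one_sided_tail A0 hA T2; have h2 := one_sided_tail A0 hN T2.
apply: (@le_trans _ _ (mu ([set X | T * A <= dot a X]%R `|` [set X | T * A <= dot (tscale (-1) a) X]%R))).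
  apply: le_measure; rewrite ?inE //; first exact: measurable_ge_fun.
    by apply: measurableU; exact: measurable_ge_fun.
  move=> X /=; rewrite dot_scaleN; case: (ger0P (dot a X)) => _ h; [by left|by right].
apply: (le_trans (measureU2 _ _ _)); try exact: measurable_ge_fun.
apply: (le_trans (leeD h1 h2)); rewrite -EFinD lee_fin.
have : expR (- ((T + 2) / 8)) <= expR (- (T / 8)) by rewrite ler_expR; lra.
have := expR_ge0 (- (T / 8)); lra.
Qed.

Lemma geometric_partial_sum_le (q : R) N : 0 <= q < 1 -> \sum_(0 <= k < N) q ^+ k <= (1 - q)^-1.
Proof.
move=> /andP[q0 q1]; have q1' : 0 < 1 - q by rewrite subr_gt0.
rewrite -(ler_pM2l q1') mulfV ?gt_eqF //.
have -> : (1 - q) * \sum_(0 <= k < N) q ^+ k = 1 - q ^+ N.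
  rewrite big_mkord; have := subrXX (1 : R) q N; rewrite expr1n => ->.
  by congr (_ * _); apply: eq_bigr => i _; rewrite expr1n mul1r.
by rewrite gerBl exprn_ge0.
Qed.

(** Layers of thickness A: exp((k + 1) / 16) bounds the integrand on the k-th one. The rate 1/16 is
    half of the decay rate 1/8 of the tails, which leaves a geometric series of ratio exp(- 1/16),
    and 3 (16/15) 17 < 55. *)
Lemma exponential_moment a (A : R) : 0 < A -> nsq a <= A ^+ 2 ->
  (\int[mu]_X (expR (`|dot a X| / A / 16))%:E <= 55%:E)%E.
Proof.
move=> A0 hA.
have mabs : measurable_fun setT (fun X => `|dot a X|) by apply: measurableT_comp => //; mR.
pose E (k : nat) : set (n.-tuple R) := [set X | k%:R * A <= `|dot a X|].
have mE k : measurable (E k) by exact: measurable_ge_fun.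
pose f (k : nat) X := ((expR ((k%:R + 1) / 16))%:E * (\1_(E k) X : R)%:E)%E.
have f0 k X : (0 <= f k X)%E by apply: mule_ge0; rewrite lee_fin ?expR_ge0.
have mi k : measurable_fun setT (fun X => (\1_(E k) X : R)%:E) by apply/measurable_EFinP; exact: measurable_indic.
have mf k : measurable_fun setT (f k) by apply: measurable_funeM; exact: mi.
apply: (@le_trans _ _ (\int[mu]_X (\sum_(0 <= k <oo) f k X))%E).
  apply: ge0_leT.
  - by mR; apply: measurable_funM => //; apply: measurable_funM.
  - by apply: ge0_emeasurable_sum.
  - by move=> X; rewrite lee_fin expR_ge0.
  move=> X; pose k := Num.truncn (`|dot a X| / A).
  have Y0 : 0 <= `|dot a X| / A by rewrite divr_ge0 // ltW.
  have /andP[k1 k2] : k%:R <= `|dot a X| / A < k.+1%:R by exact: truncn_itv.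
  apply: (@le_trans _ _ (f k X)).
    rewrite /f indicE mem_set; last by rewrite /E /= -ler_pdivlMr.
    by rewrite mule1 lee_fin ler_expR ler_pM2r ?invr_gt0 // natr1 ltW.
  apply: le_trans (nneseries_lim_ge k.+1 _) => //.
  by rewrite big_nat_recr //= leeDr // sume_ge0.
rewrite integral_nneseries //.
have q01 : 0 <= expR (- 16^-1 : R) < 1 by rewrite expR_ge0 /= expR_lt1 // oppr_lt0 invr_gt0.
have hk k : (\int[mu]_X f k X <= (3 * expR 16^-1 * expR (- 16^-1) ^+ k)%:E)%E.
  rewrite ge0_ZlT ?expR_ge0 //.
  rewrite -measure_indicE //.
  apply: le_trans (lee_wpmul2l _ (two_sided_tail k%:R A0 hA)) _; first by rewrite lee_fin expR_ge0.
  rewrite -EFinM lee_fin -expRM_natl -[X in _ <= X]mulrA -expRD mulrCA -expRD.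
  by rewrite le_eqVlt; apply/orP; left; apply/eqP; congr (_ * expR _); field.
apply: lime_le.
  by apply: is_cvg_nneseries => k _ _; apply: integral_ge0.
near=> N; apply: (@le_trans _ _ (\sum_(0 <= k < N) (3 * expR 16^-1 * expR (- 16^-1) ^+ k)%:E)%E).
  by apply: lee_sum => k _.
rewrite sumEFin lee_fin -mulr_sumr.
apply: (@le_trans _ _ (3 * expR 16^-1 * (1 - expR (- 16^-1))^-1)).
  by rewrite ler_wpM2l ?geometric_partial_sum_le // mulr_ge0 ?expR_ge0.
have h1 : 15 / 16 <= expR (- 16^-1) :> R by apply: le_trans (expR_ge1Dx _); lra.
have h2 : expR 16^-1 <= 16 / 15 :> R.
  rewrite -[X in X <= _]invrK -expRN -[X in _ <= X]invf_div lef_pV2 ?posrE ?expR_gt0 //; lra.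
have h3 : expR (- 16^-1) <= 16 / 17 :> R.
  rewrite expRN -(ler_pM2l (expR_gt0 16^-1)) mulfV ?gt_eqF ?expR_gt0 //.
  by have := expR_ge1Dx (16^-1 : R); lra.
have h4 : (1 - expR (- 16^-1))^-1 <= 17 :> R.
  by rewrite -[X in _ <= X]invrK lef_pV2 ?posrE ?invr_gt0 //; lra.
have e0 := expR_ge0 (16^-1 : R).
have h5 : 3 * expR 16^-1 * (1 - expR (- 16^-1))^-1 <= 3 * (16 / 15) * 17 :> R.
  by apply: ler_pM => //; rewrite ler_wpM2l.
lra.
Unshelve. all: by end_near. Qed.

(** From z^4 <= 4! exp z with z = |<a, X>| / (16 A) and the bound 55 of [exponential_moment]. *)
Definition C4 : R := 24 * 16 ^+ 4 * 55.

Lemma fourth_moment a (A : R) : 0 < A -> nsq a <= A ^+ 2 ->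
  (\int[mu]_X (dot a X ^+ 4)%:E <= (C4 * A ^+ 4)%:E)%E.
Proof.
move=> A0 hA; have := exponential_moment A0 hA.
have mabs : measurable_fun setT (fun X => `|dot a X|) by apply: measurableT_comp => //; mR.
have me : measurable_fun setT (fun X => (expR (`|dot a X| / A / 16))%:E).
  by mR; apply: measurable_funM => //; apply: measurable_funM.
set c := 24 * 16 ^+ 4 * A ^+ 4.
have c0 : 0 <= c by rewrite !mulr_ge0 ?exprn_ge0 // ltW.
move=> h; apply: (@le_trans _ _ (c%:E * \int[mu]_X (expR (`|dot a X| / A / 16))%:E)%E).
  rewrite -ge0_ZlT //.
  apply: ge0_leT.
  - by mR.
  - exact: measurable_funeM.
  - by move=> X; rewrite lee_fin exprn_even_ge0.
  move=> X; rewrite -EFinM lee_fin.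
  have z0 : 0 <= `|dot a X| / A / 16 by rewrite !divr_ge0 // ltW.
  have := expR_ge1Dxn 3 z0 => /(le_trans (ler_wpDl ler01 (lexx _))).
  move/(ler_wpM2l c0); apply: le_trans; rewrite le_eqVlt; apply/orP; left; apply/eqP.
  have -> : dot a X ^+ 4 = `|dot a X| ^+ 4 by rewrite -normrX ger0_norm // exprn_even_ge0.
  by rewrite /c (_ : 4`! = 24)%N //; field; rewrite gt_eqF.
apply: le_trans (lee_wpmul2l _ h) _; first by rewrite lee_fin.
by rewrite -EFinM lee_fin /c /C4 le_eqVlt; apply/orP; left; apply/eqP; ring.
Qed.

Definition tunit (i : 'I_n) : n.-tuple R := [tuple (j == i)%:R | j < n].

Lemma dot_tunit i X : dot (tunit i) X = tnth X i.
Proof.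
rewrite dot.unlock (bigD1 i) //= tnth_mktuple eqxx mul1r big1 ?addr0 // => j /negbTE ji.
by rewrite tnth_mktuple ji mul0r.
Qed.

Lemma nsq_tunit i : nsq (tunit i) = 1.
Proof. by rewrite /nsq dot_tunit tnth_mktuple eqxx. Qed.

Lemma nsq_second_moment : (\int[mu]_X (nsq X ^+ 2)%:E <= (C4 * n%:R ^+ 2)%:E)%E.
Proof.
apply: (@le_trans _ _ (\int[mu]_X (n%:R%:E * \sum_(i < n) (dot (tunit i) X ^+ 4)%:E))%E).
  apply: ge0_leT.
  - by mR.
  - by apply: measurable_funeM; apply: emeasurable_sum => i; mR.
  - by move=> X; rewrite lee_fin sqr_ge0.
  move=> X; rewrite sumEFin -EFinM lee_fin nsqE.
  have := @dot_sqr_le R n [tuple 1 | i < n] [tuple tnth X i ^+ 2 | i < n].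
  have -> : dot [tuple (1 : R) | i < n] [tuple tnth X i ^+ 2 | i < n] = \sum_(i < n) tnth X i ^+ 2.
    by rewrite dot.unlock; apply: eq_bigr => i _; rewrite !tnth_mktuple mul1r.
  rewrite !nsqE.
  have -> : \sum_(i < n) tnth [tuple (1 : R) | i0 < n] i ^+ 2 = n%:R.
    rewrite -[in RHS](card_ord n) -sum1_card natr_sum; apply: eq_bigr => i _; by rewrite tnth_mktuple expr1n.
  move/le_trans; apply; rewrite le_eqVlt; apply/orP; left; apply/eqP; congr (_ * _).
  by apply: eq_bigr => i _; rewrite tnth_mktuple dot_tunit -exprM.
have ms : measurable_fun setT (fun X => \sum_(i < n) (dot (tunit i) X ^+ 4)%:E)%E by apply: emeasurable_sum => i; mR.
have d0 i X : (0 <= (dot (tunit i) X ^+ 4)%:E)%E by rewrite lee_fin exprn_even_ge0.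
rewrite ge0_ZlT //; last by move=> X; apply: sume_ge0.
rewrite ge0_integral_sum //; last by move=> i; mR.
apply: (@le_trans _ _ (n%:R%:E * \sum_(i < n) C4%:E)%E).
  apply: lee_wpmul2l; first by rewrite lee_fin.
  apply: lee_sum => i _; have := @fourth_moment (tunit i) 1 ltr01.
  by rewrite nsq_tunit !expr1n mulr1; apply.
rewrite sumEFin sumr_const card_ord -EFinM lee_fin -(mulr_natr C4).
by rewrite le_eqVlt; apply/orP; left; apply/eqP; ring.
Qed.

(** If |X|^2 exceeds n T^2, some coordinate exceeds T in absolute value. *)
Lemma nsq_tail (T A : R) : 0 <= T -> n%:R * T ^+ 2 <= A ^+ 2 ->
  (mu [set X | A ^+ 2 < nsq X]%R <= (3 * n%:R * expR (- (T / 8)))%:E)%E.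
Proof.
move=> T0 hTA.
have mi i : measurable [set X : n.-tuple R | T * 1 <= `|dot (tunit i) X|].
  by apply: measurable_ge_fun; apply: measurableT_comp => //; mR.
pose E i : set (n.-tuple R) := [set X | T * 1 <= `|dot (tunit i) X|].
have m1 i : measurable_fun setT (fun X => (\1_(E i) X : R)%:E) by apply/measurable_EFinP; apply: measurable_indic; exact: mi.
have i0 i X : (0 <= (\1_(E i) X : R)%:E)%E by rewrite lee_fin.
apply: (@le_trans _ _ (\sum_(i < n) mu (E i))%E).
  have -> : (\sum_(i < n) mu (E i) = \int[mu]_X \sum_(i < n) (\1_(E i) X : R)%:E)%E.
    by rewrite ge0_integral_sum //; apply: eq_bigr => i _; exact: (measure_indicE (mi i)).
  rewrite -[X in (X <= _)%E]mul1e; apply: le_mul_measure => //.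
  - exact: measurable_nsq_gt.
  - exact: emeasurable_sum.
  - by move=> X; apply: sume_ge0.
  move=> X /= hX; rewrite leNgt; apply/negP => h; move: hX; rewrite ltNge => /negP; apply.
  apply: le_trans hTA; rewrite nsqE -[in X in _ <= X](card_ord n) mulr_natl -sumr_const.
  apply: ler_sum => i _; rewrite -real_normK ?num_real // lerXn2r ?nnegrE //.
  rewrite leNgt; apply/negP => hi; move: h; rewrite ltNge => /negP; apply.
  rewrite (bigD1 i) //= indicE mem_set ?leeDl ?sume_ge0 //.
  by rewrite /E /= mulr1 dot_tunit ltW.
apply: (@le_trans _ _ (\sum_(i < n) (3 * expR (- (T / 8)))%:E)%E).
  by apply: lee_sum => i _; apply: two_sided_tail; rewrite // nsq_tunit expr1n.
rewrite sumEFin sumr_const card_ord lee_fin -(mulr_natr (3 * expR _)).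
by rewrite le_eqVlt; apply/orP; left; apply/eqP; ring.
Qed.

(** For X of norm at most A, the inner product with Y is a linear functional of Y and
    [two_sided_tail] applies; the remaining X are rare by [nsq_tail]. *)
Lemma bad_pair_le (w rho T A : R) : 0 < w -> 0 < A -> 0 <= T -> n%:R * T ^+ 2 <= A ^+ 2 -> w * (T * A) <= rho ->
  (\int[mu]_X \int[mu]_Y (\1_(bad_pair w rho) (X, Y) : R)%:E <= (3 * (n%:R + 1) * expR (- (T / 8)))%:E)%E.
Proof.
move=> w0 A0 T0 hTA hrho; set q := 3 * expR (- (T / 8)).
have q0 : 0 <= q by rewrite mulr_ge0 ?expR_ge0.
have mB := measurable_bad_pair (n := n) w rho.
have mi : measurable_fun setT (fun z : n.-tuple R * n.-tuple R => (\1_(bad_pair w rho) (z.1, z.2) : R)%:E).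
  apply/measurable_EFinP; rewrite (_ : (fun _ => _) = \1_(bad_pair w rho)); first by apply: measurable_indic.
  by apply/funext => -[].
have i0 X Y : (0 <= (\1_(bad_pair w rho) (X, Y) : R)%:E)%E by rewrite lee_fin.
pose N : set (n.-tuple R) := [set X | A ^+ 2 < nsq X].
have mN : measurable N by exact: measurable_nsq_gt.
have m1N : measurable_fun setT (fun X => (\1_N X : R)%:E) by apply/measurable_EFinP; exact: measurable_indic.
apply: (@le_trans _ _ (\int[mu]_X ((\1_N X : R)%:E + q%:E))%E).
  apply: ge0_leT.
  - exact: measurable_int2.
  - by apply: emeasurable_funD => //; exact: measurable_cst.
  - by move=> X; apply: integral_ge0.
  move=> X; have mX := measurable_sec (f := fun X Y => (\1_(bad_pair w rho) (X, Y) : R)%:E) mi X.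
  rewrite indicE; have [hX|hX] := pselect (N X).
    rewrite mem_set //; apply: (@le_trans _ _ 1%E); last by rewrite leeDl.
    rewrite -[X in (_ <= X)%E](integral_prob_cst 1%E mu_prob); apply: ge0_leT => //.
    by move=> Y; rewrite lee_fin indicE; case: (_ \in _).
  rewrite memNset // add0e.
  have hX' : nsq X <= A ^+ 2 by rewrite leNgt; apply/negP.
  apply: le_trans (two_sided_tail T A0 hX').
  rewrite measure_indicE; last by apply: measurable_ge_fun; apply: measurableT_comp => //; mR.
  apply: ge0_leT => //.
  - apply/measurable_EFinP; apply: measurable_indic; apply: measurable_ge_fun; apply: measurableT_comp => //; mR.
  - move=> Y; rewrite lee_fin !indicE; have [hY|hY] := pselect (bad_pair w rho (X, Y)).
      rewrite mem_set // mem_set //=; rewrite /bad_pair /= in hY.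
      rewrite -(ler_pM2l w0); apply: (le_trans hrho); apply: ltW; apply: lt_le_trans hY _.
      by rewrite normrM gtr0_norm.
    by rewrite memNset.
rewrite ge0_DT //.
rewrite -measure_indicE // integral_prob_cst //.
apply: (le_trans (leeD2r _ (nsq_tail T0 hTA))); rewrite -EFinD lee_fin /q le_eqVlt; apply/orP; left; apply/eqP; ring.
Qed.

End Tails.

(** * Radial profiles and the thin shell estimate *)

Lemma bernoulli_ineq (R : realType) (h : R) k : 0 <= h <= 1 -> 1 - k%:R * h <= (1 - h) ^+ k.
Proof.
move=> /andP[h0 h1]; elim: k => [|k IH]; first by rewrite mul0r subr0 expr0.
have := ler_wpM2l (_ : 0 <= 1 - h) IH; rewrite subr_ge0 => /(_ h1); rewrite -exprS; apply: le_trans.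
have : 0 <= k%:R * h * h by rewrite !mulr_ge0.
rewrite -natr1; lra.
Qed.

(** Stability of the arithmetic-geometric inequality: the quotient is 1 + (b - a)^2 / (4 a b), and d
    <= (b - a) (b + a). In [thin_pair] its l-th power is the gain at the midpoint of two radii. *)
Lemma sqr_div_prod_ge (R : realType) (a b G d : R) : 0 < a -> 0 < b -> 0 <= d -> a ^+ 2 <= G -> b ^+ 2 <= G -> d <= b ^+ 2 - a ^+ 2 ->
  1 + d ^+ 2 / (16 * G ^+ 2) <= ((a + b) / 2) ^+ 2 / (a * b).
Proof.
move=> a0 b0 d0 aG bG dab.
have G0 : 0 < G by apply: lt_le_trans aG; rewrite exprn_gt0.
have ab0 : 0 < a * b by exact: mulr_gt0.
rewrite ler_pdivlMr // mulrDl mul1r.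
have -> : ((a + b) / 2) ^+ 2 = a * b + (b - a) ^+ 2 / 4 by field.
rewrite lerD2l.
have h1 : a * b <= G by nra.
have h2 : (a + b) ^+ 2 <= 4 * G by nra.
have h3 : d ^+ 2 <= (b - a) ^+ 2 * (4 * G).
  apply: (@le_trans _ _ ((b ^+ 2 - a ^+ 2) ^+ 2)).
    by rewrite lerXn2r ?nnegrE //; apply: le_trans dab.
  have -> : (b ^+ 2 - a ^+ 2) ^+ 2 = (b - a) ^+ 2 * (a + b) ^+ 2 by ring.
  by rewrite ler_wpM2l ?sqr_ge0.
have -> : d ^+ 2 / (16 * G ^+ 2) * (a * b) = (d ^+ 2 / (4 * G)) * ((a * b) / G) / 4 by field; rewrite gt_eqF.
rewrite ler_pM2r ?invr_gt0 //.
apply: (@le_trans _ _ (d ^+ 2 / (4 * G) * 1)).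
  rewrite ler_wpM2l ?divr_ge0 ?sqr_ge0 ?mulr_ge0 ?(ltW G0) //.
  by rewrite ler_pdivrMr // mul1r.
by rewrite mulr1 ler_pdivrMr // mulr_gt0.
Qed.

Section Radial.
Context (R : realType) (l M : nat) (i0 : 'I_l).
Hypothesis lM : (l = M ^ 2)%N.
Hypothesis M0 : (0 < M)%N.

Definition rad (r : R) : l.-tuple R := tscale r (tunit R i0).

Lemma nsq_rad r : nsq (rad r) = r ^+ 2.
Proof.
rewrite nsqE (bigD1 i0) //= !tnth_mktuple eqxx mulr1 big1 ?addr0 // => j /negbTE ji.
by rewrite !tnth_mktuple ji mulr0 expr0n.
Qed.

Lemma tmix_rad t r r' : tmix t (rad r) (rad r') = rad (t * r + (1 - t) * r').
Proof. by apply: eq_from_tnth => i; rewrite !tnth_mktuple; ring. Qed.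

(** The maximum over r of (2 pi)^(l/2) r^l times the density of N(0, s I) at distance r, attained at
    r^2 = l s and independent of s. Taking l = M^2 makes sqrt l an integer. *)
Definition rad_max : R := (M%:R * expR (- 2^-1)) ^+ l.

Lemma rad_max_gt0 : 0 < rad_max.
Proof. by rewrite exprn_gt0 // mulr_gt0 ?expR_gt0 // ltr0n. Qed.

Let lR : l%:R = M%:R ^+ 2 :> R. Proof. by rewrite lM natrX. Qed.
Let Mp : 0 < M%:R :> R. Proof. by rewrite ltr0n. Qed.

Lemma gpdfn_rad s r : 0 < s -> 0 < r ->
  Num.sqrt (2 * pi) ^+ l * r ^+ l * gpdfn s (rad r) = (r / Num.sqrt s * expR (- (r ^+ 2 / (2 * s * M%:R ^+ 2)))) ^+ l.
Proof.
move=> s0 r0; rewrite gpdfnE // nsq_rad [in RHS]exprMn -expRM_natl lR.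
have -> : M%:R ^+ 2 * - (r ^+ 2 / (2 * s * M%:R ^+ 2)) = - (r ^+ 2 / (2 * s)) by field; rewrite !gt_eqF.
rewrite mulrA; congr (_ * _); rewrite -!exprMn; congr (_ ^+ _).
have pi20 : 0 < 2 * pi :> R by rewrite mulr_gt0 // pi_gt0.
rewrite gpdf.unlock expr0n /= mul0r oppr0 expR0 mulr1 [Num.sqrt (2 * pi * s)]sqrtrM ?(ltW pi20) // invfM.
by rewrite mulrACA divff ?mul1r // gt_eqF // sqrtr_gt0.
Qed.

Lemma gpdfn_rad_le s r : 0 < s -> 0 < r -> Num.sqrt (2 * pi) ^+ l * r ^+ l * gpdfn s (rad r) <= rad_max.
Proof.
move=> s0 r0; rewrite gpdfn_rad //.
have ss : 0 < Num.sqrt s by rewrite sqrtr_gt0.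
have q0 : 0 <= r / Num.sqrt s * expR (- (r ^+ 2 / (2 * s * M%:R ^+ 2))).
  by rewrite mulr_ge0 ?expR_ge0 // divr_ge0 // ltW.
have m0 : 0 <= M%:R * expR (- 2^-1) :> R by rewrite mulr_ge0 ?expR_ge0.
rewrite lerXn2r ?nnegrE //; apply: le_of_sqr => //.
rewrite !exprMn exprVn sqr_sqrtr ?(ltW s0) // -!expRM_natl.
have -> : 2%:R * - 2^-1 = -1 :> R by field.
have -> : 2%:R * - (r ^+ 2 / (2 * s * M%:R ^+ 2)) = - (r ^+ 2 / s / M%:R ^+ 2) by field; rewrite !gt_eqF.
set t := r ^+ 2 / s / M%:R ^+ 2.
have -> : r ^+ 2 / s = M%:R ^+ 2 * t by rewrite /t; field; rewrite !gt_eqF.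
rewrite -mulrA ler_pM2l ?exprn_gt0 // -ler_pdivlMr ?expR_gt0 // -expRN opprK -expRD.
by have := expR_ge1Dx (-1 + t); lra.
Qed.

(** With h = 1 - g / s, the squared ratio to the maximum is ((1 - h) exp h)^l >= (1 - h^2)^l >= 1 -
    l h^2. Variances at most 1 / (2 M) = 1 / (2 sqrt l) above g give l h^2 <= 1/4; this fixes the
    width of the bins below. *)
Lemma gpdfn_rad_ge s g : 1 <= g -> g <= s -> s <= g + (2 * M%:R)^-1 ->
  rad_max / 2 <= Num.sqrt (2 * pi) ^+ l * (M%:R * Num.sqrt g) ^+ l * gpdfn s (rad (M%:R * Num.sqrt g)).
Proof.
move=> g1 gs sg.
have g0 : 0 < g by lra.
have s0 : 0 < s by lra.
have sqg : 0 < Num.sqrt g by rewrite sqrtr_gt0.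
have ss : 0 < Num.sqrt s by rewrite sqrtr_gt0.
rewrite gpdfn_rad //; last exact: mulr_gt0.
pose h := 1 - g / s.
have h0 : 0 <= h by rewrite subr_ge0 ler_pdivrMr // mul1r.
have h1 : h <= (2 * M%:R)^-1.
  have -> : h = (s - g) / s by rewrite /h; field; rewrite gt_eqF.
  rewrite ler_pdivrMr //.
  have : (2 * M%:R)^-1 * 1 <= (2 * M%:R)^-1 * s :> R.
    by rewrite ler_pM2l ?invr_gt0 ?mulr_gt0 //; lra.
  lra.
have M1 : 1 <= M%:R :> R by rewrite ler1n.
have hl1 : h <= 2^-1.
  apply: (le_trans h1); rewrite lef_pV2 ?posrE ?mulr_gt0 //; lra.
have q0 : 0 <= M%:R * Num.sqrt g / Num.sqrt s * expR (- ((M%:R * Num.sqrt g) ^+ 2 / (2 * s * M%:R ^+ 2))).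
  by rewrite mulr_ge0 ?expR_ge0 // divr_ge0 ?mulr_ge0 // ltW.
apply: le_of_sqr; first by rewrite exprn_ge0.
rewrite -exprM mulnC exprM.
have -> : (M%:R * Num.sqrt g / Num.sqrt s * expR (- ((M%:R * Num.sqrt g) ^+ 2 / (2 * s * M%:R ^+ 2)))) ^+ 2 =
   (M%:R * expR (- 2^-1)) ^+ 2 * ((1 - h) * expR h).
  rewrite !exprMn exprVn !sqr_sqrtr ?(ltW s0) ?(ltW g0) // -!expRM_natl.
  have -> : 2%:R * - (M%:R ^+ 2 * g / (2 * s * M%:R ^+ 2)) = -1 + h by rewrite /h; field; rewrite !gt_eqF.
  have -> : 1 - h = g / s by rewrite /h; ring.
  rewrite expRD (_ : 2%:R * - 2^-1 = -1 :> R); last by field.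
  by ring.
have H : (1 - l%:R * h ^+ 2) <= ((1 - h) * expR h) ^+ l.
  apply: (@le_trans _ _ ((1 - h ^+ 2) ^+ l)).
    apply: bernoulli_ineq; rewrite sqr_ge0 /= expr_le1 //; lra.
  have hh : 0 <= 1 - h ^+ 2 by rewrite subr_ge0 expr_le1 //; lra.
  have eh : 1 - h ^+ 2 <= (1 - h) * expR h.
    have -> : 1 - h ^+ 2 = (1 - h) * (1 + h) by ring.
    by rewrite ler_wpM2l ?expR_ge1Dx //; lra.
  by rewrite lerXn2r ?nnegrE // (le_trans hh).
have lh : l%:R * h ^+ 2 <= 4^-1.
  apply: (@le_trans _ _ (l%:R * (2 * M%:R)^-1 ^+ 2)).
    by rewrite ler_wpM2l // lerXn2r ?nnegrE // invr_ge0 mulr_ge0.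
  by rewrite lR le_eqVlt; apply/orP; left; apply/eqP; field; rewrite gt_eqF.
have -> : ((M%:R * expR (- 2^-1)) ^+ 2 * ((1 - h) * expR h)) ^+ l = rad_max ^+ 2 * ((1 - h) * expR h) ^+ l.
  by rewrite exprMn /rad_max -!exprM mulnC.
rewrite exprMn ler_wpM2l ?sqr_ge0 //.
apply: le_trans H; rewrite (_ : 2^-1 ^+ 2 = 4^-1 :> R); last by field.
lra.
Qed.

End Radial.

Section ThinShell.
Context (R : realType) (n : nat) (mu : probability (n.-tuple R) R) (w : R).
Implicit Types (X Y : n.-tuple R).
Hypothesis w0 : 0 < w.

Definition ssq X : R := w * nsq X.

Lemma ssq_ge0 X : 0 <= ssq X. Proof. by rewrite /ssq mulr_ge0 ?nsq_ge0 // ltW. Qed.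

Lemma measurable_ssq : measurable_fun setT ssq.
Proof. by rewrite /ssq; mR. Qed.

Lemma measurable_ssq_set (I : interval R) : measurable [set X | ssq X \in I].
Proof.
have := measurable_ssq measurableT (measurable_itv I); rewrite setTI.
by congr measurable.
Qed.

Definition Pr (A : set (n.-tuple R)) : R := fine (mu A).

Lemma PrE A : measurable A -> (Pr A)%:E = mu A.
Proof. by move=> mA; rewrite /Pr fineK // fin_num_measure. Qed.

Lemma Pr_ge0 A : 0 <= Pr A. Proof. by rewrite /Pr fine_ge0. Qed.

Lemma Pr_le A B : measurable A -> measurable B -> A `<=` B -> Pr A <= Pr B.
Proof. by move=> mA mB AB; rewrite -lee_fin !PrE //; apply: le_measure; rewrite ?inE. Qed.

Section Pair.
Variables (l M S : nat) (i0 : 'I_l).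
Hypothesis lM : (l = M ^ 2)%N.
Hypothesis M0 : (0 < M)%N.
Hypothesis S0 : (0 < S)%N.

Let N := (2 * M * S)%N.
Let N0 : (0 < N)%N. Proof. by rewrite !muln_gt0 M0 S0. Qed.
Let Mp : 0 < M%:R :> R. Proof. by rewrite ltr0n. Qed.
Let cM : 0 < 2 * M%:R :> R. Proof. by rewrite mulr_gt0. Qed.

Definition bin (i : nat) : set (n.-tuple R) := [set X | i%:R / (2 * M%:R) <= ssq X <= i.+1%:R / (2 * M%:R)].

Lemma measurable_bin i : measurable (bin i).
Proof.
have := measurable_ssq_set `[i%:R / (2 * M%:R), i.+1%:R / (2 * M%:R)].
by congr measurable; apply/seteqP; split => X /=; rewrite in_itv.
Qed.

(** The bins with i < N cover [0, S[ because N / (2 M) = S, so one of them carries at least the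
    average share. *)
Lemma pigeonhole (E : set (n.-tuple R)) : measurable E -> (forall X, E X -> ssq X < S%:R) ->
  exists i : nat, Pr E / N%:R <= Pr (E `&` bin i).
Proof.
move=> mE ES; apply: contrapT => /forallNP h.
have mi i : measurable (E `&` bin i) by apply: measurableI => //; exact: measurable_bin.
have m1 i : measurable_fun setT (fun X => (\1_(E `&` bin i) X : R)%:E) by apply/measurable_EFinP; exact: measurable_indic.
have i1 i X : (0 <= (\1_(E `&` bin i) X : R)%:E)%E by rewrite lee_fin.
have : (mu E <= \sum_(i < N) mu (E `&` bin i))%E.
  have -> : (\sum_(i < N) mu (E `&` bin i) = \int[mu]_X \sum_(i < N) (\1_(E `&` bin i) X : R)%:E)%E.
    by rewrite ge0_integral_sum //; apply: eq_bigr => i _; exact: (measure_indicE _ (mi i)).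
  rewrite -[X in (X <= _)%E]mul1e; apply: le_mul_measure => //.
  - exact: emeasurable_sum.
  - by move=> X; apply: sume_ge0.
  move=> X EX; have Y0 : 0 <= ssq X * (2 * M%:R) by rewrite mulr_ge0 ?ssq_ge0 // ltW.
  have /andP[k1 k2] := truncn_itv Y0; set k := Num.truncn _ in k1 k2.
  have kN : (k < N)%N.
    rewrite -(ltr_nat R); apply: (le_lt_trans k1); rewrite /N !natrM mulrC ltr_pM2l //; exact: ES.
  rewrite (bigD1 (Ordinal kN)) //= indicE mem_set ?leeDl ?sume_ge0 //.
  by split => //; rewrite /bin /= ler_pdivrMr // k1 ler_pdivlMr // ltW.
rewrite -PrE //; under eq_bigr do rewrite -PrE //.
rewrite sumEFin lee_fin leNgt => /negP; apply.
apply: (@lt_le_trans _ _ (\sum_(i < N) Pr E / N%:R)).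
  apply: ltr_sum; first by apply/hasP; exists (Ordinal N0); rewrite // mem_index_enum.
  by move=> i _; rewrite ltNge; apply/negP; exact: h.
rewrite sumr_const card_ord -(mulr_natr (_ / _)) divfK // pnatr_eq0 -lt0n //.
Qed.

Hypothesis Hmid : forall r r', 0 < r -> 0 < r' -> r ^+ 2 <= M%:R ^+ 2 * (1 + S%:R) -> r' ^+ 2 <= M%:R ^+ 2 * (1 + S%:R) ->
  0 < mix mu 1 w (rad i0 r) -> 0 < mix mu 1 w (rad i0 r') ->
  Num.sqrt (mix mu 1 w (rad i0 r) * mix mu 1 w (rad i0 r')) / 2 <= mix mu 1 w (tmix 2^-1 (rad i0 r) (rad i0 r')).

Lemma mix_rad_le r : 0 < r -> Num.sqrt (2 * pi) ^+ l * r ^+ l * mix mu 1 w (rad i0 r) <= rad_max R l M.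
Proof.
move=> r0; set c := Num.sqrt _ ^+ _ * _.
have c0 : 0 <= c by rewrite mulr_ge0 // exprn_ge0 // ?sqrtr_ge0 // ltW.
have mg : measurable_fun setT (fun X => (gpdfn (1 + w * nsq X) (rad i0 r))%:E).
  apply/measurable_EFinP; apply: measurable_gpdfn_var; [by mR|by mR|move=> X].
  by rewrite addr_ge0 // ssq_ge0.
rewrite -lee_fin EFinM mixE // -ge0_ZlT //; last by move=> X; rewrite lee_fin gpdfn_ge0.
rewrite -[X in (_ <= X)%E](integral_prob_cst _ (probability_setT mu)).
apply: ge0_leT => //.
- exact: measurable_funeM.
- by move=> X; apply: mule_ge0; rewrite lee_fin // gpdfn_ge0.
- move=> X; rewrite -EFinM lee_fin; apply: gpdfn_rad_le => //.
  by rewrite ltr_pwDl // ssq_ge0.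
Qed.

Lemma mix_rad_ge g p : 1 <= g -> 0 <= p -> p <= Pr [set X | g - 1 <= ssq X <= g - 1 + (2 * M%:R)^-1] ->
  p * rad_max R l M / 2 <= Num.sqrt (2 * pi) ^+ l * (M%:R * Num.sqrt g) ^+ l * mix mu 1 w (rad i0 (M%:R * Num.sqrt g)).
Proof.
move=> g1 p0 hp; set c := Num.sqrt _ ^+ _ * _.
have c0 : 0 <= c by rewrite mulr_ge0 // exprn_ge0 // ?mulr_ge0 ?sqrtr_ge0.
have mg : measurable_fun setT (fun X => (gpdfn (1 + w * nsq X) (rad i0 (M%:R * Num.sqrt g)))%:E).
  apply/measurable_EFinP; apply: measurable_gpdfn_var; [by mR|by mR|move=> X].
  by rewrite addr_ge0 // ssq_ge0.
have mA : measurable [set X | g - 1 <= ssq X <= g - 1 + (2 * M%:R)^-1].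
  have := measurable_ssq_set `[g - 1, g - 1 + (2 * M%:R)^-1].
  by congr measurable; apply/seteqP; split => X /=; rewrite in_itv.
rewrite -lee_fin [X in (_ <= X)%E]EFinM mixE // -ge0_ZlT //; last by move=> X; rewrite lee_fin gpdfn_ge0.
have z0 : 0 <= rad_max R l M / 2 by rewrite divr_ge0 // ltW // rad_max_gt0.
apply: (@le_trans _ _ ((rad_max R l M / 2)%:E * mu [set X | g - 1 <= ssq X <= g - 1 + (2 * M%:R)^-1]%R)%E).
  by rewrite -PrE // -EFinM lee_fin -mulrA mulrC ler_wpM2l.
apply: le_mul_measure => //.
- exact: measurable_funeM.
- by move=> X; apply: mule_ge0; rewrite lee_fin // gpdfn_ge0.
- move=> X /= /andP[h1 h2]; rewrite -EFinM lee_fin; apply: gpdfn_rad_ge => //.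
    by rewrite -/(ssq X); lra.
  by rewrite -/(ssq X); lra.
Qed.

(* The radial profile r^l mix(r) never exceeds its value for a single Gaussian. If the norm charged two separated
   shells, the profile would be nearly maximal at two radii, and log-concavity would make it too large at their
   midpoint, because the geometric mean of the radii is much smaller than the midpoint. *)
Lemma thin_pair (a b d : R) : 0 <= d -> b < S%:R -> d + (2 * M%:R)^-1 <= a - b ->
  Pr [set X | ssq X <= b] * Pr [set X | a <= ssq X < S%:R] * (1 + d ^+ 2 / (16 * (1 + S%:R) ^+ 2)) ^+ l <= 16 * N%:R ^+ 2.
Proof.
move=> d0 bS dab.
set A1 := [set X | ssq X <= b]; set A2 := [set X | a <= ssq X < S%:R].
have mA1 : measurable A1.
  have := measurable_ssq_set `]-oo, b].
  by congr measurable; apply/seteqP; split => X /=; rewrite in_itv.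
have mA2 : measurable A2.
  have := measurable_ssq_set `[a, S%:R[.
  by congr measurable; apply/seteqP; split => X /=; rewrite in_itv.
have Np : 0 < N%:R :> R by rewrite ltr0n.
have Sp : 0 < S%:R :> R by rewrite ltr0n.
have G0 : 0 < 1 + S%:R :> R by rewrite addr_gt0.
have rhs0 : 0 <= 16 * N%:R ^+ 2 :> R by rewrite mulr_ge0 // sqr_ge0.
have [P10|P1n] := eqVneq (Pr A1) 0; first by rewrite P10 !mul0r.
have [P20|P2n] := eqVneq (Pr A2) 0; first by rewrite P20 mulr0 mul0r.
have P1p : 0 < Pr A1 by rewrite lt_neqAle eq_sym P1n Pr_ge0.
have P2p : 0 < Pr A2 by rewrite lt_neqAle eq_sym P2n Pr_ge0.
have [i1 hi1] := pigeonhole mA1 (fun X (h : A1 X) => le_lt_trans h bS).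
have [i2 hi2] := pigeonhole mA2 (fun X (h : A2 X) => proj2 (andP h)).
have [X1 [X1A X1B]] : exists X, (A1 `&` bin i1) X.
  apply: contrapT => /forallNP h; have E : A1 `&` bin i1 = set0 by apply/seteqP; split => // X /h.
  by move: hi1; rewrite E /Pr measure0 /= leNgt divr_gt0.
have [X2 [X2A X2B]] : exists X, (A2 `&` bin i2) X.
  apply: contrapT => /forallNP h; have E : A2 `&` bin i2 = set0 by apply/seteqP; split => // X /h.
  by move: hi2; rewrite E /Pr measure0 /= leNgt divr_gt0.
have iv i : i.+1%:R / (2 * M%:R) = i%:R / (2 * M%:R) + (2 * M%:R)^-1 :> R.
  by rewrite -natr1 mulrDl mul1r.
rewrite /A1 /A2 /bin /= in X1A X1B X2A X2B; rewrite iv in X1B; rewrite iv in X2B.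
pose g i : R := 1 + i%:R / (2 * M%:R).
have g1 i : 1 <= g i by rewrite lerDl divr_ge0 // ltW.
have binE i : bin i = [set X | g i - 1 <= ssq X <= g i - 1 + (2 * M%:R)^-1].
  by apply/seteqP; split => X /=; rewrite /bin /= iv /g addrAC subrr add0r.
have mb i : measurable (bin i) by exact: measurable_bin.
have p1 : Pr A1 / N%:R <= Pr [set X | g i1 - 1 <= ssq X <= g i1 - 1 + (2 * M%:R)^-1].
  by rewrite -binE; apply: (le_trans hi1); apply: Pr_le; [exact: measurableI|exact: mb|move=> X []].
have p2 : Pr A2 / N%:R <= Pr [set X | g i2 - 1 <= ssq X <= g i2 - 1 + (2 * M%:R)^-1].
  by rewrite -binE; apply: (le_trans hi2); apply: Pr_le; [exact: measurableI|exact: mb|move=> X []].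
have q1 : 0 < Pr A1 / N%:R by exact: divr_gt0.
have q2 : 0 < Pr A2 / N%:R by exact: divr_gt0.
have sg i : 0 < Num.sqrt (g i) by rewrite sqrtr_gt0 (lt_le_trans _ (g1 i)).
have sg2 i : Num.sqrt (g i) ^+ 2 = g i by rewrite sqr_sqrtr // (le_trans _ (g1 i)).
pose r i := M%:R * Num.sqrt (g i).
have r0 i : 0 < r i by exact: mulr_gt0.
have gS1 : g i1 <= 1 + S%:R by rewrite /g lerD2l; move: X1B bS X1A => /andP[h1 h2] h3 h4; move: h1 h2 h3 h4; goal_lra.
have gS2 : g i2 <= 1 + S%:R by rewrite /g lerD2l; move: X2B X2A => /andP[h1 h2] /andP[h3 h4]; move: h1 h2 h3 h4; goal_lra.
have gd : d <= g i2 - g i1.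
  rewrite /g; move: X1B X1A X2B X2A => /andP[h1 h2] h3 /andP[h4 h5] /andP[h6 h7]; move: dab h1 h2 h3 h4 h5 h6 h7; goal_lra.
have rS i : g i <= 1 + S%:R -> r i ^+ 2 <= M%:R ^+ 2 * (1 + S%:R).
  by move=> h; rewrite /r exprMn sg2 ler_wpM2l // sqr_ge0.
have L1 := mix_rad_ge (g1 i1) (ltW q1) p1; have L2 := mix_rad_ge (g1 i2) (ltW q2) p2.
rewrite -/(r i1) in L1; rewrite -/(r i2) in L2.
have Z0 := rad_max_gt0 R l M0; set Z := rad_max R l M in Z0 L1 L2.
set c := Num.sqrt (2 * pi) ^+ l in L1 L2.
have c0 : 0 < c by rewrite exprn_gt0 // sqrtr_gt0 mulr_gt0 // pi_gt0.
have rl i : 0 < r i ^+ l by rewrite exprn_gt0.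
have m1 : 0 < mix mu 1 w (rad i0 (r i1)).
  rewrite -(pmulr_rgt0 _ (mulr_gt0 c0 (rl i1))); apply: lt_le_trans L1.
  by rewrite divr_gt0 // mulr_gt0.
have m2 : 0 < mix mu 1 w (rad i0 (r i2)).
  rewrite -(pmulr_rgt0 _ (mulr_gt0 c0 (rl i2))); apply: lt_le_trans L2.
  by rewrite divr_gt0 // mulr_gt0.
have := Hmid (r0 i1) (r0 i2) (rS _ gS1) (rS _ gS2) m1 m2.
rewrite tmix_rad (_ : 2^-1 * r i1 + (1 - 2^-1) * r i2 = (r i1 + r i2) / 2); last by field.
set z := (r i1 + r i2) / 2; have z0 : 0 < z by rewrite divr_gt0 // addr_gt0.
have := mix_rad_le z0; rewrite -/c -/Z.
move: m1 m2 L1 L2; set m1 := mix _ _ _ _; set m2 := mix _ _ _ _; set mz := mix _ _ _ _.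
move=> m10 m20 L1 L2 Uz hz.
have mz0 : 0 <= mz by exact: mix_ge0.
have hz2 : m1 * m2 <= 4 * mz ^+ 2.
  have s0 : 0 <= Num.sqrt (m1 * m2) / 2 by rewrite divr_ge0 // sqrtr_ge0.
  have : (Num.sqrt (m1 * m2) / 2) ^+ 2 <= mz ^+ 2 by rewrite lerXn2r ?nnegrE.
  rewrite exprMn sqr_sqrtr; last by rewrite mulr_ge0 // ltW.
  rewrite (_ : 2^-1 ^+ 2 = 4^-1 :> R); last by field.
  goal_lra.
have zl : 0 < z ^+ l by rewrite exprn_gt0.
have ratio : 1 + d ^+ 2 / (16 * (1 + S%:R) ^+ 2) <= z ^+ 2 / (r i1 * r i2).
  have -> : z ^+ 2 / (r i1 * r i2) = ((Num.sqrt (g i1) + Num.sqrt (g i2)) / 2) ^+ 2 / (Num.sqrt (g i1) * Num.sqrt (g i2)).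
    by rewrite /z /r; field; rewrite !gt_eqF.
  by apply: sqr_div_prod_ge; rewrite // !sg2.
have D0 : 0 <= d ^+ 2 / (16 * (1 + S%:R) ^+ 2) by rewrite divr_ge0 ?sqr_ge0 // mulr_ge0 // sqr_ge0.
set D := 1 + d ^+ 2 / _ in ratio *.
have ratiol : D ^+ l * (r i1 ^+ l * r i2 ^+ l) <= z ^+ l * z ^+ l.
  have rr : 0 < r i1 * r i2 by exact: mulr_gt0.
  rewrite -!exprMn; apply: lerXn2r; rewrite ?nnegrE.
  - by rewrite mulr_ge0 ?(ltW rr) // addr_ge0.
  - by rewrite mulr_ge0 // ltW.
  - by rewrite -ler_pdivlMr // -expr2.
have Dl : 0 <= D ^+ l by rewrite exprn_ge0 // addr_ge0.
(* Each of the two values of the profile is at least half the maximum times a bin mass, and [Hmid]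
   loses another factor 1/2 at the midpoint, squared in [hz2]: together these give the constant
   16. *)
have K1 : (Pr A1 / N%:R * Z / 2) * (Pr A2 / N%:R * Z / 2) <= (c * r i1 ^+ l * m1) * (c * r i2 ^+ l * m2).
  by apply: ler_pM => //; rewrite divr_ge0 // mulr_ge0 // ltW.
have K2 : (c * r i1 ^+ l * m1) * (c * r i2 ^+ l * m2) * D ^+ l <= 4 * Z ^+ 2.
  apply: (@le_trans _ _ (4 * (c * z ^+ l * mz) ^+ 2)); last first.
    rewrite ler_pM2l // lerXn2r ?nnegrE // ?(ltW Z0) //.
    by rewrite mulr_ge0 // mulr_ge0 // ltW.
  have -> : (c * r i1 ^+ l * m1) * (c * r i2 ^+ l * m2) * D ^+ l = c ^+ 2 * ((m1 * m2) * (D ^+ l * (r i1 ^+ l * r i2 ^+ l))) by ring.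
  have -> : 4 * (c * z ^+ l * mz) ^+ 2 = c ^+ 2 * ((4 * mz ^+ 2) * (z ^+ l * z ^+ l)) by ring.
  have c2 : 0 < c ^+ 2 by exact: exprn_gt0.
  rewrite (ler_pM2l c2); apply: ler_pM => //.
  - by rewrite mulr_ge0 // ltW.
  - by rewrite mulr_ge0 // mulr_ge0 // ltW.
have K3 : (Pr A1 / N%:R * Z / 2) * (Pr A2 / N%:R * Z / 2) * D ^+ l <= 4 * Z ^+ 2.
  by apply: le_trans K2; apply: ler_wpM2r.
have E : (Pr A1 / N%:R * Z / 2) * (Pr A2 / N%:R * Z / 2) * D ^+ l = (Pr A1 * Pr A2 * D ^+ l) * (Z ^+ 2 / (4 * N%:R ^+ 2)).
  by field; rewrite gt_eqF.
rewrite E -ler_pdivlMr in K3; last by rewrite divr_gt0 ?exprn_gt0 // mulr_gt0 // exprn_gt0.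
apply: (le_trans K3); rewrite le_eqVlt; apply/orP; left; apply/eqP; field.
by rewrite !gt_eqF.
Qed.

End Pair.

Lemma integral_indic_Pr (c : R) A : 0 <= c -> measurable A -> (\int[mu]_X (c * \1_A X)%:E = (c * Pr A)%:E)%E.
Proof.
move=> c0 mA; have m1 : measurable_fun setT (fun X => (\1_A X : R)%:E) by apply/measurable_EFinP; exact: measurable_indic.
under eq_integral do rewrite EFinM.
by rewrite ge0_ZlT // -measure_indicE // EFinM PrE.
Qed.

(** [thin_pair] bounds only products of masses of separated sets. Each tail, below 1 - tau or
    between 1 + tau and S, is therefore paired with a reference set on its other side, and the mean
    1 forces the two reference sets to have mass at least tau / (4 S). Values above S are left to
    the second moment. *)
Lemma thin_shell (l M S : nat) (i0 : 'I_l) (C tau : R) : l = (M ^ 2)%N -> (0 < M)%N -> (1 < S)%N ->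
  0 <= C -> 0 < tau <= 1 -> 4 * C <= S%:R * tau -> (2 * M%:R)^-1 <= tau / 4 ->
  (\int[mu]_X (ssq X)%:E = 1)%E -> (\int[mu]_X (ssq X ^+ 2)%:E <= C%:E)%E ->
  (forall r r', 0 < r -> 0 < r' -> r ^+ 2 <= M%:R ^+ 2 * (1 + S%:R) -> r' ^+ 2 <= M%:R ^+ 2 * (1 + S%:R) ->
    0 < mix mu 1 w (rad i0 r) -> 0 < mix mu 1 w (rad i0 r') ->
    Num.sqrt (mix mu 1 w (rad i0 r) * mix mu 1 w (rad i0 r')) / 2 <= mix mu 1 w (tmix 2^-1 (rad i0 r) (rad i0 r'))) ->
  1 - (8 * (16 * (2 * M * S)%:R ^+ 2 / (1 + (tau / 4) ^+ 2 / (16 * (1 + S%:R) ^+ 2)) ^+ l) * S%:R / tau + C / S%:R ^+ 2) <=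
    Pr [set X | `|ssq X - 1| <= tau].
Proof.
move=> lM M0 S1 C0 /andP[t0 t1] CS Mt E1 E2 Hmid.
have S0 : (0 < S)%N by apply: leq_trans S1.
have Sp : 0 < S%:R :> R by rewrite ltr0n.
have S2 : 2 <= S%:R :> R by rewrite (ler_nat _ 2).
set Dl := (1 + _) ^+ l; set N := (2 * M * S)%N.
have Dl0 : 0 < Dl.
  rewrite exprn_gt0 // ltr_pwDl // divr_ge0 ?sqr_ge0 // mulr_ge0 // sqr_ge0.
have mI := measurable_ssq_set.
pose A1 := [set X | ssq X <= 1 - tau]; pose B2 := [set X | 1 - tau / 2 <= ssq X < S%:R].
pose B1 := [set X | ssq X <= 1 + tau / 2]; pose A2 := [set X | 1 + tau <= ssq X < S%:R].
pose A3 := [set X | S%:R <= ssq X].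
have mA1 : measurable A1 by have := mI `]-oo, (1 - tau)]; congr measurable; apply/seteqP; split => X /=; rewrite in_itv.
have mB2 : measurable B2 by have := mI `[1 - tau / 2, S%:R[; congr measurable; apply/seteqP; split => X /=; rewrite in_itv.
have mB1 : measurable B1 by have := mI `]-oo, (1 + tau / 2)]; congr measurable; apply/seteqP; split => X /=; rewrite in_itv.
have mA2 : measurable A2 by have := mI `[1 + tau, S%:R[; congr measurable; apply/seteqP; split => X /=; rewrite in_itv.
have mA3 : measurable A3 by have := mI `[S%:R, +oo[; congr measurable; apply/seteqP; split => X /=; rewrite in_itv /= andbT.
have mA0 : measurable [set X | `|ssq X - 1| <= tau].
  by have := mI `[1 - tau, 1 + tau]; congr measurable; apply/seteqP; split => X /=; rewrite in_itv /= ler_distl.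
have ms : measurable_fun setT (fun X => (ssq X)%:E) by apply/measurable_EFinP; exact: measurable_ssq.
have ms2 : measurable_fun setT (fun X => (ssq X ^+ 2)%:E) by apply/measurable_EFinP; apply: measurable_funX; exact: measurable_ssq.
have s0 X : (0 <= (ssq X)%:E)%E by rewrite lee_fin ssq_ge0.
have s20 X : (0 <= (ssq X ^+ 2)%:E)%E by rewrite lee_fin sqr_ge0.
have mind (c : R) A : measurable A -> measurable_fun setT (fun X => (c * \1_A X)%:E).
  by move=> mA; apply/measurable_EFinP; apply: measurable_funM => //; exact: measurable_indic.
have ind0 (c : R) A X : 0 <= c -> (0 <= (c * \1_A X)%:E)%E by move=> c0; rewrite lee_fin mulr_ge0.
have mu1 := probability_setT mu.
(* Integrate ssq <= 1 - tau / 2 + S 1_B2 + ssq^2 / S: the last term has mean at most tau / 4 by the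
   choice of S, so B2 must carry mass. *)
have HB2 : tau / (4 * S%:R) <= Pr B2.
  have Si : 0 <= S%:R^-1 :> R by rewrite invr_ge0 ltW.
  have K : (1%:E <= (1 - tau / 2)%:E + (S%:R * Pr B2)%:E + S%:R^-1%:E * C%:E)%E.
    rewrite -E1; apply: (@le_trans _ _ (\int[mu]_X ((1 - tau / 2)%:E + (S%:R * \1_B2 X)%:E + S%:R^-1%:E * (ssq X ^+ 2)%:E))%E).
      apply: ge0_leT => //.
      - apply: emeasurable_funD; last exact: measurable_funeM.
        by apply: emeasurable_funD; [exact: measurable_cst|exact: mind].
      - move=> X; rewrite -EFinM -!EFinD lee_fin indicE.
        have h0 := ssq_ge0 X; have h2 : 0 <= S%:R^-1 * ssq X ^+ 2 by rewrite mulr_ge0 // sqr_ge0.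
        have [h|h] := ltP (ssq X) (1 - tau / 2).
          have : 0 <= S%:R * ((X \in B2)%:R : R) by rewrite mulr_ge0.
          move: h h2; goal_lra.
        have [h3|h3] := ltP (ssq X) S%:R.
          rewrite mem_set ?mulr1; last by rewrite /B2 /= h h3.
          move: h3 h2 t1; goal_lra.
        have : ssq X <= S%:R^-1 * ssq X ^+ 2.
          rewrite expr2 mulrA ler_peMl // mulrC ler_pdivlMr // mul1r //.
        have : 0 <= S%:R * ((X \in B2)%:R : R) by rewrite mulr_ge0.
        move: t1; goal_lra.
    have t2 : 0 <= 1 - tau / 2 by move: t1; goal_lra.
    rewrite ge0_DT; last 4 first.
    - by apply: emeasurable_funD; [exact: measurable_cst|exact: mind].
    - exact: measurable_funeM.
    - by move=> X; apply: adde_ge0; [rewrite lee_fin|exact: ind0].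
    - by move=> X; apply: mule_ge0; rewrite lee_fin // sqr_ge0.
    rewrite ge0_DT; last 4 first.
    - exact: measurable_cst.
    - exact: mind.
    - by move=> X; rewrite lee_fin.
    - by move=> X; exact: ind0.
    rewrite integral_prob_cst // integral_indic_Pr // ge0_ZlT //.
    by apply: leeD2l; apply: lee_wpmul2l; rewrite ?lee_fin.
  rewrite -EFinM -!EFinD lee_fin in K.
  have h1 : S%:R^-1 * C <= tau / 4.
    rewrite mulrC ler_pdivrMr //; move: CS; goal_lra.
  rewrite ler_pdivrMr ?mulr_gt0 //; move: h1 K; goal_lra.
(* Markov's inequality for the complement of B1. *)
have HB1 : tau / (4 * S%:R) <= Pr B1.
  have c0 : 0 <= 1 + tau / 2 by move: t0; goal_lra.
  have K : ((1 + tau / 2)%:E <= 1%:E + ((1 + tau / 2) * Pr B1)%:E)%E.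
    rewrite -E1 -integral_indic_Pr // -ge0_DT //.
    - rewrite -[X in (X <= _)%E](integral_prob_cst _ mu1); apply: ge0_leT.
      + exact: measurable_cst.
      + by apply: emeasurable_funD => //; exact: mind.
      + by move=> X; rewrite lee_fin.
      + move=> X; rewrite -EFinD lee_fin indicE; have h0 := ssq_ge0 X.
        have [h|h] := leP (ssq X) (1 + tau / 2).
          by rewrite mem_set // mulr1 lerDr.
        by rewrite memNset ?mulr0 ?addr0 ?(ltW h) // /B1 /= => h'; move: (lt_le_trans h h'); rewrite ltxx.
    - exact: mind.
    - by move=> X; exact: ind0.
  rewrite -EFinD lee_fin in K.
  have P0 := Pr_ge0 B1.
  apply: (@le_trans _ _ (tau / 4)).
    by rewrite ler_wpM2l ?(ltW t0) // lef_pV2 ?posrE ?mulr_gt0 //; move: S2; goal_lra.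
  nra.
have HA3 : Pr A3 <= C / S%:R ^+ 2.
  rewrite ler_pdivlMr ?exprn_gt0 // -lee_fin EFinM PrE // muleC; apply: le_trans E2.
  apply: le_mul_measure => // X h.
  by rewrite lee_fin lerXn2r ?nnegrE ?ssq_ge0 // ltW.
have t40 : 0 <= tau / 4 by move: t0; goal_lra.
pose k := 16 * N%:R ^+ 2 / Dl : R.
have K1 : Pr A1 * Pr B2 <= k.
  have b1 : 1 - tau < S%:R by move: S2 t0; goal_lra.
  have b2 : tau / 4 + (2 * M%:R)^-1 <= (1 - tau / 2) - (1 - tau) by move: Mt; goal_lra.
  rewrite /k ler_pdivlMr //; exact: (thin_pair lM M0 S0 Hmid t40 b1 b2).
have K2 : Pr B1 * Pr A2 <= k.
  have b1 : 1 + tau / 2 < S%:R by move: S2 t1; goal_lra.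
  have b2 : tau / 4 + (2 * M%:R)^-1 <= (1 + tau) - (1 + tau / 2) by move: Mt; goal_lra.
  rewrite /k ler_pdivlMr //; exact: (thin_pair lM M0 S0 Hmid t40 b1 b2).
have ts : 0 < tau / (4 * S%:R) by rewrite divr_gt0 ?mulr_gt0.
have H1 : Pr A1 <= k * (4 * S%:R / tau).
  rewrite -invf_div ler_pdivlMr //; apply: le_trans K1.
  by apply: ler_wpM2l; rewrite ?Pr_ge0.
have H2 : Pr A2 <= k * (4 * S%:R / tau).
  rewrite -invf_div ler_pdivlMr //; apply: le_trans K2.
  by rewrite mulrC; apply: ler_wpM2r; rewrite ?Pr_ge0.
have T : (1 <= \int[mu]_X ((1 * \1_[set X | `|ssq X - 1| <= tau]%R X)%:E + ((1 * \1_A1 X)%:E + ((1 * \1_A2 X)%:E + (1 * \1_A3 X)%:E))))%E.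
  rewrite -[X in (X <= _)%E](integral_prob_cst _ mu1); apply: ge0_leT.
  - exact: measurable_cst.
  - by repeat apply: emeasurable_funD; exact: mind.
  - by [].
  - move=> X; rewrite -!EFinD lee_fin !mul1r.
    have i0' (A : set (n.-tuple R)) : 0 <= (\1_A X : R) by [].
    have i1' (A : set (n.-tuple R)) : A X -> (\1_A X : R) = 1 by move=> h; rewrite indicE mem_set.
    have a0 := i0' [set X | `|ssq X - 1| <= tau]; have a1 := i0' A1; have a2 := i0' A2; have a3 := i0' A3.
    have [h|h] := leP `|ssq X - 1| tau; first by rewrite (i1' _ h); move: a1 a2 a3; goal_lra.
    have [h1|h1] := leP (ssq X) (1 - tau); first by rewrite (i1' A1) //; move: a0 a2 a3; goal_lra.
    have h4 : 1 + tau <= ssq X.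
      move: h; rewrite real_ltNge ?num_real // ler_distl (ltW h1) /= -ltNge => /ltW //.
    have [h3|h3] := ltP (ssq X) S%:R; first by rewrite (i1' A2) /A2 /= ?h3 ?h4 //; move: a0 a1 a3; goal_lra.
    by rewrite (i1' A3) //; move: a0 a1 a2; goal_lra.
have m4 A B : measurable A -> measurable B -> measurable_fun setT (fun X => (1 * \1_A X : R)%:E + (1 * \1_B X : R)%:E)%E.
  by move=> mA mB; apply: emeasurable_funD; exact: mind.
move: T; rewrite ge0_DT; last 4 first.
- exact: mind.
- by apply: emeasurable_funD; [exact: mind|exact: m4].
- by move=> X; exact: ind0.
- by move=> X; apply: adde_ge0; [exact: ind0|apply: adde_ge0; exact: ind0].
rewrite ge0_DT; last 4 first.
- exact: mind.
- exact: m4.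
- by move=> X; exact: ind0.
- by move=> X; apply: adde_ge0; exact: ind0.
rewrite ge0_DT; last 4 first.
- exact: mind.
- exact: mind.
- by move=> X; exact: ind0.
- by move=> X; exact: ind0.
rewrite !integral_indic_Pr // -!EFinD lee_fin !mul1r -/k => T.
have -> : 8 * k * S%:R / tau = k * (4 * S%:R / tau) + k * (4 * S%:R / tau) by field; rewrite gt_eqF.
move: T H1 H2 HA3; goal_lra.
Qed.

End ThinShell.

(** * Rotation invariance of the Gaussian measure *)

Definition tmul (R : realType) n m (g : n.-tuple R) (M : 'M[R]_(n, m)) : m.-tuple R :=
  [tuple (rv_of g *m M) 0 j | j < m].

Section TupleMatrix.
Context (R : realType).
Implicit Types (n m : nat).

Lemma rv_of_tmul n m (g : n.-tuple R) (M : 'M[R]_(n, m)) : rv_of (tmul g M) = rv_of g *m M.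
Proof. by apply/rowP => j; rewrite [LHS]mxE tnth_mktuple. Qed.

Lemma rv_of_inj n : injective (@rv_of R n).
Proof. by move=> x y /rowP h; apply: eq_from_tnth => i; have := h i; rewrite !mxE. Qed.

Lemma rv_of_tadd n (x y : n.-tuple R) : rv_of (tadd x y) = rv_of x + rv_of y.
Proof. by apply/rowP => j; rewrite !mxE tnth_mktuple. Qed.

Lemma rv_of_tscale n c (x : n.-tuple R) : rv_of (tscale c x) = c *: rv_of x.
Proof. by apply/rowP => j; rewrite !mxE tnth_mktuple. Qed.

Lemma rv_of_tsub n (x y : n.-tuple R) : rv_of (tsub x y) = rv_of x - rv_of y.
Proof. by rewrite /tsub rv_of_tadd rv_of_tscale scaleN1r. Qed.

Lemma dotE n (x y : n.-tuple R) : dot x y = (rv_of x *m (rv_of y)^T) 0 0.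
Proof. by rewrite dot.unlock !mxE; apply: eq_bigr => i _; rewrite !mxE. Qed.

Lemma nsq_mxE n (x : n.-tuple R) : nsq x = (rv_of x *m (rv_of x)^T) 0 0.
Proof. exact: dotE. Qed.

Lemma tmulA n m p (x : n.-tuple R) (M : 'M[R]_(n, m)) (N : 'M[R]_(m, p)) : tmul (tmul x M) N = tmul x (M *m N).
Proof. by apply: rv_of_inj; rewrite !rv_of_tmul mulmxA. Qed.

Lemma tmul1 n (x : n.-tuple R) : tmul x 1%:M = x.
Proof. by apply: rv_of_inj; rewrite rv_of_tmul mulmx1. Qed.

Lemma nsq_tmul n m (g : n.-tuple R) (V : 'M[R]_(n, m)) : V *m V^T = 1%:M -> nsq (tmul g V) = nsq g.
Proof. by move=> hV; rewrite !nsq_mxE rv_of_tmul trmx_mul mulmxA -(mulmxA (rv_of g)) hV mulmx1. Qed.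

Lemma tnth_tmul n m (g : n.-tuple R) (M : 'M[R]_(n, m)) j : tnth (tmul g M) j = \sum_k tnth g k * M k j.
Proof. by rewrite tnth_mktuple mxE; apply: eq_bigr => k _; rewrite mxE. Qed.

Lemma measurable_tmulf d (T : measurableType d) n m (f : T -> n.-tuple R) (M : 'M[R]_(n, m)) :
  measurable_fun setT f -> measurable_fun setT (fun x => tmul (f x) M).
Proof.
move=> mf; apply/measurable_fun_tnthP => j.
by rewrite (_ : _ \o _ = fun x => \sum_k tnth (f x) k * M k j); [mR|apply/funext => x /=; rewrite tnth_tmul].
Qed.

Lemma measurable_tmul n m (M : 'M[R]_(n, m)) : measurable_fun setT (fun g : n.-tuple R => tmul g M).
Proof. exact: measurable_tmulf. Qed.

End TupleMatrix.

Section Rotation.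
Context (R : realType).
Local Notation leb := (@leb R).
Local Notation lebn := (pw leb).
Local Notation gau := (@gau R).

Lemma gaun_shift n (w t : R) (a b : n.-tuple R) (f : n.-tuple R -> \bar R) : 0 < w -> 0 < t ->
  measurable_fun setT f -> (forall x, 0 <= f x <= 1)%E ->
  (\int[pw (gau w) n]_g f (tadd a g) <= \int[pw (gau w) n]_g f (tadd b g) + (t * nsq (tsub a b) / (8 * w) + 2 / t)%:E)%E.
Proof.
move=> w0 t0 mf f01.
have f0 x : (0 <= f x)%E by case/andP: (f01 x).
have f1 x : (f x <= 1)%E by case/andP: (f01 x).
rewrite !smoothing // -/(tsub _ _).
have mp e : measurable_fun setT (fun x : n.-tuple R => (gpdfn w (tsub x e))%:E) by mR.
have p0 e x : (0 <= (gpdfn w (tsub x e : n.-tuple R))%:E)%E by rewrite lee_fin gpdfn_ge0.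
have mfp e : measurable_fun setT (fun x : n.-tuple R => f x * (gpdfn w (tsub x e))%:E)%E by exact: emeasurable_funM.
have mI : measurable_fun setT (fun x : n.-tuple R => (`|gpdfn w (tsub x a) - gpdfn w (tsub x b)|)%:E).
  by apply/measurable_EFinP; apply: measurableT_comp => //; mR.
apply: le_trans (leeD2l _ (gpdfn_TV a b w0 t0)).
rewrite -ge0_DT; [|exact: (mfp b)|exact: mI|by move=> x; apply: mule_ge0; [exact: f0|exact: (p0 b x)]|by move=> x; rewrite lee_fin].
apply: ge0_leT.
- exact: (mfp a).
- by apply: emeasurable_funD; [exact: (mfp b)|exact: mI].
- by move=> x; apply: mule_ge0; [exact: f0|exact: (p0 a x)].
move=> x; set p := gpdfn w (tsub x a); set q := gpdfn w (tsub x b).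
case E : (f x) => [r| |]; [|by have := f1 x; rewrite E|by have := f0 x; rewrite E].
have r0 : 0 <= r by rewrite -lee_fin -E.
have r1 : r <= 1 by rewrite -lee_fin -E.
rewrite -!EFinM -EFinD lee_fin -lerBlDl -mulrBr.
apply: (@le_trans _ _ (r * `|p - q|)); first by rewrite ler_wpM2l // ler_norm.
by rewrite ler_piMl.
Qed.

Lemma gaun_conv n (w v : R) (y : n.-tuple R) : 0 < w -> 0 < v ->
  (\int[pw (gau w) n]_g (gpdfn v (tsub y g))%:E = (gpdfn (v + w) y)%:E)%E.
Proof.
move=> w0 v0.
transitivity (\int[pw (gau w) n]_g \prod_(i < n) (gpdf v (tnth y i - 1 * tnth g i))%:E)%E.
  apply: eq_integral => g _; rewrite prodEFin gpdfn.unlock; congr EFin.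
  by apply: eq_bigr => i _; rewrite tnth_tsub mul1r.
rewrite (ge0_pw_prod (gau w) (F := fun i g => (gpdf v (tnth y i - 1 * g))%:E)); last 2 first.
- by move=> i; mR.
- by move=> i g; rewrite lee_fin gpdf_ge0.
rewrite gpdfn.unlock -prodEFin; apply: eq_bigr => i _.
by rewrite integral_gau_gpdf // expr1n mulr1.
Qed.

Lemma gpdfn_nsq n (v : R) (x y : n.-tuple R) : 0 < v -> nsq x = nsq y -> gpdfn v x = gpdfn v y.
Proof. by move=> v0 xy; rewrite !gpdfnE // xy. Qed.

(* The smoothed laws have densities depending on norms only, so no pi-lambda argument is needed; the smoothing is
   removed by letting v tend to 0. *)
Lemma smoothed_rotation n (w v : R) (V : 'M[R]_n) (f : n.-tuple R -> \bar R) : 0 < w -> 0 < v -> V *m V^T = 1%:M ->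
  measurable_fun setT f -> (forall x, 0 <= f x)%E ->
  (\int[pw (gau v) n]_z \int[pw (gau w) n]_g f (tadd (tmul g V) z) =
   \int[lebn n]_x (f x * (gpdfn (v + w) x)%:E))%E.
Proof.
move=> w0 v0 hV mf f0; have hV' : V^T *m V = 1%:M by exact: mulmx1C.
rewrite ge0_swap; last 2 first.
- apply: (measurableT_comp mf); apply: measurable_tadd; last exact: measurable_fst.
  by apply: measurable_tmulf; exact: measurable_snd.
- by move=> z g; exact: f0.
transitivity (\int[pw (gau w) n]_g \int[lebn n]_x (f x * (gpdfn v (tsub x (tmul g V)))%:E))%E.
  by apply: eq_integral => g _; rewrite smoothing.
rewrite ge0_swap; last 2 first.
- apply: emeasurable_funM; first by apply: (measurableT_comp mf); exact: measurable_snd.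
  apply/measurable_EFinP; apply: measurable_gpdfnf; apply: measurable_tsubf; first exact: measurable_snd.
  by apply: measurable_tmulf; exact: measurable_fst.
- by move=> g x; rewrite mule_ge0 // lee_fin gpdfn_ge0.
apply: eq_integral => x _.
have mg : measurable_fun setT (fun g : n.-tuple R => (gpdfn v (tsub x (tmul g V)))%:E).
  apply/measurable_EFinP; apply: measurable_gpdfnf; apply: measurable_tsubf; first exact: measurable_cst.
  exact: measurable_tmul.
have -> : (\int[pw (gau w) n]_g (f x * (gpdfn v (tsub x (tmul g V)))%:E) =
   f x * \int[pw (gau w) n]_g (gpdfn v (tsub x (tmul g V)))%:E)%E.
  by rewrite ge0_integralZl // => g _; rewrite lee_fin gpdfn_ge0.
congr (_ * _)%E.
transitivity (\int[pw (gau w) n]_g (gpdfn v (tsub (tmul x V^T) g))%:E)%E.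
  apply: eq_integral => g _; congr EFin; apply: gpdfn_nsq => //.
  have hVt : V^T *m V^T^T = 1%:M by rewrite trmxK.
  rewrite -(nsq_tmul _ hVt); congr nsq; apply: rv_of_inj.
  by rewrite !(rv_of_tmul, rv_of_tsub) mulmxBl -mulmxA hV mulmx1.
rewrite gaun_conv //; congr EFin; apply: gpdfn_nsq; first exact: addr_gt0.
by rewrite nsq_tmul // trmxK.
Qed.

(** Adding a small Gaussian vector z to the argument changes each side little, by [gaun_shift], and
    after averaging over z the two sides become the same integral, by [smoothed_rotation] for V and
    for the identity. *)
Lemma gaun_orth_le n (w : R) (V : 'M[R]_n) (f : n.-tuple R -> \bar R) : 0 < w -> V *m V^T = 1%:M ->
  measurable_fun setT f -> (forall x, 0 <= f x <= 1)%E ->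
  (\int[pw (gau w) n]_g f (tmul g V) <= \int[pw (gau w) n]_g f g)%E.
Proof.
move=> w0 hV mf f01.
have f0 x : (0 <= f x)%E by case/andP: (f01 x).
have hV' : V^T *m V = 1%:M by exact: mulmx1C.
have I1 : pw (gau w) n setT = 1%E by apply: pw_setT; exact: gau_setT.
have T0 (x : n.-tuple R) : tadd [tuple 0 | i < n] x = x.
  by apply: rv_of_inj; rewrite rv_of_tadd; apply/rowP => j; rewrite !mxE tnth_mktuple add0r.
have nsqN (z : n.-tuple R) : nsq (tsub [tuple 0 | i < n] z) = nsq z.
  by rewrite !nsqE; apply: eq_bigr => i _; rewrite tnth_tsub tnth_mktuple sub0r sqrrN.
have mfV : measurable_fun setT (fun g : n.-tuple R => f (tmul g V)) by apply: (measurableT_comp mf); exact: measurable_tmul.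
apply/lee_addgt0Pr => e e0.
(* Then 2 / t = e / 4, and v is taken so small that the other part of the error also averages to at
   most e / 4. *)
pose t : R := 8 / e; have t0 : 0 < t by rewrite divr_gt0.
have n1 : 0 < n%:R + 1 :> R by rewrite ltr_wpDl.
have [v v0 hv] : exists2 v : R, 0 < v & t * (6 * v * n%:R) / (8 * w) <= e / 4.
  exists (e / 4 * (8 * w) / (t * 6 * (n%:R + 1))).
    apply: divr_gt0; [apply: mulr_gt0; [exact: divr_gt0|exact: mulr_gt0]|apply: mulr_gt0 => //; exact: mulr_gt0].
  rewrite ler_pdivrMr ?mulr_gt0 //.
  have -> : t * (6 * (e / 4 * (8 * w) / (t * 6 * (n%:R + 1))) * n%:R) = e / 4 * (8 * w) * (n%:R / (n%:R + 1)).
    by field; rewrite !gt_eqF.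
  by rewrite ler_piMr ?mulr_ge0 ?divr_ge0 ?(ltW e0) ?(ltW w0) // ler_pdivrMr // mul1r lerDl.
pose er (z : n.-tuple R) : R := t * nsq z / (8 * w) + 2 / t.
have er0 z : 0 <= er z.
  apply: addr_ge0; last by apply: divr_ge0 => //; exact: ltW.
  by apply: divr_ge0; apply: mulr_ge0; rewrite ?nsq_ge0 // ltW.
have mer : measurable_fun setT (fun z : n.-tuple R => (er z)%:E).
  by rewrite /er; apply/measurable_EFinP; apply: measurable_funD => //; apply: measurable_funM => //; mR.
have Eer : (\int[pw (gau v) n]_z (er z)%:E <= (e / 2)%:E)%E.
  have c0 : 0 <= t / (8 * w) by apply: divr_ge0; [exact: ltW|apply: mulr_ge0 => //; exact: ltW].
  have mn : measurable_fun setT (fun z : n.-tuple R => (nsq z)%:E) by mR.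
  have n0 (z : n.-tuple R) : (0 <= (nsq z)%:E)%E by rewrite lee_fin nsq_ge0.
  apply: (@le_trans _ _ (\int[pw (gau v) n]_z ((t / (8 * w))%:E * (nsq z)%:E + (2 / t)%:E))%E).
    rewrite le_eqVlt; apply/orP; left; apply/eqP; apply: eq_integral => z _.
    by rewrite /er mulrAC.
  have c2 : 0 <= 2 / t by apply: divr_ge0 => //; exact: ltW.
  rewrite ge0_DT //; last 2 first.
  - exact: measurable_funeM.
  - by move=> z; apply: mule_ge0.
  rewrite ge0_ZlT // integral_prob_cst; last by apply: pw_setT; exact: gau_setT.
  apply: (@le_trans _ _ ((t / (8 * w))%:E * (6 * v * n%:R)%:E + (2 / t)%:E)%E).
    by apply: leeD2r; apply: lee_wpmul2l; [rewrite lee_fin|exact: gaun_nsq_le].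
  rewrite -EFinM -EFinD lee_fin.
  have -> : 2 / t = e / 4 by rewrite /t; field; rewrite gt_eqF.
  have -> : t / (8 * w) * (6 * v * n%:R) = t * (6 * v * n%:R) / (8 * w) by rewrite mulrAC.
  lra.
have pv1 : pw (gau v) n setT = 1%E by apply: pw_setT; exact: gau_setT.
have mfz W : measurable_fun setT (fun z : n.-tuple R * n.-tuple R => f (tadd (tmul z.2 W) z.1)).
  apply: (measurableT_comp mf); apply: measurable_tadd; last exact: measurable_fst.
  by apply: measurable_tmulf; exact: measurable_snd.
have mi W : measurable_fun setT (fun z => \int[pw (gau w) n]_g f (tadd (tmul g W) z))%E.
  by apply: measurable_int2.
have i0 W z : (0 <= \int[pw (gau w) n]_g f (tadd (tmul g W) z))%E by exact: integral_ge0.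
have H W : W *m W^T = 1%:M -> forall z : n.-tuple R,
   (\int[pw (gau w) n]_g f (tmul g W) <= \int[pw (gau w) n]_g f (tadd (tmul g W) z) + (er z)%:E)%E /\
   (\int[pw (gau w) n]_g f (tadd (tmul g W) z) <= \int[pw (gau w) n]_g f (tmul g W) + (er z)%:E)%E.
  move=> hW z; have hW' : W^T *m W = 1%:M by exact: mulmx1C.
  have mfW : measurable_fun setT (fun g : n.-tuple R => f (tmul g W)) by apply: (measurableT_comp mf); exact: measurable_tmul.
  have E g : tadd (tmul g W) z = tmul (tadd (tmul z W^T) g) W.
    apply: rv_of_inj; rewrite !(rv_of_tadd, rv_of_tmul) mulmxDl -mulmxA hW' mulmx1; exact: addrC.
  have nz : nsq (tmul z W^T) = nsq z by rewrite nsq_tmul // trmxK.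
  have nz' : nsq (tsub (tmul z W^T) [tuple 0 | i < n]) = nsq z by rewrite tsub0.
  split.
    have := gaun_shift [tuple 0 | i < n] (tmul z W^T) w0 t0 mfW (fun g => f01 _).
    rewrite nsqN nz; under eq_integral do rewrite T0.
    by under [X in (_ <= X + _)%E -> _]eq_integral do rewrite -E.
  have := gaun_shift (tmul z W^T) [tuple 0 | i < n] w0 t0 mfW (fun g => f01 _).
  rewrite nz'; under eq_integral do rewrite -E.
  by under [X in (_ <= X + _)%E -> _]eq_integral do rewrite T0.
have If0 W : (0 <= \int[pw (gau w) n]_g f (tmul g W))%E by exact: integral_ge0.
have L : (\int[pw (gau w) n]_g f (tmul g V) <= \int[lebn n]_x (f x * (gpdfn (v + w) x)%:E) + (e / 2)%:E)%E.
  rewrite -(smoothed_rotation w0 v0 hV mf f0) -[X in (X <= _)%E](integral_prob_cst _ pv1).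
  apply: le_trans (leeD2l _ Eer); rewrite -ge0_DT //.
  apply: ge0_leT => //.
  - exact: emeasurable_funD.
  - by move=> z; case: (H V hV z).
have U : (\int[lebn n]_x (f x * (gpdfn (v + w) x)%:E) <= \int[pw (gau w) n]_g f g + (e / 2)%:E)%E.
  have h1 : (1%:M : 'M[R]_n) *m 1%:M^T = 1%:M by rewrite trmx1 mulmx1.
  rewrite -(smoothed_rotation w0 v0 h1 mf f0).
  apply: (@le_trans _ _ (\int[pw (gau w) n]_g f (tmul g 1%:M) + (e / 2)%:E)%E); last first.
    by apply: leeD2r; rewrite le_eqVlt; apply/orP; left; apply/eqP; apply: eq_integral => g _; rewrite tmul1.
  rewrite -[X in (_ <= X + _)%E](integral_prob_cst _ pv1).
  apply: le_trans (leeD2l _ Eer); rewrite -ge0_DT //.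
  apply: ge0_leT => //.
  - exact: emeasurable_funD.
  - by move=> z; case: (H _ h1 z).
apply: (le_trans L); apply: (le_trans (leeD2r _ U)); rewrite -addeA -EFinD.
by rewrite -splitr.
Qed.

(** Equality follows from the inequality for V and for its transpose, which is its inverse. *)
Lemma gaun_orth_set n (w : R) (V : 'M[R]_n) (A : set (n.-tuple R)) : 0 < w -> V *m V^T = 1%:M -> measurable A ->
  pw (gau w) n ((fun g => tmul g V) @^-1` A) = pw (gau w) n A.
Proof.
move=> w0 hV mA.
have hV' : V^T *m V = 1%:M by exact: mulmx1C.
have mpre W (B : set (n.-tuple R)) : measurable B -> measurable ((fun g : n.-tuple R => tmul g W) @^-1` B).
  by move=> mB; rewrite -[X in measurable X]setTI; exact: measurable_tmul.
have H W (B : set (n.-tuple R)) : W *m W^T = 1%:M -> measurable B -> (pw (gau w) n ((fun g => tmul g W) @^-1` B) <= pw (gau w) n B)%E.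
  move=> hW mB; have := @gaun_orth_le n w W (fun x => (\1_B x : R)%:E) w0 hW.
  have E C : measurable C -> pw (gau w) n C = (\int[pw (gau w) n]_x (\1_C x : R)%:E)%E.
    by move=> mC; rewrite integral_indic // setIT.
  rewrite (E B) // (E _ (mpre W B mB)); apply.
  - by apply/measurable_EFinP; exact: measurable_indic.
  - by move=> x; rewrite lee_fin indicE ler0n /=; case: (_ \in _).
apply/eqP; rewrite eq_le H //=.
have := H V^T _ _ (mpre V A mA); rewrite trmxK => /(_ hV').
suff -> : (fun g => tmul g V^T) @^-1` ((fun g => tmul g V) @^-1` A) = A by [].
by apply/seteqP; split => g /=; rewrite tmulA hV' tmul1.
Qed.

Lemma ge0_integral_gaun_orth n (w : R) (V : 'M[R]_n) (f : n.-tuple R -> \bar R) : 0 < w -> V *m V^T = 1%:M ->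
  measurable_fun setT f -> (forall x, 0 <= f x)%E ->
  (\int[pw (gau w) n]_g f (tmul g V) = \int[pw (gau w) n]_g f g)%E.
Proof.
move=> w0 hV mf f0.
have := ge0_integral_pushforward (measurable_tmul V) (pw (gau w) n) measurableT mf (fun x _ => f0 x).
rewrite preimage_setT => <-.
apply: eq_measure_integral; first exact: measurable_tmul.
by move=> mV A mA _; exact: (gaun_orth_set w0 hV mA).
Qed.

Lemma ge0_integral_gaumat_orth l n (w : R) (V : 'M[R]_n) (f : l.-tuple (n.-tuple R) -> \bar R) : 0 < w -> V *m V^T = 1%:M ->
  measurable_fun setT f -> (forall x, 0 <= f x)%E ->
  (\int[pw (pw (gau w) n) l]_G f [tuple tmul (tnth G i) V | i < l] = \int[pw (pw (gau w) n) l]_G f G)%E.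
Proof.
move=> w0 hV; elim: l f => [|l IH] f mf f0.
  by rewrite !integral_pw0; congr f; apply: eq_from_tnth => -[].
have mG : measurable_fun setT (fun G : l.+1.-tuple (n.-tuple R) => [tuple tmul (tnth G i) V | i < l.+1]).
  apply/measurable_fun_tnthP => i.
  rewrite (_ : _ \o _ = fun G => tmul (tnth G i) V); last by apply/funext => G /=; rewrite tnth_mktuple.
  by apply: measurable_tmulf; exact: measurable_tnth.
rewrite ge0_integral_pwS; [|exact: (measurableT_comp mf mG)|by move=> t; exact: f0].
rewrite [RHS]ge0_integral_pwS; [|exact: mf|exact: f0].
have mI := measurable_integral_cons (pw (gau w) n) mf f0.
rewrite -[RHS](ge0_integral_gaun_orth w0 hV mI); last by move=> x; exact: integral_ge0.
apply: eq_integral => g _.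
rewrite -(IH (fun t => f [tuple of tmul g V :: t])) //; last first.
  by apply: (measurableT_comp mf); exact: measurable_cons_r.
apply: eq_integral => G _; congr f; apply: eq_from_tnth => i; rewrite tnth_mktuple.
by have [j ->|->] := unliftP ord0 i; rewrite ?tnth0 // !tnthS tnth_mktuple.
Qed.

End Rotation.

(** * Orthonormal frames and orthogonal projections *)

Section Frames.
Context (R : realType).
Implicit Types (n k r l : nat).

Lemma rv_sqr_ge0 n (u : 'rV[R]_n) : 0 <= (u *m u^T) 0 0.
Proof. by rewrite mxE; apply: sumr_ge0 => i _; rewrite mxE -expr2 sqr_ge0. Qed.

Lemma rv_sqr_eq0 n (u : 'rV[R]_n) : (u *m u^T) 0 0 = 0 -> u = 0.
Proof.
rewrite mxE => /eqP; rewrite psumr_eq0; last by move=> i _; rewrite mxE -expr2 sqr_ge0.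
move=> /allP h; apply/rowP => i; have := h i (mem_index_enum _); rewrite /= mxE -expr2 sqrf_eq0 => /eqP ->.
by rewrite mxE.
Qed.

Lemma rv_normalize n (u : 'rV[R]_n) : u != 0 ->
  ((Num.sqrt ((u *m u^T) 0 0))^-1 *: u) *m ((Num.sqrt ((u *m u^T) 0 0))^-1 *: u)^T = 1%:M.
Proof.
move=> u0; have a0 : 0 < (u *m u^T) 0 0.
  rewrite lt_neqAle rv_sqr_ge0 andbT eq_sym; apply: contra u0 => /eqP /rv_sqr_eq0 ->; exact: eqxx.
rewrite linearZ /= -scalemxAl -scalemxAr scalerA -invfM -expr2 sqr_sqrtr ?(ltW a0) //.
by rewrite [X in _ *: X]mx11_scalar scale_scalar_mx mulVf // gt_eqF.
Qed.

Definition projm n (S : 'M[R]_n) := S^T = S /\ S *m S = S.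

Lemma projm1 n : projm (1%:M : 'M[R]_n).
Proof. by split; rewrite ?trmx1 ?mulmx1. Qed.

Lemma projm0 n : projm (0 : 'M[R]_n).
Proof. by split; rewrite ?trmx0 ?mulmx0. Qed.

Lemma frame_projm k n (U : 'M[R]_(k, n)) : U *m U^T = 1%:M -> projm (U^T *m U).
Proof. by move=> hU; split; rewrite ?trmx_mul ?trmxK // mulmxA -(mulmxA U^T) hU mulmx1. Qed.

Lemma frame_leq k n (U : 'M[R]_(k, n)) : U *m U^T = 1%:M -> (k <= n)%N.
Proof.
move=> hU; rewrite -(mxrank1 R k) -hU; apply: leq_trans (mxrankM_maxl _ _) _; exact: rank_leq_col.
Qed.

Lemma frame_rank k n (U : 'M[R]_(k, n)) : U *m U^T = 1%:M -> \rank (U^T *m U) = k.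
Proof.
move=> hU; have rU : \rank U = k.
  apply/eqP; rewrite eqn_leq rank_leq_row /= -{1}(mxrank1 R k) -hU; exact: mxrankM_maxl.
apply/eqP; rewrite eqn_leq; apply/andP; split.
  by have := mxrankM_maxr U^T U; rewrite rU.
have := mxrankM_maxr U (U^T *m U); rewrite mulmxA hU mul1mx rU; exact.
Qed.

Lemma frame_trace k n (U : 'M[R]_(k, n)) : U *m U^T = 1%:M -> \tr (U^T *m U) = k%:R.
Proof. by move=> hU; rewrite mxtrace_mulC hU mxtrace1. Qed.

(** Some row of P - U^T U is nonzero; it lies in the range of P, is orthogonal to the rows of U, and
    only has to be normalised. *)
Lemma frame_extend n k (P : 'M[R]_n) (U : 'M[R]_(k, n)) : projm P -> U *m U^T = 1%:M -> U *m P = U -> U^T *m U != P ->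
  exists u : 'rV[R]_n, [/\ u *m P = u, u *m u^T = 1%:M & u *m U^T = 0].
Proof.
move=> [PT PP] hU UP UnP; pose D : 'M[R]_n := P - U^T *m U.
have D0 : D != 0 by rewrite subr_eq0 eq_sym.
have [i ri] : exists i, row i D != 0.
  by case/rowV0Pn: D0 => v /submxP[w ->] h; apply/existsP; apply: contraNT h; rewrite negb_exists => /forallP h;
  have -> : D = 0; [apply/row_matrixP => i; rewrite row0; apply/eqP; have := h i; rewrite negbK|rewrite mulmx0].
have DP : D *m P = D by rewrite mulmxBl PP -mulmxA UP.
have DU : D *m U^T = 0.
  rewrite mulmxBl -mulmxA hU mulmx1 -[X in X - _]trmxK trmx_mul trmxK PT UP; exact: subrr.
exists ((Num.sqrt ((row i D *m (row i D)^T) 0 0))^-1 *: row i D); split.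
- by rewrite -scalemxAl; congr (_ *: _); rewrite -row_mul DP.
- exact: rv_normalize.
- by rewrite -scalemxAl -[X in _ *: X]row_mul DU row0 scaler0.
Qed.

Lemma frame_complete n k (P : 'M[R]_n) (U : 'M[R]_(k, n)) : projm P -> U *m U^T = 1%:M -> U *m P = U ->
  exists r (W : 'M[R]_(r, n)), [/\ W *m W^T = 1%:M, U *m W^T = 0 & U^T *m U + W^T *m W = P].
Proof.
move=> hP; have [m] := ubnP (n - k); elim: m k U => // m IH k U nk hU UP.
have [UPe|UPn] := eqVneq (U^T *m U) P.
  exists 0%N, (0 : 'M[R]_(0%N, n)); split.
  - by apply/matrixP => -[].
  - by rewrite trmx0 mulmx0.
  - by rewrite mulmx0 addr0.
have [u [uP uu uU]] := frame_extend hP hU UP UPn.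
have Uu : U *m u^T = 0 by rewrite -[LHS]trmxK trmx_mul trmxK uU trmx0.
have hU' : col_mx U u *m (col_mx U u)^T = 1%:M.
  by rewrite tr_col_mx mul_col_row hU uu uU Uu -scalar_mx_block.
have kn := frame_leq hU'; rewrite addn1 in kn.
have nk' : (n - (k + 1) < m)%N by rewrite addn1 subnS prednK ?subn_gt0 // -ltnS; exact: nk.
have [|r [W [WW UW E]]] := IH _ (col_mx U u) nk' hU'.
  by rewrite mul_col_mx UP uP.
rewrite mul_col_mx -col_mx0 in UW; have [UW0 uW0] := eq_col_mx UW.
have Wu : W *m u^T = 0 by rewrite -[LHS]trmxK trmx_mul trmxK uW0 trmx0.
exists (1 + r)%N, (col_mx u W); split.
- by rewrite tr_col_mx mul_col_row WW uu uW0 Wu -scalar_mx_block.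
- by rewrite tr_col_mx mul_mx_row Uu UW0 row_mx0.
- by rewrite tr_col_mx mul_row_col addrA -E tr_col_mx mul_row_col.
Qed.

Lemma projm_frame n (P : 'M[R]_n) : projm P -> exists r (U : 'M[R]_(r, n)), U *m U^T = 1%:M /\ U^T *m U = P.
Proof.
move=> hP; have [||r [W [WW _ E]]] := @frame_complete n 0 P 0 hP.
- by rewrite flatmx0 [RHS]flatmx0.
- by rewrite flatmx0.
by exists r, W; split => //; rewrite -E mulmx0 add0r.
Qed.

Lemma projm_rank_trace n (P : 'M[R]_n) : projm P -> \tr P = (\rank P)%:R.
Proof. by move=> /projm_frame[r [U [hU <-]]]; rewrite frame_rank // frame_trace. Qed.

(** The rank condition becomes a trace condition, which is polynomial in the entries; this makes the
    Grassmannian a measurable set. *)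
Lemma is_orth_projP n l (P : 'M[R]_n) : is_orth_proj l P <-> projm P /\ \tr P = l%:R.
Proof.
split=> [[h1 h2 h3]|[[h1 h2] h3]]; first by split; rewrite // projm_rank_trace // h3.
split=> //; have hP : projm P by [].
by move: h3; rewrite projm_rank_trace // => /eqP; rewrite eqr_nat => /eqP.
Qed.

Lemma frame_cast n k m (e : k = m) (U : 'M[R]_(k, n)) : exists V : 'M[R]_(m, n),
  [/\ (U *m U^T = 1%:M -> V *m V^T = 1%:M), V^T *m V = U^T *m U & forall (i : 'I_k) (j : 'I_m), i = j :> nat -> row j V = row i U].
Proof. by case: m / e; exists U; split => // i j /ord_inj ->. Qed.

Lemma frame_to_orth l n (U : 'M[R]_(l, n)) : U *m U^T = 1%:M ->
  exists V : 'M[R]_n, V *m V^T = 1%:M /\ forall (i : 'I_l) (j : 'I_n), i = j :> nat -> row j V = row i U.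
Proof.
move=> hU; have [|r [W [WW UW E]]] := frame_complete (projm1 n) hU; first by rewrite mulmx1.
have WU : W *m U^T = 0 by rewrite -[LHS]trmxK trmx_mul trmxK UW trmx0.
have hV : col_mx U W *m (col_mx U W)^T = 1%:M.
  by rewrite tr_col_mx mul_col_row hU WW WU UW -scalar_mx_block.
(* The dimension count is read off the trace of the identity. *)
have e : (l + r)%N = n.
  have := frame_trace hV; rewrite tr_col_mx mul_row_col E mxtrace1 => /eqP.
  by rewrite eqr_nat => /eqP.
have [V [h1 h2 h3]] := frame_cast e (col_mx U W).
exists V; split; first exact: h1.
move=> i j ij; rewrite (h3 (lshift r i) j) //; exact: col_mx_row_lshift || by apply/rowP => c; rewrite !mxE; case: splitP => k hk; [congr (U _ _); exact/ord_inj|have := ltn_ord i; rewrite [X in (X < _)%N]hk ltnNge leq_addr].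
Qed.

End Frames.

(** * Coordinates of a Gaussian vector in a frame *)

Section Marginals.
Context d (T : measurableType d) (R : realType) (m : {sigma_finite_measure set T -> \bar R}).
Hypothesis m1 : m setT = 1%E.

Definition ttake l n (h : (l <= n)%N) (x : n.-tuple T) : l.-tuple T := [tuple tnth x (widen_ord h i) | i < l].

Lemma measurable_ttake l n (h : (l <= n)%N) : measurable_fun setT (ttake h).
Proof.
apply/measurable_fun_tnthP => i.
rewrite (_ : _ \o _ = fun x => tnth x (widen_ord h i)); last by apply/funext => x /=; rewrite tnth_mktuple.
exact: measurable_tnth.
Qed.

Lemma ge0_pw_marginal l n (h : (l <= n)%N) (f : l.-tuple T -> \bar R) : measurable_fun setT f -> (forall x, 0 <= f x)%E ->
  (\int[pw m n]_x f (ttake h x) = \int[pw m l]_x f x)%E.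
Proof.
elim: l n h f => [|l IH] n h f mf f0.
  rewrite integral_pw0; transitivity (\int[pw m n]_x f [tuple])%E.
    by apply: eq_integral => x _; congr f; apply: eq_from_tnth => -[].
  by apply: integral_prob_cst; exact: pw_setT.
case: n h => // n h; have h' : (l <= n)%N by [].
rewrite ge0_integral_pwS; [|by apply: (measurableT_comp mf); exact: measurable_ttake|by move=> x; exact: f0].
rewrite ge0_integral_pwS //.
apply: eq_integral => x _; rewrite -(IH n h' (fun t => f [tuple of x :: t])) //; last first.
  by apply: (measurableT_comp mf); exact: measurable_cons_r.
apply: eq_integral => t _; congr f; apply: eq_from_tnth => i; rewrite tnth_mktuple.
have [j ->|->] := unliftP ord0 i.
  rewrite tnthS tnth_mktuple (_ : widen_ord h (lift ord0 j) = lift ord0 (widen_ord h' j)); last exact: ord_inj.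
  by rewrite tnthS.
by rewrite (_ : widen_ord h ord0 = ord0) ?tnth0 //; exact: ord_inj.
Qed.

End Marginals.

Section GaussianFrames.
Context (R : realType).
Local Notation gau := (@gau R).

(** Complete U to an orthogonal matrix, rotate, and integrate out the other coordinates. *)
Lemma ge0_integral_gaun_frame n l (w : R) (U : 'M[R]_(l, n)) (f : l.-tuple R -> \bar R) : 0 < w -> U *m U^T = 1%:M ->
  measurable_fun setT f -> (forall x, 0 <= f x)%E ->
  (\int[pw (gau w) n]_g f (tmul g U^T) = \int[pw (gau w) l]_x f x)%E.
Proof.
move=> w0 hU mf f0; have [V [hV rV]] := frame_to_orth hU.
have ln := frame_leq hU.
have hVT : V^T *m V^T^T = 1%:M by rewrite trmxK; exact: mulmx1C.
rewrite -(ge0_pw_marginal (gau_setT w) ln mf f0).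
have mft : measurable_fun setT (fun x : n.-tuple R => f (ttake ln x)) by apply: (measurableT_comp mf); exact: measurable_ttake.
rewrite -(ge0_integral_gaun_orth w0 hVT mft); last by move=> x; exact: f0.
apply: eq_integral => g _; congr f; apply: eq_from_tnth => i.
rewrite [RHS]tnth_mktuple !tnth_tmul; apply: eq_bigr => k _; congr (_ * _).
by have /rowP /(_ k) := rV i (widen_ord ln i) erefl; rewrite !mxE.
Qed.

Lemma integral_gaun_expR_nsq k (w c : R) : 0 < w -> 2 * c * w < 1 ->
  (\int[pw (gau w) k]_y (expR (c * nsq y))%:E = ((Num.sqrt (1 - 2 * c * w))^-1 ^+ k)%:E)%E.
Proof.
move=> w0 cw.
transitivity (\int[pw (gau w) k]_y \prod_(i < k) (expR (c * tnth y i ^+ 2))%:E)%E.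
  by apply: eq_integral => y _; rewrite prodEFin nsqE mulr_sumr expR_sum.
rewrite (ge0_pw_prod (gau w) (F := fun _ y => (expR (c * y ^+ 2))%:E)); last 2 first.
- by move=> i; mR.
- by move=> i y; rewrite lee_fin expR_ge0.
under eq_bigr do rewrite integral_gau_expR_sqr //.
by rewrite prodEFin prodr_const card_ord.
Qed.

(** The squared length of the projection is w times a chi-square variable with [\rank S] degrees of
    freedom. *)
Lemma gaun_projm_expR n (S : 'M[R]_n) (w c : R) : 0 < w -> 2 * c * w < 1 -> projm S ->
  (\int[pw (gau w) n]_g (expR (c * nsq (tmul g S)))%:E = ((Num.sqrt (1 - 2 * c * w))^-1 ^+ (\rank S))%:E)%E.
Proof.
move=> w0 cw /projm_frame[r [U [hU <-]]]; rewrite frame_rank //.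
rewrite -(integral_gaun_expR_nsq r w0 cw) -(ge0_integral_gaun_frame w0 hU); last 2 first.
- by mR.
- by move=> x; rewrite lee_fin expR_ge0.
by apply: eq_integral => g _; rewrite -tmulA nsq_tmul.
Qed.

End GaussianFrames.

(** * Gram-Schmidt orthogonalisation: algebra, equivariance, measurability *)

Section MeasurableMatrix.
Context d (T : measurableType d) (R : realType).
Implicit Types (m n p : nat).

(** Measurability entry by entry; the matrices themselves carry no sigma-algebra here. *)
Definition mxm m n (F : T -> 'M[R]_(m, n)) := forall i j, measurable_fun setT (fun x => F x i j).

Lemma mxm_cst m n (M : 'M[R]_(m, n)) : mxm (fun _ => M).
Proof. by move=> i j; exact: measurable_cst. Qed.

Lemma mxm_tr m n (F : T -> 'M[R]_(m, n)) : mxm F -> mxm (fun x => (F x)^T).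
Proof. by move=> mF i j; rewrite (_ : (fun x => _) = fun x => F x j i) //; apply/funext => x; rewrite mxE. Qed.

Lemma mxm_add m n (F G : T -> 'M[R]_(m, n)) : mxm F -> mxm G -> mxm (fun x => F x + G x).
Proof.
move=> mF mG i j; rewrite (_ : (fun x => _) = fun x => F x i j + G x i j); first exact: measurable_funD.
by apply/funext => x; rewrite mxE.
Qed.

Lemma mxm_opp m n (F : T -> 'M[R]_(m, n)) : mxm F -> mxm (fun x => - F x).
Proof.
move=> mF i j; rewrite (_ : (fun x => _) = fun x => - F x i j); first exact: measurableT_comp.
by apply/funext => x; rewrite mxE.
Qed.

Lemma mxm_scale m n (a : T -> R) (F : T -> 'M[R]_(m, n)) : measurable_fun setT a -> mxm F -> mxm (fun x => a x *: F x).
Proof.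
move=> ma mF i j; rewrite (_ : (fun x => _) = fun x => a x * F x i j); first exact: measurable_funM.
by apply/funext => x; rewrite mxE.
Qed.

Lemma mxm_mul m n p (F : T -> 'M[R]_(m, n)) (G : T -> 'M[R]_(n, p)) : mxm F -> mxm G -> mxm (fun x => F x *m G x).
Proof.
move=> mF mG i j; rewrite (_ : (fun x => _) = fun x => \sum_k F x i k * G x k j).
  by apply: measurable_sum => k; exact: measurable_funM.
by apply/funext => x; rewrite mxE.
Qed.

Lemma mxm_rv_of n (f : T -> n.-tuple R) : measurable_fun setT f -> mxm (fun x => rv_of (f x)).
Proof.
move=> /measurable_fun_tnthP mf i j; rewrite (_ : (fun x => _) = fun x => tnth (f x) j); first exact: (mf j).
by apply/funext => x; rewrite mxE.
Qed.

Lemma mxm_mx_of n (f : T -> n.-tuple (n.-tuple R)) : measurable_fun setT f -> mxm (fun x => mx_of (f x)).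
Proof.
move=> /measurable_fun_tnthP mf i j; rewrite (_ : (fun x => _) = fun x => tnth (tnth (f x) i) j).
  by have /measurable_fun_tnthP := mf i; exact.
by apply/funext => x; rewrite mxE.
Qed.

Lemma mxm_tuple m n (F : T -> 'M[R]_(m, n)) : mxm F ->
  measurable_fun setT (fun x => [tuple [tuple F x i j | j < n] | i < m]).
Proof.
move=> mF; apply/measurable_fun_tnthP => i; apply/measurable_fun_tnthP => j.
by rewrite (_ : _ \o _ = fun x => F x i j) //; apply/funext => x /=; rewrite !tnth_mktuple.
Qed.

Lemma mxm_eq0 m n (F : T -> 'M[R]_(m, n)) : mxm F -> measurable [set x | F x = 0].
Proof.
move=> mF; rewrite (_ : [set x | _] = (fun x => \sum_i \sum_j F x i j ^+ 2) @^-1` [set 0]).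
  have ms : measurable_fun setT (fun x => \sum_i \sum_j F x i j ^+ 2).
    by apply: measurable_sum => i; apply: measurable_sum => j; exact: measurable_funX.
  by rewrite -[X in measurable X]setTI; exact: ms.
apply/seteqP; split => x /= h.
  by rewrite h big1 // => i _; rewrite big1 // => j _; rewrite mxE expr0n.
apply/matrixP => i j; rewrite mxE; apply/eqP.
have h0 i' : 0 <= \sum_j F x i' j ^+ 2 by apply: sumr_ge0 => j' _; exact: sqr_ge0.
move/eqP: h; rewrite psumr_eq0; last by move=> i' _; exact: h0.
move=> /allP /(_ i (mem_index_enum _)) /=; rewrite psumr_eq0; last by move=> j' _; exact: sqr_ge0.
by move=> /allP /(_ j (mem_index_enum _)) /=; rewrite sqrf_eq0.
Qed.

End MeasurableMatrix.

Lemma measurable_negbE d (T : measurableType d) (R : realType) (b : T -> bool) :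
  measurable_fun setT b -> measurable_fun setT (fun x => (~~ b x)%:R%:E : \bar R).
Proof.
move=> mb; apply/measurable_EFinP.
rewrite (_ : (fun x => _) = fun x => if b x then 0 else 1 : R); last by apply/funext => x; case: (b x).
by apply: measurable_fun_ifT; [exact: mb|exact: measurable_cst|exact: measurable_cst].
Qed.

Section GramSchmidt.
Context (R : realType) (n : nat).
Implicit Types (S : 'M[R]_n) (g : n.-tuple R) (s : seq (n.-tuple R)).

(* Gram-Schmidt: S is the projection onto the span of the previous vectors, [gsp S g] the component of g orthogonal
   to it, [gsq S g] its normalisation (0 when g is in the span) and [gstep S g] the next projection. *)
Definition gsp S g : 'rV[R]_n := rv_of g *m (1%:M - S).
Definition gsq S g : 'rV[R]_n := (Num.sqrt ((gsp S g *m (gsp S g)^T) 0 0))^-1 *: gsp S g.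
Definition gstep S g : 'M[R]_n := S + (gsq S g)^T *m gsq S g.

Lemma gsp_mulS S g : projm S -> gsp S g *m S = 0.
Proof. by move=> [_ SS]; rewrite /gsp -mulmxA mulmxBl mul1mx SS subrr mulmx0. Qed.

Lemma gsq_mulS S g : projm S -> gsq S g *m S = 0.
Proof. by move=> hS; rewrite -scalemxAl gsp_mulS // scaler0. Qed.

Lemma gsq_unit S g : gsp S g != 0 -> gsq S g *m (gsq S g)^T = 1%:M.
Proof. exact: rv_normalize. Qed.

Lemma gsq_eq0 S g : gsp S g = 0 -> gsq S g = 0.
Proof. by move=> h; rewrite /gsq h scaler0. Qed.

Lemma gsqqq S g : gsq S g *m (gsq S g)^T *m gsq S g = gsq S g.
Proof.
have [h|h] := eqVneq (gsp S g) 0; first by rewrite gsq_eq0 // mulmx0.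
by rewrite gsq_unit // mul1mx.
Qed.

Lemma gstep_projm S g : projm S -> projm (gstep S g).
Proof.
move=> hS; have [ST SS] := hS; have qS := gsq_mulS g hS.
have Sq : S *m (gsq S g)^T = 0 by rewrite -{1}ST -trmx_mul qS trmx0.
split; first by rewrite linearD /= trmx_mul trmxK ST.
rewrite /gstep mulmxDl !mulmxDr SS (mulmxA S) Sq mul0mx addr0 -(mulmxA _ _ S) qS mulmx0 add0r.
by rewrite mulmxA -(mulmxA _ _ (gsq S g)^T) -mulmxA gsqqq.
Qed.

Lemma gstep_trace S g : \tr (gstep S g) = \tr S + (gsp S g != 0)%:R.
Proof.
rewrite /gstep mxtraceD mxtrace_mulC; have [h|h] := eqVneq (gsp S g) 0.
  by rewrite gsq_eq0 // mul0mx mxtrace0.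
by rewrite gsq_unit // mxtrace1.
Qed.

Lemma gstep_mul S g : projm S -> S *m gstep S g = S.
Proof.
move=> hS; have [ST SS] := hS; rewrite /gstep mulmxDr SS mulmxA.
by rewrite -{2}ST -trmx_mul gsq_mulS // trmx0 mul0mx addr0.
Qed.

Lemma gsq_gstep S g : projm S -> gsq S g *m gstep S g = gsq S g.
Proof. by move=> hS; rewrite /gstep mulmxDr gsq_mulS // add0r mulmxA gsqqq. Qed.

Section Equivariance.
Variable V : 'M[R]_n.
Hypothesis hV : V *m V^T = 1%:M.

Lemma gsp_orth S g : gsp (V^T *m S *m V) (tmul g V) = gsp S g *m V.
Proof.
rewrite /gsp rv_of_tmul -mulmxA mulmxBr mulmx1 !mulmxA hV mul1mx -mulmxA; congr (_ *m _).
by rewrite mulmxBl mul1mx.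
Qed.

Lemma gsq_orth S g : gsq (V^T *m S *m V) (tmul g V) = gsq S g *m V.
Proof.
rewrite /gsq gsp_orth trmx_mul mulmxA -(mulmxA _ V) hV mulmx1 -scalemxAl //.
Qed.

Lemma gstep_orth S g : gstep (V^T *m S *m V) (tmul g V) = V^T *m gstep S g *m V.
Proof. by rewrite /gstep gsq_orth trmx_mul mulmxDr mulmxDl !mulmxA. Qed.

End Equivariance.

Fixpoint gsrows S s : seq 'rV[R]_n := if s is g :: s' then gsq S g :: gsrows (gstep S g) s' else [::].

Lemma size_gsrows S s : size (gsrows S s) = size s.
Proof. by elim: s S => //= g s IH S; rewrite IH. Qed.

(** Applied to [gsnd], linear independence, and later to [gsgood], near orthonormality. S is updated
    along the list, so that each vector is tested against the span of its predecessors. *)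
Fixpoint gsall (B : 'M[R]_n -> n.-tuple R -> bool) S s :=
  if s is g :: s' then B S g && gsall B (gstep S g) s' else true.

Definition gsnd S g := gsp S g != 0.

Lemma gsrows_mul S s q : projm S -> q \in gsrows S s -> q *m S = 0.
Proof.
elim: s S => // g s IH S hS; rewrite inE => /orP[/eqP ->|]; first exact: gsq_mulS.
move=> /(IH _ (gstep_projm g hS)) h.
have [ST _] := hS; have [gT _] := gstep_projm g hS.
by rewrite -{1}ST -(gstep_mul g hS) trmx_mul gT mulmxA h mul0mx.
Qed.

Lemma gsrows_orth S s i j : projm S -> gsall gsnd S s -> (i < size s)%N -> (j < size s)%N ->
  nth 0 (gsrows S s) i *m (nth 0 (gsrows S s) j)^T = (i == j)%:R%:M.
Proof.
elim: s S i j => // g s IH S i j hS /= /andP[hg hs].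
have hS' := gstep_projm g hS; have [gT _] := hS'.
have off k : (k < size s)%N -> nth 0 (gsrows (gstep S g) s) k *m (gsq S g)^T = 0.
  move=> ks; rewrite -(gsq_gstep g hS) trmx_mul gT mulmxA (@gsrows_mul _ s) ?mul0mx //.
  by rewrite mem_nth // size_gsrows.
case: i j => [|i] [|j] //= hi hj.
- by rewrite gsq_unit.
- by rewrite -[LHS]trmxK trmx_mul trmxK off // trmx0 scalemx0 || by rewrite -[LHS]trmxK trmx_mul trmxK off // trmx0 raddf0.
- by rewrite off // raddf0.
- exact: IH.
Qed.

Lemma gsrows_sum S s : S + \sum_(q <- gsrows S s) q^T *m q = foldl gstep S s.
Proof.
elim: s S => [|g s IH] S /=; first by rewrite big_nil addr0.
by rewrite big_cons addrA IH.
Qed.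

Lemma gsrows_map (V : 'M[R]_n) S s : V *m V^T = 1%:M ->
  gsrows (V^T *m S *m V) [seq tmul g V | g <- s] = [seq q *m V | q <- gsrows S s].
Proof. by move=> hV; elim: s S => //= g s IH S; rewrite gstep_orth // IH gsq_orth. Qed.

Definition gsmx k (G : k.-tuple (n.-tuple R)) : 'M[R]_(k, n) := \matrix_(i, j) (nth 0 (gsrows 0 G) i) 0 j.

Lemma row_gsmx k (G : k.-tuple (n.-tuple R)) i : row i (gsmx G) = nth 0 (gsrows 0 G) i.
Proof. by apply/rowP => j; rewrite !mxE. Qed.

Lemma gsmx_frame k (G : k.-tuple (n.-tuple R)) : gsall gsnd 0 G -> gsmx G *m (gsmx G)^T = 1%:M.
Proof.
move=> hG; apply/matrixP => i j.
transitivity ((row i (gsmx G) *m (row j (gsmx G))^T) 0 0).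
  by rewrite !mxE; apply: eq_bigr => k' _; rewrite !mxE.
by rewrite !row_gsmx gsrows_orth ?size_tuple //; [rewrite !mxE mulr1n|exact: projm0].
Qed.

Lemma gsmx_proj k (G : k.-tuple (n.-tuple R)) : (gsmx G)^T *m gsmx G = foldl gstep 0 G.
Proof.
rewrite -[RHS]gsrows_sum add0r (big_nth 0) size_gsrows size_tuple big_mkord.
apply/matrixP => a b; rewrite mxE summxE; apply: eq_bigr => i _.
by rewrite !mxE big_ord_recl big_ord0 addr0 !mxE.
Qed.

(** Gram-Schmidt commutes with rotations acting on the right. Both the invariance of the law of the
    span and [gsconj_grass] rest on this. *)
Lemma gsmx_orth k (V : 'M[R]_n) (G : k.-tuple (n.-tuple R)) : V *m V^T = 1%:M ->
  gsmx [tuple tmul (tnth G i) V | i < k] = gsmx G *m V.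
Proof.
move=> hV; apply/row_matrixP => i; rewrite row_gsmx row_mul row_gsmx.
have -> : [tuple tmul (tnth G i) V | i < k] = [seq tmul g V | g <- G] :> seq _.
  rewrite -[RHS]/(tval [tuple of [seq tmul g V | g <- G]]); congr tval.
  by apply: eq_from_tnth => j; rewrite tnth_mktuple tnth_map.
have V0 : V^T *m 0 *m V = 0 by rewrite mulmx0 mul0mx.
have := gsrows_map 0 G hV; rewrite V0 => ->.
by rewrite (nth_map 0) // size_gsrows size_tuple.
Qed.

End GramSchmidt.

Section GramSchmidtMeasurable.
Context (R : realType) (n : nat).

Section Fixed.
Context d (T : measurableType d).
Implicit Types (F : T -> 'M[R]_n) (h : T -> n.-tuple R).

Lemma mxm_gsp F h : mxm F -> measurable_fun setT h -> mxm (fun x => gsp (F x) (h x)).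
Proof.
move=> mF mh; apply: mxm_mul; first exact: mxm_rv_of.
by apply: mxm_add; [exact: mxm_cst|exact: mxm_opp].
Qed.

Lemma mxm_gsq F h : mxm F -> measurable_fun setT h -> mxm (fun x => gsq (F x) (h x)).
Proof.
move=> mF mh; have mp := mxm_gsp mF mh; apply: mxm_scale => //.
have mm := mxm_mul mp (mxm_tr mp) 0 0.
apply: measurable_invf => [|x]; last exact: sqrtr_ge0.
by apply: measurable_sqrtf => // x; exact: rv_sqr_ge0.
Qed.

Lemma mxm_gstep F h : mxm F -> measurable_fun setT h -> mxm (fun x => gstep (F x) (h x)).
Proof. by move=> mF mh; have mq := mxm_gsq mF mh; apply: mxm_add => //; apply: mxm_mul => //; exact: mxm_tr. Qed.

Lemma measurable_gsnd F h : mxm F -> measurable_fun setT h -> measurable_fun setT (fun x => gsnd (F x) (h x)).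
Proof.
move=> mF mh; rewrite /gsnd.
have mm := mxm_eq0 (mxm_gsp mF mh).
apply: (measurable_fun_bool true); rewrite setTI.
rewrite (_ : _ @^-1` _ = ~` [set x | gsp (F x) (h x) = 0]); first exact: measurableC.
by apply/seteqP; split => x /=; [move=> /eqP|move=> /eqP].
Qed.

Lemma measurable_theadf k (f : T -> k.+1.-tuple (n.-tuple R)) : measurable_fun setT f -> measurable_fun setT (fun x => thead (f x)).
Proof. by move=> /measurable_fun_tnthP /(_ ord0). Qed.

Lemma measurable_behead k (f : T -> k.+1.-tuple (n.-tuple R)) : measurable_fun setT f -> measurable_fun setT (fun x => [tuple of behead (f x)]).
Proof.
move=> /measurable_fun_tnthP mf; apply/measurable_fun_tnthP => i.
rewrite (_ : _ \o _ = fun x => tnth (f x) (lift ord0 i)); first exact: mf.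
by apply/funext => x /=; rewrite tnth_behead; congr tnth; apply: ord_inj; rewrite inordK // ltnS ltn_ord.
Qed.

Lemma measurable_gsall (B : 'M[R]_n -> n.-tuple R -> bool) k F (f : T -> k.-tuple (n.-tuple R)) :
  (forall F h, mxm F -> measurable_fun setT h -> measurable_fun setT (fun x => B (F x) (h x))) ->
  mxm F -> measurable_fun setT f -> measurable_fun setT (fun x => gsall B (F x) (f x)).
Proof.
move=> mB; elim: k F f => [|k IH] F f mF mf.
  by rewrite (_ : (fun x => _) = fun _ => true) //; apply/funext => x; rewrite tuple0.
rewrite (_ : (fun x => _) = fun x => B (F x) (thead (f x)) && gsall B (gstep (F x) (thead (f x))) [tuple of behead (f x)]).
  have mt := measurable_theadf mf.
  apply: measurable_and; first exact: mB.
  by apply: IH; [exact: mxm_gstep|exact: measurable_behead].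
by apply/funext => x; rewrite {1}(tuple_eta (f x)).
Qed.

Lemma mxm_gsS k F (f : T -> k.-tuple (n.-tuple R)) :
  mxm F -> measurable_fun setT f -> mxm (fun x => foldl (@gstep R n) (F x) (f x)).
Proof.
elim: k F f => [|k IH] F f mF mf.
  by rewrite (_ : (fun x => _) = F) //; apply/funext => x; rewrite tuple0.
rewrite (_ : (fun x => _) = fun x => foldl (@gstep R n) (gstep (F x) (thead (f x))) [tuple of behead (f x)]).
  by apply: IH; [apply: mxm_gstep => //; exact: measurable_theadf|exact: measurable_behead].
by apply/funext => x; rewrite {1}(tuple_eta (f x)).
Qed.

Lemma mxm_gsrows k i F (f : T -> k.-tuple (n.-tuple R)) :
  mxm F -> measurable_fun setT f -> mxm (fun x => nth 0 (gsrows (F x) (f x)) i).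
Proof.
elim: k i F f => [|k IH] i F f mF mf.
  by rewrite (_ : (fun x => _) = fun _ => 0); [exact: mxm_cst|apply/funext => x; rewrite tuple0 nth_nil].
case: i => [|i].
  rewrite (_ : (fun x => _) = fun x => gsq (F x) (thead (f x))).
    by apply: mxm_gsq => //; exact: measurable_theadf.
  by apply/funext => x; rewrite {1}(tuple_eta (f x)).
rewrite (_ : (fun x => _) = fun x => nth 0 (gsrows (gstep (F x) (thead (f x))) [tuple of behead (f x)]) i).
  by apply: IH; [apply: mxm_gstep => //; exact: measurable_theadf|exact: measurable_behead].
by apply/funext => x; rewrite {1}(tuple_eta (f x)).
Qed.

Lemma mxm_gsmx k (f : T -> k.-tuple (n.-tuple R)) : measurable_fun setT f -> mxm (fun x => gsmx (f x)).
Proof.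
move=> mf i j; rewrite (_ : (fun x => _) = fun x => nth 0 (gsrows 0 (f x)) i 0 j).
  exact: (mxm_gsrows i (mxm_cst (0 : 'M[R]_n)) mf).
by apply/funext => x; rewrite mxE.
Qed.

End Fixed.

Context (w : R).
Local Notation N := (pw (@gau R w) n).

(* Step i is taken conditionally on S, the projection onto the span of the previous vectors. *)
Lemma gsall_prob (B : 'M[R]_n -> n.-tuple R -> bool) (r k : nat) (e : R) (S : 'M[R]_n) :
  (forall d (T : measurableType d) (F : T -> 'M[R]_n) h, mxm F -> measurable_fun setT h ->
     measurable_fun setT (fun x => B (F x) (h x))) ->
  (forall S, projm S -> \tr S < r%:R -> (\int[N]_g ((~~ B S g)%:R%:E : \bar R) <= e%:E)%E) -> 0 <= e ->
  projm S -> \tr S + k%:R <= r%:R ->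
  (\int[pw N k]_G ((~~ gsall B S G)%:R%:E : \bar R) <= (k%:R * e)%:E)%E.
Proof.
move=> mB hB e0.
have N1 : N setT = 1%E by apply: pw_setT; exact: gau_setT.
have mb := @measurable_negbE.
elim: k S => [|k IH] S hS tS.
  by rewrite integral_pw0 /= mul0r.
have mg k' d (T : measurableType d) F (f : T -> k'.-tuple (n.-tuple R)) : mxm F -> measurable_fun setT f ->
    measurable_fun setT (fun x => (~~ gsall B (F x) (f x))%:R%:E : \bar R).
  by move=> mF mf; apply: mb; apply: measurable_gsall => //; exact: mB.
have b0 (b : bool) : (0 <= (b%:R : R)%:E)%E by rewrite lee_fin ler0n.
rewrite ge0_integral_pwS; [|apply: mg; [exact: mxm_cst|exact: measurable_id]|by move=> x; exact: b0].
have mBS : measurable_fun setT (fun g => (~~ B S g)%:R%:E : \bar R).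
  by apply: mb; apply: mB; [exact: mxm_cst|exact: measurable_id].
apply: (@le_trans _ _ (\int[N]_g ((~~ B S g)%:R%:E + (k%:R * e)%:E))%E); last first.
  rewrite ge0_DT //; last by move=> x; rewrite lee_fin mulr_ge0.
  rewrite integral_prob_cst // -natr1 mulrDl mul1r [k%:R * e + e]addrC EFinD; apply: leeD2r.
  apply: hB => //; apply: lt_le_trans tS; rewrite ltrDl ltr0n //.
apply: ge0_leT.
- apply: (measurable_integral_cons (pw (@gau R w) n) (f := fun G => (~~ gsall B S G)%:R%:E)) => //.
  by apply: mg; [exact: mxm_cst|exact: measurable_id].
- by apply: emeasurable_funD.
- by move=> g; exact: integral_ge0.
move=> g.
have mgg : measurable_fun setT (fun G : k.-tuple (n.-tuple R) => (~~ gsall B (gstep S g) G)%:R%:E : \bar R).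
  by apply: mg; [exact: mxm_cst|exact: measurable_id].
apply: (@le_trans _ _ (\int[pw N k]_G ((~~ B S g)%:R%:E + (~~ gsall B (gstep S g) G)%:R%:E))%E).
  apply: ge0_leT => //.
  - by rewrite (_ : (fun G => _) = (fun G : k.-tuple (n.-tuple R) => (~~ (B S g && gsall B (gstep S g) G))%:R%:E : \bar R)) //; apply: mb; apply: measurable_and; [exact: measurable_cst|apply: measurable_gsall; [exact: mB|exact: mxm_cst|exact: measurable_id]].
  - by apply: emeasurable_funD.
  - by move=> G /=; rewrite -EFinD lee_fin; case: (B S g); case: gsall; rewrite /= ?addr0 ?add0r // ler_wpDr.
rewrite ge0_DT // integral_prob_cst; last exact: pw_setT.
apply: leeD2l; apply: IH; first exact: gstep_projm.
rewrite gstep_trace; apply: le_trans tS; rewrite -addrA lerD2l -[k.+1]add1n natrD lerD2r.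
by rewrite lern1; case: (_ != _).
Qed.

End GramSchmidtMeasurable.

(** * Uniqueness of the invariant law on the Grassmannian *)

Definition rows_of (R : realType) k n (M : 'M[R]_(k, n)) : k.-tuple (n.-tuple R) := [tuple [tuple M i j | j < n] | i < k].

Section Grassmannian.
Context (R : realType) (n l : nat).
Hypothesis ln : (l <= n)%N.
Implicit Types (t : n.-tuple (n.-tuple R)).

Lemma mx_of_tuple (M : 'M[R]_n) : mx_of (tuple_of_mx M) = M.
Proof. by apply/matrixP => i j; rewrite mxE !tnth_mktuple. Qed.

Lemma mxm_eq d (T : measurableType d) a b (F G : T -> 'M[R]_(a, b)) : mxm F -> mxm G -> measurable [set x | F x = G x].
Proof.
move=> mF mG; rewrite (_ : [set x | _] = [set x | F x - G x = 0]).
  by apply: mxm_eq0; apply: mxm_add => //; exact: mxm_opp.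
by apply/seteqP; split => x /=; [move=> ->; rewrite subrr|move=> /eqP; rewrite subr_eq0 => /eqP].
Qed.

Lemma measurable_grass_set : measurable (@grass_set R n l).
Proof.
rewrite (_ : @grass_set R n l = [set t | (mx_of t)^T = mx_of t] `&` [set t | mx_of t *m mx_of t = mx_of t] `&` [set t | (\tr (mx_of t))%:M = l%:R%:M :> 'M[R]_(1, 1)]).
  have mi := @measurable_id _ (n.-tuple (n.-tuple R)) setT.
  have mm := mxm_mx_of mi.
  apply: measurableI; first apply: measurableI.
  - by apply: mxm_eq => //; exact: mxm_tr.
  - by apply: mxm_eq => //; exact: mxm_mul.
  apply: mxm_eq; last exact: mxm_cst.
  move=> i j; rewrite (_ : (fun x => _) = fun x => \sum_k (mx_of x) k k); first by apply: measurable_sum => k; exact: mm.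
  by apply/funext => x; rewrite mxE !ord1 mulr1n.
apply/seteqP; split => t /=; rewrite /grass_set /= is_orth_projP.
  by move=> [[h1 h2] ->].
by move=> [[h1 h2]] /matrixP /(_ 0 0); rewrite !mxE !mulr1n => h3; split.
Qed.

Context (w : R).
Hypothesis w0 : 0 < w.
Local Notation N := (pw (@gau R w) n).

(** On the event that g lies in the span, exp(c |g (1 - S)|^2) equals 1 for every c, whereas its
    mean (1 - 2 c w)^(- rank / 2) tends to 0 as c tends to minus infinity. *)
Lemma gsnd_prob (S : 'M[R]_n) : projm S -> \tr S < n%:R -> (\int[N]_g ((~~ gsnd S g)%:R%:E : \bar R) <= 0)%E.
Proof.
move=> hS tS; have [ST SS] := hS.
have hS' : projm (1%:M - S).
  split; first by rewrite linearB /= trmx1 ST.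
  by rewrite mulmxBl mul1mx mulmxBr mulmx1 SS subrr subr0.
have r0 : (0 < \rank (1%:M - S)%R)%N.
  rewrite -(ltr_nat R) -projm_rank_trace // linearB /= mxtrace1 subr_gt0 //.
apply/lee_addgt0Pr => e0 e0gt; rewrite add0e.
pose e := Num.min e0 1; have e_gt0 : 0 < e by rewrite lt_min e0gt ltr01.
have e1 : e <= 1 by rewrite ge_min lexx orbT.
(* Then 1 - 2 c w = 1 + 1 / e^2, so a single factor of the mean is already at most e. *)
pose c := - (2 * w * e ^+ 2)^-1.
have ew : 0 < 2 * w * e ^+ 2 by rewrite !mulr_gt0 ?exprn_gt0.
have cw : 1 - 2 * c * w = 1 + (e ^+ 2)^-1 by rewrite /c; field; rewrite !gt_eqF.
have cw1 : 2 * c * w < 1 by rewrite -subr_gt0 cw addr_gt0 ?invr_gt0 ?exprn_gt0.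
apply: (@le_trans _ _ (\int[N]_g (expR (c * nsq (tmul g (1%:M - S))))%:E)%E).
  apply: ge0_leT.
  - by apply: measurable_negbE; apply: measurable_gsnd; [exact: mxm_cst|exact: measurable_id].
  - have mt := measurable_tmul (1%:M - S); mR.
  - by move=> g; rewrite lee_fin ler0n.
  move=> g; rewrite lee_fin /gsnd negbK; have [h|h] := eqVneq (gsp S g) 0; last by rewrite expR_ge0.
  by rewrite nsq_mxE rv_of_tmul -/(gsp S g) h mul0mx mxE mulr0 expR0.
rewrite gaun_projm_expR // lee_fin cw.
have s1 : e^-1 <= Num.sqrt (1 + (e ^+ 2)^-1).
  rewrite -[leLHS]ger0_norm ?invr_ge0 ?(ltW e_gt0) // -sqrtr_sqr; apply: ler_wsqrtr; by rewrite exprVn lerDr.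
have s0 : 0 < Num.sqrt (1 + (e ^+ 2)^-1) by apply: lt_le_trans s1; rewrite invr_gt0.
have ie : (Num.sqrt (1 + (e ^+ 2)^-1))^-1 <= e.
  by rewrite -[leRHS]invrK lef_pV2 // posrE invr_gt0.
have i0 : 0 <= (Num.sqrt (1 + (e ^+ 2)^-1))^-1 by rewrite invr_ge0 sqrtr_ge0.
apply: (@le_trans _ _ e); last by rewrite ge_min lexx.
apply: le_trans ie; rewrite -(prednK r0) exprS ler_piMr // exprn_ile1 //.
by apply: le_trans e1; rewrite -[leRHS]invrK lef_pV2 // posrE invr_gt0.
Qed.

Lemma gsnd_all k : (k <= n)%N -> (\int[pw N k]_G ((~~ gsall (@gsnd R n) 0 G)%:R%:E : \bar R) = 0)%E.
Proof.
move=> kn; apply/eqP; rewrite eq_le; apply/andP; split; last by apply: integral_ge0 => G _; rewrite lee_fin ler0n.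
have H := @gsall_prob R n w (@gsnd R n) n k 0 0; rewrite mulr0 in H; apply: H.
- by move=> d T F h; exact: measurable_gsnd.
- exact: gsnd_prob.
- exact: lexx.
- exact: projm0.
- by rewrite mxtrace0 add0r ler_nat.
Qed.

Lemma frame_pid (U : 'M[R]_(l, n)) (V : 'M[R]_n) : (forall (i : 'I_l) (j : 'I_n), i = j :> nat -> row j V = row i U) ->
  U = (pid_mx l : 'M[R]_(l, n)) *m V.
Proof.
move=> h; apply/matrixP => i a; rewrite mxE (bigD1 (widen_ord ln i)) //= big1; last first.
  by move=> j ji; rewrite mxE; case: eqP => [e|]; [case/eqP: ji; apply: ord_inj; rewrite -e|rewrite mul0r].
rewrite addr0 mxE /= eqxx ltn_ord mul1r.
by have /rowP /(_ a) := h i (widen_ord ln i) erefl; rewrite !mxE.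
Qed.

Local Notation E0 := ((pid_mx l : 'M[R]_(l, n))^T *m (pid_mx l : 'M[R]_(l, n))).

(** The indicator of A at O M O^T for the random rotation O = [gsmx G]. The first factor discards
    the null set of G for which Gram-Schmidt does not produce an orthogonal matrix. *)
Definition gsconj (A : set (n.-tuple (n.-tuple R))) (M : 'M[R]_n) (G : n.-tuple (n.-tuple R)) : \bar R :=
  ((gsmx G *m (gsmx G)^T == 1%:M)%:R * \1_A (tuple_of_mx (gsmx G *m M *m (gsmx G)^T)))%:E.

Lemma gsconj_ge0 A M G : (0 <= gsconj A M G)%E.
Proof. by rewrite lee_fin mulr_ge0 // indicE ler0n. Qed.

Lemma measurable_gsconj d (T : measurableType d) A (F : T -> 'M[R]_n) (f : T -> n.-tuple (n.-tuple R)) :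
  measurable A -> mxm F -> measurable_fun setT f -> measurable_fun setT (fun x => gsconj A (F x) (f x)).
Proof.
move=> mA mF mf; have mH := mxm_gsmx mf; apply/measurable_EFinP; apply: measurable_funM.
  rewrite (_ : (fun x => _) = \1_[set x | gsmx (f x) *m (gsmx (f x))^T = 1%:M]).
    apply: measurable_indic; apply: mxm_eq; last exact: mxm_cst.
    by apply: mxm_mul => //; exact: mxm_tr.
  apply/funext => x; rewrite indicE; congr (_%:R); apply: congr1; apply/eqP/idP => [h|]; first by rewrite inE.
  by rewrite inE.
apply: (measurableT_comp (measurable_indic mA : measurable_fun setT (\1_A : _ -> R))).
by apply: mxm_tuple; apply: mxm_mul; [apply: mxm_mul|exact: mxm_tr].
Qed.

(** M is V^T E0 V for an orthogonal V, where E0 is the coordinate projection of rank l. Multiplying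
    the rows of G by V^T does not change the law of G and multiplies [gsmx G] by V^T. *)
Lemma gsconj_grass A (M : 'M[R]_n) : measurable A -> is_orth_proj l M ->
  (\int[pw N n]_G gsconj A M G = \int[pw N n]_G gsconj A E0 G)%E.
Proof.
move=> mA /is_orth_projP[/projm_frame[r [U [hU hM]]] tM].
have rl : r = l by apply/eqP; rewrite -(eqr_nat R) -(frame_trace hU) hM tM.
subst r; have [V [hV rV]] := frame_to_orth hU.
have UV := frame_pid rV.
have hVT : V^T *m V^T^T = 1%:M by rewrite trmxK; exact: mulmx1C.
rewrite -[RHS](ge0_integral_gaumat_orth w0 hVT); last 2 first.
- by apply: measurable_gsconj => //; exact: mxm_cst.
- by move=> x; exact: gsconj_ge0.
apply: eq_integral => G _; rewrite /gsconj gsmx_orth // trmx_mul trmxK.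
have -> : gsmx G *m V^T *m (V *m (gsmx G)^T) = gsmx G *m (gsmx G)^T.
  by rewrite mulmxA -(mulmxA _ V^T) (mulmx1C hV) mulmx1.
congr ((_ * \1_A (tuple_of_mx _))%:E).
by rewrite -hM UV trmx_mul !mulmxA.
Qed.

(* Averaging over a random rotation turns the indicator of A into a function that is constant on the Grassmannian;
   its integral with respect to an invariant probability does not depend on that probability. *)
Lemma grass_unique d (W : measurableType d) (P : {sigma_finite_measure set W -> \bar R}) (Z : W -> n.-tuple (n.-tuple R))
  (A : set (n.-tuple (n.-tuple R))) : P setT = 1%E -> measurable_fun setT Z ->
  P (Z @^-1` (~` @grass_set R n l)) = 0%E ->
  (forall O, orthogonal_mx O -> P ((fun x => tuple_of_mx (O *m mx_of (Z x) *m O^T)) @^-1` A) = P (Z @^-1` A)) ->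
  measurable A ->
  P (Z @^-1` A) = (\int[pw N n]_G gsconj A E0 G)%E.
Proof.
move=> P1 mZ Zg Zi mA.
have mgZ : measurable (Z @^-1` (~` @grass_set R n l)).
  by rewrite -[X in measurable X]setTI; apply: mZ => //; apply: measurableC; exact: measurable_grass_set.
have mpre (O : 'M[R]_n) : measurable ((fun x => tuple_of_mx (O *m mx_of (Z x) *m O^T)) @^-1` A).
  rewrite -[X in measurable X]setTI; suff : measurable_fun setT (fun x => tuple_of_mx (O *m mx_of (Z x) *m O^T)) by apply.
  by apply: mxm_tuple; apply: mxm_mul; [apply: mxm_mul; [exact: mxm_cst|exact: mxm_mx_of]|exact: mxm_cst].
have NN1 : pw N n setT = 1%E by apply: pw_setT; apply: pw_setT; exact: gau_setT.
have mI : measurable_fun setT (fun z : W * n.-tuple (n.-tuple R) => gsconj A (mx_of (Z z.1)) z.2).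
  apply: measurable_gsconj => //; apply: mxm_mx_of; exact: (measurableT_comp mZ measurable_fst).
transitivity (\int[P]_x \int[pw N n]_G gsconj A (mx_of (Z x)) G)%E; last first.
  transitivity (\int[P]_x (\int[pw N n]_G gsconj A E0 G))%E; last by rewrite integral_prob_cst // => *; exact: integral_ge0.
  apply: ae_eq_integral => //.
  - by apply: (@measurable_int2 _ _ _ _ _ (pw N n) (fun x G => gsconj A (mx_of (Z x)) G)) => [|*]; [exact: mI|exact: gsconj_ge0].
  exists (Z @^-1` (~` @grass_set R n l)); split => // x /= h g; apply: h => _.
  exact: gsconj_grass.
(* With the integrals exchanged, G is fixed and the invariance under the single rotation [gsmx G]
   applies. *)
rewrite ge0_swap //; last by move=> *; exact: gsconj_ge0.
pose ok (G : n.-tuple (n.-tuple R)) : R := (gsmx G *m (gsmx G)^T == 1%:M)%:R.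
have mok : measurable_fun setT (fun G => (ok G)%:E).
  have := @measurable_gsconj _ _ setT (fun _ => 0) id measurableT (mxm_cst (0 : 'M[R]_n)) (@measurable_id _ _ setT).
  apply: eq_measurable_fun => G _; rewrite /gsconj indicT mulr1 //.
transitivity (\int[pw N n]_G ((ok G)%:E * P (Z @^-1` A)))%E.
  have mZA : measurable (Z @^-1` A) by rewrite -[X in measurable X]setTI; exact: mZ.
  have PA1 : (P (Z @^-1` A) <= 1)%E by rewrite -P1; apply: le_measure => //; rewrite inE.
  have [p hp p0] : exists2 p : R, P (Z @^-1` A) = p%:E & 0 <= p.
    have PA0 := measure_ge0 P (Z @^-1` A); exists (fine (P (Z @^-1` A))); last exact: fine_ge0.
    by rewrite fineK // ge0_fin_numE //; apply: le_lt_trans PA1 _; rewrite ltry.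
  have ok0 G : (0 <= (ok G)%:E)%E by rewrite lee_fin ler0n.
  rewrite hp ge0_ZrT //; suff -> : (\int[pw N n]_G (ok G)%:E = 1)%E by rewrite mul1e.
  apply/eqP; rewrite eq_le; apply/andP; split.
    rewrite -[leRHS](integral_prob_cst 1%E NN1); apply: ge0_leT => //; by move=> G; rewrite lee_fin /ok lern1 leq_b1.
  have mb : measurable_fun setT (fun G : n.-tuple (n.-tuple R) => (~~ gsall (@gsnd R n) 0 G)%:R%:E : \bar R).
    apply: measurable_negbE; apply: measurable_gsall; [|exact: mxm_cst|exact: measurable_id].
    by move=> *; exact: measurable_gsnd.
  have b0 (G : n.-tuple (n.-tuple R)) : (0 <= (~~ gsall (@gsnd R n) 0 G)%:R%:E :> \bar R)%E by rewrite lee_fin ler0n.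
  rewrite -[leLHS](integral_prob_cst 1%E NN1) -[leRHS]adde0 -(gsnd_all (leqnn n)) -ge0_DT //.
  apply: ge0_leT => //; first exact: emeasurable_funD.
  move=> G; rewrite -EFinD lee_fin /ok; case E : gsall; last by rewrite lerDr ler0n.
  by rewrite gsmx_frame // eqxx addr0.
apply: eq_integral => G _; rewrite /gsconj -/(ok G).
have [h|h] := eqVneq (gsmx G *m (gsmx G)^T) 1%:M; last first.
  rewrite /ok (negbTE h) mul0e; under eq_integral do rewrite mul0r.
  by rewrite integral0.
rewrite /ok h eqxx mul1e -(Zi _ h).
under [RHS]eq_integral do rewrite mul1r.
transitivity (\int[P]_x (\1_((fun x => tuple_of_mx (gsmx G *m mx_of (Z x) *m (gsmx G)^T)) @^-1` A) x : R)%:E)%E.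
  by rewrite integral_indic // setIT.
by apply: eq_integral => x _; rewrite !indicE.
Qed.

End Grassmannian.

(** * Gram-Schmidt moves a Gaussian matrix very little *)

Section GramSchmidtClose.
Context (R : realType) (n : nat).
Local Notation gau := (@gau R).

Definition gsgood (e : R) (S : 'M[R]_n) (g : n.-tuple R) : bool :=
  (nsq (tmul g S) <= e) && (`|nsq g - 1| <= e).

Lemma nsq_rv (x : n.-tuple R) (u : 'rV[R]_n) : rv_of x = u -> nsq x = (u *m u^T) 0 0.
Proof. by move=> <-; exact: nsq_mxE. Qed.

(** With s = |gsp S g|, the difference has squared length (1 - s)^2 + |g S|^2 by orthogonality. Here
    s^2 = |g|^2 - |g S|^2 is within 2 e of 1, and (1 - s)^2 <= (1 - s^2)^2 <= 4 e^2. *)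
Lemma gsq_close (e : R) S (g : n.-tuple R) : 0 <= e <= 1 -> projm S -> gsnd S g -> gsgood e S g ->
  ((gsq S g - rv_of g) *m (gsq S g - rv_of g)^T) 0 0 <= 5 * e.
Proof.
move=> /andP[e0 e1] hS hnd /andP[h1 h2]; have [ST SS] := hS.
have pq : (gsp S g *m (gsp S g)^T) 0 0 = nsq g - nsq (tmul g S).
  have PT : (1%:M - S)^T = 1%:M - S by rewrite linearB /= trmx1 ST.
  have PP : (1%:M - S) *m (1%:M - S) = 1%:M - S by rewrite mulmxBl mul1mx mulmxBr mulmx1 SS subrr subr0.
  have -> : gsp S g *m (gsp S g)^T = rv_of g *m (rv_of g)^T - rv_of g *m S *m (rv_of g)^T.
    by rewrite /gsp trmx_mul PT mulmxA -(mulmxA (rv_of g)) PP mulmxBr mulmx1 mulmxBl.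
  rewrite mxE [X in _ + X]mxE -nsq_mxE; congr (_ - _).
  by rewrite nsq_mxE rv_of_tmul trmx_mul ST mulmxA -(mulmxA (rv_of g) S S) SS.
set p := gsp S g; set a := (p *m p^T) 0 0.
have a0 : 0 < a.
  rewrite lt_neqAle rv_sqr_ge0 andbT eq_sym; apply: contra hnd => /eqP /rv_sqr_eq0 h; rewrite /gsnd -/p h //.
set s := Num.sqrt a; have s0 : 0 < s by rewrite sqrtr_gt0.
have ss : s ^+ 2 = a by rewrite sqr_sqrtr // ltW.
have gE : rv_of g = p + rv_of (tmul g S) by rewrite /p /gsp rv_of_tmul mulmxBr mulmx1 subrK.
have pS : p *m (rv_of (tmul g S))^T = 0.
  by rewrite rv_of_tmul trmx_mul ST mulmxA gsp_mulS // mul0mx.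
have pS' : rv_of (tmul g S) *m p^T = 0 by rewrite -[LHS]trmxK trmx_mul trmxK pS trmx0.
have -> : gsq S g - rv_of g = (s^-1 - 1) *: p - rv_of (tmul g S).
  by rewrite /gsq -/p -/a -/s gE opprD addrA scalerBl scale1r.
rewrite linearB /= linearZ /= mulmxBl !mulmxBr -!scalemxAl -!scalemxAr pS pS' !scaler0 sub0r subr0 opprK.
rewrite scalerA mxE -nsq_mxE [X in X + _]mxE -/a.
have -> : (s^-1 - 1) * (s^-1 - 1) * a = (1 - s) ^+ 2 by rewrite -ss; field; rewrite gt_eqF.
have n0 : 0 <= nsq (tmul g S) by exact: nsq_ge0.
move: pq; rewrite -/p -/a => pq.
move: h2; rewrite ler_norml => /andP[h2 h3].
have hs : (1 - s) ^+ 2 <= (1 - a) ^+ 2.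
  rewrite -ss -subr_ge0 (_ : _ - _ = (1 - s) ^+ 2 * (s * (2 + s))); last by ring.
  by apply: mulr_ge0; rewrite ?sqr_ge0 //; apply: mulr_ge0; [exact: ltW|apply: addr_ge0 => //; exact: ltW].
have ha : (1 - a) ^+ 2 <= 4 * e ^+ 2.
  rewrite (_ : 4 * _ = (2 * e) ^+ 2); last by ring.
  rewrite -[leLHS]real_normK ?num_real // lerXn2r ?nnegrE ?mulr_ge0 //.
  rewrite ler_norml; apply/andP; split; lra.
have ee : e ^+ 2 <= e by rewrite expr2 ler_piMl.
lra.
Qed.

Lemma gsmx_close (e : R) k (G : k.-tuple (n.-tuple R)) : 0 <= e <= 1 -> gsall (@gsnd R n) 0 G -> gsall (gsgood e) 0 G ->
  gdist (rows_of (gsmx G)) G <= k%:R * (5 * e).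
Proof.
move=> he.
have H (s : seq (n.-tuple R)) S : projm S -> gsall (@gsnd R n) S s -> gsall (gsgood e) S s -> forall i, (i < size s)%N ->
   let d := nth 0 (gsrows S s) i - nth 0 [seq rv_of g | g <- s] i in (d *m d^T) 0 0 <= 5 * e.
  elim: s S => // g s IH S hS /= /andP[h1 h2] /andP[h3 h4] [_|i].
    exact: gsq_close.
  by rewrite ltnS => /(IH _ (gstep_projm g hS) h2 h4).
move=> h1 h2; rewrite /gdist -[k in k%:R]card_ord mulr_natl -sumr_const; apply: ler_sum => i _.
have := H _ _ (@projm0 R n) h1 h2 i; rewrite size_tuple => /(_ (ltn_ord i)) /=.
rewrite (nth_map (tnth G i)) ?size_tuple // -tnth_nth => h.
apply: le_trans h; rewrite (@nsq_rv _ (nth 0 (gsrows 0 G) i - rv_of (tnth G i))) //.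
rewrite rv_of_tsub; congr (_ - _); rewrite -row_gsmx.
by apply/rowP => j; rewrite !mxE /rows_of !tnth_mktuple mxE.
Qed.

Lemma rank_pow (S : 'M[R]_n) (r : nat) (w : R) : projm S -> \tr S < r%:R ->
  (Num.sqrt (1 - 2^-1))^-1 ^+ (\rank S) <= 2 ^+ r :> R.
Proof.
move=> hS; rewrite projm_rank_trace // ltr_nat => rr.
have h1 : (Num.sqrt (1 - 2^-1))^-1 <= 2 :> R.
  have -> : (1 - 2^-1 : R) = 2^-1 by field.
  rewrite -[leRHS]invrK lef_pV2 ?posrE ?sqrtr_gt0 ?invr_gt0 //.
  rewrite -[leLHS]ger0_norm // -sqrtr_sqr; apply: ler_wsqrtr; lra.
apply: (@le_trans _ _ (2 ^+ \rank S)).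
  by rewrite lerXn2r // nnegrE // invr_ge0 sqrtr_ge0.
by rewrite ler_weXn2l // ?ler1n // ltnW.
Qed.

Lemma nsq_tmul_tail (S : 'M[R]_n) (w c a K : R) : 0 < w -> 2 * c * w < 1 -> projm S ->
  (Num.sqrt (1 - 2 * c * w))^-1 ^+ (\rank S) <= K ->
  (pw (gau w) n [set g | a <= c * nsq (tmul g S)]%R <= (expR (- a) * K)%:E)%E.
Proof.
move=> w0 cw hS hK.
have mt := measurable_tmul S.
have mf : measurable_fun setT (fun g : n.-tuple R => c * nsq (tmul g S)) by mR.
have mA : measurable [set g : n.-tuple R | a <= c * nsq (tmul g S)].
  rewrite (_ : [set _ | _] = (fun g : n.-tuple R => c * nsq (tmul g S)) @^-1` `[a, +oo[).
    by rewrite -[X in measurable X]setTI; apply: mf.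
  by apply/seteqP; split => g /=; rewrite in_itv /= andbT.
have me : measurable_fun setT (fun g : n.-tuple R => (expR (c * nsq (tmul g S)))%:E).
  by apply/measurable_EFinP; apply: measurableT_comp.
rewrite expRN.
have {}H : ((expR a)%:E * pw (gau w) n [set g | (a <= c * nsq (tmul g S))%R] <= K%:E)%E.
  apply: (@le_trans _ _ (\int[pw (gau w) n]_g (expR (c * nsq (tmul g S)))%:E)%E); last by rewrite gaun_projm_expR.
  apply: le_mul_measure => //; by move=> g /= h; rewrite lee_fin ler_expR.
rewrite EFinM.
have -> : pw (gau w) n [set g | (a <= c * nsq (tmul g S))%R] = ((expR a)^-1%:E * ((expR a)%:E * pw (gau w) n [set g | (a <= c * nsq (tmul g S))%R]))%E.
  by rewrite muleA -EFinM mulVf ?mul1e // gt_eqF // expR_gt0.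
by apply: lee_wpmul2l => //; rewrite lee_fin invr_ge0 expR_ge0.
Qed.

Lemma invr_sqrt_le_expR (a u : R) : expR (- u) <= a -> (Num.sqrt a)^-1 <= expR (u / 2).
Proof.
move=> h; have a0 : 0 < a by apply: lt_le_trans h; exact: expR_gt0.
rewrite -[leRHS]invrK -expRN lef_pV2 ?posrE ?sqrtr_gt0 ?expR_gt0 //.
rewrite -[leLHS]ger0_norm ?expR_ge0 // -sqrtr_sqr; apply: ler_wsqrtr.
by rewrite expr2 -expRD -opprD -splitr.
Qed.

Lemma tail_up (s : R) : 0 < s <= 1 / 2 -> (Num.sqrt (1 - s))^-1 <= expR ((s + 2 * s ^+ 2) / 2).
Proof.
move=> /andP[s0 s1]; apply: invr_sqrt_le_expR; rewrite expRN.
have h : 1 + (s + 2 * s ^+ 2) <= expR (s + 2 * s ^+ 2) by exact: expR_ge1Dx.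
have h1 : 1 <= (1 - s) * (1 + (s + 2 * s ^+ 2)).
  rewrite (_ : (1 - s) * (1 + (s + 2 * s ^+ 2)) = 1 + s ^+ 2 * (1 - 2 * s)); last by ring.
  by rewrite lerDl mulr_ge0 ?sqr_ge0 //; lra.
rewrite -[leLHS]mul1r ler_pdivrMr ?expR_gt0 //; apply: le_trans h1 _.
by rewrite ler_wpM2l //; lra.
Qed.

Lemma tail_down (s : R) : 0 < s <= 1 / 2 -> (Num.sqrt (1 + s))^-1 <= expR ((s ^+ 2 - s) / 2).
Proof.
move=> /andP[s0 s1]; apply: invr_sqrt_le_expR.
have h : 1 + (s ^+ 2 - s) <= expR (s ^+ 2 - s) by exact: expR_ge1Dx.
have h0 : 0 < 1 + (s ^+ 2 - s).
  rewrite (_ : _ + _ = (1 - s) + s ^+ 2); last by ring.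
  by apply: ltr_wpDr; [exact: sqr_ge0|lra].
have h1 : 1 <= (1 + s) * (1 + (s ^+ 2 - s)).
  rewrite (_ : _ * _ = 1 + s ^+ 3); last by ring.
  by rewrite lerDl exprn_ge0 // ltW.
rewrite expRN -[leLHS]mul1r ler_pdivrMr ?expR_gt0 //; apply: le_trans h1 _.
by rewrite ler_wpM2l //; lra.
Qed.

Lemma mxm_nsq_tmul d (T : measurableType d) (F : T -> 'M[R]_n) h : mxm F -> measurable_fun setT h ->
  measurable_fun setT (fun x => nsq (tmul (h x) (F x))).
Proof.
move=> mF mh; rewrite (_ : (fun x => _) = fun x => ((rv_of (h x) *m F x) *m (rv_of (h x) *m F x)^T) 0 0).
  by have mm := mxm_mul (mxm_rv_of mh) mF; exact: (mxm_mul mm (mxm_tr mm)).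
by apply/funext => x; rewrite nsq_mxE rv_of_tmul.
Qed.

Lemma measurable_gsgood e d (T : measurableType d) (F : T -> 'M[R]_n) h : mxm F -> measurable_fun setT h ->
  measurable_fun setT (fun x => gsgood e (F x) (h x)).
Proof.
move=> mF mh; apply: measurable_and; apply: measurable_fun_ler => //; first exact: mxm_nsq_tmul.
by apply: measurableT_comp => //; mR.
Qed.

Lemma gsgood_prob (e : R) (r : nat) (S : 'M[R]_n) : (0 < n)%N -> 0 < e <= 1 -> projm S -> \tr S < r%:R ->
  (\int[pw (gau n%:R^-1) n]_g ((~~ gsgood e S g)%:R%:E : \bar R) <=
   (2 ^+ r * expR (- (n%:R * e / 4)) + 2 * expR (- (n%:R * e ^+ 2 / 16)))%:E)%E.
Proof.
move=> n0 /andP[e0 e1] hS tS; have nR : 0 < n%:R :> R by rewrite ltr0n.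
have w0 : 0 < n%:R^-1 :> R by rewrite invr_gt0.
pose A c a (S' : 'M[R]_n) := [set g : n.-tuple R | a <= c * nsq (tmul g S')]%R.
have mA c a S' : measurable (A c a S').
  have mt := measurable_tmul S'.
  have mf : measurable_fun setT (fun g : n.-tuple R => c * nsq (tmul g S')) by mR.
  rewrite (_ : A _ _ _ = (fun g : n.-tuple R => c * nsq (tmul g S')) @^-1` `[a, +oo[).
    by rewrite -[X in measurable X]setTI; apply: mf.
  by apply/seteqP; split => g /=; rewrite in_itv /= andbT.
(* The minimiser of s^2 - s e / 2, which is the exponent per dimension that [tail_up] gives for the
   upper tail of |g|^2. *)
pose s : R := e / 4.
have s0 : 0 < s by rewrite /s; lra.
have s1 : s <= 1 / 2 by rewrite /s; lra.
have hs : 0 < s <= 1 / 2 by rewrite s0 s1.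
have rk1 : \rank (1%:M : 'M[R]_n) = n by rewrite mxrank1.
have c1w : 2 * (n%:R / 4) * n%:R^-1 = 2^-1 :> R by field; rewrite gt_eqF.
have c2w : 2 * (n%:R * s / 2) * n%:R^-1 = s by field; rewrite gt_eqF.
have c3w : 2 * (- (n%:R * s / 2)) * n%:R^-1 = - s by field; rewrite gt_eqF.
have T1 : (pw (gau n%:R^-1) n (A (n%:R / 4)%R (n%:R * e / 4)%R S) <= (2 ^+ r * expR (- (n%:R * e / 4)))%:E)%E.
  rewrite [2 ^+ r * _]mulrC; apply: nsq_tmul_tail => //; rewrite c1w; first by lra.
  exact: rank_pow.
have T2 : (pw (gau n%:R^-1) n (A (n%:R * s / 2)%R (n%:R * s / 2 * (1 + e))%R 1%:M) <= (expR (- (n%:R * e ^+ 2 / 16)))%:E)%E.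
  apply: le_trans (@nsq_tmul_tail 1%:M _ _ _ (expR ((s + 2 * s ^+ 2) / 2) ^+ n) w0 _ (@projm1 R n) _) _; rewrite ?c2w.
  - lra.
  - by rewrite rk1 lerXn2r ?nnegrE ?expR_ge0 ?invr_ge0 ?sqrtr_ge0 // tail_up.
  rewrite lee_fin -expRM_natl -expRD ler_expR /s le_eqVlt; apply/orP; left; apply/eqP; by field.
have T3 : (pw (gau n%:R^-1) n (A (- (n%:R * s / 2))%R (- (n%:R * s / 2 * (1 - e)))%R 1%:M) <= (expR (- (n%:R * e ^+ 2 / 16)))%:E)%E.
  apply: le_trans (@nsq_tmul_tail 1%:M _ _ _ (expR ((s ^+ 2 - s) / 2) ^+ n) w0 _ (@projm1 R n) _) _; rewrite ?c3w.
  - lra.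
  - by rewrite opprK rk1 lerXn2r ?nnegrE ?expR_ge0 ?invr_ge0 ?sqrtr_ge0 // tail_down.
  rewrite lee_fin -expRM_natl -expRD ler_expR /s -subr_ge0.
  rewrite (_ : _ - _ = n%:R * e ^+ 2 / 32); last by field.
  by rewrite divr_ge0 // mulr_ge0 ?sqr_ge0 // ltW.
have E (B : set (n.-tuple R)) : measurable B -> pw (gau n%:R^-1) n B = (\int[pw (gau n%:R^-1) n]_x (\1_B x : R)%:E)%E.
  by move=> mB; rewrite integral_indic // setIT.
have mi (B : set (n.-tuple R)) : measurable B -> measurable_fun setT (fun x => (\1_B x : R)%:E).
  by move=> mB; apply/measurable_EFinP; exact: measurable_indic.
have i0 (B : set (n.-tuple R)) x : (0 <= (\1_B x : R)%:E)%E by rewrite lee_fin indicE ler0n.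
rewrite EFinD (_ : 2 * expR _ = expR (- (n%:R * e ^+ 2 / 16)) + expR (- (n%:R * e ^+ 2 / 16))); last by ring.
rewrite EFinD; apply: le_trans (leeD T1 (leeD T2 T3)); rewrite !E //.
rewrite -ge0_DT; [|exact: mi|exact: mi|exact: i0|exact: i0].
rewrite -ge0_DT; [|exact: mi|by apply: emeasurable_funD; exact: mi|exact: i0|by move=> x; apply: adde_ge0; exact: i0].
apply: ge0_leT.
- by apply: measurable_negbE; apply: measurable_gsgood; [exact: mxm_cst|exact: measurable_id].
- by apply: emeasurable_funD; [exact: mi|apply: emeasurable_funD; exact: mi].
- by move=> x; rewrite lee_fin ler0n.
move=> g; rewrite -!EFinD lee_fin !indicE.
have [h|h] := boolP (gsgood e S g); first by rewrite !addr_ge0.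
suff : (g \in A (n%:R / 4) (n%:R * e / 4) S) || (g \in A (n%:R * s / 2) (n%:R * s / 2 * (1 + e)) 1%:M) || (g \in A (- (n%:R * s / 2)) (- (n%:R * s / 2 * (1 - e))) 1%:M).
  by rewrite -!natrD ler_nat; do 3 case: (_ \in _).
have ns : 0 < n%:R * s / 2 by rewrite divr_gt0 // mulr_gt0.
move: h; rewrite /gsgood negb_and -!ltNge => /orP[h|].
  by apply/orP; left; apply/orP; left; rewrite inE /A /= mulrAC ler_pM2l ?divr_gt0 // ltW.
rewrite lter_normr => /orP[h|h].
  apply/orP; left; apply/orP; right; rewrite inE /A /= ler_pM2l // tmul1; move: h; goal_lra.
by apply/orP; right; rewrite inE /A /= mulNr lerN2 ler_pM2l // tmul1; move: h; goal_lra.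
Qed.

End GramSchmidtClose.

(** * Concentration of the overlap on the Grassmannian *)

Section Transfer.
Context (R : realType) (n l : nat) (mu : probability (n.-tuple R) R) (v : R).
Hypothesis ln : (l <= n)%N.
Hypothesis v0 : 0 < v.
Local Notation gau := (@gau R).

(** The quotient of the kernel of [sm] by the standard Gaussian density, both read in a frame of the
    range of M at the coordinates of g and X. Only lengths of projections occur, so the frame
    disappears. *)
Definition tkern (M : 'M[R]_n) (g X : n.-tuple R) : R :=
  (gpdf v 0 / gpdf 1 0) ^+ l * expR (nsq (tmul g M) / 2 - nsq (tmul (tsub g X) M) / (2 * v)).

(* The overlap [ovl] written in terms of the projection alone: the integral over R^l is replaced by one
   over R^n of a function of the projection of g. *)
Definition povl (t : n.-tuple (n.-tuple R)) : \bar R :=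
  (\int[pw (gau 1) n]_g Order.min 1 (\int[mu]_X (tkern (mx_of t) g X)%:E))%E.

Lemma tkern_ge0 M g X : 0 <= tkern M g X.
Proof. by rewrite mulr_ge0 ?expR_ge0 // exprn_ge0 // divr_ge0 // gpdf_ge0. Qed.

Lemma measurable_tkern d (T : measurableType d) (F : T -> 'M[R]_n) g X : mxm F ->
  measurable_fun setT g -> measurable_fun setT X -> measurable_fun setT (fun x => tkern (F x) (g x) (X x)).
Proof.
move=> mF mg mX; rewrite /tkern; apply: measurable_funM => //; apply: measurableT_comp => //.
have m1 := mxm_nsq_tmul mF mg; have m2 := mxm_nsq_tmul mF (measurable_tsubf mg mX).
by apply: measurable_funD; [exact: measurable_funM|apply: measurable_funN; exact: measurable_funM].
Qed.

Lemma measurable_povl : measurable_fun setT povl.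
Proof.
apply: (@measurable_int2 _ _ _ _ _ (pw (gau 1) n) (fun t g => Order.min 1 (\int[mu]_X (tkern (mx_of t) g X)%:E))%E); last first.
  move=> t g; rewrite le_min lee01 /=; apply: integral_ge0 => X _; rewrite lee_fin; exact: tkern_ge0.
apply: measurable_mine => //.
apply: (@measurable_int2 _ _ _ _ _ mu (fun z X => (tkern (mx_of z.1) z.2 X)%:E)); last first.
  by move=> z X; rewrite lee_fin; exact: tkern_ge0.
apply/measurable_EFinP; apply: measurable_tkern.
- apply: mxm_mx_of; exact: (measurableT_comp measurable_fst measurable_fst).
- exact: (measurableT_comp measurable_snd measurable_fst).
- exact: measurable_snd.
Qed.

Lemma app_rows (U : 'M[R]_(l, n)) X : app (rows_of U) X = tmul X U^T.
Proof.
apply: eq_from_tnth => i; rewrite tnth_app tnth_tmul dot.unlock; apply: eq_bigr => j _.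
by rewrite /rows_of !tnth_mktuple mxE mulrC.
Qed.

Lemma nsq_tmul_frame (U : 'M[R]_(l, n)) y : U *m U^T = 1%:M -> nsq (tmul y U^T) = nsq (tmul y (U^T *m U)).
Proof. by move=> hU; rewrite -tmulA [RHS]nsq_tmul. Qed.

(** min(g, f) = g min(1, f / g), with the Gaussian density g absorbed into the measure; by
    [ge0_integral_gaun_frame] that measure is the law of the frame coordinates of a Gaussian vector
    of R^n. Hence the overlap is a function of the subspace. *)
Lemma povlE t (U : 'M[R]_(l, n)) : U *m U^T = 1%:M -> U^T *m U = mx_of t -> povl t = (ovl mu v (rows_of U))%:E.
Proof.
move=> hU hP; rewrite ovlE //.
pose f (x : l.-tuple R) : \bar R := (Num.min 1 (sm mu v (rows_of U) x / gpdfn 1 x))%:E.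
have ms : measurable_fun setT (fun x => sm mu v (rows_of U) x).
  by apply: (measurableT_comp (measurable_sm mu v0) (g := fun x => (rows_of U, x))); apply: measurable_fun_pair.
have mf : measurable_fun setT f.
  apply/measurable_EFinP; apply: measurable_minr => //; apply: measurable_funM => //.
  by apply: measurable_invf => [|x]; [mR|exact: gpdfn_ge0].
have f0 x : (0 <= f x)%E.
  by rewrite lee_fin le_min ler01 /= divr_ge0 ?sm_ge0 ?gpdfn_ge0.
transitivity (\int[pw (gau 1) l]_x f x)%E; last first.
  rewrite ge0_integral_gaun //; apply: eq_integral => x _.
  rewrite -EFinM; congr EFin; have g0 : 0 < gpdfn 1 x by exact: gpdfn_gt0.
  rewrite minr_pMl ?(ltW g0) // mul1r divfK // gt_eqF //.
rewrite -(ge0_integral_gaun_frame ltr01 hU mf f0); apply: eq_integral => g _.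
rewrite /f EFin_min; congr Order.min.
have g0 : 0 < gpdfn 1 (tmul g U^T) by exact: gpdfn_gt0.
rewrite EFinM smE // -ge0_ZrT ?invr_ge0 ?(ltW g0) //; last 2 first.
- by mR.
- by move=> X; rewrite lee_fin gpdfn_ge0.
apply: eq_integral => X _; rewrite -EFinM; congr EFin; rewrite app_rows.
have -> : tsub (tmul g U^T) (tmul X U^T) = tmul (tsub g X) U^T.
  by apply: rv_of_inj; rewrite !(rv_of_tsub, rv_of_tmul) mulmxBl.
rewrite [in RHS]gpdfnE // [in X in _ = _ / X]gpdfnE // nsq_tmul_frame // nsq_tmul_frame // hP /tkern.
rewrite mulr1 expRD expr_div_n.
have -> : expR (nsq (tmul g (mx_of t)) / 2) = (expR (- (nsq (tmul g (mx_of t)) / 2)))^-1 by rewrite expRN invrK.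
have alg (a b x y : R) : a / b * (y^-1 * x) = a * x / (b * y) by rewrite invfM; ring.
exact: alg.
Qed.

Lemma gdistC (G G' : l.-tuple (n.-tuple R)) : gdist G G' = gdist G' G.
Proof.
apply: eq_bigr => i _; rewrite !nsqE; apply: eq_bigr => j _.
by rewrite !tnth_tsub -sqrrN opprB.
Qed.

Lemma gaumat_concentration (w e s : R) : 0 < w -> 0 < s -> sub_isotropic mu ->
  (\int[pw (pw (gau w) n) l]_G (ovl mu v G)%:E = e%:E)%E ->
  (pw (pw (gau w) n) l [set G | ovl mu v G <= e - s]%R <= (expR (- (s ^+ 2 * v / (4 * w))))%:E)%E.
Proof.
move=> w0 s0 hiso he.
apply: (@prop_tau_concentration R _ _ (pw (pw (gau w) n) l) (@gdist R l n) (fun G => ovl mu v G)) => //.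
- by apply: pw_setT; apply: pw_setT; exact: gau_setT.
- have h := prop_tau_pw (n := l) (prop_tau_pw (n := n) (prop_tau_gau w0)).
  have E : (fun x y : l.-tuple (n.-tuple R) => gdist x y / (4 * w)) =
     (fun x y => \sum_(i < l) \sum_(j < n) (tnth (tnth x i) j - tnth (tnth y i) j) ^+ 2 / (4 * w)).
    apply/funext => x; apply/funext => y; rewrite /gdist mulr_suml; apply: eq_bigr => i _.
    by rewrite nsqE mulr_suml; apply: eq_bigr => j _; rewrite tnth_tsub.
  by rewrite E; exact: h.
- exact: measurable_ovl.
- by move=> x; exact: ovl_ge0.
- by move=> x y t t0; rewrite [gdist x y]gdistC; exact: ovl_lipschitz.
Qed.

Definition gsproj (G : l.-tuple (n.-tuple R)) : n.-tuple (n.-tuple R) := tuple_of_mx (foldl (@gstep R n) 0 G).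

Lemma measurable_gsproj : measurable_fun setT gsproj.
Proof. by apply: mxm_tuple; apply: mxm_gsS; [exact: mxm_cst|exact: measurable_id]. Qed.

(** Both laws are invariant and carried by the Grassmannian, so [grass_unique] gives them the same
    value. Estimates for Gaussian matrices thereby become estimates for any invariant m. *)
Lemma grass_gsproj (w : R) (m : probability (n.-tuple (n.-tuple R)) R) (A : set (n.-tuple (n.-tuple R))) :
  0 < w -> grass_invariant l m -> measurable A -> m A = pw (pw (gau w) n) l (gsproj @^-1` A).
Proof.
move=> w0 [hg hi] mA.
have NN1 : pw (pw (gau w) n) l setT = 1%E by apply: pw_setT; apply: pw_setT; exact: gau_setT.
have mG := @measurable_grass_set R n l.
rewrite -[m A]/(m (id @^-1` A)) (@grass_unique R n l ln w w0 _ _ m id A) //; last 3 first.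
- exact: probability_setT.
- by apply: hg; [exact: measurableC|rewrite setICl].
- by move=> O hO; exact: hi.
symmetry; apply: grass_unique => //.
- exact: measurable_gsproj.
- have mb : measurable_fun setT (fun G : l.-tuple (n.-tuple R) => (~~ gsall (@gsnd R n) 0 G)%:R%:E : \bar R).
    apply: measurable_negbE; apply: measurable_gsall; [|exact: mxm_cst|exact: measurable_id].
    by move=> *; exact: measurable_gsnd.
  have mpg : measurable (gsproj @^-1` (~` @grass_set R n l)).
    by rewrite -[X in measurable X]setTI; apply: measurable_gsproj => //; exact: measurableC.
  apply/eqP; rewrite eq_le measure_ge0 andbT -(gsnd_all w0 ln) -[leLHS]mul1e.
  apply: le_mul_measure => //.
  move=> G /= h; rewrite lee_fin; case E : gsall => //=; exfalso; apply: h.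
  rewrite /grass_set /= mx_of_tuple is_orth_projP -gsmx_proj; split; first by apply: frame_projm; exact: gsmx_frame.
  by apply: frame_trace; exact: gsmx_frame.
move=> O hO; have hOT : O^T *m O^T^T = 1%:M by rewrite trmxK; exact: mulmx1C.
pose sh (G : l.-tuple (n.-tuple R)) := [tuple tmul (tnth G i) O^T | i < l].
have E G : tuple_of_mx (O *m mx_of (gsproj G) *m O^T) = gsproj (sh G).
  rewrite /gsproj mx_of_tuple; congr tuple_of_mx.
  by rewrite -!gsmx_proj gsmx_orth // trmx_mul trmxK !mulmxA.
have mpA : measurable (gsproj @^-1` A) by rewrite -[X in measurable X]setTI; exact: measurable_gsproj.
have msh : measurable_fun setT sh.
  apply/measurable_fun_tnthP => i; rewrite (_ : _ \o _ = fun G => tmul (tnth G i) O^T); last by apply/funext => G /=; rewrite tnth_mktuple.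
  by apply: measurable_tmulf; exact: measurable_tnth.
have mpA' : measurable (sh @^-1` (gsproj @^-1` A)) by rewrite -[X in measurable X]setTI; exact: msh.
rewrite (_ : _ @^-1` A = sh @^-1` (gsproj @^-1` A)); last by apply/seteqP; split => G /=; rewrite E.
have I (B : set (l.-tuple (n.-tuple R))) : measurable B -> pw (pw (gau w) n) l B = (\int[pw (pw (gau w) n) l]_x (\1_B x : R)%:E)%E.
  by move=> mB; rewrite integral_indic // setIT.
rewrite !I //.
rewrite -[RHS](ge0_integral_gaumat_orth w0 hOT) //.
by apply/measurable_EFinP; exact: measurable_indic.
Qed.

(** Outside small events the Gaussian matrix has overlap above e - s, and Gram-Schmidt moves it by a
    squared distance of at most 5 l eps; the last two terms of the threshold are the Lipschitz cost
    of this move. The bound adds the concentration estimate and the failure probability of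
    [gsgood]. *)
Lemma povl_concentration (e s t eps : R) (m : probability (n.-tuple (n.-tuple R)) R) : (0 < n)%N -> 0 < s -> 0 < t -> 0 < eps <= 1 ->
  sub_isotropic mu -> grass_invariant l m ->
  (\int[pw (pw (gau n%:R^-1) n) l]_G (ovl mu v G)%:E = e%:E)%E ->
  (m [set x | povl x < (e - s - t * (l%:R * (5 * eps)) / (8 * v) - 2 / t)%:E]%E <=
   (expR (- (s ^+ 2 * v / (4 * n%:R^-1))) +
    l%:R * (2 ^+ l * expR (- (n%:R * eps / 4)) + 2 * expR (- (n%:R * eps ^+ 2 / 16))))%:E)%E.
Proof.
move=> n0 s0 t0 /andP[eps0 eps1] hiso hm he; set th := _ - 2 / t.
have w0 : 0 < n%:R^-1 :> R by rewrite invr_gt0 ltr0n.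
pose A := [set x | povl x < th%:E]%E.
have mA : measurable A.
  rewrite (_ : A = povl @^-1` [set` `]-oo, th%:E[%E]); last by apply/seteqP; split => x /=; rewrite in_itv.
  by rewrite -[X in measurable X]setTI; apply: measurable_povl => //; exact: emeasurable_itv.
rewrite -/A (grass_gsproj w0 hm mA).
set N := pw (pw _ n) l.
have mpA : measurable (gsproj @^-1` A) by rewrite -[X in measurable X]setTI; exact: measurable_gsproj.
have I (B : set (l.-tuple (n.-tuple R))) : measurable B -> N B = (\int[N]_x (\1_B x : R)%:E)%E.
  by move=> mB; rewrite integral_indic // setIT.
pose C := [set G : l.-tuple (n.-tuple R) | ovl mu v G <= e - s]%R.
have mC : measurable C.
  rewrite (_ : C = ovl mu v @^-1` `]-oo, (e - s)]); last by apply/seteqP; split => G /=; rewrite in_itv.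
  by rewrite -[X in measurable X]setTI; exact: (measurable_ovl mu v0).
have hC := gaumat_concentration w0 s0 hiso he.
pose b1 (G : l.-tuple (n.-tuple R)) : \bar R := (~~ gsall (@gsnd R n) 0 G)%:R%:E.
pose b2 (G : l.-tuple (n.-tuple R)) : \bar R := (~~ gsall (gsgood eps) 0 G)%:R%:E.
have mb1 : measurable_fun setT b1.
  apply: measurable_negbE; apply: measurable_gsall; [|exact: mxm_cst|exact: measurable_id].
  by move=> *; exact: measurable_gsnd.
have mb2 : measurable_fun setT b2.
  apply: measurable_negbE; apply: measurable_gsall; [|exact: mxm_cst|exact: measurable_id].
  by move=> *; exact: measurable_gsgood.
have b10 G : (0 <= b1 G)%E by rewrite lee_fin ler0n.
have b20 G : (0 <= b2 G)%E by rewrite lee_fin ler0n.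
have i1 : (\int[N]_G b1 G = 0)%E by exact: (gsnd_all w0 ln).
have i2 : (\int[N]_G b2 G <= (l%:R * (2 ^+ l * expR (- (n%:R * eps / 4)) + 2 * expR (- (n%:R * eps ^+ 2 / 16))))%:E)%E.
  apply: (@gsall_prob R n n%:R^-1 (gsgood eps) l) => //.
  - by move=> *; exact: measurable_gsgood.
  - by move=> S hS tS; apply: gsgood_prob => //; rewrite eps0.
  - exact: projm0.
  - by rewrite mxtrace0 add0r.
have mi (B : set (l.-tuple (n.-tuple R))) : measurable B -> measurable_fun setT (fun x => (\1_B x : R)%:E).
  by move=> mB; apply/measurable_EFinP; exact: measurable_indic.
have i0 (B : set (l.-tuple (n.-tuple R))) x : (0 <= (\1_B x : R)%:E)%E by rewrite lee_fin indicE ler0n.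
rewrite EFinD; apply: le_trans (leeD hC i2); rewrite -/N -/C -[X in (X + _)%E]adde0 -i1 !I //.
rewrite -ge0_DT; [|exact: mi|exact: mb1|exact: i0|exact: b10].
rewrite -ge0_DT; [|by apply: emeasurable_funD; [exact: mi|exact: mb1]|exact: mb2|by move=> x; apply: adde_ge0; [exact: i0|exact: b10]|exact: b20].
apply: ge0_leT.
- exact: mi.
- by apply: emeasurable_funD; [apply: emeasurable_funD; [exact: mi|exact: mb1]|exact: mb2].
- exact: i0.
move=> G; rewrite /b1 /b2 -!EFinD lee_fin !indicE.
case h1 : (gsall (@gsnd R n) 0 G); last by rewrite /= -!natrD ler_nat; do 2 case: (_ \in _); case: gsall.
case h2 : (gsall (gsgood eps) 0 G); last by rewrite /= -!natrD ler_nat; do 2 case: (_ \in _).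
rewrite /= !addr0; suff : (G \in gsproj @^-1` A) -> (G \in C).
  by case: (G \in C); case: (_ \in _) => //= /(_ isT).
rewrite !inE /A /C /=; have hU := gsmx_frame h1.
rewrite (@povlE (gsproj G) (gsmx G) hU); last by rewrite /gsproj mx_of_tuple gsmx_proj.
rewrite lte_fin => hth.
have := ovl_lipschitz (rows_of (gsmx G)) G hiso v0 t0.
have hd : t * gdist G (rows_of (gsmx G)) / (8 * v) <= t * (l%:R * (5 * eps)) / (8 * v).
  rewrite ler_pM2r ?invr_gt0 ?mulr_gt0 // ler_pM2l // gdistC; apply: gsmx_close => //.
  by rewrite (ltW eps0).
move: hth hd; rewrite /th; goal_lra.
Qed.

End Transfer.

(** * Log-concave densities under contractions and translations *)

Section LogConcaveDensity.
Context (R : realType) (l : nat) (f : l.-tuple R -> R).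
Local Notation leb := (@leb R).
Local Notation lebn := (pw leb).
Hypothesis f0 : forall x, 0 <= f x.
Hypothesis mf : measurable_fun setT f.
Hypothesis f1 : (\int[lebn l]_x (f x)%:E = 1)%E.
Hypothesis flc : forall x y (t a b : R), 0 < t < 1 -> expR a <= f x -> expR b <= f y -> expR (t * a + (1 - t) * b) <= f (tmix t x y).

Lemma integral_lebn_shift (g : l.-tuple R -> \bar R) (b : l.-tuple R) : measurable_fun setT g -> (forall x, 0 <= g x)%E ->
  (\int[lebn l]_x g (tadd x b) = \int[lebn l]_x g x)%E.
Proof.
move=> mg g0; have := integral_lebn_affine b ltr01 mg g0; rewrite expr1n invr1 mul1e => <-.
apply: eq_integral => x _; congr g; congr tadd; apply: eq_from_tnth => i; by rewrite tnth_mktuple mul1r.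
Qed.

Definition dshift (h : l.-tuple R) : \bar R := (\int[lebn l]_x (`|f x - f (tadd x h)|)%:E)%E.

Lemma measurable_fadd b : measurable_fun setT (fun x => f (tadd x b)).
Proof. by apply: (measurableT_comp mf); mR. Qed.

Lemma measurable_absD (g1 g2 : l.-tuple R -> R) : measurable_fun setT g1 -> measurable_fun setT g2 ->
  measurable_fun setT (fun x => (`|g1 x - g2 x|)%:E).
Proof. by move=> m1 m2; apply/measurable_EFinP; apply: measurableT_comp => //; exact: measurable_funB. Qed.

Lemma taddA (x y z : l.-tuple R) : tadd x (tadd y z) = tadd (tadd x y) z.
Proof. by apply: eq_from_tnth => i; rewrite !tnth_mktuple addrA. Qed.

Lemma dshift_add h k : (dshift (tadd h k) <= dshift h + dshift k)%E.
Proof.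
have -> : dshift k = (\int[lebn l]_x (`|f (tadd x h) - f (tadd x (tadd h k))|)%:E)%E.
  rewrite /dshift -(integral_lebn_shift h).
  - by apply: eq_integral => x _; rewrite taddA.
  - by apply: measurable_absD => //; exact: measurable_fadd.
  - by move=> x; rewrite lee_fin.
have m1 := measurable_absD mf (measurable_fadd h).
have m2 := measurable_absD (measurable_fadd h) (measurable_fadd (tadd h k)).
rewrite -ge0_DT //; apply: ge0_leT => //.
- by apply: measurable_absD => //; exact: measurable_fadd.
- exact: emeasurable_funD.
by move=> x; rewrite -EFinD lee_fin ler_distD.
Qed.

Variables (x0 : l.-tuple R).
Hypothesis fx0 : 0 < f x0.
Hypothesis fmax : forall x, f x <= 2 * f x0.
Let M : R := 2 * l%:R + 8.
(** [x0] is a maximiser up to a factor 2, and M = 2 l + 8 makes exp(M / 2) beat 2^(l + 4) in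
    [bulk_mass]. *)
Definition bulk : set (l.-tuple R) := [set x | expR (- M) * f x0 <= f x].

Lemma expR1_ge2 : 2 <= expR 1 :> R.
Proof. by have := expR_ge1Dx (1 : R); rewrite (_ : 1 + 1 = 2). Qed.

Lemma measurable_bulk : measurable bulk.
Proof.
rewrite (_ : bulk = f @^-1` `[expR (- M) * f x0, +oo[); first by rewrite -[X in measurable X]setTI; exact: mf.
by apply/seteqP; split => x /=; rewrite in_itv /= andbT.
Qed.

(** Outside the bulk, log-concavity along the segment to [x0] gives f x <= 2^-(l + 4) f((x + x0) /
    2). The right side integrates to 2^-4, because the change of variables x -> (x + x0) / 2
    multiplies integrals by 2^l. *)
Lemma bulk_mass : ((15 / 16)%:E <= \int[lebn l]_x ((\1_bulk x : R)%:E * (f x)%:E))%E.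
Proof.
have mi : measurable_fun setT (fun x => ((\1_bulk x : R)%:E * (f x)%:E)%E).
  apply: emeasurable_funM; last exact/measurable_EFinP.
  by apply/measurable_EFinP; apply: measurable_indic; exact: measurable_bulk.
pose h x := tadd (tscale 2^-1 x) (tscale 2^-1 x0).
have mh : measurable_fun setT (fun x => (f (h x))%:E).
  by apply/measurable_EFinP; apply: (measurableT_comp mf); rewrite /h; mR.
have mf' : measurable_fun setT (fun x => (f x)%:E) by exact/measurable_EFinP.
have ih : (\int[lebn l]_x (f (h x))%:E = (2 ^+ l)%:E)%E.
  have c0 : 0 < 2^-1 :> R by [].
  rewrite (integral_lebn_affine (tscale 2^-1 x0) c0 mf') ?f1; last by move=> x; rewrite lee_fin.
  by rewrite mule1 exprVn invrK.
have key x : f x <= \1_bulk x * f x + (2 ^- (l + 4)) * f (h x).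
  have p0 : 0 <= (2 ^- (l + 4)) * f (h x) by rewrite mulr_ge0 // invr_ge0 exprn_ge0.
  rewrite indicE; have [xb|xb] := boolP (x \in bulk); first by rewrite mul1r lerDl.
  rewrite mul0r add0r; have := xb; rewrite notin_setE /bulk /= => /negP; rewrite -ltNge => hx.
  have := f0 x; rewrite le_eqVlt => /orP[/eqP <- //|fx].
  have lnx : ln (f x) <= - M + ln (f x0).
    rewrite -ler_expR expRD !lnK ?posrE //; exact: ltW.
  have := @flc x x0 2^-1 (ln (f x)) (ln (f x0)); rewrite !lnK ?posrE // !lexx.
  have -> : tmix 2^-1 x x0 = h x.
    by apply: eq_from_tnth => i; rewrite !tnth_mktuple; congr (_ + _ * _); field.
  have t01 : 0 < (2^-1 : R) < 1 by apply/andP; split; lra.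
  move=> /(_ t01 isT isT) hh.
  have h2 : expR (ln (f x) - - (M / 2)) <= f (h x).
    by apply: le_trans hh; rewrite ler_expR; lra.
  move: h2; rewrite expRD lnK ?posrE // => h2.
  have h3 : 2 ^+ (l + 4) <= expR (- - (M / 2)).
    rewrite opprK (_ : M / 2 = (l + 4)%:R * 1); last by rewrite /M natrD; field.
    by rewrite expRM_natl lerXn2r ?nnegrE ?expR_ge0 // expR1_ge2.
  rewrite ler_pdivlMl ?exprn_gt0 // mulrC; apply: le_trans h2.
  by rewrite ler_wpM2l.
have c0 : 0 <= 2 ^- (l + 4) :> R by rewrite invr_ge0 exprn_ge0.
have : (\int[lebn l]_x (f x)%:E <= \int[lebn l]_x ((\1_bulk x : R)%:E * (f x)%:E) + (16^-1)%:E)%E.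
  have -> : (16^-1)%:E = (\int[lebn l]_x ((2 ^- (l + 4))%:E * (f (h x))%:E))%E.
    rewrite ge0_ZlT; [|exact: c0|exact: mh|by move=> x; rewrite lee_fin].
    rewrite ih -EFinM exprD invfM -mulrA mulrCA mulVf ?mulr1; last by rewrite expf_neq0.
    by congr (_%:E); rewrite !exprS expr0; field.
  rewrite -ge0_DT //; last 3 first.
  - exact: measurable_funeM.
  - by move=> x; rewrite -EFinM lee_fin mulr_ge0 // indicE ler0n.
  - by move=> x; rewrite -EFinM lee_fin mulr_ge0.
  apply: ge0_leT => //.
  - by apply: emeasurable_funD => //; exact: measurable_funeM.
rewrite f1 => /(@lee_subr_fin _ _ 1); apply: le_trans; rewrite lee_fin; lra.
Qed.

(** The point x is (1 - e) z + e y, with z the argument of f on the left. Log-concavity gives f x >=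
    f(z) exp(- e (M + 1)), since f y >= exp(- M - 1) f z, and (1 + s)^l = (1 - e)^-l is absorbed by
    Bernoulli's inequality. *)
Lemma contraction_lower (s e : R) x y : 0 < s -> e = s / (1 + s) -> bulk y ->
  (1 - e * (l%:R + M + 1)) * ((1 + s) ^+ l * f (tadd (tscale (1 + s) x) (tscale (- s) y))) <= f x.
Proof.
move=> s0 eE yb; set z := tadd _ _.
have s1 : 0 < 1 + s by rewrite addr_gt0.
have e0 : 0 < e by rewrite eE divr_gt0.
have e1 : e < 1 by rewrite eE ltr_pdivrMr // mul1r ltrDr.
have ce : (1 - e) * (1 + s) = 1 by rewrite eE; field; rewrite gt_eqF.
have := f0 z; rewrite le_eqVlt => /orP[/eqP <- |fz]; first by rewrite !mulr0.
have fy : 0 < f y by apply: lt_le_trans yb; rewrite mulr_gt0 // expR_gt0.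
have t01 : 0 < 1 - e < 1 by apply/andP; split; lra.
have := @flc z y (1 - e) (ln (f z)) (ln (f y)) t01; rewrite !lnK ?posrE // !lexx => /(_ isT isT).
have -> : tmix (1 - e) z y = x.
  apply: eq_from_tnth => i; rewrite !tnth_mktuple.
  rewrite mulrDr !mulrA ce mul1r -addrA -mulrDl.
  rewrite (_ : (1 - e) * - s + (1 - (1 - e)) = 0) ?mul0r ?addr0 // eE; field; rewrite gt_eqF //.
move=> h.
have hy : ln (f z) - (M + 1) <= ln (f y).
  rewrite lerBlDr -ler_expR lnK ?posrE // [leRHS]expRD lnK ?posrE // [expR (M + 1)]expRD.
  apply: (le_trans (fmax z)).
  have h2 : f x0 <= expR M * f y.
    have := yb; rewrite /bulk /= expRN mulrC ler_pdivrMr ?expR_gt0 // mulrC; exact.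
  rewrite mulrA [leRHS]mulrC [f y * _]mulrC; apply: ler_pM; [by []|exact: ltW|exact: expR1_ge2|exact: h2].
have h' : expR (ln (f z) - e * (M + 1)) <= f x.
  apply: le_trans h; rewrite ler_expR.
  have := ler_wpM2l (ltW e0) hy; lra.
apply: le_trans h'; rewrite expRD lnK ?posrE //.
have -> : (1 + s) ^+ l = ((1 - e) ^+ l)^-1.
  rewrite -exprVn; congr (_ ^+ _); have h1e : 1 - e != 0 by rewrite gt_eqF //; lra.
  by apply: (mulfI h1e); rewrite mulfV.
have q0 : 0 < (1 - e) ^+ l by rewrite exprn_gt0 //; lra.
have q1 : (1 - e) ^+ l <= 1 by rewrite exprn_ile1 //; lra.
have hq : 1 - l%:R * e <= (1 - e) ^+ l by apply: bernoulli_ineq; apply/andP; split; exact: ltW.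
have hE : 1 + - (e * (M + 1)) <= expR (- (e * (M + 1))) by exact: expR_ge1Dx.
have u0 : 0 <= e * (M + 1) by rewrite mulr_ge0 ?(ltW e0) // /M; have := ler0n R l; lra.
rewrite mulrA [leRHS]mulrC ler_pM2r // ler_pdivrMr // mulrC.
apply: (@le_trans _ _ ((1 - e) ^+ l * (1 + - (e * (M + 1))))); last first.
  by rewrite [leRHS]mulrC ler_pM2l.
have : (1 - e) ^+ l * (e * (M + 1)) <= e * (M + 1) by rewrite ler_piMl.
move: (_ ^+ l) hq => q; lra.
Qed.

(** The rescaled function is again a probability density, so the one-sided bound of
    [contraction_lower] already controls the L1 distance, at the price of a factor 2. *)
Lemma contraction_close (s e : R) y : 0 < s -> e = s / (1 + s) -> bulk y ->
  (\int[lebn l]_x (`|f x - (1 + s) ^+ l * f (tadd (tscale (1 + s) x) (tscale (- s) y))|)%:E <= (2 * (s * (l%:R + M + 1)))%:E)%E.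
Proof.
move=> s0 eE yb; set z := e * (l%:R + M + 1).
have s1 : 0 < 1 + s by rewrite addr_gt0.
have es : e <= s by rewrite eE ler_pdivrMr // ler_peMr ?lerDl // ltW.
have e0 : 0 <= e by rewrite eE divr_ge0 // ltW.
have zs : z <= s * (l%:R + M + 1) by rewrite /z ler_wpM2r // /M; have := ler0n R l; lra.
have z0 : 0 <= z by rewrite /z mulr_ge0 // /M; have := ler0n R l; lra.
pose h x := (1 + s) ^+ l * f (tadd (tscale (1 + s) x) (tscale (- s) y)).
have h0 x : 0 <= h x by rewrite mulr_ge0 // exprn_ge0 // ltW.
have mf' : measurable_fun setT (fun x => (f x)%:E) by exact/measurable_EFinP.
have mfa : measurable_fun setT (fun x => f (tadd (tscale (1 + s) x) (tscale (- s) y))).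
  by apply: (measurableT_comp mf); mR.
have mh : measurable_fun setT h by exact: measurable_funM.
have mh' : measurable_fun setT (fun x => (h x)%:E) by exact/measurable_EFinP.
have ih : (\int[lebn l]_x (h x)%:E = 1)%E.
  transitivity (\int[lebn l]_x (((1 + s) ^+ l)%:E * (f (tadd (tscale (1 + s) x) (tscale (- s) y)))%:E))%E.
    by apply: eq_integral => x _; rewrite -EFinM.
  rewrite ge0_ZlT //; last 3 first.
  - by rewrite exprn_ge0 // ltW.
  - exact/measurable_EFinP.
  - by move=> x; rewrite lee_fin.
  rewrite (integral_lebn_affine (tscale (- s) y) s1 mf'); last by move=> x; rewrite lee_fin.
  by rewrite f1 mule1 -EFinM mulfV // expf_neq0 // gt_eqF.
have mD := measurable_absD mf mh.
have key x : `|f x - h x| + h x <= f x + 2 * z * h x.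
  have hl : (1 - z) * h x <= f x by exact: (contraction_lower x s0 eE yb).
  have zh : 0 <= z * h x by rewrite mulr_ge0.
  have [fh|fh] := lerP (f x) (h x).
    by move: hl; rewrite mulrBl mul1r -mulrA; lra.
  by rewrite subrK lerDl -mulrA mulr_ge0.
have H : (\int[lebn l]_x (`|f x - h x|)%:E + 1%:E <= 1%:E + (2 * z)%:E)%E.
  rewrite -{1}ih -{1}f1 -[X in (_ <= _ + X)%E]mule1 -ih -ge0_DT //.
  have z2 : 0 <= 2 * z by rewrite mulr_ge0.
  rewrite -ge0_ZlT // -ge0_DT //; last 2 first.
  - exact: measurable_funeM.
  - by move=> x; rewrite -EFinM lee_fin mulr_ge0.
  apply: ge0_leT => //.
  - exact: emeasurable_funD.
  - by apply: emeasurable_funD => //; exact: measurable_funeM.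
  - by move=> x; rewrite -EFinD lee_fin addr_ge0.
have {}H := lee_addr_fin H.
by apply: (le_trans H); rewrite lee_fin; lra.
Qed.

(* By log-concavity f is almost invariant under contractions towards points of the bulk; the contractions towards
   two such points differ by a translation. *)
Lemma dshift_bulk (s : R) a b : 0 < s -> bulk a -> bulk b ->
  (dshift (tscale s (tsub a b)) <= (4 * (s * (3 * l%:R + 9)))%:E)%E.
Proof.
move=> s0 ha hb; have s1 : 0 < 1 + s by rewrite addr_gt0.
pose h y x := (1 + s) ^+ l * f (tadd (tscale (1 + s) x) (tscale (- s) y)).
have mh y : measurable_fun setT (h y).
  by apply: measurable_funM => //; apply: (measurableT_comp mf); mR.
have C : (\int[lebn l]_x (`|h a x - h b x|)%:E <= (2 * (s * (l%:R + M + 1)) + 2 * (s * (l%:R + M + 1)))%:E)%E.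
  have Ca := contraction_close s0 erefl ha; have Cb := contraction_close s0 erefl hb.
  rewrite EFinD; apply: le_trans (leeD Ca Cb).
  have ma := measurable_absD mf (mh a); have mb := measurable_absD mf (mh b).
  rewrite -ge0_DT //; apply: ge0_leT => //.
  - exact: measurable_absD.
  - exact: emeasurable_funD.
  move=> x; rewrite -EFinD lee_fin -/(h a x) -/(h b x); apply: le_trans (ler_distD (f x) _ _) _.
  by rewrite [`|h a x - f x|]distrC.
have E : (\int[lebn l]_x (`|h a x - h b x|)%:E = dshift (tscale s (tsub a b)))%E.
  pose g u : \bar R := (`|f u - f (tadd u (tscale s (tsub a b)))|)%:E.
  have mg : measurable_fun setT g by apply: measurable_absD => //; exact: measurable_fadd.
  have g0 u : (0 <= g u)%E by rewrite lee_fin.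
  have cc : 0 <= (1 + s) ^+ l by rewrite exprn_ge0 // ltW.
  transitivity (\int[lebn l]_x (((1 + s) ^+ l)%:E * g (tadd (tscale (1 + s) x) (tscale (- s) a))))%E.
    apply: eq_integral => x _; rewrite /g -EFinM; congr EFin.
    rewrite -[(1 + s) ^+ l in RHS]ger0_norm // -normrM mulrBr; congr (`|_ - _ * f _|).
    by apply: eq_from_tnth => i; rewrite !tnth_mktuple; ring.
  rewrite ge0_ZlT //; last first.
    by apply: (measurableT_comp mg); mR.
  by rewrite integral_lebn_affine // muleA -EFinM mulfV ?mul1e // expf_neq0 // gt_eqF.
rewrite -E; apply: (le_trans C); rewrite lee_fin /M; lra.
Qed.

End LogConcaveDensity.

(** * Regularity of the smoothed density *)

Section GaussianTail.
Context (R : realType) (n : nat) (v : R).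
Hypothesis v0 : 0 < v.
Local Notation gau := (@gau R).

Lemma gaun_nsq_markov r : 0 < r -> (pw (gau v) n [set z | r < nsq z]%R <= (6 * v * n%:R / r)%:E)%E.
Proof.
move=> r0; have mB := @measurable_nsq_gt R n r.
have H : (r%:E * pw (gau v) n [set z | r < nsq z]%R <= (6 * v * n%:R)%:E)%E.
  apply: le_trans (@gaun_nsq_le R n v v0); apply: le_mul_measure => //.
  - exact: ltW.
  - by mR.
  - by move=> x; rewrite lee_fin nsq_ge0.
  - by move=> x /= ?; rewrite lee_fin ltW.
have := lee_wpmul2l (_ : (0 <= (r^-1)%:E)%E) H; rewrite lee_fin invr_ge0 (ltW r0) => /(_ isT).
by rewrite muleA -EFinM mulVf ?gt_eqF // mul1e -EFinM mulrC.
Qed.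

Lemma indic_lt_le (r : R) (z : n.-tuple R) : (\1_[set z : n.-tuple R | nsq z <= r] z + \1_[set z : n.-tuple R | r < nsq z] z = 1 :> R).
Proof.
rewrite !indicE; have [h|h] := leP (nsq z) r.
  by rewrite mem_set // memNset /= ?addr0 // => h'; move: (lt_le_trans h' h); rewrite ltxx.
by rewrite memNset ?mem_set ?add0r //= => h'; move: (lt_le_trans h h'); rewrite ltxx.
Qed.

Lemma gaun_ball_mass r : 0 < r -> ((1 - 6 * v * n%:R / r)%:E <= \int[pw (gau v) n]_z (\1_[set z : n.-tuple R | nsq z <= r] z : R)%:E)%E.
Proof.
move=> r0; have mA := @measurable_nsq_le R n r; have mB := @measurable_nsq_gt R n r.
have GT : pw (gau v) n setT = 1%E by apply: pw_setT; exact: gau_setT.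
apply: lee_subr_fin; apply: le_trans (leeD2l _ (gaun_nsq_markov r0)).
have -> : pw (gau v) n [set z | r < nsq z]%R = (\int[pw (gau v) n]_z (\1_[set z : n.-tuple R | r < nsq z] z : R)%:E)%E.
  by rewrite integral_indic // setIT.
rewrite -ge0_DT //; [|by apply/measurable_EFinP; exact: measurable_indic|by apply/measurable_EFinP; exact: measurable_indic].
rewrite -[leLHS](integral_prob_cst 1%E GT) le_eqVlt; apply/orP; left; apply/eqP.
by apply: eq_integral => z _; rewrite -EFinD indic_lt_le.
Qed.

End GaussianTail.

Section SmoothedDensity.
Context (R : realType) (l n : nat) (mu : probability (n.-tuple R) R) (G : l.-tuple (n.-tuple R)).
Local Notation leb := (@leb R).
Local Notation lebn := (pw leb).
Local Notation gau := (@gau R).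
Hypothesis Hlc : log_concave_marginals mu.

Lemma measurable_smx v : 0 < v -> measurable_fun setT (fun x => sm mu v G x).
Proof.
move=> v0; apply: (measurableT_comp (measurable_sm mu v0) (g := fun x => (G, x))).
exact: measurable_fun_pair.
Qed.

(** The supremum, reached here up to a factor 2, is positive because the density integrates to
    one. *)
Lemma sm_maximizer v : 0 < v -> exists2 x0, 0 < sm mu v G x0 & forall x, sm mu v G x <= 2 * sm mu v G x0.
Proof.
move=> v0; pose E : set R := range (sm mu v G).
have hE : has_sup E.
  split; first by exists (sm mu v G [tuple 0 | i < l]); exists [tuple 0 | i < l].
  by exists (gpdf v 0 ^+ l) => _ [x _ <-]; exact: sm_le.
have hub x : sm mu v G x <= sup E by apply: sup_upper_bound => //; exists x.
have s0 : 0 < sup E.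
  rewrite ltNge; apply/negP => h.
  have := integral_sm mu G v0; rewrite (_ : (\int[lebn l]_x _)%E = 0%E).
    by move=> /eqP; rewrite eq_sym onee_eq0.
  apply: integral0_eq => x _; congr EFin; apply/eqP; rewrite eq_le sm_ge0 // andbT.
  exact: le_trans (hub x) h.
have [_ [x0 _ <-] hx] := sup_adherent (divr_gt0 s0 (ltr0n R 2)) hE.
exists x0; first by lra.
by move=> x; apply: le_trans (hub x) _; lra.
Qed.

(** A modulus of continuity that degenerates with v. It ends the scaling iteration in [dshift_le] at
    an arbitrarily small scale, so its dependence on v does not reach the final bound. *)
Lemma dshift_small v h (t : R) : 0 < v -> 0 < t -> (dshift (sm mu v G) h <= (t * nsq h / (8 * v) + 2 / t)%:E)%E.
Proof.
move=> v0 t0; pose k (x : l.-tuple R) (X : n.-tuple R) : R := `|gpdfn v (tsub x (app G X)) - gpdfn v (tsub (tadd x h) (app G X))|.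
have mk : measurable_fun setT (fun z : l.-tuple R * n.-tuple R => (k z.1 z.2)%:E).
  by apply/measurable_EFinP; rewrite /k; apply: measurableT_comp => //; apply: measurable_funB; mR.
have k0 x X : (0 <= (k x X)%:E)%E by rewrite lee_fin /k normr_ge0.
have mg x : measurable_fun setT (fun X : n.-tuple R => (gpdfn v (tsub x (app G X)))%:E) by mR.
have g0 x X : (0 <= (gpdfn v (tsub x (app G X)))%:E)%E by rewrite lee_fin gpdfn_ge0.
have mk1 x := measurable_sec (f := fun x X => (k x X)%:E) mk x.
have H x y (kk : n.-tuple R -> R) : measurable_fun setT (fun X => (kk X)%:E) ->
    (forall X, `|gpdfn v (tsub x (app G X)) - gpdfn v (tsub y (app G X))| <= kk X) ->
    ((sm mu v G x - sm mu v G y)%:E <= \int[mu]_X (kk X)%:E)%E.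
  move=> mkk hk; have kk0 X : (0 <= (kk X)%:E)%E by rewrite lee_fin; apply: le_trans (hk X).
  have : ((sm mu v G x)%:E <= (sm mu v G y)%:E + \int[mu]_X (kk X)%:E)%E.
    rewrite !smE // -ge0_DT //; apply: ge0_leT => //; first exact: emeasurable_funD.
    move=> X; rewrite -EFinD lee_fin -lerBlDl; apply: le_trans (hk X); exact: ler_norm.
  by case: (\int[mu]_X _)%E => [r| |] //=; rewrite ?leey // -EFinD !lee_fin lerBlDl.
apply: (@le_trans _ _ (\int[lebn l]_x \int[mu]_X (k x X)%:E)%E).
  apply: ge0_leT.
  - by apply: measurable_absD; [exact: measurable_smx|apply: measurable_fadd; exact: measurable_smx].
  - exact: measurable_int2.
  - by move=> x; rewrite lee_fin.
  move=> x; have [h1|h1] := lerP (sm mu v G x) (sm mu v G (tadd x h)); last exact: H.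
  by apply: H => // X; rewrite /k distrC.
rewrite ge0_swap //.
have mu1 : mu setT = 1%E by exact: probability_setT.
rewrite -[leRHS](integral_prob_cst _ mu1).
have b0 : (0 <= (t * nsq h / (8 * v) + 2 / t)%:E)%E.
  rewrite lee_fin addr_ge0 //; apply: divr_ge0 => //; try (by apply: ltW); apply: mulr_ge0 => //; [exact: ltW|exact: nsq_ge0|exact: ltW].
apply: ge0_leT => //.
- by apply: (@measurable_int2 _ _ _ _ _ (lebn l) (fun X x => (k x X)%:E)) => //; apply: (measurableT_comp mk (g := fun z => (z.2, z.1))); apply: measurable_fun_pair.
- by move=> X; exact: integral_ge0.
move=> X; have := gpdfn_TV (app G X) (tsub (app G X) h) v0 t0.
have -> : nsq (tsub (app G X) (tsub (app G X) h)) = nsq h.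
  by rewrite !nsqE; apply: eq_bigr => i _; rewrite !tnth_tsub; congr (_ ^+ 2); ring.
apply: le_trans; rewrite le_eqVlt; apply/orP; left; apply/eqP; apply: eq_integral => x _.
rewrite /k; congr (`|_ - gpdfn v _|%:E); apply: eq_from_tnth => i.
by rewrite !tnth_tsub tnth_mktuple; ring.
Qed.

Lemma ge0_integral_smoothed v (F : l.-tuple R -> \bar R) : 0 < v -> measurable_fun setT F -> (forall x, 0 <= F x)%E ->
  (\int[mu]_X \int[pw (gau v) l]_z F (tadd (app G X) z) = \int[lebn l]_x (F x * (sm mu v G x)%:E))%E.
Proof.
move=> v0 mF F0.
have mg : measurable_fun setT (fun z : n.-tuple R * l.-tuple R => (gpdfn v (tsub z.2 (app G z.1)))%:E) by mR.
transitivity (\int[mu]_X \int[lebn l]_x (F x * (gpdfn v (tsub x (app G X)))%:E))%E.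
  by apply: eq_integral => X _; rewrite smoothing.
rewrite ge0_swap; last 2 first.
- by apply: emeasurable_funM => //; exact: (measurableT_comp mF measurable_snd).
- by move=> X x; rewrite mule_ge0 // lee_fin gpdfn_ge0.
apply: eq_integral => x _; rewrite smE //.
have mg1 : measurable_fun setT (fun X : n.-tuple R => (gpdfn v (tsub x (app G X)))%:E) by mR.
by rewrite ge0_integralZl // => X _; rewrite lee_fin gpdfn_ge0.
Qed.

End SmoothedDensity.

(** * Removal of the Gaussian noise *)

Section Desmoothing.
Context (R : realType) (l n : nat) (mu : probability (n.-tuple R) R) (G : l.-tuple (n.-tuple R)).
Local Notation leb := (@leb R).
Local Notation lebn := (pw leb).
Local Notation gau := (@gau R).
Hypothesis Hlc : log_concave_marginals mu.
Variables (v v' : R).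
Hypothesis v0 : 0 < v.
Hypothesis v'0 : 0 < v'.
Variable rho : R.
Hypothesis rhoE : rho * 256 = 1.
Hypothesis vl : 6 * v * l%:R / rho <= 1 / 16.
Hypothesis vl' : 6 * v' * l%:R / rho <= 1 / 16.
Hypothesis hovl : 9 / 10 <= ovl mu v G.
Variable x0 : l.-tuple R.
Let f x := sm mu v' G x.
Hypothesis fx0 : 0 < f x0.
Hypothesis fmax : forall x, f x <= 2 * f x0.

Let A := bulk f x0.
Let ball : set (l.-tuple R) := [set z | nsq z <= rho].
(** Two noises are added to the same G X: one of variance v, for which the overlap is known, and one
    of variance v', which makes f a density and later tends to 0. [p X] is the probability that the
    second is small and leads into the bulk; [gA] is the part of the density [sm mu v G] due to such
    X and a small first noise. A point charged by [gA] is therefore within 2 sqrt rho of the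
    bulk. *)
Let p (X : n.-tuple R) : \bar R := (\int[pw (gau v') l]_z ((\1_A (tadd (app G X) z) : R)%:E * (\1_ball z : R)%:E))%E.
Let gA (w : l.-tuple R) : \bar R := (\int[mu]_X ((gpdfn v (tsub w (app G X)))%:E * (\1_ball (tsub w (app G X)) : R)%:E * p X))%E.

Let rho0 : 0 < rho. Proof. by move: rhoE; lra. Qed.
Let mA : measurable A. Proof. by apply: measurable_bulk; exact: measurable_smx. Qed.
Let mB : measurable ball. Proof. exact: measurable_nsq_le. Qed.

Let mi (C : set (l.-tuple R)) d (T : measurableType d) (h : T -> l.-tuple R) : measurable C -> measurable_fun setT h ->
  measurable_fun setT (fun x => (\1_C (h x) : R)%:E).
Proof.
move=> mC mh; apply/measurable_EFinP; exact: (measurableT_comp (measurable_indic mC : measurable_fun setT (\1_C : _ -> R))).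
Qed.

Let i0 (C : set (l.-tuple R)) x : (0 <= (\1_C x : R)%:E)%E. Proof. by rewrite lee_fin indicE ler0n. Qed.
Let i1 (C : set (l.-tuple R)) x : ((\1_C x : R)%:E <= 1)%E. Proof. by rewrite lee_fin indicE lern1 leq_b1. Qed.

Let mpp : measurable_fun setT (fun z : n.-tuple R * l.-tuple R => (\1_A (tadd (app G z.1) z.2) : R)%:E * (\1_ball z.2 : R)%:E)%E.
Proof. by apply: emeasurable_funM; apply: mi => //; mR. Qed.

Let mp : measurable_fun setT p.
Proof.
apply: (@measurable_int2 _ _ _ _ _ (pw (gau v') l) (fun X z => ((\1_A (tadd (app G X) z) : R)%:E * (\1_ball z : R)%:E)%E)) => //.
Qed.

Let p0 X : (0 <= p X)%E.
Proof. by apply: integral_ge0 => z _; apply: mule_ge0; exact: i0. Qed.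

Let g1 w : pw (gau w) l setT = 1%E. Proof. by apply: pw_setT; exact: gau_setT. Qed.

Let p1 X : (p X <= 1)%E.
Proof.
rewrite -[leRHS](integral_prob_cst 1%E (g1 v')); apply: ge0_leT => //.
- exact: (measurable_sec (f := fun X z => ((\1_A (tadd (app G X) z) : R)%:E * (\1_ball z : R)%:E)%E) mpp).
- move=> z; rewrite -EFinM lee_fin !indicE -natrM lern1; by do 2 case: (_ \in _).
Qed.

Let mgA2 : measurable_fun setT (fun z : l.-tuple R * n.-tuple R => (gpdfn v (tsub z.1 (app G z.2)))%:E * (\1_ball (tsub z.1 (app G z.2)) : R)%:E * p z.2)%E.
Proof.
apply: emeasurable_funM; last exact: (measurableT_comp mp measurable_snd).
by apply: emeasurable_funM; [mR|apply: mi => //; mR].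
Qed.

Let gA0' w X : (0 <= (gpdfn v (tsub w (app G X)))%:E * (\1_ball (tsub w (app G X)) : R)%:E * p X)%E.
Proof. by apply: mule_ge0 => //; apply: mule_ge0 => //; rewrite lee_fin gpdfn_ge0. Qed.

Let gA0 w : (0 <= gA w)%E. Proof. by apply: integral_ge0. Qed.

Let mgA : measurable_fun setT gA.
Proof. exact: measurable_int2. Qed.

Let gA_le w : (gA w <= (sm mu v G w)%:E)%E.
Proof.
rewrite smE //; apply: ge0_leT => //.
- exact: (measurable_sec (f := fun w X => ((gpdfn v (tsub w (app G X)))%:E * (\1_ball (tsub w (app G X)) : R)%:E * p X)%E) mgA2).
- by mR.
move=> X; have g0 : (0 <= (gpdfn v (tsub w (app G X)))%:E)%E by rewrite lee_fin gpdfn_ge0.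
rewrite -[leRHS]mule1 -[X in (_ <= _ * X)%E]mule1 muleA.
by apply: lee_pmul; [apply: mule_ge0|exact: p0|apply: lee_wpmul2l|exact: p1].
Qed.

Let p_mass : ((7 / 8)%:E <= \int[mu]_X p X)%E.
Proof.
have mu1 : mu setT = 1%E by exact: probability_setT.
have := @bulk_mass R l f (fun x => sm_ge0 mu G x v'0) (measurable_smx mu G v'0) (integral_sm mu G v'0)
  (fun x y t a b => @sm_log_concave R l n mu v' G x y t a b Hlc v'0) x0 fx0.
rewrite -/A -(ge0_integral_smoothed mu G v'0 (F := fun x => (\1_A x : R)%:E)); [|exact: mi|exact: i0].
move=> H; apply: (@le_trans _ _ ((15 / 16 - 1 / 16)%:E)); first by rewrite lee_fin; lra.
apply: lee_subr_fin; apply: (le_trans H).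
rewrite -[X in (_ <= _ + X)%E](integral_prob_cst _ mu1) -ge0_DT //.
apply: ge0_leT.
- apply: (@measurable_int2 _ _ _ _ _ (pw (gau v') l) (fun X z => (\1_A (tadd (app G X) z) : R)%:E)) => //.
  by apply: mi => //; mR.
- by apply: emeasurable_funD.
- by move=> X; exact: integral_ge0.
move=> X; have mk := gaun_nsq_markov l v'0 rho0.
have mk' : (pw (gau v') l [set z | (rho < nsq z)%R] <= (1 / 16)%:E)%E by apply: (le_trans mk); rewrite lee_fin.
have mG := @measurable_nsq_gt R l rho.
apply: le_trans (leeD2l _ mk').
have -> : pw (gau v') l [set z | rho < nsq z]%R = (\int[pw (gau v') l]_z (\1_[set z : l.-tuple R | rho < nsq z] z : R)%:E)%E.
  by rewrite integral_indic // setIT.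
have ms : measurable_fun setT (fun z => (\1_A (tadd (app G X) z) : R)%:E * (\1_ball z : R)%:E)%E.
  exact: (measurable_sec (f := fun X z => ((\1_A (tadd (app G X) z) : R)%:E * (\1_ball z : R)%:E)%E) mpp).
rewrite /p -ge0_DT; [|exact: ms|exact: mi|by move=> z; apply: mule_ge0; exact: i0|exact: i0].
apply: ge0_leT => //.
- by apply: mi => //; mR.
- by apply: emeasurable_funD; [exact: ms|exact: mi].
move=> z; rewrite -EFinM -EFinD lee_fin -[leLHS]mulr1 -(indic_lt_le rho z) mulrDr lerD2l.
by rewrite -[leRHS]mul1r ler_wpM2r // indicE ?ler0n // lern1 leq_b1.
Qed.

Let gA_mass : ((41 / 50)%:E <= \int[lebn l]_w gA w)%E.
Proof.
rewrite /gA ge0_swap; [|exact: mgA2|exact: gA0'].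
have E X : (\int[lebn l]_w ((gpdfn v (tsub w (app G X)))%:E * (\1_ball (tsub w (app G X)) : R)%:E * p X) =
    (\int[pw (gau v) l]_z (\1_ball z : R)%:E) * p X)%E.
  have mb : measurable_fun setT (fun x => (\1_ball x : R)%:E) by exact: mi.
  have mgb : measurable_fun setT (fun x : l.-tuple R => (gpdfn v x)%:E * (\1_ball x : R)%:E)%E.
    by apply: emeasurable_funM; [mR|exact: mi].
  have gb0 (x : l.-tuple R) : (0 <= (gpdfn v x)%:E * (\1_ball x : R)%:E)%E by apply: mule_ge0 => //; rewrite lee_fin gpdfn_ge0.
  rewrite ge0_integral_gaun //.
  have -> : (\int[lebn l]_x ((\1_ball x : R)%:E * (gpdfn v x)%:E) =
     \int[lebn l]_w ((gpdfn v (tsub w (app G X)))%:E * (\1_ball (tsub w (app G X)) : R)%:E))%E.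
    rewrite /tsub (integral_lebn_shift (tscale (-1) (app G X)) mgb gb0).
    by apply: eq_integral => x _; rewrite muleC.
  rewrite -ge0_integralZr //; last first.
    have mT : measurable_fun setT (fun w : l.-tuple R => tsub w (app G X)) by mR.
    exact: (measurableT_comp mgb mT).
under eq_integral do rewrite E.
have hb := gaun_ball_mass l v0 rho0.
have hb' : ((15 / 16)%:E <= \int[pw (gau v) l]_z (\1_ball z : R)%:E)%E by apply: le_trans hb; rewrite lee_fin; move: vl; lra.
have b0 : (0 <= \int[pw (gau v) l]_z (\1_ball z : R)%:E)%E by exact: integral_ge0.
rewrite ge0_integralZl; [|by []|exact: mp|by move=> X _; exact: p0|exact: b0].
apply: (@le_trans _ _ ((15 / 16)%:E * (7 / 8)%:E)%E); first by rewrite -EFinM lee_fin; lra.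
by apply: lee_pmul; [rewrite lee_fin; lra|rewrite lee_fin; lra|exact: hb'|exact: p_mass].
Qed.

Let q (w : l.-tuple R) : \bar R := Order.min (gpdfn 1 w)%:E (gA w).

Let mq : measurable_fun setT q. Proof. by apply: measurable_mine => //; mR. Qed.
Let q0 w : (0 <= q w)%E. Proof. by rewrite le_min gA0 lee_fin gpdfn_ge0. Qed.

(** An overlap 9/10 and a part [gA] of mass 41/50 of the smoothed density leave 9/10 + 41/50 - 1 =
    18/25. *)
Let q_mass : ((18 / 25)%:E <= \int[lebn l]_w q w)%E.
Proof.
have ms := measurable_smx mu G v0.
have ms' : measurable_fun setT (fun x => (sm mu v G x)%:E) by exact/measurable_EFinP.
have mg : measurable_fun setT (fun x : l.-tuple R => (gpdfn 1 x)%:E) by mR.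
have mm : measurable_fun setT (fun x => (Num.min (gpdfn 1 x) (sm mu v G x))%:E).
  by apply/measurable_EFinP; apply: measurable_minr => //; exact/measurable_EFinP.
have H : (\int[lebn l]_x (Num.min (gpdfn 1 x) (sm mu v G x))%:E + \int[lebn l]_x gA x <= \int[lebn l]_x q x + 1%:E)%E.
  rewrite -(integral_sm mu G v0) -!ge0_DT //; last 2 first.
  - by move=> x; rewrite lee_fin sm_ge0.
  - by move=> x; rewrite lee_fin le_min gpdfn_ge0 // sm_ge0.
  apply: ge0_leT.
  - exact: emeasurable_funD.
  - exact: emeasurable_funD.
  - by move=> x; apply: adde_ge0 => //; rewrite lee_fin le_min gpdfn_ge0 // sm_ge0.
  move=> x; rewrite /q; have := gA_le x; have := gA0 x; case: (gA x) => [r| |] // r0 rs.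
  rewrite -EFin_min -!EFinD lee_fin; rewrite !lee_fin in r0 rs.
  by case: (leP (gpdfn 1 x) r); case: (leP (gpdfn 1 x) (sm mu v G x)); lra.
rewrite -ovlE // in H.
apply: (@le_trans _ _ ((9 / 10 + 41 / 50 - 1)%:E)); first by rewrite lee_fin; lra.
apply: lee_subr_fin; apply: le_trans H; rewrite EFinD; apply: leeD; [rewrite lee_fin; exact: hovl|exact: gA_mass].
Qed.

Let gA_witness w : gA w != 0%E -> exists2 a, A a & exists b, nsq b <= rho /\ exists2 c, nsq c <= rho & a = tadd (tsub w b) c.
Proof.
move=> gw; have [X hX] : exists X, ((gpdfn v (tsub w (app G X)))%:E * (\1_ball (tsub w (app G X)) : R)%:E * p X != 0)%E.
  apply/not_existsP => h; case/eqP: gw; apply: integral0_eq => X _; apply/eqP.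
  by apply/negPn/negP; exact: h.
have hb : ball (tsub w (app G X)).
  apply: contrapT => hb; case/eqP: hX; rewrite indicE memNset // mule0 mul0e //.
have hp : p X != 0%E by apply: contra hX => /eqP ->; rewrite mule0.
have [z hz] : exists z, ((\1_A (tadd (app G X) z) : R)%:E * (\1_ball z : R)%:E != 0)%E.
  apply/not_existsP => h; case/eqP: hp; apply: integral0_eq => z _; apply/eqP.
  by apply/negPn/negP; exact: h.
exists (tadd (app G X) z).
  by apply: contrapT => h; case/eqP: hz; rewrite indicE memNset // mul0e.
exists (tsub w (app G X)); split => //; exists z.
  by apply: contrapT => h; case/eqP: hz; rewrite [X in (_ * X%:E)%E]indicE memNset // mule0.
by apply: eq_from_tnth => i; rewrite !tnth_mktuple; ring.
Qed.

Lemma nsq_add2 (x y : l.-tuple R) : nsq (tadd x y) <= 2 * nsq x + 2 * nsq y.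
Proof.
rewrite !nsqE !mulr_sumr -big_split /=; apply: ler_sum => i _; rewrite tnth_mktuple.
rewrite -subr_ge0 (_ : _ - _ = (tnth x i - tnth y i) ^+ 2); [exact: sqr_ge0|ring].
Qed.

(* Otherwise the smoothed densities of the bulk at w and at w + h would have disjoint supports, while the overlap
   makes both of them close to Gaussian densities. *)
Lemma bulk_difference h : nsq h <= 1 / 4 -> exists a b, [/\ bulk f x0 a, bulk f x0 b & nsq (tsub (tsub a b) h) <= 1 / 16].
Proof.
move=> hh; apply: contrapT => hn.
have disj w : q w = 0%E \/ q (tadd w h) = 0%E.
  have [->|qw] := eqVneq (q w) 0%E; [by left|have [->|qwh] := eqVneq (q (tadd w h)) 0%E; first by right].
  exfalso; apply: hn.
  have gq y : q y != 0%E -> gA y != 0%E.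
    by apply: contra => /eqP h0; rewrite /q h0 min_r // lee_fin gpdfn_ge0.
  have [b hb [b1 [hb1 [c1 hc1 bE]]]] := gA_witness (gq _ qw).
  have [a ha [b2 [hb2 [c2 hc2 aE]]]] := gA_witness (gq _ qwh).
  exists a, b; split => //.
  have -> : tsub (tsub a b) h = tadd (tsub b1 b2) (tsub c2 c1).
    by rewrite aE bE; apply: eq_from_tnth => i; rewrite !tnth_mktuple; ring.
  apply: (le_trans (nsq_add2 _ _)).
  have nN (y : l.-tuple R) : nsq (tscale (-1) y) = nsq y.
    by rewrite !nsqE; apply: eq_bigr => i _; rewrite tnth_mktuple mulN1r sqrrN.
  have k1 := nsq_add2 b1 (tscale (-1) b2); have k2 := nsq_add2 c2 (tscale (-1) c1).
  (* Four errors of squared length at most rho add up to at most 16 rho; this is the origin of rho =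
     1/256. *)
  rewrite !nN -!/(tsub _ _) in k1 k2.
  have re := rhoE.
  lra.
have mg : measurable_fun setT (fun x : l.-tuple R => (gpdfn 1 x)%:E) by mR.
have mT : measurable_fun setT (fun w : l.-tuple R => tadd w h) by mR.
have mqh : measurable_fun setT (fun w => q (tadd w h)) by exact: (measurableT_comp mq mT).
have mgh : measurable_fun setT (fun w : l.-tuple R => (gpdfn 1 (tadd w h))%:E) by mR.
have g0 (x : l.-tuple R) : (0 <= (gpdfn 1 x)%:E)%E by rewrite lee_fin gpdfn_ge0.
(* The parameter 8 bounds the L1 distance by nsq h + 1/4 <= 1/2; the final contradiction is 4
   (18/25) > 2 + 1/2. *)
have := @gpdfn_TV R l 1 [tuple 0 | i < l] (tscale (-1) h) 8 ltr01 (ltr0n _ _).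
set D := (\int[lebn l]_x _)%E => hD.
have md : measurable_fun setT (fun x : l.-tuple R => (`|gpdfn 1 (tsub x [tuple 0 | i < l]) - gpdfn 1 (tsub x (tscale (-1) h))|)%:E).
  by apply: measurable_absD; mR.
have {}hD : (D <= (1 / 2)%:E)%E.
  apply: (le_trans hD); rewrite lee_fin.
  have -> : nsq (tsub [tuple 0 | i < l] (tscale (-1) h)) = nsq h.
    by rewrite !nsqE; apply: eq_bigr => i _; rewrite !tnth_mktuple; congr (_ ^+ 2); ring.
  lra.
have key w : (2%:E * q w + 2%:E * q (tadd w h) <= (gpdfn 1 w)%:E + (gpdfn 1 (tadd w h))%:E + (`|gpdfn 1 (tsub w [tuple 0 | i < l]) - gpdfn 1 (tsub w (tscale (-1) h))|)%:E)%E.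
  have -> : tsub w [tuple 0 | i < l] = w by exact: tsub0.
  have -> : tsub w (tscale (-1) h) = tadd w h by apply: eq_from_tnth => i; rewrite !tnth_mktuple; ring.
  have qg y : (q y <= (gpdfn 1 y)%:E)%E by rewrite /q ge_min lexx.
  rewrite -!EFinD.
  have [d1|d1] := disj w; rewrite d1 mule0 ?add0e ?adde0.
    apply: (@le_trans _ _ (2%:E * (gpdfn 1 (tadd w h))%:E)%E); first by apply: lee_wpmul2l.
    by rewrite -EFinM lee_fin; have := ler_norm (gpdfn 1 (tadd w h) - gpdfn 1 w); rewrite distrC; lra.
  apply: (@le_trans _ _ (2%:E * (gpdfn 1 w)%:E)%E); first by apply: lee_wpmul2l.
  by rewrite -EFinM lee_fin; have := ler_norm (gpdfn 1 w - gpdfn 1 (tadd w h)); lra.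
have I1 : (\int[lebn l]_w (gpdfn 1 w)%:E = 1)%E.
  by rewrite -[RHS](@integral_gpdfn R l 1 [tuple 0 | i < l] ltr01); apply: eq_integral => x _; rewrite tsub0.
have Q := q_mass; pose Iq := (\int[lebn l]_w q w)%E.
have H : (2%:E * Iq + 2%:E * Iq <= 1 + 1 + D)%E; rewrite /Iq.
  rewrite -{2}(integral_lebn_shift h mq q0) -{1}I1 -{1}I1 -{2}(integral_lebn_shift h mg g0).
  have gen (u1 u2 a1 a2 a3 : l.-tuple R -> \bar R) :
     measurable_fun setT u1 -> measurable_fun setT u2 -> measurable_fun setT a1 -> measurable_fun setT a2 -> measurable_fun setT a3 ->
     (forall x, 0 <= u1 x)%E -> (forall x, 0 <= u2 x)%E -> (forall x, 0 <= a1 x)%E -> (forall x, 0 <= a2 x)%E -> (forall x, 0 <= a3 x)%E ->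
     (forall x, 2%:E * u1 x + 2%:E * u2 x <= a1 x + a2 x + a3 x)%E ->
     (2%:E * \int[lebn l]_x u1 x + 2%:E * \int[lebn l]_x u2 x <= \int[lebn l]_x a1 x + \int[lebn l]_x a2 x + \int[lebn l]_x a3 x)%E.
    move=> mu1 mu2 m1 m2 m3 u10 u20 a10 a20 a30 hk.
    have t0 : 0 <= 2 :> R by [].
    have mz (u : l.-tuple R -> \bar R) : measurable_fun setT u -> measurable_fun setT (fun x => 2%:E * u x)%E by exact: measurable_funeM.
    have z0 (u : l.-tuple R -> \bar R) x : (0 <= u x)%E -> (0 <= 2%:E * u x)%E by move=> h0; apply: mule_ge0.
    rewrite -(ge0_ZlT _ t0 mu1 u10) -(ge0_ZlT _ t0 mu2 u20).
    rewrite -(ge0_DT _ (mz _ mu1) (mz _ mu2) (fun x => z0 _ x (u10 x)) (fun x => z0 _ x (u20 x))).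
    rewrite -(ge0_DT _ m1 m2 a10 a20) -(ge0_DT _ (emeasurable_funD m1 m2) m3 (fun x => adde_ge0 (a10 x) (a20 x)) a30).
    apply: ge0_leT.
    - exact: (emeasurable_funD (mz _ mu1) (mz _ mu2)).
    - exact: (emeasurable_funD (emeasurable_funD m1 m2) m3).
    - by move=> x; apply: adde_ge0; apply: z0.
    - exact: hk.
  apply: (gen q (fun w => q (tadd w h))); [exact: mq|exact: mqh|exact: mg|exact: mgh|exact: md|exact: q0|by move=> x; exact: q0|exact: g0|by move=> x; exact: g0|by move=> x; rewrite lee_fin normr_ge0|exact: key].
have : ((2 * (18 / 25) + 2 * (18 / 25))%:E <= (1 + 1 + 1 / 2)%:E :> \bar R)%E.
  apply: (@le_trans _ _ (2%:E * Iq + 2%:E * Iq)%E); last first.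
    by apply: (le_trans H); rewrite EFinD; apply: leeD2l.
  by rewrite EFinD EFinM; apply: leeD; apply: lee_wpmul2l.
by rewrite lee_fin; lra.
Qed.

(** The cost 4 s (3 l + 9) of a bulk translation at s = 2 t is K t / 2, so the costs over the scales
    t, t / 2, t / 4, ... sum to K t. *)
Let K : R := 16 * (3 * l%:R + 9).

Let K0 : 0 < K. Proof. by rewrite /K; have := ler0n R l; lra. Qed.

Lemma nsq_tscale (c : R) (x : l.-tuple R) : nsq (tscale c x) = c ^+ 2 * nsq x.
Proof. by rewrite !nsqE mulr_sumr; apply: eq_bigr => i _; rewrite tnth_mktuple exprMn. Qed.

(* The modulus of continuity satisfies omega(t) <= C t + omega(t / 2). *)
Lemma dshift_doubling k (e t : R) : 0 < t -> (forall h, nsq h <= (t / 2 ^+ k) ^+ 2 -> (dshift f h <= e%:E)%E) ->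
  forall h, nsq h <= t ^+ 2 -> (dshift f h <= (e + K * t)%:E)%E.
Proof.
elim: k t => [|k IH] t t0 H h ht.
  apply: (@le_trans _ _ e%:E); first by apply: H; rewrite expr0 divr1.
  by rewrite lee_fin lerDl mulr_ge0 // ltW.
(* Dividing by 2 t brings h into the range of [bulk_difference], whose error 1/16 becomes (2 t)^2 /
   16 = (t / 2)^2. *)
pose s := 2 * t; have s0 : 0 < s by rewrite mulr_gt0.
have [|a [b [ha hb hab]]] := @bulk_difference (tscale s^-1 h).
  rewrite nsq_tscale exprVn mulrC ler_pdivrMr ?exprn_gt0 // /s; lra.
pose d := tscale s (tsub a b).
have hd : (dshift f d <= (4 * (s * (3 * l%:R + 9)))%:E)%E.
  apply: (@dshift_bulk R l f (fun x => sm_ge0 mu G x v'0) (measurable_smx mu G v'0) (integral_sm mu G v'0)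
    (fun x y t a b => @sm_log_concave R l n mu v' G x y t a b Hlc v'0) x0 fx0 fmax) => //.
have -> : h = tadd d (tsub h d) by apply: eq_from_tnth => i; rewrite !tnth_mktuple; ring.
have hr : nsq (tsub h d) <= (t / 2) ^+ 2.
  have -> : tsub h d = tscale (- s) (tsub (tsub a b) (tscale s^-1 h)).
    by apply: eq_from_tnth => i; rewrite /d !tnth_mktuple; field; rewrite gt_eqF.
  rewrite nsq_tscale sqrrN; apply: (@le_trans _ _ (s ^+ 2 * (1 / 16))).
    by rewrite ler_pM2l // exprn_gt0.
  by rewrite /s le_eqVlt; apply/orP; left; apply/eqP; field.
have hs : (dshift f (tadd d (tsub h d)) <= dshift f d + dshift f (tsub h d))%E.
  by apply: dshift_add; exact: measurable_smx.
apply: (le_trans hs).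
have t2 : 0 < t / 2 by rewrite divr_gt0.
have H2 h' : nsq h' <= (t / 2 / 2 ^+ k) ^+ 2 -> (dshift f h' <= e%:E)%E.
  by move=> hh; apply: H; apply: (le_trans hh); rewrite [2 ^+ k.+1]exprS invfM mulrA.
apply: (@le_trans _ _ ((4 * (s * (3 * l%:R + 9)))%:E + (e + K * (t / 2))%:E)%E).
  by apply: leeD => //; apply: (IH _ t2 H2).
by rewrite -EFinD lee_fin /K /s; lra.
Qed.

(** Iterate [dshift_doubling] down to a scale at which [dshift_small] is below e. The resulting
    constant depends on l only, not on v'. *)
Lemma dshift_le (t : R) h : 0 < t -> nsq h <= t ^+ 2 -> (dshift f h <= (K * t)%:E)%E.
Proof.
move=> t0 ht; apply/lee_addgt0Pr => e e0; rewrite -EFinD addrC.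
pose tau : R := 4 / e; have tau0 : 0 < tau by rewrite divr_gt0.
pose c : R := e / 2 * (8 * v') / tau; have c0 : 0 < c.
  by rewrite divr_gt0 // mulr_gt0 ?divr_gt0 // mulr_gt0.
pose k := (Num.truncn (t ^+ 2 / c)).+1.
have hk : t ^+ 2 / c < 2 ^+ k.
  apply: (@lt_trans _ _ k%:R).
    by have /andP[_] := truncn_itv (ltW (divr_gt0 (exprn_gt0 2 t0) c0)).
  by rewrite -natrX ltr_nat ltn_expl.
apply: (@dshift_doubling k) => // h' hh.
have hds : (dshift f h' <= (tau * nsq h' / (8 * v') + 2 / tau)%:E)%E by exact: dshift_small.
apply: (le_trans hds); rewrite lee_fin.
have h1 : nsq h' <= c.
  apply: (le_trans hh); rewrite expr_div_n.
  have p2 : 0 < 2 ^+ k :> R by rewrite exprn_gt0.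
  rewrite ler_pdivrMr ?exprn_gt0 //.
  apply: (@le_trans _ _ (c * 2 ^+ k)); first by rewrite mulrC -ler_pdivrMr // ltW.
  rewrite ler_pM2l // expr2 ler_peMl ?(ltW p2) // exprn_ege1 // ler1n //.
have h2 : tau * nsq h' / (8 * v') <= e / 2.
  rewrite ler_pdivrMr ?mulr_gt0 // mulrC -ler_pdivlMr //.
have h3 : 2 / tau = e / 2 by rewrite /tau; field; rewrite gt_eqF.
lra.
Qed.

(** A translation by z costs K |z|. The length is linearised as |z| <= al |z|^2 + 1 / (4 al), so
    that only the mean of |z|^2 under the noise is required. *)
Lemma smoothing_error (F : l.-tuple R -> \bar R) (al : R) : 0 < al -> measurable_fun setT F -> (forall x, 0 <= F x <= 1)%E ->
  (\int[lebn l]_x (F x * (f x)%:E) <=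
   \int[pw (gau v) l]_z \int[lebn l]_x (F (tadd x z) * (f x)%:E) + (K * (al * (6 * v * l%:R) + 1 / (4 * al)))%:E)%E.
Proof.
move=> al0 mF F01.
have F0 x : (0 <= F x)%E by case/andP: (F01 x).
have F1 x : (F x <= 1)%E by case/andP: (F01 x).
have mf := measurable_smx mu G v'0; have f0 x : (0 <= (f x)%:E)%E by rewrite lee_fin sm_ge0.
have mf' : measurable_fun setT (fun x => (f x)%:E) by exact/measurable_EFinP.
have mFf : measurable_fun setT (fun x => F x * (f x)%:E)%E by exact: emeasurable_funM.
have Ff0 x : (0 <= F x * (f x)%:E)%E by apply: mule_ge0.
have step z : (\int[lebn l]_x (F x * (f x)%:E) <= \int[lebn l]_x (F (tadd x z) * (f x)%:E) + (K * (al * nsq z + 1 / (4 * al)))%:E)%E.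
  have mT : measurable_fun setT (fun w : l.-tuple R => tadd w z) by mR.
  have mFz : measurable_fun setT (fun x => F (tadd x z)) by exact: (measurableT_comp mF mT).
  have mfz : measurable_fun setT (fun x => (f (tadd x z))%:E) by exact: (measurableT_comp mf' mT).
  have hD : (dshift f z <= (K * (al * nsq z + 1 / (4 * al)))%:E)%E.
    have a4 : 0 < 1 / (4 * al) by rewrite divr_gt0 // mulr_gt0.
    have n0 : 0 <= al * nsq z by rewrite mulr_ge0 ?nsq_ge0 // ltW.
    apply: dshift_le; first by lra.
    rewrite -subr_ge0 (_ : _ - _ = (al * nsq z - 1 / (4 * al)) ^+ 2); first exact: sqr_ge0.
    by field; rewrite gt_eqF.
  apply: le_trans (leeD2l _ hD); rewrite -(integral_lebn_shift z mFf Ff0).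
  have md : measurable_fun setT (fun x => (`|f x - f (tadd x z)|)%:E).
    by apply: measurable_absD => //; exact: (measurableT_comp mf mT).
  have m1 : measurable_fun setT (fun x => F (tadd x z) * (f x)%:E)%E by exact: emeasurable_funM.
  rewrite /dshift -ge0_DT //; last by move=> x; apply: mule_ge0.
  apply: ge0_leT => //.
  - exact: emeasurable_funM.
  - exact: emeasurable_funD.
  move=> x; have := F0 (tadd x z); have := F1 (tadd x z); case: (F (tadd x z)) => [r| |] //.
  rewrite !lee_fin => r1 r0; rewrite -lerBlDl -mulrBr; apply: (@le_trans _ _ (r * `|f x - f (tadd x z)|)).
    by rewrite ler_wpM2l // distrC ler_norm.
  by rewrite ler_piMl.
have c0 : 0 <= 1 / (4 * al) by rewrite divr_ge0 // mulr_ge0 // ltW.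
have mi2 : measurable_fun setT (fun z => \int[lebn l]_x (F (tadd x z) * (f x)%:E))%E.
  apply: (@measurable_int2 _ _ _ _ _ (lebn l) (fun z x => F (tadd x z) * (f x)%:E)%E).
    apply: emeasurable_funM; last exact: (measurableT_comp mf' measurable_snd).
    by apply: (measurableT_comp mF); mR.
  by move=> z x; apply: mule_ge0.
have mn : measurable_fun setT (fun z : l.-tuple R => (K * (al * nsq z + 1 / (4 * al)))%:E) by mR.
have n0 (z : l.-tuple R) : (0 <= (K * (al * nsq z + 1 / (4 * al)))%:E)%E.
  by rewrite lee_fin mulr_ge0 ?(ltW K0) // addr_ge0 // mulr_ge0 ?nsq_ge0 // ltW.
have j0 z : (0 <= \int[lebn l]_x (F (tadd x z) * (f x)%:E))%E by apply: integral_ge0 => x _; apply: mule_ge0.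
rewrite -[leLHS](integral_prob_cst _ (g1 v)).
apply: (@le_trans _ _ (\int[pw (gau v) l]_z (\int[lebn l]_x (F (tadd x z) * (f x)%:E) + (K * (al * nsq z + 1 / (4 * al)))%:E))%E).
  apply: ge0_leT => //; first exact: emeasurable_funD.
  by move=> z; exact: integral_ge0.
rewrite ge0_DT //; apply: leeD2l.
have mnz : measurable_fun setT (fun z : l.-tuple R => (nsq z)%:E) by mR.
have E : (\int[pw (gau v) l]_z (K * (al * nsq z + 1 / (4 * al)))%:E = (K * al)%:E * \int[pw (gau v) l]_z (nsq z)%:E + (K * (1 / (4 * al)))%:E)%E.
  have ka : 0 <= K * al by rewrite mulr_ge0 // ltW.
  have z0 (z : l.-tuple R) : (0 <= (nsq z)%:E)%E by rewrite lee_fin nsq_ge0.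
  rewrite -ge0_ZlT // -[X in (_ + X)%E](integral_prob_cst _ (g1 v)) -ge0_DT //.
  - by apply: eq_integral => z _; rewrite -EFinM -EFinD; congr EFin; ring.
  - exact: measurable_funeM.
  - by move=> z; apply: mule_ge0.
  - by move=> z; rewrite lee_fin mulr_ge0 // ltW.
rewrite E (_ : K * (al * (6 * v * l%:R) + _) = K * al * (6 * v * l%:R) + K * (1 / (4 * al))); last by ring.
rewrite EFinD; apply: leeD2r; rewrite [(K * al * (6 * v * l%:R))%:E]EFinM; apply: lee_wpmul2l; last exact: gaun_nsq_le.
by rewrite lee_fin mulr_ge0 // ltW.
Qed.

End Desmoothing.

(** * Letting the auxiliary noise tend to zero *)

Section DesmoothingLimit.
Context (R : realType) (l n : nat) (mu : probability (n.-tuple R) R).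
Local Notation leb := (@leb R).
Local Notation lebn := (pw leb).
Local Notation gau := (@gau R).

Definition tv_continuous := forall e : R, 0 < e -> exists2 d : R, 0 < d & forall u : n.-tuple R, nsq u <= d ->
  forall F : n.-tuple R -> \bar R, measurable_fun setT F -> (forall X, 0 <= F X <= 1)%E ->
  (\int[mu]_X F (tadd X u) <= \int[mu]_X F X + e%:E)%E.

Hypothesis Hlc : log_concave_marginals mu.
Hypothesis Htv : tv_continuous.
Variable U : 'M[R]_(l, n).
Hypothesis hU : U *m U^T = 1%:M.
Let G := rows_of U.

Lemma app_shift (X : n.-tuple R) (y : l.-tuple R) : app G (tadd X (tmul y U)) = tadd (app G X) y.
Proof.
rewrite !app_rows; apply: rv_of_inj; rewrite !(rv_of_tmul, rv_of_tadd) mulmxDl; congr (_ + _).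
by rewrite -mulmxA hU mulmx1.
Qed.

Lemma near_law (e : R) : 0 < e -> exists2 d : R, 0 < d & forall y : l.-tuple R, nsq y <= d ->
  forall F : l.-tuple R -> \bar R, measurable_fun setT F -> (forall x, 0 <= F x <= 1)%E ->
  (\int[mu]_X F (tadd (app G X) y) <= \int[mu]_X F (app G X) + e%:E)%E /\
  (\int[mu]_X F (app G X) <= \int[mu]_X F (tadd (app G X) y) + e%:E)%E.
Proof.
move=> e0; have [d d0 hd] := Htv e0; exists d => // y hy F mF F01; split.
  have h := hd (tmul y U) _ (fun X => F (app G X)).
  under eq_integral do rewrite -app_shift; apply: h => //; first by rewrite nsq_tmul.
  by apply: (measurableT_comp mF); mR.
pose ny := tscale (-1) y.
have hny : nsq (tmul ny U) <= d.
  rewrite nsq_tmul //; apply: le_trans hy; rewrite !nsqE; apply: ler_sum => i _.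
  by rewrite tnth_mktuple mulN1r sqrrN.
have mFy : measurable_fun setT (fun X : n.-tuple R => F (tadd (app G X) y)).
  by apply: (measurableT_comp mF); mR.
apply: le_trans (hd _ hny _ mFy (fun X => F01 _)).
rewrite le_eqVlt; apply/orP; left; apply/eqP; apply: eq_integral => X _; rewrite app_shift; congr F.
by apply: eq_from_tnth => i; rewrite !tnth_mktuple; ring.
Qed.

Lemma near_smooth (e : R) : 0 < e -> exists2 w : R, 0 < w & forall v, 0 < v -> v <= w ->
  forall F : l.-tuple R -> \bar R, measurable_fun setT F -> (forall x, 0 <= F x <= 1)%E ->
  (\int[lebn l]_x (F x * (sm mu v G x)%:E) <= \int[mu]_X F (app G X) + e%:E)%E /\
  (\int[mu]_X F (app G X) <= \int[lebn l]_x (F x * (sm mu v G x)%:E) + e%:E)%E.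
Proof.
move=> e0; have e2 : 0 < e / 2 by rewrite divr_gt0.
have [d d0 hd] := near_law e2.
exists (e / 2 * d / (6 * (l%:R + 1))).
  by rewrite divr_gt0 ?mulr_gt0 // ltr_wpDl.
move=> v v0 vw F mF F01.
have F0 x : (0 <= F x)%E by case/andP: (F01 x).
have F1 x : (F x <= 1)%E by case/andP: (F01 x).
have l1 : 0 < l%:R + 1 :> R by rewrite ltr_wpDl.
have tail : (pw (gau v) l [set z | d < nsq z]%R <= (e / 2)%:E)%E.
  apply: (le_trans (gaun_nsq_markov l v0 d0)); rewrite lee_fin ler_pdivrMr //.
  move: vw; rewrite ler_pdivlMr ?mulr_gt0 // => vw; apply: le_trans vw.
  rewrite mulrAC mulrA [6 * v]mulrC ler_pM2l ?mulr_gt0 // || by rewrite [6 * v]mulrC -mulrA ler_pM2l // ler_pM2l // lerDl.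
have g1 : pw (gau v) l setT = 1%E by apply: pw_setT; exact: gau_setT.
have mG := @measurable_nsq_gt R l d.
pose b (z : l.-tuple R) : \bar R := (\1_[set z : l.-tuple R | d < nsq z] z : R)%:E.
have mb : measurable_fun setT b by apply/measurable_EFinP; exact: measurable_indic.
have b0 z : (0 <= b z)%E by rewrite lee_fin indicE ler0n.
have ib : (\int[pw (gau v) l]_z b z <= (e / 2)%:E)%E by rewrite integral_indic // setIT.
have mFz : measurable_fun setT (fun z : l.-tuple R * n.-tuple R => F (tadd (app G z.2) z.1)).
  by apply: (measurableT_comp mF); mR.
have mI : measurable_fun setT (fun z => \int[mu]_X F (tadd (app G X) z))%E.
  exact: (@measurable_int2 _ _ _ _ _ mu (fun z X => F (tadd (app G X) z)) mFz (fun z X => F0 _)).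
have I0 z : (0 <= \int[mu]_X F (tadd (app G X) z))%E by exact: integral_ge0.
have mu1 : mu setT = 1%E by exact: probability_setT.
have I1 z : (\int[mu]_X F (tadd (app G X) z) <= 1)%E.
  rewrite -[leRHS](integral_prob_cst 1%E mu1); apply: ge0_leT => //.
  exact: (measurable_sec (f := fun z X => F (tadd (app G X) z)) mFz).
pose c := (\int[mu]_X F (app G X))%E.
have c0 : (0 <= c)%E by exact: integral_ge0.
have c1 : (c <= 1)%E.
  rewrite -[leRHS](integral_prob_cst 1%E mu1); apply: ge0_leT => //.
  by apply: (measurableT_comp mF); mR.
rewrite -(ge0_integral_smoothed mu G v0 mF F0).
rewrite (@ge0_swap _ _ _ _ _ mu (pw (gau v) l) (fun X z => F (tadd (app G X) z))); [|by apply: (measurableT_comp mF); mR|by []].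
rewrite -/c.
have h0 : (0 <= (e / 2)%:E)%E by rewrite lee_fin ltW.
have [cr ccr] : exists r, c = r%:E.
  by exists (fine c); rewrite fineK // ge0_fin_numE //; apply: le_lt_trans c1 _; rewrite ltry.
have pt z : (\int[mu]_X F (tadd (app G X) z) <= c + (e / 2)%:E + b z)%E /\ (c <= \int[mu]_X F (tadd (app G X) z) + (e / 2)%:E + b z)%E.
  rewrite /b indicE; have [hz|hz] := leP (nsq z) d.
    rewrite memNset /=; last by apply/negP; rewrite -leNgt.
    by rewrite !adde0; exact: hd.
  rewrite mem_set //=; split.
    by apply: (le_trans (I1 z)); rewrite -[leLHS]add0e; apply: leeD => //; apply: adde_ge0.
  by apply: (le_trans c1); rewrite -[leLHS]add0e; apply: leeD => //; apply: adde_ge0.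
have ee : e%:E = ((e / 2)%:E + (e / 2)%:E)%E by rewrite -EFinD -splitr.
split.
  apply: (@le_trans _ _ (\int[pw (gau v) l]_z (c + (e / 2)%:E + b z))%E).
    apply: ge0_leT; [exact: mI|by apply: emeasurable_funD; [exact: measurable_cst|exact: mb]|exact: I0|by move=> z; case: (pt z)].
  rewrite ge0_DT; [|exact: measurable_cst|exact: mb|by move=> z; apply: adde_ge0|exact: b0].
  rewrite (integral_prob_cst _ g1) ee [X in (_ <= X)%E]addeA.
  by apply: leeD; [exact: lexx|exact: ib].
rewrite -[leLHS](integral_prob_cst _ g1).
apply: (@le_trans _ _ (\int[pw (gau v) l]_z (\int[mu]_X F (tadd (app G X) z) + ((e / 2)%:E + b z)))%E).
  apply: ge0_leT; [exact: measurable_cst| |by []|by move=> z; rewrite addeA; case: (pt z)].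
  by apply: emeasurable_funD; [exact: mI|apply: emeasurable_funD; [exact: measurable_cst|exact: mb]].
rewrite ge0_DT; [|exact: mI|by apply: emeasurable_funD; [exact: measurable_cst|exact: mb]|exact: I0|by move=> z; apply: adde_ge0].
apply: leeD2l; rewrite ge0_DT; [|exact: measurable_cst|exact: mb|by []|exact: b0].
by rewrite (integral_prob_cst _ g1) ee; exact: (leeD2l _ ib).
Qed.

(** F is compared with its average under the noise v, first for the density with noise v'. The bound
    of [smoothing_error] is uniform in v', so [near_smooth] removes v' from both sides as it tends
    to 0. *)
Lemma desmoothing (v al : R) (F : l.-tuple R -> \bar R) : 0 < v -> 6 * v * l%:R * 256 <= 1 / 16 -> 9 / 10 <= ovl mu v G -> 0 < al ->
  measurable_fun setT F -> (forall x, 0 <= F x <= 1)%E ->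
  (\int[mu]_X F (app G X) <= \int[lebn l]_x (F x * (sm mu v G x)%:E) +
    (16 * (3 * l%:R + 9) * (al * (6 * v * l%:R) + 1 / (4 * al)))%:E)%E.
Proof.
move=> v0 vl ho al0 mF F01; apply/lee_addgt0Pr => e e0.
have F0 x : (0 <= F x)%E by case/andP: (F01 x).
have F1 x : (F x <= 1)%E by case/andP: (F01 x).
have e2 : 0 < e / 2 by rewrite divr_gt0.
have [w w0 hw] := near_smooth e2.
have l1 : 0 < l%:R + 1 :> R by rewrite ltr_wpDl.
(* The bound w1 puts v' in the range where [smoothing_error] applies; the bound w makes each of the
   two uses of [near_smooth] cost e / 2. *)
pose w1 : R := (6 * 16 * 256 * (l%:R + 1))^-1.
have w10 : 0 < w1 by rewrite invr_gt0; lra.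
pose v' := Num.min w w1; have v'0 : 0 < v' by rewrite lt_min w0 w10.
have v'w : v' <= w by rewrite ge_min lexx.
have v'l : 6 * v' * l%:R * 256 <= 1 / 16.
  have h1 : v' <= w1 by rewrite ge_min lexx orbT.
  have h2 : v' * l%:R <= w1 * (l%:R + 1).
    by apply: ler_pM => //; [exact: ltW|rewrite lerDl].
  have h3 : w1 * (l%:R + 1) = (6 * 16 * 256)^-1 by rewrite /w1; field; rewrite gt_eqF.
  by move: h2; rewrite h3; goal_lra.
pose rho : R := 256^-1; have rhoE : rho * 256 = 1 by rewrite /rho; field.
have vr : 6 * v * l%:R / rho <= 1 / 16 by rewrite /rho invrK.
have vr' : 6 * v' * l%:R / rho <= 1 / 16 by rewrite /rho invrK.
have [x0 fx0 fmax] := sm_maximizer mu G v'0.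
have [_ h1] := hw v' v'0 v'w F mF F01.
apply: (le_trans h1).
have h2 := smoothing_error Hlc v0 v'0 rhoE vr vr' ho fx0 fmax al0 mF F01.
pose Ft y := (\int[pw (gau v) l]_z F (tadd y z))%E.
have mFt2 : measurable_fun setT (fun p : l.-tuple R * l.-tuple R => F (tadd p.1 p.2)) by apply: (measurableT_comp mF); mR.
have mFt : measurable_fun setT Ft.
  exact: (@measurable_int2 _ _ _ _ _ (pw (gau v) l) (fun y z => F (tadd y z)) mFt2 (fun y z => F0 _)).
have Ft01 y : (0 <= Ft y <= 1)%E.
  apply/andP; split; first by exact: integral_ge0.
  have g1 : pw (gau v) l setT = 1%E by apply: pw_setT; exact: gau_setT.
  rewrite -[leRHS](integral_prob_cst 1%E g1); apply: ge0_leT => //.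
  exact: (measurable_sec (f := fun y z => F (tadd y z)) mFt2).
have [h3 _] := hw v' v'0 v'w Ft mFt Ft01.
have h4 : (\int[pw (gau v) l]_z \int[lebn l]_x (F (tadd x z) * (sm mu v' G x)%:E) = \int[lebn l]_x (Ft x * (sm mu v' G x)%:E))%E.
  have msm := measurable_smx mu G v'0.
  rewrite (@ge0_swap _ _ _ _ _ (pw (gau v) l) (lebn l) (fun z x => F (tadd x z) * (sm mu v' G x)%:E)%E); last 2 first.
  - apply: emeasurable_funM; first by apply: (measurableT_comp mF); mR.
    by apply/measurable_EFinP; exact: (measurableT_comp msm measurable_snd).
  - by move=> z x; apply: mule_ge0 => //; rewrite lee_fin sm_ge0.
  apply: eq_integral => x _; rewrite ge0_ZrT //; first exact: sm_ge0.
  by apply: (measurableT_comp mF); mR.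
have h5 : (\int[mu]_X Ft (app G X) = \int[lebn l]_x (F x * (sm mu v G x)%:E))%E.
  by rewrite -ge0_integral_smoothed.
rewrite h4 in h2; rewrite h5 in h3.
set Kc := (16 * _ * _)%:E in h2 *.
apply: (@le_trans _ _ (\int[lebn l]_x (F x * (sm mu v G x)%:E) + (e / 2)%:E + Kc + (e / 2)%:E)%E).
  apply: leeD2r; apply: (le_trans h2); exact: leeD2r.
rewrite le_eqVlt; apply/orP; left; apply/eqP.
by rewrite /Kc; case: (\int[lebn l]_x _)%E => [r| |] //; rewrite -!EFinD; congr EFin; goal_lra.
Qed.

End DesmoothingLimit.

(** * Choice of scales *)

Lemma quartic_dominates (R : realType) (Y E : R) : 0 <= Y -> Y <= E -> 32 * 32 <= E -> 1 + Y * (E + 2) <= E * E * (E * E).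
Proof.
move=> Y0 YE E1; have E0 : 0 <= E by lra.
have e2 : 32 * 32 * E <= E * E by exact: ler_wpM2r.
have e3 : E * E * 1 <= E * E * (E * E).
  apply: ler_wpM2l; first exact: mulr_ge0.
  lra.
have e4 : E * E * 32 <= E * E * (E * E).
  apply: ler_wpM2l; first exact: mulr_ge0.
  lra.
have e5 : Y * (E + 2) <= E * (E + 2) by apply: ler_wpM2r => //; lra.
lra.
Qed.

(* All error terms are powers of u = 1 / y, where y is the integer part of n^(1/300). *)
Section PolynomialScale.
Context (R : realType) (n y : nat) (mu : probability (n.-tuple R) R).
Hypothesis Hlc : log_concave_marginals mu.
Hypothesis Hiso : sub_isotropic mu.
Hypothesis Hn : (\int[mu]_X (nsq X)%:E = n%:R%:E)%E.
Let Y : R := y%:R.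
Hypothesis Y1 : 32 * 32 <= Y.
Hypothesis YC : 4 * C4 R <= Y.
Hypothesis ny : (y ^ 300 <= n)%N.
Hypothesis ny' : (n < y.+1 ^ 300)%N.
Let u : R := Y^-1.
Let w : R := n%:R^-1.

Let Y0 : 0 < Y. Proof. by move: Y1; lra. Qed.
Let u0 : 0 < u. Proof. by rewrite invr_gt0. Qed.
Let Yu : Y * u = 1. Proof. by rewrite mulfV // gt_eqF. Qed.
Let Yge1 : 1 <= Y. Proof. by move: Y1; lra. Qed.
Let u1 : u <= 1. Proof. by rewrite invf_le1. Qed.
Let y0 : (0 < y)%N. Proof. by rewrite -(ltr0n R). Qed.
Let n0 : (0 < n)%N. Proof. by apply: leq_trans ny; rewrite expn_gt0 y0. Qed.
Let nR : 0 < n%:R :> R. Proof. by rewrite ltr0n. Qed.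
Let w0 : 0 < w. Proof. by rewrite invr_gt0. Qed.

Let Yle a b : (a <= b)%N -> Y ^+ a <= Y ^+ b.
Proof. by move=> ab; rewrite ler_weXn2l. Qed.
Let ule a b : (a <= b)%N -> u ^+ b <= u ^+ a.
Proof. by move=> ab; rewrite ler_wiXn2l // (ltW u0). Qed.
Let Yuk a b : Y ^+ a * u ^+ (a + b) = u ^+ b.
Proof. by rewrite exprD mulrA -exprMn Yu expr1n mul1r. Qed.
Let YS a : Y ^+ a.+1 = Y * Y ^+ a. Proof. exact: exprS. Qed.
Let Yk0 a : 0 < Y ^+ a. Proof. exact: exprn_gt0. Qed.
Let uk0 a : 0 < u ^+ a. Proof. exact: exprn_gt0. Qed.
Let Yc (c : R) a : c <= Y -> c * Y ^+ a <= Y ^+ a.+1.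
Proof. by move=> cY; rewrite YS; apply: ler_wpM2r => //; exact: ltW. Qed.
Let uc (c : R) a : c <= Y -> c * u ^+ a.+1 <= u ^+ a.
Proof. by move=> cY; rewrite -[leRHS](Yuk 1) expr1; apply: ler_wpM2r => //; exact: ltW. Qed.

Let sqn : Y ^+ 150 <= Num.sqrt n%:R.
Proof.
rewrite -[leLHS]ger0_norm ?(ltW (Yk0 _)) // -sqrtr_sqr; apply: ler_wsqrtr.
by rewrite -exprM -natrX ler_nat.
Qed.

(** [bad_pair_le] with T = Y^42 and A = T sqrt n: then w T A = Y^84 / sqrt n is at most rho = u^66
    because sqrt n >= Y^150, and Y^42 / 8 absorbs the polynomial factor n and still leaves Y^40. *)
Let pp : R := 3 * (n%:R + 1) * expR (- (Y ^+ 42 / 8)).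
Let rho : R := u ^+ 66.

Lemma pp_le : pp <= expR (- Y ^+ 40).
Proof.
have h1 : n%:R + 1 <= expR (300%:R * Y).
  apply: (@le_trans _ _ ((1 + Y) ^+ 300)).
    by rewrite /Y [1 + y%:R]addrC !natr1 -natrX ler_nat.
  by rewrite expRM_natl lerXn2r ?nnegrE ?expR_ge0 ?expR_ge1Dx // addr_ge0 // ltW.
have h2 : (3 : R) <= expR 2 by apply: le_trans (expR_ge1Dx _); lra.
apply: (@le_trans _ _ (expR 2 * expR (300%:R * Y) * expR (- (Y ^+ 42 / 8)))).
  by rewrite ler_wpM2r ?expR_ge0 //; apply: ler_pM => //; rewrite addr_ge0.
rewrite -!expRD ler_expR.
have hY := Yle (isT : (1 <= 40)%N); rewrite expr1 in hY.
have := Yc 41 Y1; have := Yc 40 Y1; have := Y1; lra.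
Qed.

Lemma bad_pp : (\int[mu]_X \int[mu]_Z (\1_(bad_pair w rho) (X, Z) : R)%:E <= pp%:E)%E.
Proof.
have sn0 : 0 < Num.sqrt n%:R :> R by rewrite sqrtr_gt0.
apply: (bad_pair_le Hlc Hiso (A := Y ^+ 42 * Num.sqrt n%:R)) => //.
- exact: mulr_gt0.
- exact: ltW.
- by rewrite [leRHS]exprMn sqr_sqrtr ?(ltW nR) // mulrC.
have -> : w * (Y ^+ 42 * (Y ^+ 42 * Num.sqrt n%:R)) = Y ^+ 84 / Num.sqrt n%:R.
  rewrite /w -{1}[n%:R](sqr_sqrtr (ltW nR)) (exprD _ 42 42) expr2; field; rewrite gt_eqF //.
rewrite ler_pdivrMr // /rho.
apply: (@le_trans _ _ (u ^+ 66 * Y ^+ 150)); last by rewrite ler_pM2l.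
by rewrite (exprD Y 66 84) mulrA -exprMn [u * Y]mulrC Yu expr1n mul1r.
Qed.

Lemma ssq_mean : (\int[mu]_X (ssq w X)%:E = 1)%E.
Proof.
transitivity (\int[mu]_X (w%:E * (nsq X)%:E))%E; first by apply: eq_integral => X _; rewrite -EFinM.
rewrite ge0_ZlT //; [by rewrite Hn -EFinM /w mulVf // gt_eqF|exact: ltW|by mR|by move=> X; rewrite lee_fin nsq_ge0].
Qed.

Lemma ssq_second : (\int[mu]_X (ssq w X ^+ 2)%:E <= (C4 R)%:E)%E.
Proof.
have mn : measurable_fun setT (fun X : n.-tuple R => (nsq X ^+ 2)%:E) by mR.
have -> : (\int[mu]_X (ssq w X ^+ 2)%:E = (w ^+ 2)%:E * \int[mu]_X (nsq X ^+ 2)%:E)%E.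
  rewrite -ge0_ZlT //; [by apply: eq_integral => X _; rewrite -EFinM exprMn|exact: exprn_ge0 (ltW w0)|by move=> X; rewrite lee_fin sqr_ge0].
apply: (@le_trans _ _ ((w ^+ 2)%:E * (C4 R * n%:R ^+ 2)%:E)%E).
  by apply: lee_wpmul2l; [rewrite lee_fin exprn_ge0 // ltW|exact: nsq_second_moment].
rewrite -EFinM lee_fin /w le_eqVlt; apply/orP; left; apply/eqP; field; rewrite gt_eqF //.
Qed.

(** By Markov's inequality ssq < 2 with probability at least 1/2, and for such X the variance 1 +
    ssq lies between 1 and 3. *)
Lemma mix1_ge k (x : k.-tuple R) : 2^-1 * (gpdf 3 0 ^+ k * expR (- (nsq x / 2))) <= mix mu 1 w x.
Proof.
have mn : measurable_fun setT (fun X : n.-tuple R => (ssq w X)%:E) by rewrite /ssq; mR.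
pose A : set (n.-tuple R) := [set X | 2 <= ssq w X].
have mA : measurable A.
  have mf : measurable_fun setT (fun X : n.-tuple R => ssq w X) by rewrite /ssq; mR.
  rewrite (_ : A = (fun X : n.-tuple R => ssq w X) @^-1` `[2, +oo[).
    by rewrite -[X in measurable X]setTI; exact: mf.
  by apply/seteqP; split => X /=; rewrite in_itv /= andbT.
have hA : (2%:E * mu A <= 1)%E.
  rewrite -ssq_mean; apply: le_mul_measure => //.
  - by move=> X; rewrite lee_fin; exact: ssq_ge0.
have hA' : (mu A <= (2^-1)%:E)%E.
  have := lee_wpmul2l (_ : (0 <= (2^-1)%:E :> \bar R)%E) hA; rewrite lee_fin invr_ge0 => /(_ (ler0n _ _)).
  by rewrite muleA -EFinM mulVf // mul1e mule1.
have hAc : ((2^-1)%:E <= mu (~` A))%E.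
  rewrite -[X in (X <= _)%E](_ : (1 - 2^-1)%:E = _); last by congr EFin; field.
  apply: lee_subr_fin; rewrite -(@probability_setT _ _ _ mu) -(setvU A) measureU //; last by rewrite setICl.
  + by apply: leeD2l.
  + exact: measurableC.
have c0 : 0 <= gpdf 3 0 ^+ k * expR (- (nsq x / 2)) by rewrite mulr_ge0 ?expR_ge0 // exprn_ge0 // gpdf_ge0.
rewrite -lee_fin mixE // mulrC EFinM.
apply: (@le_trans _ _ ((gpdf 3 0 ^+ k * expR (- (nsq x / 2)))%:E * mu (~` A))%E); first by apply: lee_wpmul2l.
apply: le_mul_measure => //.
- exact: measurableC.
- apply/measurable_EFinP; apply: measurable_gpdfn_var; [by mR|by mR|move=> X].
  by rewrite addr_ge0 //; exact: ssq_ge0.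
- by move=> X; rewrite lee_fin gpdfn_ge0.
move=> X /=; rewrite /A /= => /negP; rewrite -ltNge /ssq => hX.
have s0 : 0 <= w * nsq X by exact: ssq_ge0.
have s1 : 0 < 1 + w * nsq X by rewrite ltr_pwDl.
rewrite lee_fin gpdfnE //; apply: ler_pM; rewrite ?expR_ge0 // ?exprn_ge0 // ?gpdf_ge0 //.
  by rewrite lerXn2r // ?nnegrE ?gpdf_ge0 //; apply: gpdf0_antitone => //; lra.
rewrite ler_expR lerN2 ler_wpM2l ?nsq_ge0 // lef_pV2 ?posrE ?mulr_gt0 //; lra.
Qed.

Lemma expR_le_affine (z : R) : 0 <= z <= 2^-1 -> expR z <= 1 + 2 * z.
Proof.
move=> /andP[z0 z1]; have h : 1 + - z <= expR (- z) by exact: expR_ge1Dx.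
have h1 : 0 < 1 - z by lra.
rewrite -[z in expR z]opprK expRN; apply: (@le_trans _ _ (1 - z)^-1).
  by rewrite lef_pV2 ?posrE ?expR_gt0.
rewrite -[leLHS]mul1r ler_pdivrMr // (_ : (1 + 2 * z) * (1 - z) = 1 + z * (1 - 2 * z)); last by ring.
by rewrite lerDl mulr_ge0 //; lra.
Qed.

Lemma pow_le_expR (c : R) k : 0 <= c -> (1 + c) ^+ k <= expR (k%:R * c).
Proof. by move=> c0; rewrite expRM_natl lerXn2r ?nnegrE ?expR_ge0 ?expR_ge1Dx // addr_ge0. Qed.

Let rho0 : 0 <= rho. Proof. by apply: ltW; exact: uk0. Qed.

(** Noise 1, dimension up to Y^32, at the radii where the shell argument evaluates the mixture. The
    squared mean is at least of order exp(- 2 Y^39), up to factors exponential in k, so the bad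
    pairs, of probability at most exp(- Y^40), cost at most 1/32 of it; the good pairs cost another
    1/32. *)
Lemma sm2_shell k (x : k.-tuple R) : k%:R <= Y ^+ 32 -> nsq x <= 2 * Y ^+ 39 ->
  (\int[pw (pw (@gau R w) n) k]_G ((sm mu 1 G x)%:E * (sm mu 1 G x)%:E) <= ((1 + 16^-1) * mix mu 1 w x ^+ 2)%:E)%E.
Proof.
move=> kY xY; have N0 := nsq_ge0 x; have r0 := rho0; have k0 := ler0n R k.
have u2 : u ^+ 132 <= u by have := ule (isT : (1 <= 132)%N); rewrite expr1.
have z1 := uc 0 Y1; rewrite expr0 expr1 in z1.
have rr : rho ^+ 2 = u ^+ 132 by rewrite /rho -exprM.
have rho1 : rho ^+ 2 <= 1 ^+ 2 / 2 by rewrite rr expr1n; move: u2 z1; goal_lra.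
apply: (le_trans (expectation_sm2_le x ltr01 w0 rho0 rho1 bad_pp)).
rewrite lee_fin !expr1n !divr1 rr.
set m := mix mu 1 w x; set g3 : R := gpdf 3 0.
have hm : 2^-1 * (g3 ^+ k * expR (- (nsq x / 2))) <= m by exact: mix1_ge.
have g30 : 0 < g3 by exact: gpdf_gt0.
have b0 : 0 <= 2^-1 * (g3 ^+ k * expR (- (nsq x / 2))).
  by rewrite mulr_ge0 // ?invr_ge0 // mulr_ge0 ?expR_ge0 // exprn_ge0 // ltW.
have hm2 : 4^-1 * ((g3 ^+ 2) ^+ k * expR (- nsq x)) <= m ^+ 2.
  apply: (@le_trans _ _ ((2^-1 * (g3 ^+ k * expR (- (nsq x / 2)))) ^+ 2)).
    have sq (a b : R) : (2^-1 * (a * b)) ^+ 2 = 4^-1 * (a ^+ 2 * b ^+ 2) by field.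
    by rewrite sq [g3 ^+ k ^+ 2]exprAC -expRM_natl (_ : 2%:R * - (nsq x / 2) = - nsq x); [|field].
  by rewrite lerXn2r // nnegrE //; exact: le_trans hm.
have m0 : 0 <= m ^+ 2 by exact: sqr_ge0.
have hexp : expR (k%:R * u ^+ 132 + 2 * rho * nsq x) <= 1 + 32^-1.
  have e1 : k%:R * u ^+ 132 <= u ^+ 100.
    by rewrite -(Yuk 32 100); apply: ler_wpM2r => //; exact: ltW.
  have e2 : rho * nsq x <= 2 * u ^+ 27.
    apply: (@le_trans _ _ (u ^+ 66 * (2 * Y ^+ 39))); first exact: ler_wpM2l.
    by rewrite mulrCA [u ^+ 66 * _]mulrC (Yuk 39 27).
  have e3 := ule (isT : (1 <= 100)%N); have e4 := ule (isT : (1 <= 27)%N); rewrite !expr1 in e3 e4.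
  have p1 : 0 <= k%:R * u ^+ 132 by rewrite mulr_ge0 // ltW.
  have p2 : 0 <= rho * nsq x by exact: mulr_ge0.
  apply: le_trans (expR_le_affine _) _; first by apply/andP; split; move: p1 p2 e1 e2 e3 e4 z1; goal_lra.
  by move: e1 e2 e3 e4 z1; goal_lra.
have hsec : gpdf 1 0 ^+ (2 * k) * pp <= 32^-1 * (4^-1 * ((g3 ^+ 2) ^+ k * expR (- nsq x))).
  have -> : gpdf (1 : R) 0 ^+ (2 * k) = (1 + 2) ^+ k * (g3 ^+ 2) ^+ k.
    rewrite exprM -exprMn; congr (_ ^+ _); rewrite /g3 !gpdf0_sqr //.
    have := pi_gt0 R; move: (@pi R) => p p0; field; rewrite gt_eqF //.
  have g3k : 0 < (g3 ^+ 2) ^+ k by rewrite !exprn_gt0.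
  have hp : (1 + 2) ^+ k * pp <= expR (k%:R * 2) * expR (- Y ^+ 40).
    apply: ler_pM.
    - by rewrite exprn_ge0.
    - by rewrite /pp mulr_ge0 ?expR_ge0 // mulr_ge0 // addr_ge0.
    - exact: pow_le_expR.
    - exact: pp_le.
  have h128 : 32 * 4 * expR (k%:R * 2 - Y ^+ 40) <= expR (- nsq x).
    apply: (@le_trans _ _ (expR (32 * 4) * expR (k%:R * 2 - Y ^+ 40))).
      by rewrite ler_wpM2r ?expR_ge0 //; apply: le_trans (expR_ge1Dx _); goal_lra.
    rewrite -expRD ler_expR; have := Yc 39 Y1; have := Yle (isT : (32 <= 39)%N); have := Yle (isT : (1 <= 39)%N).
    rewrite expr1; have := Y1; move: kY xY; goal_lra.
  rewrite -expRD in hp.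
  have -> : (1 + 2) ^+ k * (g3 ^+ 2) ^+ k * pp = (g3 ^+ 2) ^+ k * ((1 + 2) ^+ k * pp) by ring.
  have -> : 32^-1 * (4^-1 * ((g3 ^+ 2) ^+ k * expR (- nsq x))) = (g3 ^+ 2) ^+ k * (expR (- nsq x) / (32 * 4)) by field.
  rewrite ler_pM2l // ler_pdivlMr; last by goal_lra.
  by apply: le_trans h128; rewrite [leRHS]mulrC; apply: ler_wpM2r => //; goal_lra.
have hfirst : expR (k%:R * u ^+ 132 + 2 * rho * nsq x) * m ^+ 2 <= (1 + 32^-1) * m ^+ 2 by exact: ler_wpM2r.
apply: (le_trans (lerD hfirst hsec)).
by move: hm2; move: (4^-1 * _) => b; goal_lra.
Qed.

(** The marginal used here has dimension M^2 = y^32, unrelated to the l of the theorem: the larger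
    the dimension, the larger the gain of [thin_pair]. The other choices are S = y^7 and tau = u^6,
    so that S tau = Y dominates 4 C4. *)
Lemma thin : 1 - u ^+ 3 <= Pr mu [set X | `|ssq w X - 1| <= u ^+ 6].
Proof.
pose M := (y ^ 16)%N; pose S := (y ^ 7)%N.
have ME : M%:R = Y ^+ 16 :> R by rewrite /M natrX.
have SE : S%:R = Y ^+ 7 :> R by rewrite /S natrX.
have M0 : (0 < M)%N by rewrite expn_gt0 y0.
have l0 : (0 < M ^ 2)%N by rewrite expn_gt0 M0.
have S1 : (1 < S)%N.
  rewrite -(ltr_nat R) SE; have := Yle (isT : (1 <= 7)%N); rewrite expr1; have := Y1; goal_lra.
have C0 : 0 <= C4 R by rewrite /C4 mulr_ge0 // mulr_ge0 // exprn_ge0.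
have z := @thin_shell R n mu w w0 (M ^ 2) M S (Ordinal l0) (C4 R) (u ^+ 6) erefl M0 S1 C0.
apply: le_trans (z _ _ _ ssq_mean ssq_second _).
- have h1 : 8 * (16 * (2 * M * S)%:R ^+ 2 / (1 + (u ^+ 6 / 4) ^+ 2 / (16 * (1 + S%:R) ^+ 2)) ^+ (M ^ 2)) * S%:R / u ^+ 6 <= u ^+ 4.
    (* The base is at least 1 + u^27, since (u^6)^2 / Y^14 = u^26 and one more u absorbs the
       constants. Bernoulli's inequality makes Y^29 factors at least Y^2, and Y^3 >= 32 such groups
       give Y^64, enough against a prefactor of order Y^59 and the target u^4. *)
    have hb : Y ^+ 64 <= (1 + (u ^+ 6 / 4) ^+ 2 / (16 * (1 + S%:R) ^+ 2)) ^+ (M ^ 2).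
      set h := _ / _.
      have hh : u ^+ 27 <= h.
        have a1 : (1 + S%:R) ^+ 2 <= 4 * Y ^+ 14 :> R.
          rewrite (_ : 4 * Y ^+ 14 = (2 * Y ^+ 7) ^+ 2); last by rewrite exprMn -exprM; congr (_ * _); ring.
          rewrite lerXn2r ?nnegrE ?addr_ge0 ?mulr_ge0 ?(ltW (Yk0 _)) //.
          by rewrite SE; have := Yle (isT : (0 <= 7)%N); rewrite expr0; goal_lra.
        have d0 : 0 < 16 * (1 + S%:R) ^+ 2 :> R by rewrite mulr_gt0 // exprn_gt0 // ltr_pwDl.
        rewrite /h ler_pdivlMr // expr_div_n -exprM.
        apply: (@le_trans _ _ (u ^+ 27 * (16 * (4 * Y ^+ 14)))).
          by apply: ler_wpM2l; [exact: ltW|rewrite ler_pM2l].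
        have e1 : u ^+ 27 * Y ^+ 14 = u ^+ 13 by rewrite mulrC (Yuk 14 13).
        have e2 := uc 12 Y1.
        have -> : u ^+ 27 * (16 * (4 * Y ^+ 14)) = 64 * u ^+ 13 by rewrite -e1; ring.
        by rewrite (_ : (6 * 2)%N = 12%N) //; move: e2; goal_lra.
      have h0 : 0 < u ^+ 27 by [].
      have bern (c : R) k : 0 <= c -> 1 + k%:R * c <= (1 + c) ^+ k.
        move=> c0; elim: k => [|k IH]; first by rewrite mul0r addr0 expr0.
        rewrite exprS -natr1; apply: (@le_trans _ _ ((1 + c) * (1 + k%:R * c))).
          have := mulr_ge0 (ler0n R k) (mulr_ge0 c0 c0); goal_lra.
        by apply: ler_wpM2l => //; rewrite addr_ge0.
      have -> : (M ^ 2 = y ^ 29 * y ^ 3)%N by rewrite /M -expnM -expnD.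
      apply: (@le_trans _ _ ((1 + u ^+ 27) ^+ (y ^ 29 * y ^ 3))); last first.
        by rewrite lerXn2r ?nnegrE ?addr_ge0 ?(ltW h0) ?lerD2l //; apply: le_trans hh; exact: ltW.
      rewrite exprM; apply: (@le_trans _ _ ((Y ^+ 2) ^+ (y ^ 3))).
        rewrite -exprM; apply: Yle; apply: (@leq_trans (2 * 32 ^ 1)); first by [].
        rewrite leq_mul2l /=; apply: (@leq_trans (y ^ 1)).
          rewrite !expn1 -(ler_nat R); have := Y1; rewrite /Y; goal_lra.
        by rewrite leq_exp2l // -(ltr_nat R); have := Y1; rewrite /Y; goal_lra.
      rewrite lerXn2r ?nnegrE ?exprn_ge0 ?addr_ge0 ?(ltW Y0) ?(ltW h0) //.
      apply: le_trans (bern _ _ (ltW h0)); rewrite natrX -/Y.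
      by rewrite (exprD Y 2 27) -mulrA -exprMn Yu expr1n mulr1 lerDr.
    set B := (1 + _) ^+ _ in hb *.
    have B0 : 0 < B by apply: lt_le_trans hb.
    have -> : 8 * (16 * (2 * M * S)%:R ^+ 2 / B) * S%:R / u ^+ 6 = 32 * 16 * (Y ^+ 46 * Y ^+ 7 * Y ^+ 6) / B.
      have -> : (2 * M * S)%:R = 2 * Y ^+ 16 * Y ^+ 7 :> R by rewrite (natrM _ (2 * M) S) (natrM _ 2 M) ME SE.
      rewrite SE /u exprVn [(2 * _ * _) ^+ 2]exprMn [(2 * _) ^+ 2]exprMn -!exprM.
      rewrite (exprD Y 32 14); field.
      by rewrite !gt_eqF.
    rewrite ler_pdivrMr //; apply: (@le_trans _ _ (u ^+ 4 * Y ^+ 64)); last by rewrite ler_pM2l.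
    rewrite -!exprD /=; have -> : u ^+ 4 * Y ^+ 64 = Y ^+ 60.
      by rewrite (exprD Y 4 60) mulrA -exprMn [u * Y]mulrC Yu expr1n mul1r.
    by have := Yc 59 Y1; have := Yk0 59; rewrite (_ : (46 + 7 + 6)%N = 59%N) //; goal_lra.
  have h2 : C4 R / S%:R ^+ 2 <= u ^+ 4.
    rewrite SE -exprM -exprVn -/u.
    have cY : C4 R <= Y by have := C0; have := YC; goal_lra.
    by apply: le_trans (uc 13 cY) _; exact: ule.
  have := uc 3 Y1; have := uk0 4; move: h1 h2; goal_lra.
- apply/andP; split => //; by have := ule (isT : (0 <= 6)%N); rewrite expr0.
- rewrite SE -[Y ^+ 7]/(Y ^+ (1 + 6)) exprD expr1 -mulrA -exprMn Yu expr1n mulr1; exact: YC.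
- rewrite ME invfM -exprVn -/u; have := uc 6 Y1; have := ule (isT : (7 <= 16)%N); have := uk0 7; goal_lra.
move=> r r' r0 r'0 hr hr' m1 m2.
have hS : Y ^+ 32 * (1 + Y ^+ 7) <= 2 * Y ^+ 39.
  rewrite mulrDr mulr1 -exprD; have := Yle (isT : (32 <= 39)%N); rewrite (_ : (32 + 7)%N = 39%N) //; goal_lra.
have kY : (M ^ 2)%:R <= Y ^+ 32 by rewrite natrX ME -exprM.
(* With eta = 1/16, t = 1/4 makes the factor 1 - 2 (t / 2 + eta / (2 t)) of [mix_mid] equal to
   1/2. *)
have t0 : 0 < 4^-1 :> R by [].
apply: le_trans (mix_mid Hlc ltr01 w0 t0 m1 m2 (sm2_shell kY _) (sm2_shell kY _)).
- by rewrite ler_wpM2l ?sqrtr_ge0 //; goal_lra.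
- by rewrite nsq_rad; apply: (le_trans hr); rewrite ME SE -exprM.
- by rewrite nsq_rad; apply: (le_trans hr'); rewrite ME SE -exprM.
Qed.

Variable l : nat.
Hypothesis l1 : (1 <= l <= y)%N.
Let v : R := u ^+ 8.
Let v0 : 0 < v. Proof. exact: uk0. Qed.
Let lY : l%:R <= Y. Proof. by rewrite ler_nat; case/andP: l1. Qed.

Lemma thin_smoothed : ((1 - u ^+ 3)%:E <= mu [set X | `|v + w * nsq X - 1| <= 2 * u ^+ 6]%R)%E.
Proof.
have ms : measurable_fun setT (fun X : n.-tuple R => ssq w X) by rewrite /ssq; mR.
have mA (c t : R) : measurable [set X : n.-tuple R | `|c + ssq w X - 1| <= t].
  have mf : measurable_fun setT (fun X : n.-tuple R => `|c + ssq w X - 1|).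
    by apply: measurableT_comp => //; mR.
  rewrite (_ : [set X | _] = (fun X : n.-tuple R => `|c + ssq w X - 1|) @^-1` `]-oo, t]).
    by rewrite -[X in measurable X]setTI; exact: mf.
  by apply/seteqP; split => X /=; rewrite in_itv.
have E0 : [set X : n.-tuple R | `|ssq w X - 1| <= u ^+ 6] = [set X : n.-tuple R | `|0 + ssq w X - 1| <= u ^+ 6].
  by apply/seteqP; split => X /=; rewrite add0r.
apply: (@le_trans _ _ (mu [set X : n.-tuple R | `|0 + ssq w X - 1| <= u ^+ 6])).
  by rewrite -PrE // -E0 lee_fin; exact: thin.
apply: le_measure; rewrite ?inE; [exact: mA|exact: (mA v)|].
move=> X /=; rewrite add0r -/(ssq w X) => h.
rewrite -addrA; apply: le_trans (ler_normD _ _) _.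
have := ule (isT : (6 <= 8)%N); rewrite (ger0_norm (ltW v0)) /v; lra.
Qed.

(** Now the noise is v = u^8 in dimension l, and the thin shell gives mix >= gpdfn 1 / 4 on the
    ball. The price of the small noise is a factor (Y^8)^l, at most exp(8 Y^2), in the supremum of
    the squared kernel, again negligible against exp(- Y^40). *)
Lemma sm2_main (x : l.-tuple R) : nsq x <= Y ^+ 3 ->
  (\int[pw (pw (@gau R w) n) l]_G ((sm mu v G x)%:E * (sm mu v G x)%:E) <= ((1 + u ^+ 4) * mix mu v w x ^+ 2)%:E)%E.
Proof.
move=> xY; have N0 := nsq_ge0 x; have r0 := rho0; have k0 := ler0n R l.
have z1 := uc 0 Y1; rewrite expr0 expr1 in z1.
have rr : rho ^+ 2 = u ^+ 132 by rewrite /rho -exprM.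
have vv : v ^+ 2 = u ^+ 16 by rewrite /v -exprM.
have rho1 : rho ^+ 2 <= v ^+ 2 / 2.
  have := uc 16 Y1; have := ule (isT : (17 <= 132)%N); have := uk0 17; rewrite rr vv; goal_lra.
apply: (le_trans (expectation_sm2_le x v0 w0 rho0 rho1 bad_pp)).
rewrite lee_fin rr vv.
set m := mix mu v w x.
have hp2 : ((2^-1)%:E <= mu [set X | `|v + w * nsq X - 1| <= 2 * u ^+ 6]%R)%E.
  apply: le_trans thin_smoothed; rewrite lee_fin; have := ule (isT : (1 <= 3)%N); rewrite expr1; move: z1; goal_lra.
have hexp2 : 2^-1 <= expR (- (l%:R * (2 * u ^+ 6 / 2) + 2 * u ^+ 6 * Y ^+ 3)).
  apply: le_trans (expR_ge1Dx _).
  have e1 : l%:R * u ^+ 6 <= u ^+ 5.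
    by rewrite -(Yuk 1 5) expr1; apply: ler_wpM2r => //; exact: ltW.
  have e2 : u ^+ 6 * Y ^+ 3 = u ^+ 3 by rewrite mulrC (Yuk 3 3).
  have e3 := ule (isT : (1 <= 5)%N); have e4 := ule (isT : (1 <= 3)%N); rewrite !expr1 in e3 e4.
  have -> : l%:R * (2 * u ^+ 6 / 2) + 2 * u ^+ 6 * Y ^+ 3 = l%:R * u ^+ 6 + 2 * (u ^+ 6 * Y ^+ 3) by field.
  rewrite e2; move: e1 e3 e4 z1; goal_lra.
have hm : 4^-1 * gpdfn 1 x <= m.
  have tau1 : 2 * u ^+ 6 <= 1 / 2 by have := ule (isT : (1 <= 6)%N); rewrite expr1; move: z1; goal_lra.
  have tau0 : 0 <= 2 * u ^+ 6 by have := uk0 6; goal_lra.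
  have h20 : 0 <= 2^-1 :> R by rewrite invr_ge0.
  apply: le_trans (mix_ge v0 w0 tau1 xY h20 hp2 tau0).
  rewrite ler_wpM2r ?gpdfn_ge0 //; move: hexp2; goal_lra.
have g0 : 0 <= gpdfn 1 x by exact: gpdfn_ge0.
set g1 : R := gpdf 1 0.
have g10 : 0 < g1 by exact: gpdf_gt0.
have hm2 : 16^-1 * ((g1 ^+ 2) ^+ l * expR (- nsq x)) <= m ^+ 2.
  apply: (@le_trans _ _ ((4^-1 * gpdfn 1 x) ^+ 2)).
    rewrite gpdfnE // mulr1 -/g1.
    have sq (a b : R) : (4^-1 * (a * b)) ^+ 2 = 16^-1 * (a ^+ 2 * b ^+ 2) by field.
    by rewrite sq [g1 ^+ l ^+ 2]exprAC -expRM_natl (_ : 2%:R * - (nsq x / 2) = - nsq x); [|field].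
  have p0 : 0 <= 4^-1 * gpdfn 1 x by rewrite mulr_ge0 // invr_ge0.
  by rewrite lerXn2r // nnegrE //; exact: le_trans hm.
have m0 : 0 <= m ^+ 2 by exact: sqr_ge0.
have u16 : 0 < u ^+ 16 by [].
have hexp : expR (l%:R * (u ^+ 132 / u ^+ 16) + 2 * rho * nsq x / u ^+ 16) <= 1 + u ^+ 4 / 2.
  have -> : l%:R * (u ^+ 132 / u ^+ 16) = l%:R * u ^+ 116.
    by rewrite (exprD u 116 16) mulfK // gt_eqF.
  have -> : 2 * rho * nsq x / u ^+ 16 = 2 * (u ^+ 50 * nsq x).
    by rewrite /rho (exprD u 50 16); field; rewrite gt_eqF.
  have e1 : l%:R * u ^+ 116 <= u ^+ 115.
    by rewrite -(Yuk 1 115) expr1; apply: ler_wpM2r => //; exact: ltW.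
  have e2 : u ^+ 50 * nsq x <= u ^+ 47.
    by rewrite -(Yuk 3 47) mulrC; apply: ler_wpM2r => //; exact: ltW.
  have p1 : 0 <= l%:R * u ^+ 116 by rewrite mulr_ge0 // ltW.
  have p2 : 0 <= u ^+ 50 * nsq x by rewrite mulr_ge0 // ltW.
  have e3 := ule (isT : (5 <= 115)%N); have e4 := ule (isT : (5 <= 47)%N); have e5 := uc 4 Y1.
  have e6 := ule (isT : (1 <= 4)%N); rewrite expr1 in e6.
  apply: le_trans (expR_le_affine _) _; first by apply/andP; split; move: p1 p2 e1 e2 e3 e4 e5 e6 z1; goal_lra.
  by move: p1 e1 e2 e3 e4 e5; goal_lra.
have hsec : gpdf v 0 ^+ (2 * l) * pp <= u ^+ 4 / 2 * (16^-1 * ((g1 ^+ 2) ^+ l * expR (- nsq x))).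
  have -> : gpdf v 0 ^+ (2 * l) = (Y ^+ 8) ^+ l * (g1 ^+ 2) ^+ l.
    rewrite exprM -exprMn; congr (_ ^+ _); rewrite /g1 !gpdf0_sqr // /v /u exprVn.
    have := pi_gt0 R; move: (@pi R) => p p0; field; rewrite !gt_eqF //.
  have g1k : 0 < (g1 ^+ 2) ^+ l by rewrite !exprn_gt0.
  have YE : Y <= expR Y by apply: le_trans (expR_ge1Dx _); rewrite lerDr.
  have YX k : Y ^+ k <= expR (k%:R * Y).
    by rewrite expRM_natl lerXn2r ?nnegrE ?expR_ge0 // ltW.
  have hp : (Y ^+ 8) ^+ l * pp <= expR ((8 * l)%:R * Y) * expR (- Y ^+ 40).
    apply: ler_pM.
    - by rewrite -exprM ltW.
    - by rewrite /pp mulr_ge0 ?expR_ge0 // mulr_ge0 // addr_ge0.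
    - by rewrite -exprM.
    - exact: pp_le.
  have h32 : 32 * Y ^+ 4 * (expR ((8 * l)%:R * Y) * expR (- Y ^+ 40)) <= expR (- nsq x).
    apply: (@le_trans _ _ (expR 32 * expR (4%:R * Y) * (expR ((8 * l)%:R * Y) * expR (- Y ^+ 40)))).
      apply: ler_wpM2r; first by rewrite mulr_ge0 ?expR_ge0.
      apply: ler_pM => //; first by rewrite ltW.
      by apply: le_trans (expR_ge1Dx _); goal_lra.
    rewrite -!expRD ler_expR.
    have a1 : (8 * l)%:R * Y <= 8 * Y ^+ 2.
      by rewrite natrM -mulrA expr2; apply: ler_wpM2l => //; apply: ler_wpM2r => //; exact: ltW.
    have := Yc 39 Y1; have := Yle (isT : (2 <= 39)%N); have := Yle (isT : (1 <= 39)%N); have := Yle (isT : (3 <= 39)%N).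
    rewrite expr1; have := Y1; move: a1 xY; goal_lra.
  have -> : (Y ^+ 8) ^+ l * (g1 ^+ 2) ^+ l * pp = (g1 ^+ 2) ^+ l * ((Y ^+ 8) ^+ l * pp) by ring.
  have -> : u ^+ 4 / 2 * (16^-1 * ((g1 ^+ 2) ^+ l * expR (- nsq x))) = (g1 ^+ 2) ^+ l * (expR (- nsq x) / (32 * Y ^+ 4)).
    by rewrite /u exprVn; field; rewrite gt_eqF.
  rewrite ler_pM2l // ler_pdivlMr; last by rewrite mulr_gt0.
  by apply: le_trans h32; rewrite [leRHS]mulrC; apply: ler_wpM2r => //; rewrite mulr_ge0 // ltW.
have hfirst := ler_wpM2r m0 hexp.
apply: (le_trans (lerD hfirst hsec)).
have := ler_wpM2l (_ : 0 <= u ^+ 4 / 2) hm2; move=> /(_ _).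
have u40 : 0 <= u ^+ 4 / 2 by rewrite divr_ge0 // ltW.
move=> /(_ u40); move: (16^-1 * _) => b; goal_lra.
Qed.

Lemma ovl_mean : exists2 e : R, (\int[pw (pw (@gau R w) n) l]_G (ovl mu v G)%:E = e%:E)%E & 1 - 10 * u ^+ 2 <= e.
Proof.
have G1 : pw (pw (@gau R w) n) l setT = 1%E by apply: pw_setT; apply: pw_setT; exact: gau_setT.
have I0 : (0 <= \int[pw (pw (@gau R w) n) l]_G (ovl mu v G)%:E)%E.
  by apply: integral_ge0 => G _; rewrite lee_fin ovl_ge0.
have I1 : (\int[pw (pw (@gau R w) n) l]_G (ovl mu v G)%:E <= 1)%E.
  rewrite -[leRHS](integral_prob_cst 1%E G1); apply: ge0_leT.
  - by apply/measurable_EFinP; exact: measurable_ovl.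
  - exact: measurable_cst.
  - by move=> G; rewrite lee_fin ovl_ge0.
  - by move=> G; rewrite lee_fin; case: (ovlP mu G v0) => _ /andP[].
exists (fine (\int[pw (pw (@gau R w) n) l]_G (ovl mu v G)%:E)%E).
  by rewrite fineK // ge0_fin_numE //; apply: le_lt_trans I1 _; rewrite ltry.
rewrite -lee_fin fineK; last by rewrite ge0_fin_numE //; apply: le_lt_trans I1 _; rewrite ltry.
have z1 := uc 0 Y1; rewrite expr0 expr1 in z1.
have tau : 0 <= 2 * u ^+ 6 <= 1 / 2.
  by have := ule (isT : (1 <= 6)%N); rewrite expr1; have h6 := uk0 6; move=> h16; apply/andP; split; move: z1 h6 h16; goal_lra.
have r0 : 0 < Y ^+ 3 by [].
have p1 : 0 < 1 - u ^+ 3 <= 1.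
  by have := ule (isT : (1 <= 3)%N); rewrite expr1; have h3 := uk0 3; move=> h13; apply/andP; split; move: z1 h3 h13; goal_lra.
(* t = u^2 balances t / 2 and u^4 / (2 t). *)
have t0 : 0 < u ^+ 2 by [].
have te : u ^+ 2 / 2 + u ^+ 4 / (2 * u ^+ 2) = u ^+ 2.
  by rewrite (exprD u 2 2); field; rewrite gt_eqF.
have te1 : u ^+ 2 / 2 + u ^+ 4 / (2 * u ^+ 2) <= 1.
  by rewrite te; have := ule (isT : (0 <= 2)%N); rewrite expr0.
apply: le_trans (expectation_ovl_ge v0 w0 tau r0 p1 t0 te1 thin_smoothed (fun x hx => sm2_main hx)).
rewrite lee_fin te.
have c3 : 6 * l%:R / Y ^+ 3 <= 6 * u ^+ 2.
  rewrite -exprVn -/u -mulrA; apply: ler_wpM2l => //.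
  by rewrite -(Yuk 1 2) expr1; apply: ler_wpM2r => //; exact: ltW.
have c30 : 0 <= 6 * l%:R / Y ^+ 3 by rewrite divr_ge0 ?mulr_ge0 // ltW.
have c1 : l%:R * (2 * u ^+ 6 / 2) + 2 * u ^+ 6 * Y ^+ 3 <= u ^+ 2.
  have e1 : l%:R * u ^+ 6 <= u ^+ 5.
    by rewrite -(Yuk 1 5) expr1; apply: ler_wpM2r => //; exact: ltW.
  have e2 : u ^+ 6 * Y ^+ 3 = u ^+ 3 by rewrite mulrC (Yuk 3 3).
  have -> : l%:R * (2 * u ^+ 6 / 2) + 2 * u ^+ 6 * Y ^+ 3 = l%:R * u ^+ 6 + 2 * (u ^+ 6 * Y ^+ 3) by field.
  rewrite e2; have := uc 2 Y1; have := ule (isT : (3 <= 5)%N); have := uk0 3; move: e1; goal_lra.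
have hexp : 1 - u ^+ 2 <= expR (- (l%:R * (2 * u ^+ 6 / 2) + 2 * u ^+ 6 * Y ^+ 3)).
  by apply: le_trans (expR_ge1Dx _); move: c1; goal_lra.
set E := expR _ in hexp *; set c := 6 * l%:R / Y ^+ 3 in c3 c30 *.
have u2 : u ^+ 2 <= u by have := ule (isT : (1 <= 2)%N); rewrite expr1.
have u3 : u ^+ 3 <= u ^+ 2 by exact: ule.
have u20 := uk0 2.
have q1 : 1 - 2 * u ^+ 2 <= (1 - u ^+ 3) * E.
  apply: (@le_trans _ _ ((1 - u ^+ 3) * (1 - u ^+ 2))).
    have := mulr_ge0 (ltW (uk0 3)) (ltW u20); move: u3; goal_lra.
  by apply: ler_wpM2l => //; move: u2 u3 z1; goal_lra.
have q2 : 1 - 3 * u ^+ 2 <= (1 - u ^+ 3) * E * (1 - u ^+ 2).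
  apply: (@le_trans _ _ ((1 - 2 * u ^+ 2) * (1 - u ^+ 2))).
    have := mulr_ge0 (ltW u20) (ltW u20); goal_lra.
  by apply: ler_wpM2r => //; move: u2 z1; goal_lra.
apply: (@le_trans _ _ ((1 - 3 * u ^+ 2) * (1 - c))).
  have := mulr_ge0 (ltW u20) c30; move: c3 u20; goal_lra.
by apply: ler_wpM2r => //; move: c3 u2 z1; goal_lra.
Qed.

(** The parameters are s = u^2, t = Y^3, eps = u^15, with losses u^2, at most u^3, and 2 u^3. The
    exponents n u^12 / 4, n u^15 / 4 and n u^30 / 16 are all at least Y sqrt n because sqrt n >=
    Y^150; half of this pays for the factor of order l 2^l, the rest for exp(- sqrt n). *)
Lemma povl_whp (m : probability (n.-tuple (n.-tuple R)) R) : (l <= n)%N -> grass_invariant l m ->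
  (m [set x | @povl R n l mu v x < (1 - 12 * u ^+ 2)%:E]%E <= (expR (- Num.sqrt n%:R))%:E)%E.
Proof.
move=> ln hm; have [e he e1] := ovl_mean.
have z1 := uc 0 Y1; rewrite expr0 expr1 in z1.
have s0 : 0 < u ^+ 2 by [].
have t0 : 0 < Y ^+ 3 by [].
have eps : 0 < u ^+ 15 <= 1.
  by apply/andP; split => //; have := ule (isT : (0 <= 15)%N); rewrite expr0.
have H := povl_concentration ln v0 n0 s0 t0 eps Hiso hm he.
set th := e - _ - _ - _ in H.
have hth : 1 - 12 * u ^+ 2 <= th.
  have e2 : Y ^+ 3 * (l%:R * (5 * u ^+ 15)) / (8 * v) <= u ^+ 3.
    rewrite ler_pdivrMr ?mulr_gt0 //.
    apply: (@le_trans _ _ (Y ^+ 3 * (Y * (5 * u ^+ 15)))).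
      by apply: ler_wpM2l; [exact: ltW|apply: ler_wpM2r => //; rewrite mulr_ge0 // ltW].
    have -> : Y ^+ 3 * (Y * (5 * u ^+ 15)) = 5 * u ^+ 11.
      by rewrite -(Yuk 4 11) (exprSr Y 3); ring.
    have -> : u ^+ 3 * (8 * v) = 8 * u ^+ 11 by rewrite /v (exprD u 3 8); ring.
    by have := uk0 11; goal_lra.
  have e3 : 2 / Y ^+ 3 = 2 * u ^+ 3 by rewrite /u exprVn.
  rewrite /th e3; have := uc 2 Y1; have := uk0 3; move: e1 e2; goal_lra.
have mpo := measurable_povl l mu v.
have mset (a : R) : measurable [set x : n.-tuple (n.-tuple R) | @povl R n l mu v x < a%:E]%E.
  rewrite (_ : [set x | _] = @povl R n l mu v @^-1` [set` `]-oo, a%:E[%E]); last by apply/seteqP; split => x /=; rewrite in_itv.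
  by rewrite -[X in measurable X]setTI; apply: mpo => //; exact: emeasurable_itv.
apply: (@le_trans _ _ (m [set x | @povl R n l mu v x < th%:E]%E)).
  apply: le_measure; rewrite ?inE; [exact: mset|exact: mset|].
  by move=> x /= /lt_le_trans; apply; rewrite lee_fin.
apply: (le_trans H); rewrite lee_fin.
set q := Num.sqrt n%:R; have qq : n%:R = q * q by rewrite -expr2 sqr_sqrtr // ltW.
have qY := sqn; rewrite -/q in qY.
have q0 : 0 < q by rewrite sqrtr_gt0.
have big (k : nat) (c : R) : (k + 2 <= 150)%N -> c <= Y -> 0 < c -> q * Y <= n%:R * u ^+ k / c.
  move=> k2 cY c0; rewrite ler_pdivlMr // qq.
  have h1 : Y ^+ 2 <= q * u ^+ k.
    apply: (@le_trans _ _ (Y ^+ 150 * u ^+ k)); last by apply: ler_wpM2r => //; exact: ltW.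
    apply: (@le_trans _ _ (Y ^+ (k + 2) * u ^+ k)); last by apply: ler_wpM2r; [exact: ltW|exact: Yle].
    by rewrite exprD mulrAC -exprMn Yu expr1n mul1r.
  have h2 : Y * c <= q * u ^+ k by apply: le_trans h1; rewrite expr2; apply: ler_wpM2l => //; exact: ltW.
  by rewrite -!mulrA; apply: ler_wpM2l; [exact: ltW|rewrite mulrC in h2 *; rewrite [c * Y]mulrC || idtac; move: h2; rewrite [c * Y]mulrC].
have a1 : u ^+ 2 ^+ 2 * v / (4 / n%:R) = n%:R * u ^+ 12 / 4.
  rewrite /v -exprM (exprD u 4 8); field; rewrite gt_eqF //.
rewrite a1.
have b1 : q * Y <= n%:R * u ^+ 12 / 4 by apply: big => //; have := Y1; goal_lra.
have b2 : q * Y <= n%:R * u ^+ 15 / 4 by apply: big => //; have := Y1; goal_lra.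
have b3 : q * Y <= n%:R * u ^+ 15 ^+ 2 / 16 by rewrite -exprM; apply: big => //; have := Y1; goal_lra.
have hq : expR (- (q * Y)) <= expR (- q) * expR (- (q * Y / 2)).
  rewrite -expRD ler_expR; have : q * (32 * 32) <= q * Y by apply: ler_wpM2l => //; exact: ltW.
  by move: q0; goal_lra.
have d1 : expR (- (n%:R * u ^+ 12 / 4)) <= expR (- (q * Y)) by rewrite ler_expR lerN2.
have d2 : expR (- (n%:R * u ^+ 15 / 4)) <= expR (- (q * Y)) by rewrite ler_expR lerN2.
have d3 : expR (- (n%:R * u ^+ 15 ^+ 2 / 16)) <= expR (- (q * Y)) by rewrite ler_expR lerN2.
have tot : 1 + l%:R * (2 ^+ l + 2) <= expR (q * Y / 2).
  have YE : Y <= expR Y by apply: le_trans (expR_ge1Dx _); rewrite lerDr.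
  have h1 : 2 ^+ l <= expR Y :> R.
    apply: (@le_trans _ _ ((1 + 1) ^+ l)); first by rewrite (_ : 1 + 1 = 2).
    by apply: le_trans (pow_le_expR l ler01) _; rewrite ler_expR mulr1.
  have h2 : l%:R * (2 ^+ l + 2) <= Y * (expR Y + 2).
    by apply: ler_pM => //; rewrite lerD2r.
  have h3 : 1 + Y * (expR Y + 2) <= expR (q * Y / 2).
    apply: (@le_trans _ _ (expR (4 * Y))).
      have -> : 4 * Y = Y + Y + (Y + Y) by ring.
      rewrite !expRD; apply: quartic_dominates => //; exact: le_trans YE.
    rewrite ler_expR; have : 8 * Y <= q * Y.
      apply: ler_wpM2r; first exact: ltW.
      by apply: le_trans qY; have := Yle (isT : (1 <= 150)%N); rewrite expr1; have := Y1; goal_lra.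
    by goal_lra.
  by move: h2 h3; goal_lra.
set Eq := expR (- (q * Y)) in hq d1 d2 d3 *.
have Eq0 : 0 < Eq by exact: expR_gt0.
apply: (@le_trans _ _ (Eq + l%:R * (2 ^+ l * Eq + 2 * Eq))).
  apply: lerD => //; apply: ler_wpM2l => //; apply: lerD; last by rewrite ler_pM2l.
  by apply: ler_wpM2l => //; rewrite exprn_ge0.
have -> : Eq + l%:R * (2 ^+ l * Eq + 2 * Eq) = (1 + l%:R * (2 ^+ l + 2)) * Eq by ring.
apply: (@le_trans _ _ (expR (q * Y / 2) * (expR (- q) * expR (- (q * Y / 2))))).
  by apply: ler_pM => //; exact: ltW.
by rewrite mulrCA -expRD subrr expR0 mulr1.
Qed.

(** The overlap costs 12 u^2. Desmoothing with al = Y^3 costs at most 192 Y (6 u^4 + u^3 / 4), of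
    order u^2: al l v <= u^4 because v = u^8. The total stays below u / 2. *)
Lemma clt_frame (U : 'M[R]_(l, n)) (t : n.-tuple (n.-tuple R)) (B : set (l.-tuple R)) : tv_continuous mu ->
  U *m U^T = 1%:M -> U^T *m U = mx_of t -> ((1 - 12 * u ^+ 2)%:E <= @povl R n l mu v t)%E -> measurable B ->
  (\int[mu]_X (\1_B (app (rows_of U) X) : R)%:E <= \int[pw (@leb R) l]_x ((\1_B x : R)%:E * (gpdfn 1 x)%:E) + ((2 * Y)^-1)%:E)%E.
Proof.
move=> Htv hU hP; rewrite (povlE mu v0 hU hP) lee_fin => ho mB.
have z1 := uc 0 Y1; rewrite expr0 expr1 in z1.
have z2 := uc 1 Y1; have z3 := uc 2 Y1; rewrite expr1 in z2.
have [_ h1] := ovl_TV mu (rows_of U) v0 mB.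
have vl : 6 * v * l%:R * 256 <= 1 / 16.
  have e1 : l%:R * v <= u ^+ 7 by rewrite -(Yuk 1 7) expr1; apply: ler_wpM2r => //; exact: ltW.
  have -> : 6 * v * l%:R * 256 = 6 * 256 * (l%:R * v) by ring.
  have := ule (isT : (3 <= 7)%N); move: e1 z1 z2 z3; goal_lra.
have al0 : 0 < Y ^+ 3 by [].
have ho' : 9 / 10 <= ovl mu v (rows_of U) by apply: le_trans ho; have := uk0 2; move: z1 z2; goal_lra.
have mi : measurable_fun setT (fun x => (\1_B x : R)%:E) by apply/measurable_EFinP; exact: measurable_indic.
have i01 x : (0 <= (\1_B x : R)%:E <= 1)%E by rewrite lee_fin indicE ler0n lee_fin lern1 leq_b1.
apply: (le_trans (desmoothing Hlc Htv hU v0 vl ho' al0 mi i01)).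
apply: (le_trans (leeD2r _ h1)); rewrite -addeA; apply: leeD2l; rewrite -EFinD lee_fin.
have -> : (2 * Y)^-1 = u / 2 by rewrite invfM mulrC.
have e0 : 1 / (4 * Y ^+ 3) = u ^+ 3 / 4 by rewrite /u exprVn; field; rewrite gt_eqF.
have e1 : Y ^+ 3 * (6 * v * l%:R) <= 6 * u ^+ 4.
  apply: (@le_trans _ _ (Y ^+ 3 * (6 * v * Y))).
    by apply: ler_wpM2l; [exact: ltW|apply: ler_wpM2l => //; rewrite mulr_ge0 // ltW].
  rewrite (_ : Y ^+ 3 * (6 * v * Y) = 6 * (Y ^+ 4 * v)); last by rewrite (exprSr Y 3); ring.
  by rewrite /v (Yuk 4 4).
have k0 : 0 <= 6 * u ^+ 4 + u ^+ 3 / 4 by rewrite addr_ge0 ?mulr_ge0 // ?divr_ge0 // ltW.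
have e2 : 16 * (3 * l%:R + 9) * (Y ^+ 3 * (6 * v * l%:R) + 1 / (4 * Y ^+ 3)) <= 16 * (12 * Y) * (6 * u ^+ 4 + u ^+ 3 / 4).
  apply: (@le_trans _ _ (16 * (3 * l%:R + 9) * (6 * u ^+ 4 + u ^+ 3 / 4))).
    apply: ler_wpM2l; first by rewrite mulr_ge0 // addr_ge0 // mulr_ge0.
    by rewrite e0 lerD2r.
  by apply: ler_wpM2r => //; have := lY; have := Y1; goal_lra.
have e3 : 16 * (12 * Y) * (6 * u ^+ 4 + u ^+ 3 / 4) = 32 * 36 * u ^+ 3 + 48 * u ^+ 2.
  by rewrite -[in RHS](Yuk 1 3) -[in RHS](Yuk 1 2) !expr1; field.
move: e2; rewrite e3; have := uk0 3; move: z2 z3 ho; goal_lra.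
Qed.

End PolynomialScale.

(** * Iterated integrals of signed functions; measurability of closed sets *)

Section Boxes.
Context (R : realType).
Local Notation leb := (@leb R).
Local Notation lebn := (pw leb).

Definition boxf (b : R) n (x : n.-tuple R) : R := \prod_(i < n) \1_(`[- b, b]%classic : set R) (tnth x i).

Lemma boxf_ge0 b n (x : n.-tuple R) : 0 <= boxf b x.
Proof. by apply: prodr_ge0 => i _; rewrite indicE ler0n. Qed.

Lemma boxf_le1 b n (x : n.-tuple R) : boxf b x <= 1.
Proof.
suff /andP[] : 0 <= boxf b x <= 1 by [].
apply: (big_ind (fun y : R => 0 <= y <= 1)) => [|y z /andP[y0 y1] /andP[z0 z1]|i _]; first by rewrite ler01 lexx.
  by rewrite mulr_ge0 // mulr_ile1.
by rewrite indicE ler0n lern1 leq_b1.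
Qed.

Lemma boxf_in b n (x : n.-tuple R) : (forall i, `|tnth x i| <= b) -> boxf b x = 1.
Proof.
move=> h; rewrite /boxf big1 // => i _; rewrite indicE mem_set //= in_itv /=.
by have := h i; rewrite ler_norml.
Qed.

Lemma measurable_boxf b n : measurable_fun setT (@boxf b n).
Proof.
have mi : measurable_fun setT (\1_(`[- b, b]%classic : set R) : R -> R) by exact: measurable_indic.
by apply: measurable_prod => i _; apply: (measurableT_comp mi); exact: measurable_tnth.
Qed.

Lemma integral_boxf b n : 0 <= b -> (\int[lebn n]_x (boxf b x)%:E = ((2 * b) ^+ n)%:E)%E.
Proof.
move=> b0; transitivity (\int[lebn n]_x \prod_(i < n) (\1_(`[- b, b]%classic : set R) (tnth x i))%:E)%E.
  by apply: eq_integral => x _; rewrite prodEFin.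
have mi : measurable_fun setT (\1_(`[- b, b]%classic : set R) : R -> R) by exact: measurable_indic.
rewrite (ge0_pw_prod leb (F := fun _ y => (\1_(`[- b, b]%classic : set R) y)%:E)); last 2 first.
- by move=> i; exact/measurable_EFinP.
- by move=> i y; rewrite lee_fin indicE ler0n.
transitivity (\prod_(i < n) (2 * b)%:E)%E; last by rewrite prodEFin prodr_const card_ord.
apply: eq_bigr => i _; rewrite integral_indic // setIT.
transitivity (b - - b)%:E; last by rewrite opprK mulr_natl mulr2n.
by apply: leb_itvcc; rewrite -subr_ge0 opprK addr_ge0.
Qed.

Lemma boxf_cons b n (x : R) (t : n.-tuple R) : boxf b [tuple of x :: t] = \1_(`[- b, b]%classic : set R) x * boxf b t.
Proof.
rewrite /boxf big_ord_recl (tnth0 x t); congr (_ * _).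
by apply: eq_bigr => i _; rewrite tnthS.
Qed.

(** The covariance integrands x_i x_j of [isotropic_position] change sign, so Tonelli's theorem does
    not reach them; over a compact body they are bounded with bounded support. *)
Definition boxed n (C b : R) (f : n.-tuple R -> R) := measurable_fun setT f /\ forall x, `|f x| <= C * boxf b x.

Lemma boxed_integrable n C b (f : n.-tuple R -> R) : 0 <= C -> 0 <= b -> boxed C b f -> (lebn n).-integrable setT (fun x => (f x)%:E).
Proof.
move=> C0 b0 [mf fb]; apply/integrableP; split; first exact/measurable_EFinP.
apply: (@le_lt_trans _ _ (\int[lebn n]_x (C%:E * (boxf b x)%:E))%E).
  apply: ge0_leT => //.
  - by apply/measurable_EFinP; apply: measurableT_comp.
  - by apply: measurable_funeM; apply/measurable_EFinP; exact: measurable_boxf.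
rewrite ge0_ZlT ?integral_boxf -?EFinM ?ltry //.
- by apply/measurable_EFinP; exact: measurable_boxf.
- by move=> x; rewrite lee_fin boxf_ge0.
Qed.

Lemma integral_lebE (f : R -> \bar R) : measurable_fun setT f -> (\int[@lebesgue_measure R]_x f x = \int[leb]_x f x)%E.
Proof.
move=> mf; rewrite [LHS]integralE [RHS]integralE; congr (_ - _)%E.
  by apply: ge0_integral_leb; [exact: measurable_funepos|exact: funepos_ge0].
by apply: ge0_integral_leb; [exact: measurable_funeneg|exact: funeneg_ge0].
Qed.

Lemma integral_consE n (f : n.+1.-tuple R -> \bar R) (x : R) :
  (\int[lebn n]_t f [tuple of x :: t] = \int[lebn n]_t f^\+ [tuple of x :: t] - \int[lebn n]_t f^\- [tuple of x :: t])%E.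
Proof.
by rewrite integralE; congr (_ - _)%E; apply: eq_integral => t _; rewrite !(funeposE, funenegE).
Qed.

Lemma integral_pwS n (f : n.+1.-tuple R -> \bar R) : (lebn n.+1).-integrable setT f ->
  (\int[lebn n.+1]_t f t = \int[leb]_x \int[lebn n]_t f [tuple of x :: t])%E.
Proof.
move=> /integrableP[mf fi].
have mp := measurable_funepos mf; have mn := measurable_funeneg mf.
have I g : measurable_fun setT g -> (forall t, 0 <= g t <= `|f t|)%E ->
    leb.-integrable setT (fun x => \int[lebn n]_t g [tuple of x :: t])%E.
  move=> mg g0; apply/integrableP; split.
    by apply: measurable_integral_cons => // t; case/andP: (g0 t).
  rewrite (_ : (\int[leb]_x `| \int[lebn n]_t g [tuple of x :: t] | = \int[leb]_x \int[lebn n]_t g [tuple of x :: t])%E); last first.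
    by apply: eq_integral => x _; rewrite gee0_abs // integral_ge0 // => t _; case/andP: (g0 [tuple of x :: t]).
  rewrite -ge0_integral_pwS //; last by move=> t; case/andP: (g0 t).
  apply: le_lt_trans fi; apply: ge0_leT => //; first exact: measurableT_comp.
    by move=> t; case/andP: (g0 t).
  by move=> t; case/andP: (g0 t).
rewrite integralE (ge0_integral_pwS leb mp (funepos_ge0 f)) (ge0_integral_pwS leb mn (funeneg_ge0 f)).
rewrite -integralB //.
- by apply: eq_integral => x _; by rewrite -integral_consE.
- apply: I => // t; rewrite funepos_ge0 /=; by rewrite -[leRHS]/((abse \o f) t) fune_abse leeDl // funeneg_ge0.
- apply: I => // t; rewrite funeneg_ge0 /=; by rewrite -[leRHS]/((abse \o f) t) fune_abse leeDr // funepos_ge0.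
Qed.

(** [boxed] passes to sections with the same constants, so the induction hypothesis applies to them,
    and Fubini's theorem for integrable functions closes each step. *)
Lemma iint_boxed n C b (f : n.-tuple R -> R) : 0 <= C -> 0 <= b -> boxed C b f ->
  iint (fun t => (f t)%:E) = (\int[lebn n]_t (f t)%:E)%E.
Proof.
move=> C0 b0; elim: n f => [|n IH] f hf; first by rewrite integral_pw0.
have hI := boxed_integrable C0 b0 hf.
rewrite integral_pwS //=; case: hf => mf fb.
have hx x : boxed C b (fun t => f [tuple of x :: t]).
  split; first by apply: (measurableT_comp mf); exact: measurable_cons_r.
  move=> t; apply: (le_trans (fb _)); rewrite boxf_cons ler_wpM2l // ler_piMl ?boxf_ge0 //.
transitivity (\int[@lebesgue_measure R]_x \int[lebn n]_t (f [tuple of x :: t])%:E)%E.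
  by apply: eq_integral => x _; exact: (IH _ (hx x)).
apply: integral_lebE.
have mfE : measurable_fun setT (fun t => (f t)%:E) by exact/measurable_EFinP.
rewrite (_ : (fun x => _) = fun x => (\int[lebn n]_t ((fun t => (f t)%:E)^\+ [tuple of x :: t])%E - \int[lebn n]_t ((fun t => (f t)%:E)^\- [tuple of x :: t])%E)%E); last first.
  by apply/funext => x; rewrite -(integral_consE (fun t => (f t)%:E)).
apply: emeasurable_funB.
- apply: (measurable_integral_cons leb (f := (fun t => (f t)%:E)^\+%E)); [exact: measurable_funepos|exact: funepos_ge0].
- apply: (measurable_integral_cons leb (f := (fun t => (f t)%:E)^\-%E)); [exact: measurable_funeneg|exact: funeneg_ge0].
Qed.

End Boxes.

Section ClosedMeasurable.
Context (R : realType) (n : nat).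

Lemma measurable_forall_ord d (T : measurableType d) (A : 'I_n -> set T) : (forall i, measurable (A i)) -> measurable [set t | forall i, A i t].
Proof.
move=> mA; rewrite (_ : [set t | _] = \big[setI/setT]_(i <- enum 'I_n) A i).
  by apply: bigsetI_measurable.
rewrite -bigcap_seq; apply/seteqP; split => t /= h i; first by move=> _; exact: h.
by apply: h; rewrite /= mem_enum.
Qed.

(* The complement is a countable union of boxes with rational centres. *)
Lemma measurable_closed_rv (K : set 'rV[R]_n) : closed K -> measurable (@rv_of R n @^-1` K).
Proof.
move=> cK; have oK : open (~` K) by exact: closed_openC.
pose box (q : 'rV[rat]_n) (m : nat) : set (n.-tuple R) := [set t | forall i, (ratr (q 0 i) - m.+1%:R^-1 < tnth t i < ratr (q 0 i) + m.+1%:R^-1)].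
have mbox q m : measurable (box q m).
  apply: (@measurable_forall_ord _ _ (fun i => [set t : n.-tuple R | ratr (q 0 i) - m.+1%:R^-1 < tnth t i < ratr (q 0 i) + m.+1%:R^-1])) => i.
  rewrite (_ : [set t | _] = (fun t : n.-tuple R => tnth t i) @^-1` `]ratr (q 0 i) - m.+1%:R^-1, ratr (q 0 i) + m.+1%:R^-1[).
    by rewrite -[X in measurable X]setTI; exact: measurable_tnth.
  by apply/seteqP; split => t /=; rewrite in_itv.
pose F (k : nat) : set (n.-tuple R) := if unpickle k is Some (q, m) then
  (if `[< box q m `<=` (@rv_of R n @^-1` ~` K) >] then box q m else set0) else set0.
have mF k : measurable (F k).
  by rewrite /F; case: unpickle => [[q m]|//]; case: ifP => _ //; exact: mbox.
rewrite -[X in measurable X]setCK; apply: measurableC.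
rewrite (_ : ~` _ = \bigcup_k F k); first exact: bigcupT_measurable.
apply/seteqP; split => t /=; last first.
  by move=> [k _]; rewrite /F; case: unpickle => [[q m]|//]; case: asboolP => // h /h.
move=> tK; have : nbhs (rv_of t) (~` K) by exact: open_nbhs_nbhs.
move=> /nbhs_ballP[e /= e0 he].
pose m := Num.truncn (2 / e).
have me : m.+1%:R^-1 < e / 2.
  have /andP[_ h] := truncn_itv (ltW (divr_gt0 (ltr0n R 2) e0)).
  by rewrite -[ltRHS]invrK ltf_pV2 ?posrE ?invr_gt0 ?divr_gt0 // invf_div.
have m0 : 0 < m.+1%:R^-1 :> R by rewrite invr_gt0.
have hq i : exists q : rat, ratr q - m.+1%:R^-1 < tnth t i < ratr q + m.+1%:R^-1.
  have [|q] := @rat_in_itvoo R (tnth t i) (tnth t i + m.+1%:R^-1); first by rewrite ltrDl.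
  rewrite in_itv /= => /andP[h1 h2]; exists q; rewrite ltrBlDr h2 /=.
  by apply: (lt_trans h1); rewrite ltrDl.
pose q : 'rV[rat]_n := \row_i sval (cid (hq i)).
have qt : box q m t by move=> i; rewrite mxE; exact: (svalP (cid (hq i))).
exists (pickle (q, m)) => //; rewrite /F pickleK; case: asboolP => // h; exfalso; apply: h => s hs /=.
apply: he; split => // a i; rewrite ord1 !mxE /ball /= ltr_norml.
have /andP[h1 h2] := hs i; have /andP[h3 h4] := qt i; move: h1 h2 h3 h4 me.
move: (ratr _) (_^-1) (tnth s i) (tnth t i) => z v s0 t0 *; apply/andP; split; lra.
Qed.

End ClosedMeasurable.

Lemma mnormalizeE d (T : measurableType d) (R : realType) (m : {measure set T -> \bar R}) (P : probability T R) (v : R) B :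
  m setT = v%:E -> v != 0 -> mnormalize m P B = (m B * v^-1%:E)%E.
Proof. by move=> h v0; rewrite /mnormalize h eqe (negbTE v0). Qed.

(** * The uniform law on a convex body *)

Section UniformMeasure.
Context (R : realType) (n : nat) (A : set (n.-tuple R)).
Local Notation lebn := (pw (@leb R)).
Local Notation tupn := (n.-tuple R).
Variables (b r : R) (c : tupn).
Hypothesis mA : measurable A.
Hypothesis convA : forall (t : R) (x y : tupn), A x -> A y -> 0 <= t <= 1 -> A (tmix t x y).
Hypothesis b0 : 0 <= b.
Hypothesis bA : forall (x : tupn) i, A x -> `|tnth x i| <= b.
Hypothesis r0 : 0 < r.
Hypothesis ballA : forall x : tupn, (forall i, `|tnth x i - tnth c i| <= r) -> A x.

Let mi : measurable_fun setT (\1_A : tupn -> R). Proof. exact: measurable_indic. Qed.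
Let mie : measurable_fun setT (fun x : tupn => (\1_A x : R)%:E). Proof. exact/measurable_EFinP. Qed.
Let i0 (x : tupn) : 0 <= \1_A x :> R. Proof. by rewrite indicE ler0n. Qed.

Let in1 (x : tupn) : A x -> \1_A x = 1 :> R. Proof. by move=> h; rewrite indicE mem_set. Qed.
Let out0 (x : tupn) : ~ A x -> \1_A x = 0 :> R. Proof. by move=> h; rewrite indicE memNset. Qed.

Lemma indic_le_boxf (x : tupn) : \1_A x <= boxf b x :> R.
Proof.
have [h|h] := pselect (A x); last by rewrite out0 ?boxf_ge0.
by rewrite in1 // boxf_in // => i; exact: bA.
Qed.

Definition vol : R := fine (lebn n A).

Lemma volE : lebn n A = vol%:E.
Proof.
rewrite /vol fineK // ge0_fin_numE ?measure_ge0 //.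
apply: (@le_lt_trans _ _ ((2 * b) ^+ n)%:E); last exact: ltry.
rewrite -integral_boxf // -(setIT A) -integral_indic //; apply: ge0_leT; [exact: mie| | |].
- by apply/measurable_EFinP; exact: measurable_boxf.
- by move=> x; rewrite lee_fin.
- by move=> x; rewrite lee_fin; exact: indic_le_boxf.
Qed.

Lemma integral_vol : (\int[lebn n]_x (\1_A x : R)%:E = vol%:E)%E.
Proof. by rewrite integral_indic // setIT; exact: volE. Qed.

Lemma vol_gt0 : 0 < vol.
Proof.
rewrite -lte_fin -integral_vol.
apply: (@lt_le_trans _ _ (\int[lebn n]_x (boxf r (tadd (tscale 1 x) (tscale (-1) c)))%:E)%E).
  rewrite (@integral_lebn_affine _ _ 1 _ (fun x => (boxf r x)%:E)) //.
  - rewrite integral_boxf ?(ltW r0) // expr1n invr1 mul1e lte_fin; apply: exprn_gt0; exact: (mulr_gt0 (ltr0n R 2) r0).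
  - by apply/measurable_EFinP; exact: measurable_boxf.
  - by move=> x; rewrite lee_fin boxf_ge0.
apply: ge0_leT.
- have mb := @measurable_boxf R r n; by mR.
- exact: mie.
- by move=> x; rewrite lee_fin boxf_ge0.
move=> x; rewrite lee_fin; have [h|h] := pselect (A x); first by rewrite in1 // boxf_le1.
rewrite out0 // /boxf; apply: contrapT => hb; apply: h; apply: ballA => i.
apply: contrapT => hi; apply: hb; rewrite (bigD1 i) //= (indicE _ _) memNset ?mul0r //= in_itv /= !tnth_mktuple.
rewrite mul1r mulN1r -ler_norml; exact: hi.
Qed.

Let v0 := vol_gt0.
Let vn : vol != 0. Proof. by rewrite gt_eqF. Qed.

(** [mnormalize] falls back on its second argument, here the Dirac mass at c, when the total mass is
    0 or infinite; [vol_gt0] and [volE] exclude both. *)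
Definition uni : probability tupn R := mnormalize (mrestr (lebn n) mA) (\d_c).

Lemma ge0_integral_uni (f : tupn -> \bar R) : measurable_fun setT f -> (forall x, 0 <= f x)%E ->
  (\int[uni]_x f x = \int[lebn n]_x (f x * (\1_A x / vol)%:E))%E.
Proof.
move=> mf f0; apply: (@ge0_integral_density _ _ _ (lebn n) uni (fun x => \1_A x / vol)) => //.
- by mR.
- by move=> x; rewrite divr_ge0 // ltW.
move=> B mB; change (mnormalize (mrestr (lebn n) mA) (\d_c) B = \int[lebn n]_(x in B) (\1_A x / vol)%:E)%E.
have E : mrestr (lebn n) mA setT = vol%:E by rewrite /mrestr setTI; exact: volE.
rewrite (mnormalizeE _ _ E vn) /mrestr.
under eq_integral => x _ do rewrite EFinM.
rewrite ge0_integralZr //; last 2 first.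
- by apply: measurable_funTS.
- by rewrite lee_fin invr_ge0 ltW.
by rewrite integral_indic // setIC.
Qed.

(** The indicator of a convex set is log-concave, so Prekopa's theorem on R^n applies to F times the
    density; the constant 1 / vol shifts exponents by ln vol. *)
Lemma uni_log_concave : log_concave_marginals uni.
Proof.
move=> F F0 mF lF.
pose F' (s : R) (p : tupn) : \bar R := (F s p * (\1_A p / vol)%:E)%E.
rewrite (_ : (fun s : R => _) = fun s : R => (\int[lebn n]_p F' s p)%E); last first.
  by apply/funext => s; rewrite ge0_integral_uni.
apply: (@prekopa R n R^o F').
- by move=> v p; rewrite mule_ge0 // lee_fin divr_ge0 // ltW.
- by move=> v; apply: emeasurable_funM => //; mR.
have H s p a : ((expR a)%:E <= F' s p)%E -> A p /\ ((expR (a + ln vol))%:E <= F s p)%E.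
  rewrite /F'; have [h|h] := pselect (A p); last by rewrite out0 // mul0r mule0 lee_fin leNgt expR_gt0.
  by rewrite in1 // div1r lee_pdivlMr // -EFinM expRD lnK.
move=> x y p q t a a' t01 /H[Ap h1] /H[Aq h2].
have t01' : 0 <= t <= 1 by case/andP: t01 => *; rewrite !ltW.
rewrite /F' in1 ?div1r; last exact: convA.
rewrite lee_pdivlMr // -EFinM; have := lF _ _ _ _ _ _ _ t01 h1 h2.
rewrite (_ : t * _ + _ = t * a + (1 - t) * a' + ln vol); last by ring.
by rewrite expRD lnK.
Qed.

Section Isotropic.
Hypothesis isoA : forall i j : 'I_n, (\int[lebn n]_x (\1_A x * (tnth x i * tnth x j))%:E = (if i == j then vol else 0)%:E)%E.

Lemma boxed_moment (i j : 'I_n) : boxed (b * b) b (fun x : tupn => \1_A x * (tnth x i * tnth x j)).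
Proof.
split; first by mR.
move=> x; rewrite normrM ger0_norm // mulrC; have := indic_le_boxf x.
have [h|h] := pselect (A x); last by rewrite out0 // mulr0 mulr_ge0 ?mulr_ge0 ?boxf_ge0.
rewrite in1 // => hb; by rewrite normrM ler_pM ?mulr_ge0 // ler_pM // bA.
Qed.

Lemma uni_quadratic (M : 'I_n -> 'I_n -> R) (f : tupn -> R) : measurable_fun setT f -> (forall x, 0 <= f x) ->
  (forall x : tupn, f x = \sum_i \sum_j M i j * (tnth x i * tnth x j)) ->
  (\int[uni]_x (f x)%:E = (\sum_i M i i)%:E)%E.
Proof.
move=> mf f0 fE; rewrite ge0_integral_uni //; last exact/measurable_EFinP.
have hI i j := boxed_integrable (mulr_ge0 b0 b0) b0 (boxed_moment i j).
transitivity (\int[lebn n]_x (\sum_(i < n) \sum_(j < n) (M i j / vol)%:E * (\1_A x * (tnth x i * tnth x j))%:E))%E.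
  apply: eq_integral => x _; rewrite fE -EFinM mulr_suml -sumEFin; apply: eq_bigr => i _.
  rewrite mulr_suml -sumEFin; apply: eq_bigr => j _; rewrite -EFinM; congr EFin; ring.
have hJ i j : (lebn n).-integrable setT (fun x : tupn => ((M i j / vol)%:E * (\1_A x * (tnth x i * tnth x j))%:E)%E).
  by apply: integrableZl => //; exact: hI.
transitivity (\sum_(i < n) \int[lebn n]_x (\sum_(j < n) (M i j / vol)%:E * (\1_A x * (tnth x i * tnth x j))%:E))%E.
  apply: integral_sum => //.
  by move=> i; apply: integrable_sum => // j _; exact: hJ.
have IE i j : (\int[lebn n]_x ((M i j / vol)%:E * (\1_A x * (tnth x i * tnth x j))%:E) = (M i j / vol)%:E * (if i == j then vol else 0)%:E)%E.
  by rewrite -isoA; apply: integralZl => //; exact: hI.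
rewrite -sumEFin; apply: eq_bigr => i _.
transitivity (\sum_(j < n) \int[lebn n]_x ((M i j / vol)%:E * (\1_A x * (tnth x i * tnth x j))%:E))%E.
  by apply: integral_sum => // j; exact: hJ.
rewrite (bigD1 i) //= big1 ?adde0 => [|j ji].
  by rewrite IE eqxx -EFinM divfK.
by rewrite IE eq_sym (negbTE ji) mule0.
Qed.

Lemma uni_sub_isotropic : sub_isotropic uni.
Proof.
move=> a; rewrite (@uni_quadratic (fun i j => tnth a i * tnth a j)).
- by rewrite /nsq dot.unlock.
- by apply: measurable_funX; mR.
- by move=> x; exact: sqr_ge0.
move=> x; rewrite dot.unlock expr2 mulr_suml; apply: eq_bigr => i _.
by rewrite mulr_sumr; apply: eq_bigr => j _; ring.
Qed.

Lemma uni_nsq : (\int[uni]_X (nsq X)%:E = n%:R%:E)%E.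
Proof.
rewrite (@uni_quadratic (fun i j => (i == j)%:R)).
- congr EFin; rewrite (eq_bigr (fun=> 1)) => [|i _]; last by rewrite eqxx.
  by rewrite sumr_const card_ord.
- by mR.
- by move=> x; exact: nsq_ge0.
move=> x; rewrite /nsq dot.unlock; apply: eq_bigr => i _.
rewrite (bigD1 i) //= eqxx mul1r big1 ?addr0 // => j ji.
by rewrite eq_sym (negbTE ji) mul0r.
Qed.

End Isotropic.

(* A is compared with its image under a homothety of ratio 1 - s and centre c, whose small translates stay in A. *)
Lemma uni_tv_continuous : tv_continuous uni.
Proof.
(* With this s, n s <= e bounds the mass lost by the contraction through Bernoulli's inequality, and
   s < 1 for every e. *)
move=> e e0; pose s : R := e / (n.+1%:R * (1 + e)).
have e1 : 0 < 1 + e by lra.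
have s0 : 0 < s by rewrite divr_gt0 // mulr_gt0.
have se : n%:R * s <= e.
  rewrite /s mulrA ler_pdivrMr ?mulr_gt0 // mulrC ler_pM2l //.
  apply: (@le_trans _ _ n.+1%:R); first by rewrite ler_nat.
  by rewrite ler_peMr // lerDl ltW.
have s1 : s < 1.
  rewrite ltr_pdivrMr ?mulr_gt0 // mul1r; apply: (@lt_le_trans _ _ (1 + e)); first lra.
  by rewrite ler_peMl ?(ltW e1) // ler1n.
have t0 : 0 < 1 - s by lra.
pose q (x : tupn) : R := \1_A (tadd (tscale (1 - s)^-1 x) (tscale (- (s / (1 - s))) c)).
have mq : measurable_fun setT q by rewrite /q; mR.
have q0 x : 0 <= q x by exact: i0.
have qA x u : q x = 1 -> (forall i, `|tnth u i| <= s * r) -> A (tadd x u).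
  rewrite /q; set z0 := tadd _ _; have [h|h] := pselect (A z0); last by rewrite out0 // => /eqP; rewrite eq_sym oner_eq0.
  move=> _ hu.
  pose z : tupn := tadd c (tscale s^-1 u).
  have Az : A z.
    apply: ballA => i; rewrite !tnth_mktuple addrAC subrr add0r normrM gtr0_norm ?invr_gt0 //.
    by rewrite ler_pdivrMl.
  rewrite (_ : tadd x u = tmix (1 - s) z0 z); first by apply: convA => //; rewrite ltW //= lerBlDr lerDl ltW.
  apply: eq_from_tnth => i; rewrite !tnth_mktuple; field.
  by rewrite !gt_eqF.
have qle x : q x <= \1_A x.
  rewrite /q; set z0 := tadd _ _; have [h|h] := pselect (A z0); last by rewrite out0.
  have Ac : A c by apply: ballA => i; rewrite subrr normr0 ltW.
  rewrite (_ : x = tmix (1 - s) z0 c); first by rewrite (in1 h) in1 //; apply: convA => //; rewrite ltW //= lerBlDr lerDl ltW.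
  apply: eq_from_tnth => i; rewrite !tnth_mktuple; field.
  by rewrite gt_eqF.
have q01 x : q x = 1 \/ q x = 0.
  by rewrite /q; set z0 := tadd _ _; have [h|h] := pselect (A z0); [left; rewrite in1|right; rewrite out0].
pose g (x : tupn) : R := \1_A x - q x.
have g0 x : 0 <= g x by rewrite subr_ge0.
have mg : measurable_fun setT g by rewrite /g; mR.
have ge : (\int[lebn n]_x (g x / vol)%:E <= e%:E)%E.
  have Iq : (\int[lebn n]_x (q x)%:E = ((1 - s) ^+ n * vol)%:E)%E.
    rewrite (@integral_lebn_affine _ _ (1 - s)^-1 _ (fun x => (\1_A x : R)%:E)) ?invr_gt0 //.
    by rewrite integral_vol -EFinM exprVn invrK.
  have Ig : (\int[lebn n]_x (g x)%:E + ((1 - s) ^+ n * vol)%:E = vol%:E)%E.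
    rewrite -Iq -ge0_DT //; first last.
    - exact/measurable_EFinP.
    - exact/measurable_EFinP.
    by rewrite -integral_vol; apply: eq_integral => x _; rewrite -EFinD subrK.
  under eq_integral => x _ do rewrite EFinM.
  rewrite ge0_ZrT ?invr_ge0 ?(ltW v0) //; last exact/measurable_EFinP.
  rewrite lee_pdivrMr //.
  have : (\int[lebn n]_x (g x)%:E = (vol - (1 - s) ^+ n * vol)%:E)%E by rewrite EFinB -Ig addeK.
  move=> ->; rewrite -EFinM lee_fin -[X in X - _]mul1r -mulrBl ler_pM2r //.
  have := @bernoulli_ineq R s n; rewrite (ltW s0) (ltW s1) => /(_ isT) h.
  by move: h se; set a := _ ^+ n; set d := n%:R * s; lra.
exists ((s * r) ^+ 2) => [|u hu F mF F01]; first by rewrite exprn_gt0 // mulr_gt0.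
have hu' i : `|tnth u i| <= s * r.
  have sr : 0 <= s * r by rewrite mulr_ge0 // ltW.
  rewrite -(ler_pXn2r (ltn0Sn 1)) ?nnegrE // real_normK ?num_real //.
  apply: le_trans hu; rewrite /nsq dot.unlock (bigD1 i) //= expr2 lerDl.
  by apply: sumr_ge0 => j _; rewrite -expr2 sqr_ge0.
rewrite !ge0_integral_uni //; last 3 first.
- by move=> X; case/andP: (F01 X).
- by apply: (measurableT_comp mF); mR.
- by move=> X; case/andP: (F01 (tadd X u)).
pose f x := (F x * (\1_A x / vol)%:E)%E.
have mf : measurable_fun setT f by apply: emeasurable_funM => //; mR.
have f0 x : (0 <= f x)%E by rewrite mule_ge0 // ?lee_fin ?divr_ge0 ?(ltW v0) //; case/andP: (F01 x).
have mfu : measurable_fun setT (fun x => f (tadd x u)) by apply: (measurableT_comp mf); mR.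
have mgv : measurable_fun setT (fun x => (g x / vol)%:E) by mR.
have gv0 x : (0 <= (g x / vol)%:E)%E by rewrite lee_fin divr_ge0 // ltW.
have -> : (\int[lebn n]_x f x = \int[lebn n]_x f (tadd x u))%E.
  have := @integral_lebn_affine R n 1 u f ltr01 mf f0; rewrite expr1n invr1 mul1e => <-.
  apply: eq_integral => x _; congr (f (tadd _ _)); apply: eq_from_tnth => i.
  by rewrite tnth_mktuple mul1r.
apply: le_trans (leeD (lexx _) ge); rewrite -ge0_DT //.
apply: ge0_leT => //.
- apply: emeasurable_funM; last by mR.
  by apply: (measurableT_comp mF); mR.
- by apply: emeasurable_funD.
- move=> x; rewrite mule_ge0 // ?lee_fin ?divr_ge0 ?(ltW v0) //; by case/andP: (F01 (tadd x u)).
move=> x; have /andP[F0 F1] := F01 (tadd x u).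
have [qx|qx] := q01 x.
  rewrite -[leLHS]adde0 leeD // /f (in1 (qA _ _ qx hu')) lee_wpmul2l // lee_fin ler_pM2r ?invr_gt0 //.
rewrite -[leLHS]add0e leeD // /g qx subr0 -[leRHS]mul1e lee_wpmul2r // lee_fin divr_ge0 // ltW //.
Qed.

End UniformMeasure.

Section ConvexBody.
Context (R : realType) (n : nat) (K : set 'rV[R]_n).
Local Notation lebn := (pw (@leb R)).
Local Notation tupn := (n.-tuple R).
Hypothesis hK : convex_body K.

Definition body_set : set tupn := @rv_of R n @^-1` K.
Local Notation A := body_set.

Lemma body_measurable : measurable A.
Proof.
case: hK => cK _ _; apply: measurable_closed_rv; exact: compact_closed.
Qed.

Lemma body_convex (t : R) (x y : tupn) : A x -> A y -> 0 <= t <= 1 -> A (tmix t x y).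
Proof.
case: hK => _ cvK _ hx hy ht; rewrite /body_set /= (_ : rv_of _ = t *: rv_of x + (1 - t) *: rv_of y); first exact: cvK.
by apply/rowP => i; rewrite !mxE tnth_mktuple.
Qed.

Lemma body_bounded : exists2 b : R, 0 <= b & forall (x : tupn) i, A x -> `|tnth x i| <= b.
Proof.
case: hK => cK _ _; have /pinfty_ex_gt0[b b0 hb] := compact_bounded cK.
exists b => [|x i Ax]; first exact: ltW.
apply: le_trans (hb _ Ax); rewrite /Num.norm /= mx_normrE.
by apply: le_trans (le_bigmax _ _ (0, i)); rewrite /= mxE.
Qed.

Lemma body_ball : exists (c : tupn) (r : R), 0 < r /\ forall x : tupn, (forall i, `|tnth x i - tnth c i| <= r) -> A x.
Proof.
case: hK => _ _ [c /nbhs_ballP[e /= e0 he]].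
exists [tuple c 0 i | i < n], (e / 2); split; first by rewrite divr_gt0.
move=> x hx; apply: he; split => // a i; rewrite ord1 !mxE /ball /= distrC.
have := hx i; rewrite tnth_mktuple => /le_lt_trans; apply.
by rewrite ltr_pdivrMr // ltr_pMr // ltr1n.
Qed.

Hypothesis hI : isotropic_position K.

Lemma body_probability : exists2 mu : probability tupn R,
  [/\ log_concave_marginals mu, sub_isotropic mu, (\int[mu]_X (nsq X)%:E = n%:R%:E)%E & tv_continuous mu] &
  forall S : set 'rV[R]_n, rv_measurable S -> (unif_prob K S)%:E = (\int[mu]_X (\1_(@rv_of R n @^-1` S) X : R)%:E)%E.
Proof.
have [b b0 bA] := body_bounded; have [c [r [r0 ballA]]] := body_ball.
have mA := body_measurable; have cA := body_convex.
have v0 := vol_gt0 mA b0 bA r0 ballA.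
have i0 (x : tupn) : 0 <= \1_A x :> R by rewrite indicE ler0n.
have lvolE (S : set 'rV[R]_n) : rv_measurable S -> lvol S = (\int[lebn n]_x (\1_(@rv_of R n @^-1` S) x : R)%:E)%E.
  move=> mS; rewrite /lvol /integral_on.
  transitivity (iint (fun t => (\1_(@rv_of R n @^-1` S) t : R)%:E)).
    by congr iint; apply/funext => t; rewrite mulr1.
  by apply: iintE => [|t]; [apply/measurable_EFinP; exact: measurable_indic|rewrite lee_fin indicE ler0n].
have lK : lvol K = (vol A)%:E by rewrite lvolE //; exact: integral_vol mA b0 bA.
have iso (i j : 'I_n) : (\int[lebn n]_x (\1_A x * (tnth x i * tnth x j))%:E = (if i == j then vol A else 0)%:E)%E.
  have := hI.2 i j; rewrite /integral_on lK (_ : (if _ then _ else _) = (if i == j then vol A else 0)%:E); last by case: ifP.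
  move=> <-; rewrite -(iint_boxed _ b0 (boxed_moment mA b0 bA i j)) ?mulr_ge0 //.
  by congr iint; apply/funext => t; rewrite !mxE.
exists (uni c mA).
  split.
  - exact: (@uni_log_concave _ _ _ _ _ _ mA cA b0 bA r0 ballA).
  - exact: (uni_sub_isotropic mA b0 bA r0 ballA).
  - exact: (uni_nsq mA b0 bA r0 ballA).
  - exact: (uni_tv_continuous mA cA b0 bA r0 ballA).
move=> S mS; have mSi : measurable_fun setT (\1_(@rv_of R n @^-1` S) : tupn -> R) by exact: measurable_indic.
rewrite (ge0_integral_uni mA b0 bA r0 ballA); last 2 first.
- exact/measurable_EFinP.
- by move=> x; rewrite lee_fin indicE ler0n.
rewrite /unif_prob lK lvolE /=; last by rewrite /rv_measurable preimage_setI; exact: measurableI.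
transitivity (\int[lebn n]_x ((\1_(@rv_of R n @^-1` (K `&` S)) x : R)%:E * (vol A)^-1%:E))%E; last first.
  apply: eq_integral => x _; rewrite -!EFinM mulrA; congr (_ / _)%:E.
  by rewrite preimage_setI indicI mulrC.
have mKS : measurable (@rv_of R n @^-1` (K `&` S)) by rewrite preimage_setI; exact: measurableI.
rewrite ge0_ZrT ?invr_ge0 ?(ltW v0) //; last by apply/measurable_EFinP; exact: measurable_indic.
rewrite EFinM; congr (_ * _)%E; rewrite fineK // integral_indic // setIT ge0_fin_numE ?measure_ge0 //.
apply: (@le_lt_trans _ _ (lebn n A)); last by rewrite (volE mA b0 bA) ltry.
by apply: le_measure; rewrite ?inE // => x [].
Qed.

End ConvexBody.

(** * Gaussian measure of sets and the conclusion *)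

Section GaussMeasure.
Context (R : realType) (l : nat).
Local Notation lebn := (pw (@leb R)).

Lemma gpdfn1E (x : l.-tuple R) : gpdfn 1 x = ((2 * pi) `^ (l%:R / 2))^-1 * expR (- (sqnorm (rv_of x) / 2)).
Proof.
rewrite gpdfn.unlock gpdf.unlock big_split /= prodr_const card_ord -expR_sum; congr (_ * expR _).
  rewrite mulr1 exprVn; congr (_^-1).
  by rewrite (mulrC l%:R) powRrM powR12_sqrt ?mulr_ge0 ?pi_ge0 // powR_mulrn // sqrtr_ge0.
rewrite sumrN mulr1 -mulr_suml; congr (- (_ / _)); apply: eq_bigr => i _; by rewrite mxE.
Qed.

Lemma integral_gpdfn1 : (\int[lebn l]_x (gpdfn 1 x)%:E = 1 :> \bar R)%E.
Proof.
rewrite -(@integral_gpdfn R l 1 [tuple 0 | i < l]) //.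
by apply: eq_integral => x _; rewrite tsub0.
Qed.

Lemma gauss_measureE (B : set 'rV[R]_l) : rv_measurable B ->
  (gauss_measure B)%:E = (\int[lebn l]_x ((\1_(@rv_of R l @^-1` B) x : R)%:E * (gpdfn 1 x)%:E))%E.
Proof.
move=> mB; have mi : measurable_fun setT (\1_(@rv_of R l @^-1` B) : l.-tuple R -> R) by exact: measurable_indic.
have i0 (x : l.-tuple R) : 0 <= \1_(@rv_of R l @^-1` B) x :> R by rewrite indicE ler0n.
pose k : R := ((2 * pi) `^ (l%:R / 2))^-1.
have ki0 : 0 < k^-1 by rewrite invrK powR_gt0 // mulr_gt0 // pi_gt0.
have k0 : 0 < k by rewrite invr_gt0 powR_gt0 // mulr_gt0 // pi_gt0.
pose f (x : l.-tuple R) : R := \1_(@rv_of R l @^-1` B) x * expR (- (sqnorm (rv_of x) / 2)).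
have fE x : f x = k^-1 * (\1_(@rv_of R l @^-1` B) x * gpdfn 1 x).
  by rewrite gpdfn1E -/k /f mulrCA (mulrA k^-1) mulVf ?gt_eqF // mul1r.
have mg := @measurable_gpdfn R l 1.
have mf : measurable_fun setT f.
  by rewrite (_ : f = fun x => k^-1 * (\1_(@rv_of R l @^-1` B) x * gpdfn 1 x)); [mR|apply/funext].
have G0 x : (0 <= (\1_(@rv_of R l @^-1` B) x * gpdfn 1 x)%:E)%E by rewrite lee_fin mulr_ge0 // gpdfn_ge0.
rewrite /gauss_measure -/k /integral_on (_ : iint _ = \int[lebn l]_x (f x)%:E)%E; last first.
  by apply: iintE => [|t]; [exact/measurable_EFinP|rewrite lee_fin mulr_ge0 ?expR_ge0].
have -> : (\int[lebn l]_x (f x)%:E = k^-1%:E * \int[lebn l]_x (\1_(@rv_of R l @^-1` B) x * gpdfn 1 x)%:E)%E.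
  rewrite -ge0_ZlT ?(ltW ki0) //; last by mR.
  by apply: eq_integral => x _; rewrite fE EFinM.
have : (\int[lebn l]_x (\1_(@rv_of R l @^-1` B) x * gpdfn 1 x)%:E)%E \is a fin_num.
  rewrite ge0_fin_numE ?integral_ge0 //; apply: (@le_lt_trans _ _ 1%E); last exact: ltry.
  rewrite -integral_gpdfn1; apply: ge0_leT => //.
  - by mR.
  - by mR.
  - by move=> x; rewrite lee_fin ler_piMl ?gpdfn_ge0 // indicE lern1 leq_b1.
move=> h; rewrite -(fineK h) -EFinM /= mulrA mulfV ?gt_eqF // mul1r fineK //.
Qed.

End GaussMeasure.

Section NaturalRoots.
Context (R : realType).

Lemma root_nat k n : (0 < k)%N -> (0 < n)%N -> exists y, [/\ (0 < y)%N, (y ^ k <= n)%N & (n < y.+1 ^ k)%N].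
Proof.
move=> k0 n0; have ex0 : exists y, (y ^ k <= n)%N by exists 1; rewrite exp1n.
have ub y : (y ^ k <= n)%N -> (y <= n)%N.
  by apply: leq_trans; case: y => // y; rewrite -(prednK k0) expnS leq_pmulr // expn_gt0.
case: (ex_maxnP ex0 ub) => y hy hm; exists y; split => //.
  by apply: hm; rewrite exp1n.
by rewrite ltnNge; apply/negP => /hm; rewrite ltnn.
Qed.

Lemma powR_root k n y : (0 < k)%N -> (n < y.+1 ^ k)%N -> n%:R `^ (k%:R^-1) <= y.+1%:R :> R.
Proof.
move=> k0 h; have k0' : (k%:R : R) != 0 by rewrite pnatr_eq0 -lt0n.
apply: (@le_trans _ _ ((y.+1 ^ k)%:R `^ (k%:R^-1))).
  by apply: ge0_ler_powR; rewrite ?nnegrE ?invr_ge0 // ler_nat ltnW.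
by rewrite natrX -powR_mulrn // -powRrM mulfV // powRr1.
Qed.

(** Only upper estimates are available so far; for measures of mass one, the estimate for the
    complement is the lower estimate for the set. *)
Lemma tv_of_complement (p p' g g' e : R) : p + p' = 1 -> g + g' = 1 -> p <= g + e -> p' <= g' + e -> `|p - g| <= e.
Proof. by move=> *; rewrite ler_norml; apply/andP; split; lra. Qed.

End NaturalRoots.

Theorem theorem1p1 (R : realType) :
  exists c kappa : R, 0 < c /\ 0 < kappa /\
  forall (n l : nat) (K : set 'rV[R]_n),
    (1 <= l <= n)%N ->
    convex_body K -> isotropic_position K ->
    l%:R <= c * n%:R `^ kappa ->
    forall mu : probability (n.-tuple (n.-tuple R)) R,
    grass_invariant l mu ->
    exists Eset : set (n.-tuple (n.-tuple R)),
      [/\ measurable Eset, Eset `<=` @grass_set R n l,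
          (mu Eset >= (1 - expR (- (c * Num.sqrt n%:R)))%:E)%E &
          forall t, Eset t ->
          forall U : 'M[R]_(l, n), frame U (mx_of t) ->
          forall B : set 'rV[R]_l, rv_measurable B ->
            `| unif_prob K [set x | B (x *m U^T)] - gauss_measure B |
              <= (n%:R `^ kappa)^-1].
Proof.
(* All estimates assume y >= Y0. The constant c satisfies c (Y0 + 1) = 1/2, so 1 <= l <= c (y + 1)
   already forces y to be that large, and small n call for no separate treatment. *)
pose Y0 : R := 32 * 32 + 4 * C4 R.
have C0 : 0 <= C4 R by rewrite /C4 mulr_ge0 // mulr_ge0 // exprn_ge0.
have Y00 : 0 < Y0 + 1 by rewrite /Y0; lra.
pose c : R := (Y0 + 1)^-1 / 2.
have c0 : 0 < c by rewrite divr_gt0 // invr_gt0.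
have cY : 2 * (c * (Y0 + 1)) = 1 by rewrite /c; field; rewrite gt_eqF.
have c1 : c <= 1 / 2.
  rewrite ler_pdivlMr ?ltr0n // /c divfK ?pnatr_eq0 // invf_le1 // /Y0; lra.
exists c, 300%:R^-1; split; [exact: c0|split; [by rewrite invr_gt0 ltr0n|]].
move=> n l K /andP[l1 ln] hK hI hl mu hmu.
have n0 : (0 < n)%N by exact: leq_trans ln.
have [y [y0 ny ny']] := @root_nat 300 n isT n0.
have hp := @powR_root R 300 n y isT ny'.
have p0 : 0 < n%:R `^ (300%:R^-1) :> R by rewrite powR_gt0 // ltr0n.
move: hl hp p0; set pn := _ `^ _ => hl hp p0.
have hl' : l%:R <= c * y.+1%:R by apply: le_trans hl _; rewrite ler_pM2l.
have l1' : 1 <= l%:R :> R by rewrite ler1n.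
have yS : y.+1%:R = y%:R + 1 :> R by rewrite -natr1.
have y1 : 1 <= y%:R :> R by rewrite ler1n.
rewrite yS in hl' hp.
have Yy : Y0 <= y%:R.
  have : c * (Y0 + 1) <= c * (y%:R + 1) by move: cY hl' l1'; goal_lra.
  by rewrite ler_pM2l // lerD2r.
have ly : (l <= y)%N.
  rewrite -(ler_nat R); apply: (le_trans hl').
  have : c * (y%:R + 1) <= 1 / 2 * (y%:R + 1) by rewrite ler_wpM2r // addr_ge0.
  by move: y1; goal_lra.
have Y1 : 32 * 32 <= y%:R :> R by move: C0 Yy; rewrite /Y0; goal_lra.
have YC : 4 * C4 R <= y%:R :> R by move: Yy; rewrite /Y0; goal_lra.
have [nu [hlc hiso hn htv] nuE] := body_probability hK hI.
pose v : R := (y%:R^-1) ^+ 8; pose th : \bar R := (1 - 12 * (y%:R^-1) ^+ 2)%:E.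
have l1y : (1 <= l <= y)%N by rewrite l1.
have mP : measurable [set x | @povl R n l nu v x < th]%E.
  rewrite -[X in measurable X]setTI; apply: (@emeasurable_fun_infty_o _ _ _ _ (@povl R n l nu v)) => //.
  exact: measurable_povl.
have mG : measurable (@grass_set R n l) by exact: measurable_grass_set.
(* The overlap is a function of the subspace alone, so the exceptional set is fixed before any frame
   or any B. *)
exists (@grass_set R n l `&` ~` [set x | @povl R n l nu v x < th]%E); split.
- by apply: measurableI => //; exact: measurableC.
- by move=> t [].
- set E := _ `&` _; have mE : measurable E by apply: measurableI => //; exact: measurableC.
  rewrite -[E]setCK probability_setC; last exact: measurableC.
  rewrite EFinB; apply: leeB => //; rewrite /E setCI setCK.
  apply: le_trans (measureU2 _ _ _) _ => //; first exact: measurableC.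
  have z : (mu (~` @grass_set R n l) <= 0)%E by rewrite hmu.1 //; [exact: measurableC|rewrite setICl].
  apply: le_trans (leeD z (povl_whp hlc hiso hn Y1 YC ny ny' l1y ln hmu)) _.
  rewrite add0e lee_fin ler_expR lerN2 ler_piMl ?sqrtr_ge0 //; move: c1; goal_lra.
move=> t [Gt /negP]; rewrite -leNgt => ht U [hU hP] B mB.
have mapp : measurable_fun setT (app (rows_of U)) by mR.
have pre (C : set 'rV[R]_l) : @rv_of R n @^-1` [set x | C (x *m U^T)] = app (rows_of U) @^-1` (@rv_of R l @^-1` C).
  by apply/seteqP; split => X /=; rewrite app_rows rv_of_tmul.
have mpre (C : set 'rV[R]_l) : rv_measurable C -> rv_measurable [set x : 'rV[R]_n | C (x *m U^T)].
  by move=> mC; rewrite /rv_measurable pre -[X in measurable X]setTI; exact: mapp.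
have mBC : rv_measurable (~` B) by rewrite /rv_measurable preimage_setC; exact: measurableC.
have H (C : set 'rV[R]_l) : rv_measurable C -> unif_prob K [set x | C (x *m U^T)] <= gauss_measure C + (2 * y%:R)^-1.
  move=> mC; rewrite -lee_fin nuE; last exact: mpre.
  have := clt_frame hlc Y1 l1y htv hU hP ht mC.
  by rewrite EFinD gauss_measureE // pre.
(* Here n^kappa <= y + 1 <= 2 y. *)
apply: (@le_trans _ _ (2 * y%:R)^-1); last first.
  rewrite lef_pV2 ?posrE ?mulr_gt0 ?ltr0n //; move: hp y1; goal_lra.
apply: (tv_of_complement _ _ (H _ mB) (H _ mBC)).
- apply: EFin_inj; rewrite EFinD !nuE; [|exact: mpre|exact: mpre].
  have mS := mpre _ mB; have mSC := mpre _ mBC.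
  rewrite !integral_indic // !setIT (_ : _ @^-1` [set x | (~` B) _] = ~` (@rv_of R n @^-1` [set x | B (x *m U^T)])) //.
  apply: etrans (congr1 (fun z => nu (@rv_of R n @^-1` [set x | B (x *m U^T)]) + z)%E (probability_setC nu mS)) _.
  by rewrite addeC subeK // fin_num_measure.
- apply: EFin_inj; rewrite EFinD !gauss_measureE //.
  have mg := @measurable_gpdfn R l 1.
  have m1 : measurable_fun setT (\1_(@rv_of R l @^-1` B) : l.-tuple R -> R) by exact: measurable_indic.
  have m2 : measurable_fun setT (\1_(@rv_of R l @^-1` (~` B)) : l.-tuple R -> R) by exact: measurable_indic.
  have p1 (C : set (l.-tuple R)) x : (0 <= (\1_C x : R)%:E * (gpdfn 1 x)%:E)%E by rewrite -EFinM lee_fin mulr_ge0 ?gpdfn_ge0 // indicE ler0n.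
  rewrite -ge0_DT; [|by apply: emeasurable_funM; mR|by apply: emeasurable_funM; mR|exact: p1|exact: p1].
  rewrite -(integral_gpdfn1 R l); apply: eq_integral => x _; rewrite -!EFinM -EFinD -mulrDl preimage_setC !indicE in_setC.
  by case: (x \in _); rewrite ?addr0 ?add0r mul1r.
Qed.
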